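(* Given a set of nonnegative integers $g^{k,0}, g^{k-1,1},\ldots, g^{0,k}$ satisfying $k\ge 0$ and $g^{p,q}=g^{q,p}$ (for all $p,q\ge 0$ with $p+q=k$), there exists a geometric rational Hodge structure $H$ (pure of weight $k$) with $\dim H^{p,q}=g^{p,q}$.
   Context: All Hodge structures are rational: a pure Hodge structure of weight $k$ is a finite-dimensional $\mathbb{Q}$-vector space $H$ with a decomposition $H\otimes_{\mathbb{Q}}\mathbb{C}=\bigoplus_{p+q=k}H^{p,q}$ such that $\overline{H^{p,q}}=H^{q,p}$. A pure Hodge structure is called geometric if it is contained, as a sub-Hodge structure, in the cohomology (with $\mathbb{Q}$-coefficients) of a smooth complex projective variety; it is then necessarily polarizable and effective ($H^{p,q}=0$ unless $p,q\ge 0$). *)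

(* Defs.v *)
From HB Require Import structures.
From mathcomp Require Import all_boot all_order all_algebra.
From mathcomp Require Import generic_quotient ring_quotient.
From mathcomp Require Import all_classical all_reals all_analysis.
From mathcomp Require Import complex.
From mathcomp Require mpoly.
Import (canonicals, coercions) mpoly.

(* Singular cohomology, smooth complex projective varieties, differential
   forms of type (p,q) on them, and rational Hodge structures.  The real
   numbers are a realType R and the complex numbers are R[i]. *)

Set Implicit Arguments.
Unset Strict Implicit.
Unset Printing Implicit Defensive.

Import Order.TTheory GRing.Theory Num.Theory numFieldNormedType.Exports.

Local Open Scope classical_set_scope.
Local Open Scope ring_scope.
Local Open Scope quotient_scope.

(* R[i] as a numClosedFieldType: in this form it carries the topology of its
   norm. *)
Definition CC (R : realType) : numClosedFieldType := R[i].

Definition mkC (R : realType) (a b : R) : CC R := Complex a b.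
Definition reC (R : realType) (z : CC R) : R := complex.Re z.
Definition imC (R : realType) (z : CC R) : R := complex.Im z.

Section LmodQuotient.
Variables (K : pzRingType) (V : lmodType K) (S : submodClosed V).

Definition lmod_quot_pred : {pred V} := S.
HB.instance Definition _ := GRing.isZmodClosed.Build V lmod_quot_pred
  (GRing.submod_closedB (GRing.submodClosedP S)).

Definition lmod_quot := Quotient.quot lmod_quot_pred.
HB.instance Definition _ := GRing.Zmodule.on lmod_quot.
HB.instance Definition _ := EqQuotient.on lmod_quot.

Definition lmod_quot_scale (a : K) : lmod_quot -> lmod_quot :=
  lift_op1 lmod_quot ( *:%R a).

Lemma pi_lmod_quot_scale (a : K) :
  {morph \pi_lmod_quot : x / a *: x >-> lmod_quot_scale a x}.
Proof.
move=> x; unlock lmod_quot_scale; apply/eqP.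
rewrite piE Quotient.equivE -scalerBr (@rpredZ _ _ S) //.
by rewrite -[_ \in S]/(_ \in lmod_quot_pred) Quotient.idealrBE reprK.
Qed.

Lemma pi_lmod_quotD :
  {morph \pi_lmod_quot : x y / x + y >-> (x + y : lmod_quot)}.
Proof. by move=> x y; rewrite (Quotient.pi_add lmod_quot_pred). Qed.

Fact lmod_quot_scaleA (a b : K) v :
  lmod_quot_scale a (lmod_quot_scale b v) = lmod_quot_scale (a * b) v.
Proof. by rewrite -[v]reprK -!pi_lmod_quot_scale scalerA. Qed.

Fact lmod_quot_scale1 : left_id 1 lmod_quot_scale.
Proof. by move=> v; rewrite -[v]reprK -pi_lmod_quot_scale scale1r. Qed.

Fact lmod_quot_scaleDr : right_distributive lmod_quot_scale +%R.
Proof.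
move=> a u v; rewrite -[u]reprK -[v]reprK.
by rewrite -pi_lmod_quotD -!pi_lmod_quot_scale scalerDr pi_lmod_quotD.
Qed.

Fact lmod_quot_scaleDl v :
  {morph lmod_quot_scale^~ v : a b / a + b >-> a + b}.
Proof.
move=> a b; rewrite -[v]reprK.
by rewrite -!pi_lmod_quot_scale scalerDl pi_lmod_quotD.
Qed.

HB.instance Definition _ := GRing.Zmodule_isLmodule.Build K lmod_quot
  lmod_quot_scaleA lmod_quot_scale1 lmod_quot_scaleDr lmod_quot_scaleDl.

End LmodQuotient.

Section StandardSimplex.
Variable R : realType.

Definition std_simplex (k : nat) : set 'rV[R]_k.+1 :=
  [set t | (forall i, 0 <= t 0 i) /\ \sum_i t 0 i = 1].
Arguments std_simplex : clear implicits.

(* The i-th face map on coordinates: insert a 0 in position i. *)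
Definition face_row (k : nat) (i : 'I_k.+2) (t : 'rV[R]_k.+1) : 'rV[R]_k.+2 :=
  \row_j (if unlift i j is Some j' then t 0 j' else 0).

Lemma face_row_simplex k (i : 'I_k.+2) (t : 'rV[R]_k.+1) :
  std_simplex k t -> std_simplex k.+1 (face_row i t).
Proof.
case=> t0 t1; split=> [j|]; first by rewrite mxE; case: unliftP.
rewrite (bigD1_ord i) //= mxE unlift_none add0r -t1.
by apply: eq_bigr => j _; rewrite mxE liftK.
Qed.

Definition face (k : nat) (i : 'I_k.+2) (t : std_simplex k) :
    std_simplex k.+1 :=
  SigSub (mem_set (face_row_simplex i (set_valP t))).

Lemma face_continuous k (i : 'I_k.+2) : continuous (@face k i).
Proof.
suff cf : continuous (fun t : std_simplex k => face_row i (\val t)).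
  exact: (@continuous_comp_initial (std_simplex k.+1) (std_simplex k)
    'rV[R]_k.+2 (@set_val _ (std_simplex k.+1)) (@face k i) cf).
move=> t A [B nB sBA].
suff nP : nbhs (\val t) (fun u : 'rV[R]_k.+1 => A (face_row i u)).
  exact: (@initial_continuous _ _ (fun u : std_simplex k => \val u) t _ nP).
apply: (ex_intro2 _ _ (fun a j => B a (lift i j))) => [a j|u Bu].
  by have := nB a (lift i j); rewrite /= mxE liftK (ord1 a).
apply: sBA => a j; rewrite mxE; case: unliftP => [j' ->|eq_ji].
  by rewrite (ord1 a); exact: Bu.
by have /nbhs_singleton := nB a j; rewrite /= mxE eq_ji unlift_none.
Qed.

End StandardSimplex.
Arguments std_simplex : clear implicits.

Section SingularCohomology.
Variables (R : realType) (T : topologicalType) (F : comPzRingType).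

Definition singular_simplex (k : nat) : Type :=
  {s : std_simplex R k -> T | continuous s}.

Lemma sing_face_subproof k (i : 'I_k.+2) (s : singular_simplex k.+1) :
  continuous (sval s \o face i).
Proof.
by move=> t; apply: continuous_comp; [exact: face_continuous | exact: (svalP s)].
Qed.

Definition sing_face k (i : 'I_k.+2) (s : singular_simplex k.+1) :
  singular_simplex k := exist _ _ (@sing_face_subproof k i s).

Definition cochain (k : nat) : Type := singular_simplex k -> F^o.
HB.instance Definition _ k := GRing.Lmodule.copy (cochain k)
  (singular_simplex k -> F^o).

Definition coboundary k (c : cochain k) : cochain k.+1 :=
  fun s => \sum_(i < k.+2) (-1) ^+ i * c (sing_face i s).

Lemma coboundary_linear k : linear (@coboundary k).
Proof.
move=> a c d; apply/funext => s.
change (\sum_(i < k.+2)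
    ((-1) ^+ i * (a * c (sing_face i s) + d (sing_face i s)) : F) =
  a * (\sum_(i < k.+2) ((-1) ^+ i * c (sing_face i s) : F)) +
  \sum_(i < k.+2) ((-1) ^+ i * d (sing_face i s) : F)).
rewrite mulr_sumr -big_split /=.
by apply: eq_bigr => i _; rewrite mulrDr mulrCA.
Qed.

Lemma coboundary0 k : coboundary (0 : cochain k) = 0.
Proof.
have := coboundary_linear (-1) (0 : cochain k) 0.
by rewrite scaler0 addr0 scaleN1r addNr.
Qed.

Definition cocycle_pred k : {pred cochain k} :=
  fun c => `[< coboundary c = 0 >].

Lemma cocycle_submod k : submod_closed (@cocycle_pred k).
Proof.
split=> [|a c d /asboolP c0 /asboolP d0]; apply/asboolP.
  exact: coboundary0.
by rewrite coboundary_linear c0 d0 scaler0 add0r.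
Qed.

HB.instance Definition _ k :=
  GRing.isSubmodClosed.Build F (cochain k) (@cocycle_pred k)
    (@cocycle_submod k).

Record cocycle (k : nat) := Cocycle {
  cocycle_val :> cochain k;
  _ : cocycle_val \in @cocycle_pred k }.
HB.instance Definition _ k := [isSub for @cocycle_val k].
HB.instance Definition _ k := [Choice of cocycle k by <:].
HB.instance Definition _ k := [SubChoice_isSubLmodule of cocycle k by <:].

Definition is_coboundary (k : nat) : cochain k -> Prop :=
  if k is k'.+1 then fun c => exists b : cochain k', c = coboundary b
  else fun c => c = 0.

Definition coboundary_pred k : {pred cocycle k} :=
  fun c => `[< is_coboundary (c : cochain k) >].

Lemma coboundary_submod k : submod_closed (@coboundary_pred k).
Proof.
split=> [|a c d /asboolP cc /asboolP cd]; apply/asboolP.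
  case: k => //= k; exists 0.
  by rewrite coboundary0.
case: k c d cc cd => [|k] c d /= => [c0 d0|[c' cE] [d' dE]].
  by rewrite c0 d0 scaler0 addr0.
by exists (a *: c' + d'); rewrite coboundary_linear -cE -dE.
Qed.

HB.instance Definition _ k :=
  GRing.isSubmodClosed.Build F (cocycle k) (@coboundary_pred k)
    (@coboundary_submod k).

Definition cohomology (k : nat) : lmodType F :=
  lmod_quot (@coboundary_pred k).

End SingularCohomology.

Arguments cohomology : clear implicits.

Section CohomologyClasses.
Variables (R : realType) (T : topologicalType).
Local Notation C := (CC R).

Definition coh_class (F : comPzRingType) k (c : cocycle R T F k) :
  cohomology R T F k := \pi_(lmod_quot (@coboundary_pred R T F k)) c.

Definition coh_repr (F : comPzRingType) k (a : cohomology R T F k) :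
  cocycle R T F k := repr (a : lmod_quot (@coboundary_pred R T F k)).

Lemma ratr_cocycle_subproof k (c : cocycle R T rat k) :
  (fun s => ratr (cocycle_val c s) : CC R) \in @cocycle_pred R T (CC R) k.
Proof.
apply/asboolP/funext => s; rewrite /coboundary.
have /asboolP c0 : cocycle_val c \in @cocycle_pred R T rat k := valP c.
have := congr1 (fun f : cochain R T rat k.+1 => ratr (f s) : C) c0.
rewrite /coboundary [X in _ = X]rmorph0 => cs0; rewrite -[RHS]cs0.
rewrite [RHS]rmorph_sum; apply: eq_bigr => i _.
by rewrite [RHS]rmorphM rmorphXn rmorphN1.
Qed.

(* Extension of coefficients H^k(T, Q) -> H^k(T, C). *)
Definition coh_ratr k (a : cohomology R T rat k) : cohomology R T (CC R) k :=
  coh_class (Cocycle (ratr_cocycle_subproof (coh_repr a))).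

End CohomologyClasses.

Section ProjectiveSpace.
Variables (R : realType) (n : nat).
Local Notation C := (CC R).

Definition nonzero_vec : set 'rV[C]_n.+1 := [set v | v != 0].

Definition collinear (v w : nonzero_vec) : bool :=
  `[< exists a : C, set_val w = a *: set_val v >].

Lemma collinear_is_equiv : equiv_class_of collinear.
Proof.
have sym v w : collinear v w -> collinear w v.
  case/asboolP => a wE; have a0 : a != 0.
    apply/eqP => a0; have /negP[] : set_val w != 0 := set_valP w.
    by rewrite wE a0 scale0r.
  by apply/asboolP; exists a^-1; rewrite wE scalerA mulVf // scale1r.
split=> [v|v w|v u w].
- by apply/asboolP; exists 1; rewrite scale1r.
- by apply/idP/idP; exact: sym.
- move=> /asboolP[a vE] /asboolP[b wE]; apply/asboolP.
  by exists (b * a); rewrite wE vE scalerA.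
Qed.

Canonical collinear_equiv := EquivRelPack collinear_is_equiv.
Canonical collinear_encModRel := defaultEncModRel collinear.

(* P^n(C) with the quotient topology. *)
Definition proj_space : topologicalType :=
  quotient_topology {eq_quot collinear_equiv}.

Definition hom_coord (x : proj_space) (v : 'rV[C]_n.+1) : Prop :=
  exists2 w : nonzero_vec, set_val w = v & \pi_{eq_quot collinear_equiv} w = x.

Local Notation poly := (mpoly.mpoly n.+1 C).

Definition homogeneous (F : poly) : Prop :=
  exists d : nat, F \is mpoly.ishomog1 d mpoly.mdeg.

Definition peval (F : poly) (v : 'rV[C]_n.+1) : C := mpoly.meval (v 0) F.

Definition pgrad (F : poly) (v : 'rV[C]_n.+1) : 'rV[C]_n.+1 :=
  \row_j peval (mpoly.mderiv j F) v.

Definition zariski_closed (X : set proj_space) : Prop :=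
  exists S : set poly, (forall F, S F -> homogeneous F) /\
    forall x v, hom_coord x v -> X x <-> (forall F, S F -> peval F v = 0).

(* Near the point with coordinates v (on the Zariski open set where G does
   not vanish), X is cut out by c equations with independent differentials
   at v. *)
Definition smooth_at (X : set proj_space) (v : 'rV[C]_n.+1) : Prop :=
  exists (c : nat) (F : 'I_c -> poly) (G : poly),
    [/\ forall i, homogeneous (F i), homogeneous G, peval G v != 0,
        forall y w, hom_coord y w -> peval G w != 0 ->
          X y <-> (forall i, peval (F i) w = 0)
      & \rank (\matrix_(i < c) pgrad (F i) v) = c].

(* Varieties need not be connected: a structure of weight 0 and dimension > 1
   only lies in the H^0 of a disconnected X. *)
Definition smooth_projective (X : set proj_space) : Prop :=
  zariski_closed X /\
  forall x v, X x -> hom_coord x v -> smooth_at X v.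

(* The tangent space at v of the affine cone over X. *)
Definition cone_tangent (X : set proj_space) (v u : 'rV[C]_n.+1) : Prop :=
  forall F : poly, homogeneous F ->
    (forall y w, X y -> hom_coord y w -> peval F w = 0) ->
    \sum_j pgrad F v 0 j * u 0 j = 0.

End ProjectiveSpace.

Section Smoothness.
Variable R : realType.

Fixpoint Ck_on m (U : set 'rV[R]_m) (r : nat) (h : 'rV[R]_m -> R) : Prop :=
  (forall x, U x -> {for x, continuous h}) /\
  if r is r'.+1 then forall i : 'I_m,
    (forall x, U x -> derivable h x (delta_mx 0 i)) /\
    Ck_on U r' (fun x => 'D_(delta_mx 0 i) h x)
  else True.

Definition smooth_on m (U : set 'rV[R]_m) (f : 'rV[R]_m -> CC R) : Prop :=
  forall r, Ck_on U r (fun x => reC (f x)) /\ Ck_on U r (fun x => imC (f x)).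

(* R^(2N) = C^N *)
Definition of_real N (u : 'rV[R]_(N + N)) : 'rV[CC R]_N :=
  \row_j mkC (lsubmx u 0 j) (rsubmx u 0 j).

(* Derivative of f at x in the real direction v. *)
Definition dir_deriv N (f : 'rV[CC R]_N -> CC R) (x v : 'rV[CC R]_N) : CC R :=
  let g (t : R) := f (x + mkC t 0 *: v) in
  mkC (derive1 (fun t => reC (g t)) 0) (derive1 (fun t => imC (g t)) 0).

Definition jacobian k N (s : 'rV[R]_k -> 'rV[CC R]_N) (t : 'rV[R]_k) :
    'M[CC R]_(k, N) :=
  \matrix_(i, j) mkC ('D_(delta_mx 0 i) (fun u => reC (s u 0 j)) t)
                     ('D_(delta_mx 0 i) (fun u => imC (s u 0 j)) t).

(* Integral of g over the simplex 0 <= t_i, t_1 + ... + t_k <= a, as an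
   iterated integral. *)
Fixpoint simplex_integral k (a : R) : ('rV[R]_k -> R) -> R :=
  match k with
  | 0 => fun g => g 0
  | k'.+1 => fun g => \int[lebesgue_measure]_(t in `[0, a])
      simplex_integral (a - t) (fun u : 'rV[R]_k' => g (row_mx t%:M u))
  end.

Definition simplex_integralC k (g : 'rV[R]_k -> CC R) : CC R :=
  mkC (simplex_integral 1 (fun t => reC (g t)))
      (simplex_integral 1 (fun t => imC (g t))).

End Smoothness.

Section DifferentialForms.
Variables (R : realType) (n : nat).
Local Notation C := (CC R).
Local Notation N := n.+1.

(* A form of type (p, k - p) on C^N \ {0}, with p <= k, is given by its
   coefficients (f_m), m : 'I_k -> 'I_N : it is the sum over m of
     f_m dz_(m 0) /\ .. /\ dz_(m (p-1)) /\ dzbar_(m p) /\ .. /\ dzbar_(m (k-1)). *)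
Definition diff_form k := {ffun 'I_k -> 'I_N} -> 'rV[C]_N -> C.

(* Value at x of the form f, of type (p, k - p), on the rows of V. *)
Definition form_val k (p : nat) (f : diff_form k) (x : 'rV[C]_N)
    (V : 'M[C]_(k, N)) : C :=
  \sum_(m : {ffun 'I_k -> 'I_N})
    f m x * \det (\matrix_(i < k, j < k)
                    if (j < p)%N then V i (m j) else (V i (m j))^*).

Definition smooth_form k (f : diff_form k) : Prop :=
  forall m, smooth_on [set u : 'rV[R]_(N + N) | u != 0]
                      (fun u => f m (of_real u)).

(* f is the pullback of a form on P^n : it is invariant under homotheties and
   vanishes on vectors tangent to the fibres of C^N \ {0} -> P^n. *)
Definition basic_form k p (f : diff_form k) : Prop :=
  (forall x V (a : C), x != 0 -> a != 0 ->
     form_val p f (a *: x) (a *: V) = form_val p f x V) /\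
  (forall x V (a : C) i, x != 0 -> row i V = a *: x -> form_val p f x V = 0).

(* Exterior derivative at x on the rows of V (extended to constant fields). *)
Definition ext_deriv k p (f : diff_form k) (x : 'rV[C]_N)
    (V : 'M[C]_(k.+1, N)) : C :=
  \sum_(i < k.+1) (-1) ^+ i *
    dir_deriv (fun y => form_val p f y (row' i V)) x (row i V).

(* Smooth (p, k - p)-forms on P^n; every smooth (p, k - p)-form on a smooth
   closed subvariety X is the restriction of such a form. *)
Definition is_form_on_P k p (f : diff_form k) : Prop :=
  smooth_form f /\ basic_form p f.

(* The restriction of f to X is closed. *)
Definition closed_on (X : set (proj_space R n)) k p (f : diff_form k) : Prop :=
  forall x v (V : 'M[C]_(k.+1, N)), X x -> hom_coord x v ->
    (forall i, cone_tangent X v (row i V)) -> ext_deriv p f v V = 0.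

Definition corner k : set 'rV[R]_k :=
  [set t | (forall i, 0 <= t 0 i) /\ \sum_i t 0 i <= 1].
Arguments corner : clear implicits.

(* s is a smooth lift to C^N \ {0} of the singular simplex sg, the last k
   barycentric coordinates being used as coordinates on the standard simplex;
   sg is smooth iff it has such a lift. *)
Definition smooth_lift (X : set (proj_space R n)) k
    (sg : singular_simplex R X k) (s : 'rV[R]_k -> 'rV[C]_N) : Prop :=
  (exists U : set 'rV[R]_k, [/\ open U, corner k `<=` U
     & forall j, smooth_on U (fun t => s t 0 j)]) /\
  forall t : std_simplex R k,
    hom_coord (set_val (sval sg t)) (s (rsubmx (set_val t : 'rV_(1 + k)))).

Definition integral_lift k p (f : diff_form k) (s : 'rV[R]_k -> 'rV[C]_N) : C :=
  simplex_integralC (fun t => form_val p f (s t) (jacobian s t)).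

(* H^{p,q}(X) in H^k(X, C), p + q = k : the classes represented, through
   integration over smooth simplices (de Rham), by a closed (p, q)-form;
   it is 0 when p < 0, q < 0 or p + q <> k. *)
Definition in_Hpq (X : set (proj_space R n)) k (p q : int)
    (a : cohomology R X C k) : Prop :=
  a = 0 \/
  exists p' q' : nat, [/\ p = p', q = q', (p' + q' = k)%N
   & exists f : diff_form k, [/\ is_form_on_P p' f, closed_on X p' f
      & exists2 c : cocycle R X C k, coh_class c = a
          & forall sg s, smooth_lift sg s ->
              cocycle_val c sg = integral_lift p' f s]].

End DifferentialForms.

Section HodgeStructures.
Variable R : realType.
Local Notation C := (CC R).

(* V (x)_Q C, in the coordinates of the rational basis vbasis fullv of V. *)
Definition complexification (V : vectType rat) := 'rV[C]_(\dim {:V}).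

Definition conj_vec (V : vectType rat) (v : complexification V) :
  complexification V := map_mx Num.conj v.

Record hodge_structure (k : int) := HodgeStructure {
  hs_space :> vectType rat;
  hs_piece : int -> int -> {vspace complexification hs_space};
  hs_decomp : exists s : seq (int * int),
    [/\ uniq s,
        forall p q, (p, q) \in s -> p + q = k,
        forall p q, (p, q) \notin s -> hs_piece p q = 0%VS,
        (\sum_(pq <- s) hs_piece pq.1 pq.2)%VS = fullv
      & directv (\sum_(pq <- s) hs_piece pq.1 pq.2)%VS];
  hs_conj : forall p q v, v \in hs_piece p q <-> conj_vec v \in hs_piece q p }.

(* The complexification of a Q-linear map V -> H^k(X, Q). *)
Definition coh_complexify (T : topologicalType) k (V : vectType rat)
    (phi : V -> cohomology R T rat k) (v : complexification V) :
    cohomology R T C k :=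
  \sum_j v 0 j *: coh_ratr (phi (vbasis {:V})`_j).

(* H is isomorphic to a sub-Hodge structure of H^k(X, Q), i.e., it has an
   injective morphism of Hodge structures into it, for some X. *)
Definition geometric_hs (k : nat) (H : hodge_structure k) : Prop :=
  exists (n : nat) (X : set (proj_space R n)),
    smooth_projective X /\
    exists phi : {linear H -> cohomology R X rat k},
      injective phi /\
      forall p q v, v \in hs_piece H p q ->
        in_Hpq p q (coh_complexify phi v).

End HodgeStructures.

(* Main.v *)
(* In weight k > 0 take the powers of the elliptic curve E with an action of
   Z[i], in the Segre embedding. The invariant differential dz of a factor has
   periods in Z[i] (up to scale), so a wedge product of k of these
   differentials, dz_1 /\ .. /\ dz_p /\ conj dz_(p+1) /\ .. /\ conj dz_k, is a
   closed (p, k - p)-form whose class is c = a + i b with a and b rational: the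
   span of a and b is a rational Hodge structure of type (p, k - p) +
   (k - p, p), and for p = k - p the line of a is one of type (p, p). Taking
   disjoint sets of k factors for all these pieces, the classes are independent,
   as one sees by pairing them with tori. In weight 0 the variety is a finite
   set of points.

   To have c as a singular cocycle with values in Z[i], z is lifted along every
   simplex: the real and imaginary parts of dz are
   d phi / sqrt (1 + sin^2 phi), up to scale, where phi is the argument of an
   explicit nonvanishing function on E, so that it suffices to lift arguments. A
   branch of z on E, not continuous, turns the lifts into integral 1-cocycles,
   c is their cup product, and Stokes' formula on simplices provides the
   homotopy between c and the integral of the form. *)
Require Import Defs.
From HB Require Import structures.
From mathcomp Require Import all_boot all_order all_fingroup all_algebra.
From mathcomp Require Import ring lra zify.
From mathcomp Require Import generic_quotient ring_quotient.
From mathcomp Require Import all_classical all_reals all_analysis.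
From mathcomp Require Import measurable_realfun complex.
From mathcomp Require mpoly.
Import (canonicals, coercions) mpoly.

Set Implicit Arguments.
Unset Strict Implicit.
Unset Printing Implicit Defensive.

Import Order.TTheory GRing.Theory Num.Theory numFieldNormedType.Exports.

Local Open Scope classical_set_scope.
Local Open Scope ring_scope.

(** * Iterated integrals over simplices *)

(** Membership in H^{p,q} asks for one cocycle on all continuous simplices that agrees with the
    integral of a form on the smooth ones. The homotopy is therefore defined on every simplex, with
    a default value where no smooth representative exists, and its coboundary is added to the cup
    product.

    The function on E comes from the addition formulas of Jacobi's sn, cn, dn for k^2 = -1: they
    express sn and cn of z + conj z by the coordinates of z and their conjugates, and phi is the
    amplitude of 2 Re z, whence the factor 2 in forms and periods. The automorphism sn -> -i sn, cn
    <-> dn of E multiplies z by -i, so that the same function also gives Im z.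

    Forms have to be given on all of C^N minus the origin, not on X alone, so dz is extended by an
    average with a positive denominator. In the pairings with tori, letting all factors run along
    the real loop detects a, and letting one of them run along the imaginary loop detects b. *)

Section ContinuityHelpers.
Variables (T U V : topologicalType).

Lemma cont_pair (f : T -> U) (g : T -> V) x :
  {for x, continuous f} -> {for x, continuous g} ->
  {for x, continuous (fun t => (f t, g t))}.
Proof. by move=> cf cg; apply: cvg_pair; [exact: cf|exact: cg]. Qed.

Lemma cont_cmp (f : T -> U) (g : U -> V) x :
  {for x, continuous f} -> {for f x, continuous g} ->
  {for x, continuous (fun t => g (f t))}.
Proof. exact: continuous_comp. Qed.

Lemma cont_fst (x : U * V) : {for x, continuous (@fst U V)}.
Proof. by case: x => a b; exact: cvg_fst. Qed.

Lemma cont_snd (x : U * V) : {for x, continuous (@snd U V)}.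
Proof. by case: x => a b; exact: cvg_snd. Qed.

Lemma cont_curry (f : U -> V -> T) u : continuous (fun q : U * V => f q.1 q.2) ->
  continuous (f u).
Proof.
move=> cf v; apply: (@continuous_comp _ _ _ (fun t => (u, t)) (fun q : U * V => f q.1 q.2)).
  by apply: cvg_pair; [exact: cvg_cst|exact: cvg_id].
exact: cf.
Qed.

End ContinuityHelpers.

Section SegmentIntegral.
Variable R : realType.
Local Notation mu := (@lebesgue_measure R).
Implicit Types (f g h F : R -> R) (a b : R).

(** For [b < 0] the interval is empty and the value is 0, so that the integral is continuous in [b]
    on the whole line. *)
Definition seg_int b f : R := \int[mu]_(t in `[0, b]) f t.

Lemma seg_int_eq b f g : (forall t, 0 <= t <= b -> f t = g t) ->
  seg_int b f = seg_int b g.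
Proof.
by move=> fg; apply: eq_Rintegral => t; rewrite inE /= in_itv /=; exact: fg.
Qed.

Lemma cont_integrable f a b : continuous f ->
  mu.-integrable `[a, b] (EFin \o f).
Proof.
move=> cf; apply: continuous_compact_integrable; first exact: segment_compact.
exact: continuous_subspaceT.
Qed.

Lemma seg_int_neg b f : b < 0 -> seg_int b f = 0.
Proof. by move=> b0; rewrite /seg_int set_itv_ge ?Rintegral_set0 // bnd_simp -ltNge. Qed.

Lemma seg_int0 f : seg_int 0 f = 0.
Proof. by rewrite /seg_int set_itv1 Rintegral_set1. Qed.

Lemma seg_intD b f g : continuous f -> continuous g ->
  seg_int b (fun t => f t + g t) = seg_int b f + seg_int b g.
Proof. by move=> cf cg; rewrite /seg_int RintegralD //; exact: cont_integrable. Qed.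

Lemma seg_intB b f g : continuous f -> continuous g ->
  seg_int b (fun t => f t - g t) = seg_int b f - seg_int b g.
Proof. by move=> cf cg; rewrite /seg_int RintegralB //; exact: cont_integrable. Qed.

Lemma seg_intZ b c f : continuous f ->
  seg_int b (fun t => c * f t) = c * seg_int b f.
Proof. by move=> cf; rewrite /seg_int RintegralZl //; exact: cont_integrable. Qed.

Lemma seg_int_FTC b f F : 0 <= b -> continuous f -> continuous F ->
  (forall t, 0 < t < b -> is_derive t 1 F (f t)) ->
  seg_int b f = F b - F 0.
Proof.
rewrite le_eqVlt => /predU1P[<- *|b0 cf cF dF]; first by rewrite seg_int0 subrr.
rewrite /seg_int /Rintegral (@continuous_FTC2 _ f F) //.
- exact: continuous_subspaceT.
- split=> [x||]; first by rewrite in_itv /= => /dF [].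
    exact: cvg_at_right_filter (cF 0).
  exact: cvg_at_left_filter (cF b).
- by move=> x; rewrite in_itv /= => /dF [dx <-]; rewrite derive1E.
Qed.

Lemma seg_int_refl b f : continuous f -> seg_int b (fun t => f (b - t)) = seg_int b f.
Proof.
move=> cf; have [b0|b0] := ltP b 0; first by rewrite !seg_int_neg.
pose S (t : R) := b - t.
have dS x : is_derive x (1 : R) S (- 1).
  by rewrite /S; apply: is_derive_eq; rewrite add0r mul1r.
have S1 : S^`()%classic = cst (-1).
  by apply/funext => x; rewrite derive1E; case: (dS x).
have cS : continuous S.
  by move=> x; apply/differentiable_continuous/derivable1_diffP; case: (dS x).
have := @integration_by_substitution_decreasing R S f 0 b b0.
rewrite /seg_int /Rintegral /S subr0 subrr => -> //.
- congr fine; apply: eq_integral => x _ /=.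
  by rewrite -/S S1 /= opprK mulr1.
- by move=> x y _ _ xy; rewrite ltrD2l ltrN2.
- by rewrite -/S S1 => x _; exact: cst_continuous.
- by rewrite -/S S1; exact: is_cvg_cst.
- by rewrite -/S S1; exact: is_cvg_cst.
- split=> [x _||]; first by case: (dS x).
    exact: cvg_at_right_filter (cS 0).
  exact: cvg_at_left_filter (cS b).
- exact: continuous_subspaceT.
Qed.

Lemma seg_int_le b f g : continuous f -> continuous g ->
  (forall t, 0 <= t <= b -> f t <= g t) -> seg_int b f <= seg_int b g.
Proof.
move=> cf cg fg; apply: le_Rintegral => //; try exact: cont_integrable.
Qed.

Lemma seg_int_cst b c : 0 <= b -> seg_int b (fun _ => c) = c * b.
Proof.
move=> b0; have -> : c * b = c * b - c * 0 by rewrite mulr0 subr0.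
apply: (@seg_int_FTC b (fun=> c) (fun t => c * t)) => //.
- by move=> x; exact: cst_continuous.
- by move=> x; apply: cvgM; [exact: cvg_cst|exact: cvg_id].
- by move=> t _; apply: is_derive_eq; rewrite [LHS]mulr1.
Qed.

Lemma seg_int_norm b c f : 0 <= b -> continuous f ->
  (forall t, 0 <= t <= b -> `|f t| <= c) -> `|seg_int b f| <= c * b.
Proof.
move=> b0 cf fc; rewrite -seg_int_cst // ler_norml.
have cc : continuous (fun _ : R => c) by move=> ?; exact: cst_continuous.
have cN : continuous (fun _ : R => - c) by move=> ?; exact: cst_continuous.
apply/andP; split; last first.
  by apply: seg_int_le => // t /fc; exact: le_trans (ler_norm _).
rewrite -mulN1r -seg_intZ //; apply: seg_int_le => //.
  by move=> x; apply: cvgM; exact: cvg_cst.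
by move=> t /fc; rewrite mulN1r ler_norml => /andP[].
Qed.

(** Lipschitz dependence on the upper limit, also across 0: on the negative side the integral is
    constantly 0. *)
Lemma seg_int_dist B M f a b : continuous f -> a <= B -> b <= B -> 0 <= M ->
  (forall t, 0 <= t <= B -> `|f t| <= M) ->
  `|seg_int b f - seg_int a f| <= M * `|b - a|.
Proof.
move=> cf; wlog ab : a b / a <= b => [hw aB bB M0 fM|aB bB M0 fM].
  have [ab|ab] := leP a b; first exact: hw.
  by rewrite distrC [X in _ * X]distrC; apply: hw => //; exact: ltW.
have [b0|b0] := ltP b 0.
  rewrite !seg_int_neg // ?subrr ?normr0 ?mulr_ge0 //; exact: le_lt_trans b0.
have [a0|a0] := ltP a 0.
  rewrite (seg_int_neg f a0) subr0; apply: (@le_trans _ _ (M * b)).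
    apply: seg_int_norm => // t /andP[t0 tb]; apply: fM; rewrite t0 /=.
    exact: le_trans tb bB.
  rewrite ler_wpM2l // ger0_norm ?subr_ge0 //; lra.
rewrite /seg_int Rintegral_itvB ?bnd_simp //; last exact: cont_integrable.
apply: le_trans (le_normr_Rintegral _ _) _ => //.
  apply: integrableS (cont_integrable 0 b cf) => //.
  by apply: subset_itvr; rewrite bnd_simp.
apply: le_trans (le_Rintegral _ _ _ _) _.
- by [].
- apply/integrable_norm; apply: integrableS (cont_integrable 0 b cf) => //.
  by apply: subset_itvr; rewrite bnd_simp.
- apply: (@integrableS _ _ _ mu `[a, b] _ (EFin \o cst M)) => //.
    by apply: subset_itvr; rewrite bnd_simp.
  by apply: cont_integrable; exact: cst_continuous.
- move=> t; rewrite /= in_itv /= => /andP[at_ tb]; apply: fM.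
  by rewrite (le_trans a0 (ltW at_)) (le_trans tb bB).
rewrite /= Rintegral_cst //= lebesgue_measure_itv /= lte_fin.
case: ifP => [_|/negbT]; first by rewrite ger0_norm // subr_ge0.
by rewrite mulr0 mulr_ge0.
Qed.

(** The variation in the upper limit is controlled by the Lipschitz bound, that in the parameter by
    uniform closeness on a compact interval. The parameter space is arbitrary because iterated
    integrals accumulate parameters. *)
Lemma seg_int_cont (V : topologicalType) (f : V -> R -> R) (p : V * R) :
  continuous (fun q : V * R => f q.1 q.2) ->
  {for p, continuous (fun q : V * R => seg_int q.2 (f q.1))}.
Proof.
move=> cf; case: p => v0 b0.
have cfv v : continuous (f v) by exact: cont_curry cf.
pose B : R := `|b0| + 1.
have B0 : 0 < B by rewrite ltr_pwDr.
have [M M0 hM] : exists2 M : R, 0 <= M & forall t, 0 <= t <= B -> `|f v0 t| <= M.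
  have [c _ hc] := @EVT_max R (fun t => `|f v0 t|) 0 B (ltW B0)
    (continuous_subspaceT (fun x => continuous_comp (cfv v0 x) (@norm_continuous _ _ _))).
  by exists `|f v0 c| => // t tB; apply: hc; rewrite in_itv.
(* Compactness of [[0, B]] turns pointwise joint continuity into closeness that is uniform in
   [t]. *)
have nearv (e : R) : 0 < e -> \forall v \near v0, forall t, 0 <= t <= B -> `|f v0 t - f v t| < e.
  move=> e0; have /compact_near_coveringP := @segment_compact R 0 B.
  move=> /(_ V (nbhs v0) (fun v t => `|f v0 t - f v t| < e) _) H.
  apply: filterS (H _); first by move=> v hv t tB; apply: hv; rewrite /= in_itv.
  move=> t _.
  have c1 : (fun q : R * V => f v0 q.1 - f q.2 q.1) @ (t, v0) --> f v0 t - f v0 t.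
    apply: cvgB.
      apply: (@cont_cmp _ _ _ fst (f v0) (t, v0)); [exact: cont_fst|exact: cfv].
    apply: (@cont_cmp _ _ _ (fun q : R * V => (q.2, q.1)) (fun q : V * R => f q.1 q.2) (t, v0)).
      by apply: cont_pair; [exact: cont_snd|exact: cont_fst].
    exact: cf.
  by move: c1; rewrite subrr => /cvgr0_norm_lt /(_ _ e0).
apply/cvgrPdist_lt => e e0 /=.
(* [e1] times the length, at most [B], and [e2] times the bound [M] each stay within [e / 2]; the 1
   in the minimum keeps [b] below [B]. *)
pose e1 := e / 2 / (B + 1); pose e2 := Num.min 1 (e / 2 / (M + 1)).
have e10 : 0 < e1 by rewrite !divr_gt0 // addr_gt0.
have e20 : 0 < e2 by rewrite lt_min ltr01 !divr_gt0 // ltr_pwDr.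
have Hb : \forall b \near b0, `|b0 - b| < e2.
  by apply: (@cvgr_dist_lt _ _ _ (nbhs b0) _ id b0) => //; exact: cvg_id.
exists ([set v | forall t, 0 <= t <= B -> `|f v0 t - f v t| < e1], [set b | `|b0 - b| < e2]).
  by split; [exact: nearv|exact: Hb].
move=> [v b] [/= hv hb].
have bB : b <= B.
  have : `|b0 - b| < 1 by apply: lt_le_trans hb _; rewrite ge_min lexx.
  rewrite /B ltr_norml => /andP[h1 h2]; have := ler_norm b0; lra.
have -> : seg_int b0 (f v0) - seg_int b (f v) =
  (seg_int b0 (f v0) - seg_int b (f v0)) + (seg_int b (f v0) - seg_int b (f v)) by ring.
apply: le_lt_trans (ler_normD _ _) _.
have -> : e = e / 2 + e / 2 by field.
apply: ltr_leD.
  apply: le_lt_trans (@seg_int_dist B M _ _ _ _ _ _ M0 _) _ => //.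
    by rewrite /B; have := ler_norm b0; lra.
  apply: (@le_lt_trans _ _ ((M + 1) * `|b0 - b|)).
    by rewrite ler_wpM2r // lerDl.
  rewrite -ltr_pdivlMl ?ltr_pwDr // mulrC.
  by apply: lt_le_trans hb _; rewrite ge_min lexx orbT.
have [bn|bp] := ltP b 0; first by rewrite !seg_int_neg // subrr normr0 divr_ge0 // ltW.
rewrite -seg_intB //.
apply: (@le_trans _ _ (e1 * b)).
  apply: seg_int_norm => //; first by move=> x; apply: cvgB; exact: cfv.
  move=> t /andP[t0 tb]; apply/ltW/hv; rewrite t0 /=; exact: le_trans tb bB.
apply: (@le_trans _ _ (e1 * (B + 1))); first by rewrite ler_wpM2l ?(ltW e10) //; lra.
by rewrite /e1 divfK // gt_eqF // addr_gt0.
Unshelve. all: by end_near. Qed.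

End SegmentIntegral.

(** * Exchange of the order of integration over a triangle *)

Section TriangleFubini.
Variable R : realType.
Local Notation mu := (@lebesgue_measure R).

(** The sigma-algebra on the plane is the product one, so an open set is written as a countable
    union of rectangles with rational endpoints. *)
Lemma open2_measurable (O : set (R * R)) : open O -> measurable O.
Proof.
move=> oO.
pose bx (q : (rat * rat) * (rat * rat)) : set (R * R) :=
  `]ratr q.1.1, ratr q.1.2[%classic `*` `]ratr q.2.1, ratr q.2.2[%classic.
suff -> : O = \bigcup_q (if `[< bx q `<=` O >] then bx q else set0).
  apply: countable_bigcupT_measurable => // q; case: ifP => // _.
  by apply: measurableX.
apply/seteqP; split=> [p Op|p [q _]]; last by case: asboolP => // h; exact: h.
have /nbhs_ballP[e /= e0 he] : nbhs p O by exact: open_nbhs_nbhs.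
have [a /andP[a1 a2]] : exists a : rat, p.1 - e < ratr a < p.1.
  by apply: rat_in_itvoo; rewrite ltrBlDr ltrDl.
have [b /andP[b1 b2]] : exists a : rat, p.1 < ratr a < p.1 + e.
  by apply: rat_in_itvoo; rewrite ltrDl.
have [c /andP[c1 c2]] : exists a : rat, p.2 - e < ratr a < p.2.
  by apply: rat_in_itvoo; rewrite ltrBlDr ltrDl.
have [d /andP[d1 d2]] : exists a : rat, p.2 < ratr a < p.2 + e.
  by apply: rat_in_itvoo; rewrite ltrDl.
exists ((a, b), (c, d)) => //; case: asboolP => [_|[]].
  by split; rewrite /= in_itv /=; apply/andP.
move=> r [/=]; rewrite !in_itv /= => /andP[r1 r2] /andP[r3 r4].
apply: he; split => /=; rewrite /ball /= ltr_norml; apply/andP; split; lra.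
Qed.

Lemma cont2_measurable (K : R * R -> R) : continuous K -> measurable_fun setT K.
Proof.
move=> /continuousP cK; apply: (measurability _ (measurable_realfun.RGenOpens.measurableE R)).
move=> _ [_ [a [b ->] <-]]; rewrite setTI; apply: open2_measurable.
exact/cK/interval_open.
Qed.

Let tri (a : R) : set (R * R) := [set p | 0 <= p.1 /\ 0 <= p.2 /\ p.1 + p.2 <= a].

Let tri_measurable a : measurable (tri a).
Proof.
have -> : tri a = [set p | 0 <= p.1] `&` [set p | 0 <= p.2] `&` [set p | p.1 + p.2 <= a].
  by apply/seteqP; split => [p [? [? ?]]|p [[? ?] ?]].
have h (f : R * R -> R) (i : interval R) : continuous f -> measurable (f @^-1` [set` i]).
  by move=> /cont2_measurable mf; rewrite -[X in measurable X]setTI; exact: mf.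
apply: measurableI; first apply: measurableI.
- have := h fst `[0, +oo[ (@cont_fst _ _); congr measurable.
  by apply/seteqP; split=> p /=; rewrite in_itv /= andbT.
- have := h snd `[0, +oo[ (@cont_snd _ _); congr measurable.
  by apply/seteqP; split=> p /=; rewrite in_itv /= andbT.
- have c2 : continuous (fun p : R * R => p.1 + p.2).
    by move=> p; apply: cvgD; [exact: cont_fst|exact: cont_snd].
  by have := h _ `]-oo, a] c2; congr measurable.
Qed.

Let ftri a (K : R -> R -> R) (p : R * R) : R := K p.1 p.2 * \1_(tri a) p.

Let tri_section a (K : R -> R -> R) x : continuous (K x) ->
  (\int[mu]_y (ftri a K (x, y))%:E)%E =
  ((fun x => (seg_int (a - x) (K x))%:E) \_ `[0, a]) x.
Proof.
move=> cK; rewrite patchE; case: ifPn => [|/negP h].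
  rewrite inE /= in_itv /= => /andP[x0 xa].
  rewrite /seg_int /Rintegral fineK; last first.
    by apply: integrable_fin_num => //; exact: cont_integrable.
  rewrite [RHS]integral_mkcond; apply: eq_integral => y _.
  rewrite patchE /ftri indicE; case: ifPn => [|/negP yn].
    rewrite inE /= in_itv /= => /andP[y0 ya].
    by rewrite mem_set ?mulr1 //=; split=> //; split=> //=; lra.
  rewrite memNset ?mulr0 // => -[/= _ [y0 ya]]; apply: yn.
  by rewrite inE /= in_itv /= y0 /=; lra.
apply: integral0_eq => y _; rewrite /ftri indicE memNset ?mulr0 //.
move=> -[/= x0 [y0 ya]]; apply: h; rewrite inE /= in_itv /= x0 /=; lra.
Qed.

Let seg_seg_int a K : (forall x, continuous (K x)) ->
  seg_int a (fun t => seg_int (a - t) (K t)) =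
  fine (\int[mu]_x \int[mu]_y (ftri a K (x, y))%:E)%E.
Proof.
move=> cK; rewrite {1}/seg_int /Rintegral integral_mkcond.
by congr fine; apply: eq_integral => x _; rewrite tri_section.
Qed.

Let seg_seg_cont a (K : R -> R -> R) : continuous (fun p : R * R => K p.1 p.2) ->
  continuous (fun t => seg_int (a - t) (K t)).
Proof.
move=> cK t; apply: (@cont_cmp _ _ _ (fun t => (t, a - t)) (fun q : R * R => seg_int q.2 (K q.1))).
  apply: cont_pair; first exact: cvg_id.
  by apply: cvgB; [exact: cvg_cst|exact: cvg_id].
exact: seg_int_cont.
Qed.

(** Fubini for [K] times the indicator of the triangle [s, t >= 0], [s + t <= a]; integrability
    follows from the continuity of the partial integrals of [|K|]. *)
Lemma seg_int_swap a (K : R -> R -> R) : continuous (fun p : R * R => K p.1 p.2) ->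
  seg_int a (fun t => seg_int (a - t) (K t)) =
  seg_int a (fun s => seg_int (a - s) (K ^~ s)).
Proof.
move=> cK.
have cK1 x : continuous (K x) by exact: cont_curry.
have cKs : continuous (fun p : R * R => K p.2 p.1).
  move=> p; apply: (@cont_cmp _ _ _ (fun p : R * R => (p.2, p.1)) (fun p : R * R => K p.1 p.2)).
    by apply: cont_pair; [exact: cont_snd|exact: cont_fst].
  exact: cK.
have cK2 x : continuous (K ^~ x) by exact: (@cont_curry _ _ _ (fun s t => K t s)).
rewrite (seg_seg_int a cK1) (@seg_seg_int a (fun s t => K t s) cK2); congr fine.
have mf0 : measurable_fun [set: R * R] (ftri a K).
  apply: measurable_realfun.measurable_funM; first exact: cont2_measurable.
  by apply: measurable_indic; exact: tri_measurable.
have /measurable_EFinP mf := mf0.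
rewrite (@Fubini _ _ _ _ _ mu mu (EFin \o ftri a K)).
  apply: eq_integral => y _; apply: eq_integral => x _.
  rewrite /ftri !indicE; congr (_ * _)%:E; congr ((_ : bool)%:R).
  by apply/idP/idP; rewrite !inE /tri /= => -[? [? ?]]; split=> //; split=> //; rewrite addrC.
apply/(integrable12ltyP mu mu mf).
pose h x := seg_int (a - x) (fun y => `|K x y|).
have E x : (\int[mu]_y `|(ftri a K (x, y))%:E|)%E = ((fun x => (h x)%:E) \_ `[0, a]) x.
  rewrite -(@tri_section a (fun x y => `|K x y|)); last by move=> y; apply: continuous_comp; [exact: cK1|exact: norm_continuous].
  by apply: eq_integral => y _; rewrite /ftri /= normrM indicE normr_nat.
under eq_integral => x _ do rewrite E.
rewrite -integral_mkcond.
have : mu.-integrable `[0, a] (EFin \o h).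
  apply: cont_integrable; apply: (@seg_seg_cont a (fun x y => `|K x y|)) => p.
  by apply: continuous_comp; [exact: cK|exact: norm_continuous].
move=> ih; have : (\int[mu]_(x in `[0%R, a]) (h x)%:E)%E \is a fin_num.
  exact: integrable_fin_num.
by rewrite fin_numE => /andP[_]; rewrite ltey.
Qed.

End TriangleFubini.

(** * Coordinate insertions and affine symmetries of the simplex *)

Section InsertCoordinate.
Variable R : pzRingType.

Definition ins k (i : 'I_k.+1) (x : R) (u : 'rV[R]_k) : 'rV[R]_k.+1 :=
  \row_j (if unlift i j is Some j' then u 0 j' else x).

Lemma ins_at k (i : 'I_k.+1) x u : ins i x u 0 i = x.
Proof. by rewrite mxE unlift_none. Qed.

Lemma ins_lift k (i : 'I_k.+1) x u j : ins i x u 0 (lift i j) = u 0 j.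
Proof. by rewrite mxE liftK. Qed.

Lemma ins_sum k (i : 'I_k.+1) x u : \sum_j ins i x u 0 j = x + \sum_j u 0 j.
Proof.
rewrite (bigD1_ord i) //= ins_at; congr (_ + _).
by apply: eq_bigr => j _; rewrite ins_lift.
Qed.

Lemma row_eq k (i : 'I_k.+1) (u v : 'rV[R]_k.+1) : u 0 i = v 0 i ->
  (forall j, u 0 (lift i j) = v 0 (lift i j)) -> u = v.
Proof.
move=> ui ul; apply/rowP => j; case: (unliftP i j) => [j' ->|->] //.
Qed.

Lemma ins_row_mx k (x : R) (u : 'rV[R]_k) : row_mx x%:M u = ins ord0 x u.
Proof.
apply: (row_eq (i:=ord0)) => [|j]; rewrite ?ins_at.
  rewrite (_ : ord0 = lshift k (ord0 : 'I_1)); last exact: val_inj.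
  by transitivity ((x%:M : 'M[R]_1) 0 0); [exact: row_mxEl|rewrite mxE eqxx].
rewrite ins_lift (_ : lift ord0 j = rshift 1 j); last exact: val_inj.
exact: (row_mxEr (x%:M : 'M[R]_1) u).
Qed.

Lemma ins0_ins k (i : 'I_k.+1) x t (u : 'rV[R]_k) :
  ins (lift ord0 i) x (ins ord0 t u) = ins ord0 t (ins i x u).
Proof.
apply: (row_eq (i:=ord0)) => [|j]; rewrite ?ins_at.
  by rewrite (_ : ord0 = lift (lift ord0 i) ord0) ?ins_lift ?ins_at //; exact: val_inj.
rewrite ins_lift; case: (unliftP i j) => [j' ->|->]; last by rewrite !ins_at.
rewrite ins_lift (_ : lift _ (lift _ _) = lift (lift ord0 i) (lift ord0 j')); last first.
  by apply: val_inj; rewrite /= !/bump /= !add1n ltnS; case: leqP.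
by rewrite !ins_lift.
Qed.

Lemma ins_addl k (i : 'I_k.+1) h x (u : 'rV[R]_k) :
  h *: delta_mx 0 i + ins i x u = ins i (h + x) u.
Proof.
apply: (row_eq (i:=i)) => [|j]; rewrite !mxE ?eqxx /= ?unlift_none ?liftK.
  by rewrite mulr1.
by rewrite eq_sym (negbTE (neq_lift _ _)) mulr0 add0r.
Qed.

Lemma ins_addr k (i : 'I_k.+1) j h x (u : 'rV[R]_k) :
  h *: delta_mx 0 (lift i j) + ins i x u = ins i x (h *: delta_mx 0 j + u).
Proof.
apply: (row_eq (i:=i)) => [|j']; rewrite !mxE ?eqxx /= ?unlift_none ?liftK.
  by rewrite (negbTE (neq_lift _ _)) mulr0 add0r.
by rewrite !mxE eqxx (inj_eq lift_inj).
Qed.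

Definition swap01 k (u : 'rV[R]_k.+2) : 'rV[R]_k.+2 :=
  \row_j u 0 (tperm ord0 (lift ord0 ord0) j).

Lemma swap01_ins k t s (u : 'rV[R]_k) :
  swap01 (ins ord0 t (ins ord0 s u)) = ins ord0 s (ins ord0 t u).
Proof.
apply: (row_eq (i:=ord0)); first by rewrite mxE tpermL ins_lift !ins_at.
move=> j; rewrite ins_lift; case: (unliftP ord0 j) => [j' ->|->].
  by rewrite mxE tpermD // !ins_lift.
by rewrite mxE tpermR !ins_at.
Qed.

Lemma swap01_ins1 k x (u : 'rV[R]_k.+1) :
  swap01 (ins (lift ord0 ord0) x u) = ins ord0 x u.
Proof.
have -> : u = ins ord0 (u 0 ord0) (\row_j u 0 (lift ord0 j)).
  by apply: (row_eq (i:=ord0)) => [|j]; rewrite ?ins_at // ins_lift mxE.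
by rewrite ins0_ins swap01_ins.
Qed.

Lemma swap01_sum k (u : 'rV[R]_k.+2) : \sum_j swap01 u 0 j = \sum_j u 0 j.
Proof.
rewrite (reindex_inj (@perm_inj _ (tperm ord0 (lift ord0 ord0)))) /=.
by apply: eq_bigr => j _; rewrite mxE tpermK.
Qed.

Lemma swap01_add k (u : 'rV[R]_k.+2) h :
  swap01 (h *: delta_mx 0 (lift ord0 ord0) + u) = h *: delta_mx 0 ord0 + swap01 u.
Proof.
by apply/rowP => j; rewrite !mxE !eqxx /=; congr (_ * _%:R + _); case: tpermP => [->|->|/eqP/negbTE -> /eqP/negbTE ->].
Qed.

(* Exchanges the i-th coordinate with the barycentric coordinate of the
   vertex 0. *)
Definition bary_swap k (a : R) (i : 'I_k) (u : 'rV[R]_k) : 'rV[R]_k :=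
  \row_j (if j == i then a - \sum_l u 0 l else u 0 j).

Lemma bary_swap_ins k a t (i : 'I_k) (u : 'rV[R]_k) :
  bary_swap a (lift ord0 i) (ins ord0 t u) = ins ord0 t (bary_swap (a - t) i u).
Proof.
apply: (row_eq (i:=ord0)) => [|j]; first by rewrite mxE /= !ins_at.
rewrite ins_lift !mxE (inj_eq lift_inj) liftK; case: eqP => // _.
by rewrite ins_sum opprD addrA.
Qed.

Lemma bary_swap_swap01 k a (u : 'rV[R]_k.+2) :
  bary_swap a ord0 (swap01 u) = swap01 (bary_swap a (lift ord0 ord0) u).
Proof.
apply/rowP => j; rewrite !mxE swap01_sum.
by case: tpermP => [->|->|/eqP/negbTE -> /eqP/negbTE ->].
Qed.

End InsertCoordinate.

(** * Symmetries of simplex integrals and integration of a partial derivative *)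

Section SimplexIntegral.
Variable R : realType.

Lemma cont_ext (V W : topologicalType) (f g : V -> W) x : f =1 g ->
  {for x, continuous f} -> {for x, continuous g}.
Proof. by move=> /funext ->. Qed.

Lemma cont_cst (V W : topologicalType) (c : W) (x : V) : {for x, continuous (fun _ : V => c)}.
Proof. exact: cvg_cst. Qed.

Lemma cont_id (V : topologicalType) (x : V) : {for x, continuous (fun v : V => v)}.
Proof. exact: cvg_id. Qed.

Lemma contB (V : topologicalType) (f g : V -> R) x : {for x, continuous f} ->
  {for x, continuous g} -> {for x, continuous (fun v => f v - g v)}.
Proof. exact: cvgB. Qed.

Lemma contM (V : topologicalType) (f g : V -> R) x : {for x, continuous f} ->
  {for x, continuous g} -> {for x, continuous (fun v => f v * g v)}.
Proof. exact: cvgM. Qed.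

Lemma contD (V : topologicalType) (f g : V -> R) x : {for x, continuous f} ->
  {for x, continuous g} -> {for x, continuous (fun v => f v + g v)}.
Proof. exact: cvgD. Qed.

Lemma contV (V : topologicalType) (f : V -> R) x : f x != 0 -> {for x, continuous f} ->
  {for x, continuous (fun v => (f v)^-1)}.
Proof. exact: cvgV. Qed.

Lemma cont_max (V : topologicalType) (f g : V -> R) x : {for x, continuous f} ->
  {for x, continuous g} -> {for x, continuous (fun v => Num.max (f v) (g v))}.
Proof. exact: continuous_max. Qed.

Lemma cont_row (V : topologicalType) k (f : V -> 'rV[R]_k) x :
  (forall j, {for x, continuous (fun v => f v 0 j)}) -> {for x, continuous f}.
Proof.
move=> cf A [B nB sBA].
have : nbhs x [set v | forall j, B 0 j (f v 0 j)].
  by apply: filter_forall => j; apply: cf; exact: nB.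
by apply: filterS => v hv; apply: sBA => i j; rewrite (ord1 i); exact: hv.
Qed.

Lemma cont_coord k (j : 'I_k) (x : 'rV[R]_k) : {for x, continuous (fun u : 'rV[R]_k => u 0 j)}.
Proof. exact: coord_continuous. Qed.

Lemma cont_ins (V : topologicalType) k (i : 'I_k.+1) (f : V -> R) (g : V -> 'rV[R]_k) x :
  {for x, continuous f} -> {for x, continuous g} ->
  {for x, continuous (fun v => ins i (f v) (g v))}.
Proof.
move=> cf cg; apply: cont_row => j; case: (unliftP i j) => [j' ->|->].
  apply: (@cont_ext _ _ (fun v => g v 0 j')) => [v|]; first by rewrite ins_lift.
  by apply: (@cont_cmp _ _ _ g (fun u => u 0 j')) => //; exact: cont_coord.
by apply: (@cont_ext _ _ f) => // v; rewrite ins_at.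
Qed.

Lemma cont_sum (V : topologicalType) (I : Type) (r : seq I) (P : pred I) (f : I -> V -> R) x :
  (forall i, {for x, continuous (f i)}) ->
  {for x, continuous (fun v => \sum_(i <- r | P i) f i v)}.
Proof.
move=> cf; elim: r => [|i r IH].
  by apply: (@cont_ext _ _ (fun=> 0)) => [v|]; [rewrite big_nil|exact: cont_cst].
case Pi : (P i); last first.
  by apply: cont_ext IH => v; rewrite big_cons Pi.
apply: (@cont_ext _ _ (fun v => f i v + \sum_(j <- r | P j) f j v)) => [v|].
  by rewrite big_cons Pi.
by apply: cvgD => //; exact: cf.
Qed.

Lemma simplex_integralS k a (g : 'rV[R]_k.+1 -> R) :
  simplex_integral a g =
  seg_int a (fun t => simplex_integral (a - t) (fun u => g (ins ord0 t u))).
Proof.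
apply: seg_int_eq => t _; congr (simplex_integral _ _).
by apply/funext => u; rewrite ins_row_mx.
Qed.

Lemma simplex_integral_eq k a (g h : 'rV[R]_k -> R) : 0 <= a ->
  (forall t : 'rV[R]_k, (forall i, 0 <= t 0 i) -> \sum_i t 0 i <= a -> g t = h t) ->
  simplex_integral a g = simplex_integral a h.
Proof.
elim: k a g h => [|k IH] a g h a0 gh.
  by apply: gh => [[]//|]; rewrite big_ord0.
rewrite !simplex_integralS; apply: seg_int_eq => t /andP[t0 ta].
apply: IH => [|u u0 ua]; first by rewrite subr_ge0.
apply: gh => [i|]; last by rewrite ins_sum; lra.
by case: (unliftP ord0 i) => [j ->|->]; rewrite ?ins_lift ?ins_at.
Qed.

(** Induction on the dimension: the first coordinate joins the parameters of the inner integral. *)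
Lemma simplex_integral_cont (V : topologicalType) k (g : V -> 'rV[R]_k -> R) (p : V * R) :
  continuous (fun q : V * 'rV[R]_k => g q.1 q.2) ->
  {for p, continuous (fun q : V * R => simplex_integral q.2 (g q.1))}.
Proof.
elim: k V g p => [|k IH] V g p cg.
  apply: (@cont_cmp _ _ _ (fun q : V * R => (q.1, 0 : 'rV[R]_0)) (fun q : V * 'rV[R]_0 => g q.1 q.2)).
    by apply: cont_pair; [exact: cont_fst|exact: cont_cst].
  exact: cg.
pose f (v : V * R) t := simplex_integral (v.2 - t) (fun u => g v.1 (ins ord0 t u)).
apply: (@cont_ext _ _ (fun q : V * R => seg_int q.2 (f q))) => [q|].
  by rewrite simplex_integralS.
apply: (@cont_cmp _ _ _ (fun q : V * R => (q, q.2)) (fun q : (V * R) * R => seg_int q.2 (f q.1))).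
  by apply: cont_pair; [exact: cont_id|exact: cont_snd].
apply: seg_int_cont => {p} p.
pose g' (w : V * R) (u : 'rV[R]_k) := g w.1 (ins ord0 w.2 u).
apply: (@cont_cmp _ _ _ (fun q : (V * R) * R => ((q.1.1, q.2), q.1.2 - q.2))
   (fun q : (V * R) * R => simplex_integral q.2 (g' q.1))).
  have c12 : {for p, continuous (fun q : (V * R) * R => q.1.2)}.
    by apply: (@cont_cmp _ _ _ fst snd); [exact: cont_fst|exact: cont_snd].
  have c11 : {for p, continuous (fun q : (V * R) * R => q.1.1)}.
    by apply: (@cont_cmp _ _ _ fst fst); [exact: cont_fst|exact: cont_fst].
  apply: cont_pair; first by apply: cont_pair; [exact: c11|exact: cont_snd].
  by apply: contB; [exact: c12|exact: cont_snd].
apply: IH => {}p.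
apply: (@cont_cmp _ _ _ (fun q : (V * R) * 'rV[R]_k => (q.1.1, ins ord0 q.1.2 q.2)) (fun q => g q.1 q.2)); last exact: cg.
apply: cont_pair; first by apply: (@cont_cmp _ _ _ fst fst); exact: cont_fst.
apply: cont_ins; last exact: cont_snd.
by apply: (@cont_cmp _ _ _ fst snd); [exact: cont_fst|exact: cont_snd].
Qed.

Lemma simplex_integral_swap01 k a (g : 'rV[R]_k.+2 -> R) : continuous g ->
  simplex_integral a (fun u => g (swap01 u)) = simplex_integral a g.
Proof.
move=> cg; rewrite !simplex_integralS.
pose K t s := simplex_integral (a - t - s) (fun u => g (ins ord0 t (ins ord0 s u))).
transitivity (seg_int a (fun t => seg_int (a - t) (K ^~ t))).
  apply: seg_int_eq => t _; rewrite simplex_integralS; apply: seg_int_eq => s _.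
  rewrite /K addrAC; congr simplex_integral; apply/funext => u.
  by rewrite swap01_ins.
rewrite -seg_int_swap; last first.
  move=> p; pose g' (w : R * R) (u : 'rV[R]_k) := g (ins ord0 w.1 (ins ord0 w.2 u)).
  apply: (@cont_cmp _ _ _ (fun q : R * R => (q, a - q.1 - q.2))
     (fun q : (R * R) * R => simplex_integral q.2 (g' q.1))).
    apply: cont_pair; first exact: cont_id.
    apply: contB; last exact: cont_snd.
    by apply: contB; [exact: cont_cst|exact: cont_fst].
  apply: simplex_integral_cont => {}p.
  apply: (@cont_cmp _ _ _ (fun q : (R * R) * 'rV[R]_k => ins ord0 q.1.1 (ins ord0 q.1.2 q.2)) g); last exact: cg.
  apply: cont_ins; first by apply: (@cont_cmp _ _ _ fst fst); exact: cont_fst.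
  apply: cont_ins; last exact: cont_snd.
  by apply: (@cont_cmp _ _ _ fst snd); [exact: cont_fst|exact: cont_snd].
by apply: seg_int_eq => t _; rewrite simplex_integralS.
Qed.

Lemma is_derive_line k (G : 'rV[R]_k -> R) (x e : 'rV[R]_k) (c : R -> 'rV[R]_k) t d :
  c t = x -> (forall h, c (h + t) = h *: e + x) ->
  is_derive x e G d -> is_derive t 1 (fun t => G (c t)) d.
Proof.
move=> ct ch [dG <-].
have E : (fun h : R => h^-1 *: (((fun t => G (c t)) \o shift t) (h *: (1 : R)) - G (c t))) =
         (fun h : R => h^-1 *: ((G \o shift x) (h *: e) - G x)).
  by apply/funext => h /=; rewrite ct -ch [h *: 1]mulr1.
by apply: DeriveDef; [move: dG; rewrite /derivable -E|rewrite /derive E].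
Qed.

Lemma is_derive_affine k l (G : 'rV[R]_k -> R) (e : 'rV[R]_k) (c : 'rV[R]_l -> 'rV[R]_k) u f d :
  (forall h, c (h *: f + u) = h *: e + c u) ->
  is_derive (c u) e G d -> is_derive u f (fun t => G (c t)) d.
Proof.
move=> ch [dG <-].
have E : (fun h : R => h^-1 *: (((fun t => G (c t)) \o shift u) (h *: f) - G (c u))) =
         (fun h : R => h^-1 *: ((G \o shift (c u)) (h *: e) - G (c u))).
  by apply/funext => h /=; rewrite ch.
by apply: DeriveDef; [move: dG; rewrite /derivable -E|rewrite /derive E].
Qed.

Lemma cont_swap01 k : continuous (@swap01 R k).
Proof.
move=> u; apply: cont_row => j; apply: cont_ext (@cont_coord _ _ u) => v.
by rewrite mxE.
Qed.

(** Integrating out one coordinate leaves the two ends of its range: the slanted face and the face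
    [t_i = 0]. The induction treats the first coordinate as a parameter; when it is itself the one
    to be integrated, it is exchanged with the second one, so that the classical theorem is applied
    in dimension one only. *)
Lemma simplex_FTC k (i : 'I_k.+1) a (G g : 'rV[R]_k.+1 -> R) :
  0 <= a -> continuous G -> continuous g ->
  (forall t : 'rV[R]_k.+1, (forall j, 0 <= t 0 j) -> 0 < t 0 i -> \sum_j t 0 j < a ->
     is_derive t (delta_mx 0 i) G (g t)) ->
  simplex_integral a g =
  simplex_integral a (fun u => G (ins i (a - \sum_j u 0 j) u) - G (ins i 0 u)).
Proof.
elim: k i a G g => [|k IH] i a G g a0 cG cg dG.
  rewrite (ord1 i) in dG *; rewrite simplex_integralS /= big_ord0 subr0.
  apply: (@seg_int_FTC _ a _ (fun t => G (ins ord0 t 0))) => //.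
  - by move=> t; apply: (@cont_cmp R 'rV[R]_1 R (fun t => ins ord0 t (0 : 'rV[R]_0)) g); [apply: cont_ins; [exact: cont_id|exact: cont_cst]|exact: cg].
  - by move=> t; apply: (@cont_cmp R 'rV[R]_1 R (fun t => ins ord0 t (0 : 'rV[R]_0)) G); [apply: cont_ins; [exact: cont_id|exact: cont_cst]|exact: cG].
  move=> t /andP[t0 ta]; apply: (is_derive_line (x := ins ord0 t 0) (e := delta_mx 0 ord0)) => // [h|].
    by rewrite ins_addl.
  apply: dG; rewrite ?ins_at ?ins_sum ?big_ord0 ?addr0 // => j.
  by case: (unliftP ord0 j) => [[]//|->]; rewrite ins_at ltW.
have main (G' g' : 'rV[R]_k.+2 -> R) i' : continuous G' -> continuous g' -> (forall t : 'rV[R]_k.+2, (forall j, 0 <= t 0 j) -> 0 < t 0 (lift ord0 i') -> \sum_j t 0 j < a ->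
     is_derive t (delta_mx 0 (lift ord0 i')) G' (g' t)) -> simplex_integral a g' =
    simplex_integral a (fun u => G' (ins (lift ord0 i') (a - \sum_j u 0 j) u) - G' (ins (lift ord0 i') 0 u)).
  move=> cG' cg' dG'; rewrite !simplex_integralS; apply: seg_int_eq => t /andP[t0 ta].
  transitivity (simplex_integral (a - t) (fun u => G' (ins ord0 t (ins i' (a - t - \sum_j u 0 j) u))
      - G' (ins ord0 t (ins i' 0 u)))); last first.
    by congr simplex_integral; apply/funext => u; rewrite !ins0_ins ins_sum opprD addrA.
  apply: (IH i' (a - t) (fun u => G' (ins ord0 t u)) (fun u => g' (ins ord0 t u))).
  - by rewrite subr_ge0.
  - by move=> u; apply: (@cont_cmp _ _ _ (fun u => ins ord0 t u) G'); [apply: cont_ins; [exact: cont_cst|exact: cont_id]|exact: cG'].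
  - by move=> u; apply: (@cont_cmp _ _ _ (fun u => ins ord0 t u) g'); [apply: cont_ins; [exact: cont_cst|exact: cont_id]|exact: cg'].
  move=> u u0 ui ua; apply: is_derive_affine.
    by move=> h; rewrite -ins_addr.
  apply: dG'; rewrite ?ins_lift ?ins_sum //; last lra.
  by move=> j; case: (unliftP ord0 j) => [j' ->|->]; rewrite ?ins_at ?ins_lift.
case: (unliftP ord0 i) => [i' ei|ei]; first by rewrite ei in dG *; exact: main.
rewrite ei in dG *; rewrite -(simplex_integral_swap01 a cg).
have cs (h : 'rV[R]_k.+2 -> R) : continuous h -> continuous (fun u : 'rV[R]_k.+2 => h (swap01 u)).
  by move=> ch u; apply: (@cont_cmp _ _ _ (@swap01 R k) h); [exact: cont_swap01|exact: ch].
transitivity (simplex_integral a (fun u => G (swap01 (ins (lift ord0 ord0) (a - \sum_j u 0 j) u))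
    - G (swap01 (ins (lift ord0 ord0) 0 u)))); last first.
  by congr simplex_integral; apply/funext => u; rewrite !swap01_ins1.
apply: (main (fun u => G (swap01 u)) (fun u => g (swap01 u)) ord0 (cs _ cG) (cs _ cg)).
move=> t t0 ti ta; apply: is_derive_affine.
  by move=> h; exact: swap01_add.
apply: dG; rewrite ?swap01_sum // ?mxE ?tpermL // => j.
by rewrite mxE.
Qed.

(** The affine symmetry of the simplex that exchanges vertex 0 with another vertex preserves volume.
    Each case is reduced to [t -> a - t] on a segment, by fixing the first coordinate or by
    conjugating with [swap01]. *)
Lemma simplex_integral_bary_swap k (i : 'I_k) a (g : 'rV[R]_k -> R) : continuous g ->
  simplex_integral a (fun u => g (bary_swap a i u)) = simplex_integral a g.
Proof.
elim: k i a g => [|k IH] i a g cg; first by case: i.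
have main i' (g' : 'rV[R]_k.+1 -> R) : continuous g' ->
    simplex_integral a (fun u => g' (bary_swap a (lift ord0 i') u)) = simplex_integral a g'.
  move=> cg'; rewrite !simplex_integralS; apply: seg_int_eq => t _.
  rewrite -(IH i' (a - t) (fun u => g' (ins ord0 t u))).
    by congr simplex_integral; apply/funext => u; rewrite bary_swap_ins.
  by move=> u; apply: (@cont_cmp _ _ _ (fun u => ins ord0 t u) g'); [apply: cont_ins; [exact: cont_cst|exact: cont_id]|exact: cg'].
case: (unliftP ord0 i) => [i' ->|->]; first exact: main.
case: k IH i g cg main => [|k] IH i g cg main.
  rewrite !simplex_integralS /= -[RHS]seg_int_refl.
    apply: seg_int_eq => t _; congr g; apply: (row_eq (i:=ord0)) => [|[]//].
    by rewrite mxE eqxx ins_at ins_sum big_ord0 addr0.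
  by move=> t; apply: (@cont_cmp R 'rV[R]_1 R (fun t => ins ord0 t (0 : 'rV[R]_0)) g); [apply: cont_ins; [exact: cont_id|exact: cont_cst]|exact: cg].
have cs (h : 'rV[R]_k.+2 -> R) : continuous h -> continuous (fun u : 'rV[R]_k.+2 => h (swap01 u)).
  by move=> ch u; apply: (@cont_cmp _ _ _ (@swap01 R k) h); [exact: cont_swap01|exact: ch].
rewrite -(simplex_integral_swap01 a cg) -(main ord0 _ (cs _ cg)).
rewrite -[LHS]simplex_integral_swap01; last first.
  move=> u; apply: (@cont_cmp _ _ _ (@bary_swap R _ a ord0) g); last exact: cg.
  apply: cont_row => j; apply: (@cont_ext _ _ (fun v : 'rV[R]_k.+2 => if j == ord0 then a - \sum_l v 0 l else v 0 j)) => [v|].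
    by rewrite mxE.
  case: (j == ord0); last exact: cont_coord.
  by apply: contB; [exact: cont_cst|apply: cont_sum => l; exact: cont_coord].
by congr simplex_integral; apply/funext => u; rewrite bary_swap_swap01.
Qed.

(** The slanted face is parametrised by all coordinates but the [i]-th. The parametrisations for
    consecutive [i] differ by a [bary_swap], so they give the same integral. *)
Lemma simplex_integral_slanted k (i : 'I_k.+1) a (G : 'rV[R]_k.+1 -> R) : continuous G ->
  simplex_integral a (fun u : 'rV[R]_k => G (ins i (a - \sum_j u 0 j) u)) =
  simplex_integral a (fun u : 'rV[R]_k => G (ins ord0 (a - \sum_j u 0 j) u)).
Proof.
move=> cG; case: i => i; elim: i => [|i IH] ik.
  by congr simplex_integral; apply/funext => u; congr (G (ins _ _ _)); exact: val_inj.
have ik' : (i < k.+1)%N by exact: ltnW.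
rewrite -(IH ik') -(simplex_integral_bary_swap (Ordinal (ik : (i < k)%N))); last first.
  move=> u; apply: (@cont_cmp _ _ _ (fun u : 'rV[R]_k => ins _ (a - \sum_j u 0 j) u) G); last exact: cG.
  apply: cont_ins; last exact: cont_id.
  by apply: contB; [exact: cont_cst|apply: cont_sum => l; exact: cont_coord].
congr simplex_integral; apply/funext => u; congr G.
set i0 := Ordinal (ik : (i < k)%N).
have S : \sum_j bary_swap a i0 u 0 j = a - u 0 i0.
  have E : \sum_j u 0 j = u 0 i0 + \sum_(j | j != i0) u 0 j by rewrite (bigD1 i0).
  rewrite [LHS](bigD1 i0) //= mxE eqxx E.
  rewrite (eq_bigr (fun j => u 0 j)); first by rewrite opprD addrA subrK.
  by move=> j /negbTE ji; rewrite mxE ji.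
rewrite S opprB addrC subrK.
apply: (row_eq (i:=(Ordinal ik))) => [|j].
  rewrite ins_at (_ : Ordinal ik = lift (Ordinal ik') i0); last first.
    by apply: val_inj; rewrite /= /bump leqnn.
  by rewrite ins_lift.
rewrite ins_lift; have [->|ji] := eqVneq j i0.
  rewrite (_ : lift (Ordinal ik) (i0 : 'I_k.+1.-1) = Ordinal ik'); last by apply: val_inj; rewrite /= /bump ltnn.
  by rewrite ins_at mxE eqxx.
rewrite (_ : lift (Ordinal ik) j = lift (Ordinal ik') j); first by rewrite ins_lift mxE (negbTE ji).
apply: val_inj; rewrite /= /bump; congr (_ + _)%N.
move: ji; rewrite -val_eqE /= => ji; rewrite [(i <= j)%N]leq_eqVlt eq_sym (negbTE ji) //.
Qed.

End SimplexIntegral.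

(** * Complex-valued functions *)

Section ComplexParts.
Variable R : realType.
Local Notation C := (CC R).
Implicit Types z w : C.

Lemma complex_ext z w : reC z = reC w -> imC z = imC w -> z = w.
Proof. by case: z w => [a b] [c d] /= -> ->. Qed.

Lemma mkCK z : mkC (reC z) (imC z) = z. Proof. by case: z. Qed.
Lemma reCD z w : reC (z + w) = reC z + reC w. Proof. by case: z w => [a b] [c d]. Qed.
Lemma imCD z w : imC (z + w) = imC z + imC w. Proof. by case: z w => [a b] [c d]. Qed.
Lemma reCN z : reC (- z) = - reC z. Proof. by case: z. Qed.
Lemma imCN z : imC (- z) = - imC z. Proof. by case: z. Qed.
Lemma reCB z w : reC (z - w) = reC z - reC w. Proof. by rewrite reCD reCN. Qed.
Lemma imCB z w : imC (z - w) = imC z - imC w. Proof. by rewrite imCD imCN. Qed.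
Lemma reC0 : reC (0 : C) = 0. Proof. by []. Qed.
Lemma imC0 : imC (0 : C) = 0. Proof. by []. Qed.
Lemma reCM z w : reC (z * w) = reC z * reC w - imC z * imC w.
Proof. by case: z w => [a b] [c d]. Qed.
Lemma imCM z w : imC (z * w) = reC z * imC w + imC z * reC w.
Proof. by case: z w => [a b] [c d]. Qed.
Lemma reC_conj z : reC z^* = reC z. Proof. by case: z. Qed.
Lemma imC_conj z : imC z^* = - imC z. Proof. by case: z. Qed.

Lemma reC_sum (I : Type) (r : seq I) (P : pred I) (f : I -> C) :
  reC (\sum_(i <- r | P i) f i) = \sum_(i <- r | P i) reC (f i).
Proof. by apply: (big_morph (@reC R)); [exact: reCD|exact: reC0]. Qed.
Lemma imC_sum (I : Type) (r : seq I) (P : pred I) (f : I -> C) :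
  imC (\sum_(i <- r | P i) f i) = \sum_(i <- r | P i) imC (f i).
Proof. by apply: (big_morph (@imC R)); [exact: imCD|exact: imC0]. Qed.

End ComplexParts.

Section ComplexDerivative.
Variables (R : realType) (k : nat).
Local Notation C := (CC R).
Implicit Types (f g : 'rV[R]_k -> C) (t : 'rV[R]_k).

Definition is_dC (v : 'rV[R]_k) f t (d : C) : Prop :=
  is_derive t v (fun u => reC (f u)) (reC d) /\
  is_derive t v (fun u => imC (f u)) (imC d).

Definition dC (v : 'rV[R]_k) f t : C :=
  mkC ('D_v (fun u => reC (f u)) t) ('D_v (fun u => imC (f u)) t).

Definition contC (T : topologicalType) (f : T -> C) (t : T) : Prop :=
  {for t, continuous (fun u => reC (f u))} /\ {for t, continuous (fun u => imC (f u))}.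

Lemma is_dC_val v f t d : is_dC v f t d -> dC v f t = d.
Proof. by case=> [[_ e1] [_ e2]]; rewrite /dC e1 e2 mkCK. Qed.

Lemma is_dC_eq v f t d d' : is_dC v f t d -> d = d' -> is_dC v f t d'.
Proof. by move=> h <-. Qed.

Lemma is_dC_ext v f g t d : f =1 g -> is_dC v f t d -> is_dC v g t d.
Proof. by move=> /funext ->. Qed.

Lemma is_dC_cst v c t : is_dC v (fun=> c) t 0.
Proof. by split; exact: is_derive_cst. Qed.

Lemma is_dC_add v f g t d e : is_dC v f t d -> is_dC v g t e ->
  is_dC v (fun u => f u + g u) t (d + e).
Proof.
move=> [f1 f2] [g1 g2]; split.
  rewrite reCD (_ : (fun u => _) = (fun u => reC (f u)) + (fun u => reC (g u))).
    exact: is_deriveD.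
  by apply/funext => u; rewrite reCD.
rewrite imCD (_ : (fun u => _) = (fun u => imC (f u)) + (fun u => imC (g u))).
  exact: is_deriveD.
by apply/funext => u; rewrite imCD.
Qed.

Lemma is_dC_mul v f g t d e : is_dC v f t d -> is_dC v g t e ->
  is_dC v (fun u => f u * g u) t (d * g t + f t * e).
Proof.
move=> [f1 f2] [g1 g2]; split.
  rewrite (_ : (fun u => _) = (fun u => reC (f u)) * (fun u => reC (g u))
      - (fun u => imC (f u)) * (fun u => imC (g u))); last first.
    by apply/funext => u; rewrite reCM.
  apply: is_derive_eq; rewrite reCD !reCM /GRing.scale /=; ring.
rewrite (_ : (fun u => _) = (fun u => reC (f u)) * (fun u => imC (g u))
    + (fun u => imC (f u)) * (fun u => reC (g u))); last first.
  by apply/funext => u; rewrite imCM.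
apply: is_derive_eq; rewrite imCD !imCM /GRing.scale /=; ring.
Qed.

Lemma is_dC_sum (I : Type) (r : seq I) (P : pred I) v (f : I -> 'rV[R]_k -> C) t d :
  (forall i, is_dC v (f i) t (d i)) ->
  is_dC v (fun u => \sum_(i <- r | P i) f i u) t (\sum_(i <- r | P i) d i).
Proof.
move=> h; elim: r => [|i r IH].
  by apply: (@is_dC_ext _ (fun=> 0)) => [u|]; rewrite ?big_nil //; exact: is_dC_cst.
rewrite big_cons; case Pi : (P i); last first.
  by apply: is_dC_ext IH => u; rewrite big_cons Pi.
apply: (@is_dC_ext _ (fun u => f i u + \sum_(j <- r | P j) f j u)) => [u|].
  by rewrite big_cons Pi.
exact: is_dC_add.
Qed.

Lemma is_dC_prod (I : eqType) (r : seq I) (P : pred I) v (f : I -> 'rV[R]_k -> C) t d :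
  uniq r -> (forall i, is_dC v (f i) t (d i)) ->
  is_dC v (fun u => \prod_(i <- r | P i) f i u) t
    (\sum_(c <- r | P c) \prod_(i <- r | P i) (if i == c then d c else f i t)).
Proof.
move=> + h; elim: r => [_|i r IH /= /andP[ir ur]].
  rewrite big_nil; apply: (@is_dC_ext _ (fun=> 1)) => [u|]; rewrite ?big_nil //.
  exact: is_dC_cst.
rewrite big_cons; case Pi : (P i); last first.
  apply: (@is_dC_ext _ (fun u => \prod_(j <- r | P j) f j u)) => [u|].
    by rewrite big_cons Pi.
  apply: is_dC_eq (IH ur) _; apply: eq_bigr => c _; by rewrite big_cons Pi.
apply: (@is_dC_ext _ (fun u => f i u * \prod_(j <- r | P j) f j u)) => [u|].
  by rewrite big_cons Pi.
apply: is_dC_eq (is_dC_mul (h i) (IH ur)) _; rewrite big_cons Pi eqxx; congr (_ * _ + _).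
  rewrite big_seq_cond [RHS]big_seq_cond; apply: eq_bigr => j /andP[jr _].
  by case: eqP => // ji; move: ir; rewrite -ji jr.
rewrite mulr_sumr; rewrite [LHS]big_seq_cond [RHS]big_seq_cond.
apply: eq_bigr => c /andP[cr _].
rewrite big_cons Pi; case: eqP => // ic; by move: ir; rewrite ic cr.
Qed.

Lemma is_dC_scale v f t d c : is_dC v f t d -> is_dC v (fun u => c * f u) t (c * d).
Proof.
by move=> h; apply: is_dC_eq (is_dC_mul (is_dC_cst v c t) h) _; rewrite mul0r add0r.
Qed.

End ComplexDerivative.

Section ComplexContinuity.
Variables (R : realType) (T : topologicalType).
Local Notation C := (CC R).
Implicit Types (f g : T -> C) (t : T).

Lemma contC_ext f g t : f =1 g -> contC f t -> contC g t.
Proof. by move=> /funext ->. Qed.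

Lemma contC_cst c t : contC (fun=> c : C) t.
Proof. by split; exact: cont_cst. Qed.

Lemma contC_add f g t : contC f t -> contC g t -> contC (fun u => f u + g u) t.
Proof.
move=> [f1 f2] [g1 g2]; split.
  apply: (@cont_ext _ _ (fun u => reC (f u) + reC (g u))) => [u|]; rewrite ?reCD //.
  exact: cvgD.
apply: (@cont_ext _ _ (fun u => imC (f u) + imC (g u))) => [u|]; rewrite ?imCD //.
exact: cvgD.
Qed.

Lemma contC_mul f g t : contC f t -> contC g t -> contC (fun u => f u * g u) t.
Proof.
move=> [f1 f2] [g1 g2]; split.
  apply: (@cont_ext _ _ (fun u => reC (f u) * reC (g u) - imC (f u) * imC (g u))) => [u|].
    by rewrite reCM.
  by apply: contB; apply: cvgM.
apply: (@cont_ext _ _ (fun u => reC (f u) * imC (g u) + imC (f u) * reC (g u))) => [u|].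
  by rewrite imCM.
by apply: cvgD; apply: cvgM.
Qed.

Lemma contC_opp f t : contC f t -> contC (fun u => - f u) t.
Proof.
move=> h; apply: (@contC_ext (fun u => -1 * f u)) => [u|]; first by rewrite mulN1r.
by apply: contC_mul h; exact: contC_cst.
Qed.

Lemma contC_sum (I : Type) (r : seq I) (P : pred I) (f : I -> T -> C) t :
  (forall i, contC (f i) t) -> contC (fun u => \sum_(i <- r | P i) f i u) t.
Proof.
move=> h; split.
  apply: (@cont_ext _ _ (fun u => \sum_(i <- r | P i) reC (f i u))) => [u|].
    by rewrite reC_sum.
  by apply: cont_sum => i; case: (h i).
apply: (@cont_ext _ _ (fun u => \sum_(i <- r | P i) imC (f i u))) => [u|].
  by rewrite imC_sum.
by apply: cont_sum => i; case: (h i).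
Qed.

Lemma contC_prod (I : Type) (r : seq I) (P : pred I) (f : I -> T -> C) t :
  (forall i, contC (f i) t) -> contC (fun u => \prod_(i <- r | P i) f i u) t.
Proof.
move=> h; elim: r => [|i r IH].
  by apply: (@contC_ext (fun=> 1)) => [u|]; rewrite ?big_nil //; exact: contC_cst.
case Pi : (P i); last by apply: contC_ext IH => u; rewrite big_cons Pi.
apply: (@contC_ext (fun u => f i u * \prod_(j <- r | P j) f j u)) => [u|].
  by rewrite big_cons Pi.
exact: contC_mul.
Qed.

Lemma contC_det n (A : T -> 'M[C]_n) t : (forall i j, contC (fun u => A u i j) t) ->
  contC (fun u => \det (A u)) t.
Proof.
move=> h; apply: contC_sum => s; apply: contC_mul; first exact: contC_cst.
by apply: contC_prod => i; exact: h.
Qed.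

End ComplexContinuity.

(** * Integrals of functions that are continuous on the simplex only *)

Section CornerIntegral.
Variable R : realType.
Local Notation C := (CC R).

Lemma simplex_integral_lin k a c (f g : 'rV[R]_k -> R) : continuous f -> continuous g ->
  simplex_integral a (fun t => f t + c * g t) =
  simplex_integral a f + c * simplex_integral a g.
Proof.
elim: k a f g => [|k IH] a f g cf cg //.
have ci (h : 'rV[R]_k.+1 -> R) : continuous h ->
    continuous (fun t => simplex_integral (a - t) (fun u => h (ins ord0 t u))).
  move=> ch t; apply: (@cont_cmp _ _ _ (fun t => (t, a - t))
      (fun q : R * R => simplex_integral q.2 ((fun t u => h (ins ord0 t u)) q.1))).
    by apply: cont_pair; [exact: cont_id|apply: contB; [exact: cont_cst|exact: cont_id]].
  apply: (@simplex_integral_cont _ _ _ (fun (t : R) (u : 'rV[R]_k) => h (ins ord0 t u)) (t, a - t)) => p.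
  apply: (@cont_cmp _ _ _ (fun q : R * 'rV[R]_k => ins ord0 q.1 q.2) h); last exact: ch.
  by apply: cont_ins; [exact: cont_fst|exact: cont_snd].
have cl (h : 'rV[R]_k.+1 -> R) t : continuous h -> continuous (fun u : 'rV[R]_k => h (ins ord0 t u)).
  move=> ch u; apply: (@cont_cmp _ _ _ (fun u => ins ord0 t u) h); last exact: ch.
  by apply: cont_ins; [exact: cont_cst|exact: cont_id].
rewrite !simplex_integralS -seg_intZ; last exact: ci.
rewrite -seg_intD; last 2 first.
- exact: ci.
- by move=> t; apply: cvgM; [exact: cont_cst|exact: ci].
by apply: seg_int_eq => t _; rewrite IH //; exact: cl.
Qed.

(** A continuous retraction of the whole space onto the simplex. Composition with it replaces a
    function that is continuous on the simplex by one that is continuous everywhere and has the same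
    integral. *)
Definition corner_retr k (t : 'rV[R]_k) : 'rV[R]_k :=
  \row_j (Num.max 0 (t 0 j) / Num.max 1 (\sum_l Num.max 0 (t 0 l))).

Lemma corner_retr_in k (t : 'rV[R]_k) : corner (corner_retr t).
Proof.
have m1 : 0 < Num.max 1 (\sum_l Num.max 0 (t 0 l)) by rewrite lt_max ltr01.
split=> [i|]; first by rewrite mxE divr_ge0 ?(ltW m1) // le_max lexx.
under eq_bigr do rewrite mxE.
by rewrite -mulr_suml ler_pdivrMr // mul1r le_max lexx orbT.
Qed.

Lemma corner_retr_id k (t : 'rV[R]_k) : corner t -> corner_retr t = t.
Proof.
move=> [t0 t1]; apply/rowP => j; rewrite mxE.
have E l : Num.max 0 (t 0 l) = t 0 l by apply/max_idPr.
by rewrite E (eq_bigr (fun l => t 0 l)) // (max_idPl t1) divr1.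
Qed.

Lemma corner_retr_cont k : continuous (@corner_retr k).
Proof.
move=> t; apply: cont_row => j.
apply: (@cont_ext _ _ (fun t : 'rV[R]_k => Num.max 0 (t 0 j) *
   (Num.max 1 (\sum_l Num.max 0 (t 0 l)))^-1)) => [v|]; first by rewrite mxE.
have cm (l : 'I_k) : {for t, continuous (fun t : 'rV[R]_k => Num.max 0 (t 0 l))}.
  by apply: cont_max; [exact: cont_cst|exact: cont_coord].
apply: contM => //; apply: contV; first by rewrite gt_eqF // lt_max ltr01.
by apply: cont_max; [exact: cont_cst|exact: cont_sum].
Qed.

Definition cornerC k (g : 'rV[R]_k -> C) : Prop := forall t : 'rV[R]_k, corner t -> contC g t.

Lemma cornerC_retr k (g : 'rV[R]_k -> R) : (forall t : 'rV[R]_k, corner t -> {for t, continuous g}) ->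
  continuous (fun t => g (corner_retr t)).
Proof.
move=> cg t; apply: (@cont_cmp _ _ _ (@corner_retr k) g); first exact: corner_retr_cont.
by apply: cg; exact: corner_retr_in.
Qed.

Lemma simplex_integral_retr k (g : 'rV[R]_k -> R) :
  simplex_integral 1 (fun t => g (corner_retr t)) = simplex_integral 1 g.
Proof. by apply: simplex_integral_eq => // t t0 t1; rewrite corner_retr_id. Qed.

Lemma is_derive_near k (f g : 'rV[R]_k -> R) x v d :
  (\forall h \near (0 : R), f (h *: v + x) = g (h *: v + x)) -> f x = g x ->
  is_derive x v g d -> is_derive x v f d.
Proof.
move=> fg fgx [dg <-].
have E : {near (0 : R)^', (fun h : R => h^-1 *: ((g \o shift x) (h *: v) - g x)) =1
   (fun h : R => h^-1 *: ((f \o shift x) (h *: v) - f x))}.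
  apply: nbhs_dnbhs; apply: filterS fg => h /= ->; by rewrite fgx.
have L : h^-1 *: ((f \o shift x) (h *: v) - f x) @[h --> (0 : R)^'] --> 'D_v g x.
  by apply: cvg_trans (near_eq_cvg E) _; exact: dg.
by apply: DeriveDef; [apply/cvg_ex; exists ('D_v g x)|apply: cvg_lim => //; exact: L].
Qed.

(** The previous theorem is applied to the compositions with [corner_retr]. Where [t_i > 0] and the
    sum is less than 1, a small motion along the [i]-th axis stays in the simplex, on which the
    retraction is the identity; so the derivative is unchanged. *)
Lemma simplex_FTC_on k (i : 'I_k.+1) (G g : 'rV[R]_k.+1 -> R) :
  (forall t : 'rV[R]_k.+1, corner t -> {for t, continuous G}) ->
  (forall t : 'rV[R]_k.+1, corner t -> {for t, continuous g}) ->
  (forall t : 'rV[R]_k.+1, corner t -> is_derive t (delta_mx 0 i) G (g t)) ->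
  simplex_integral 1 g =
  simplex_integral 1 (fun u : 'rV[R]_k => G (ins ord0 (1 - \sum_j u 0 j) u)) -
  simplex_integral 1 (fun u : 'rV[R]_k => G (ins i 0 u)).
Proof.
move=> cG cg dG; have cG' := cornerC_retr cG; have cg' := cornerC_retr cg.
pose Gr t := G (corner_retr t).
have cins j (x : 'rV[R]_k -> R) : continuous x -> continuous (fun u => Gr (ins j (x u) u)).
  move=> cx u; apply: (@cont_cmp _ _ _ (fun u => ins j (x u) u) Gr); last exact: cG'.
  by apply: cont_ins; [exact: cx|exact: cont_id].
have c1 : continuous (fun u : 'rV[R]_k => 1 - \sum_j u 0 j).
  move=> u; apply: contB; first exact: cont_cst.
  by apply: cont_sum => j; exact: cont_coord.
have c0 : continuous (fun u : 'rV[R]_k => 0 : R) by move=> u; exact: cont_cst.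
rewrite -simplex_integral_retr.
transitivity (simplex_integral 1 (fun u : 'rV[R]_k => Gr (ins i (1 - \sum_j u 0 j) u)
   - Gr (ins i 0 u))).
  apply: (@simplex_FTC _ _ i 1 Gr (fun t => g (corner_retr t))) => //.
  move=> t t0 ti t1.
  have ct : corner t by split => //; exact: ltW.
  rewrite corner_retr_id //; apply: (@is_derive_near _ _ G) (dG _ ct); last first.
    by rewrite /Gr corner_retr_id.
  have h1 : \forall h \near (0 : R), - t 0 i < h.
    by apply: (@cvgr_gt _ _ (nbhs (0 : R)) _ id 0); [exact: cvg_id|rewrite oppr_lt0].
  have h2 : \forall h \near (0 : R), h < 1 - \sum_j t 0 j.
    by apply: (@cvgr_lt _ _ (nbhs (0 : R)) _ id 0); [exact: cvg_id|rewrite subr_gt0].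
  near=> h; rewrite /Gr corner_retr_id //; split=> [j|].
    rewrite !mxE eqxx /=; case: eqP => [->|_]; rewrite ?mulr0 ?add0r ?mulr1 //.
    by rewrite -lerBlDr sub0r ltW //; near: h.
  under eq_bigr do rewrite mxE; rewrite big_split /= -lerBrDr ltW //.
  rewrite (bigD1 i) //= !mxE !eqxx mulr1 big1 ?addr0; first by near: h.
  by move=> j /negbTE ji; rewrite !mxE ji andbF mulr0.
transitivity (simplex_integral 1 (fun u : 'rV[R]_k => Gr (ins i (1 - \sum_j u 0 j) u)
   + -1 * Gr (ins i 0 u))).
  by congr simplex_integral; apply/funext => u; rewrite mulN1r.
rewrite simplex_integral_lin ?mulN1r; [|exact: cins|exact: cins].
rewrite simplex_integral_slanted //; congr (_ - _).
  apply: simplex_integral_eq => // t t0 t1; rewrite /Gr corner_retr_id //.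
  split=> [j|]; last by rewrite ins_sum subrK.
  by case: (unliftP ord0 j) => [j' ->|->]; rewrite ?ins_lift ?ins_at ?subr_ge0.
apply: simplex_integral_eq => // t t0 t1; rewrite /Gr corner_retr_id //.
split=> [j|]; last by rewrite ins_sum add0r.
by case: (unliftP i j) => [j' ->|->]; rewrite ?ins_lift ?ins_at.
Unshelve. all: by end_near. Qed.

Lemma simplex_integralC_eq k (g h : 'rV[R]_k -> C) :
  (forall t : 'rV[R]_k, corner t -> g t = h t) -> simplex_integralC g = simplex_integralC h.
Proof.
move=> gh; congr mkC; apply: simplex_integral_eq => // t t0 t1;
  by rewrite gh.
Qed.

Lemma simplex_integralC_add k (g h : 'rV[R]_k -> C) : cornerC g -> cornerC h ->
  simplex_integralC (fun t => g t + h t) = simplex_integralC g + simplex_integralC h.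
Proof.
move=> cg ch.
have E (f1 f2 : 'rV[R]_k -> R) : (forall t : 'rV[R]_k, corner t -> {for t, continuous f1}) ->
   (forall t : 'rV[R]_k, corner t -> {for t, continuous f2}) ->
   simplex_integral 1 (fun t => f1 t + f2 t) = simplex_integral 1 f1 + simplex_integral 1 f2.
  move=> c1 c2; rewrite -simplex_integral_retr -[in RHS](simplex_integral_retr f1).
  rewrite -[in RHS](simplex_integral_retr f2) -[X in _ + X]mul1r.
  rewrite -simplex_integral_lin; try exact: cornerC_retr.
  by congr simplex_integral; apply/funext => t; rewrite mul1r.
apply: complex_ext; rewrite ?reCD ?imCD /= -E.
- by congr simplex_integral; apply/funext => t; rewrite reCD.
- by move=> t /cg[].
- by move=> t /ch[].
- by congr simplex_integral; apply/funext => t; rewrite imCD.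
- by move=> t /cg[].
- by move=> t /ch[].
Qed.

Lemma simplex_integralC_scale k c (g : 'rV[R]_k -> C) : cornerC g ->
  simplex_integralC (fun t => c * g t) = c * simplex_integralC g.
Proof.
move=> cg.
have E (f1 f2 : 'rV[R]_k -> R) a b : (forall t : 'rV[R]_k, corner t -> {for t, continuous f1}) ->
   (forall t : 'rV[R]_k, corner t -> {for t, continuous f2}) ->
   simplex_integral 1 (fun t => a * f1 t + b * f2 t) = a * simplex_integral 1 f1 + b * simplex_integral 1 f2.
  move=> c1 c2; rewrite -simplex_integral_retr -[in RHS](simplex_integral_retr f1).
  rewrite -[in RHS](simplex_integral_retr f2).
  have c1' := cornerC_retr c1; have c2' := cornerC_retr c2.
  rewrite -[a * _]add0r -(_ : simplex_integral 1 (fun _ : 'rV[R]_k => 0) = 0); last first.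
    have cz : continuous (fun _ : 'rV[R]_k => 0 : R) by move=> ?; exact: cont_cst.
    (* Linearity applied to [0 + (-1) * 0] shows that the integral of 0 vanishes. *)
    set z := simplex_integral _ _; suff : z = z + -1 * z by lra.
    rewrite -simplex_integral_lin //; congr simplex_integral.
    by apply/funext => ?; rewrite mulr0 addr0.
  rewrite -simplex_integral_lin //; last by move=> ?; exact: cont_cst.
  rewrite -simplex_integral_lin //; last first.
    move=> t; apply: (@contD _ _ (fun=> 0) (fun t => a * f1 (corner_retr t))); first exact: cont_cst.
    by apply: contM; [exact: cont_cst|exact: c1'].
  by congr simplex_integral; apply/funext => t; rewrite add0r.
have cr t : corner t -> {for t, continuous (fun u => reC (g u))} by move=> /cg[].
have ci t : corner t -> {for t, continuous (fun u => imC (g u))} by move=> /cg[].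
apply: complex_ext; rewrite ?reCM ?imCM /=.
  rewrite -mulNr -E //; congr simplex_integral; apply/funext => t.
  by rewrite reCM mulNr.
by rewrite -E //; congr simplex_integral; apply/funext => t; rewrite imCM.
Qed.

Lemma simplex_integralC_sum k (I : Type) (r : seq I) (f : I -> 'rV[R]_k -> C) :
  (forall i, cornerC (f i)) ->
  simplex_integralC (fun t => \sum_(i <- r) f i t) = \sum_(i <- r) simplex_integralC (f i).
Proof.
move=> cf; elim: r => [|i r IH].
  transitivity (0 * simplex_integralC (fun _ : 'rV[R]_k => 0 : C)); last by rewrite mul0r big_nil.
  rewrite -simplex_integralC_scale; last by move=> t _; exact: contC_cst.
  by apply: simplex_integralC_eq => t _; rewrite big_nil mul0r.
rewrite big_cons -IH -simplex_integralC_add //.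
  by apply: simplex_integralC_eq => t _; rewrite big_cons.
by move=> t ct; apply: contC_sum => j; exact: cf.
Qed.

Lemma simplex_FTC_C k (i : 'I_k.+1) (G g : 'rV[R]_k.+1 -> C) :
  cornerC G -> cornerC g ->
  (forall t : 'rV[R]_k.+1, corner t -> is_dC (delta_mx 0 i) G t (g t)) ->
  simplex_integralC g =
  simplex_integralC (fun u : 'rV[R]_k => G (ins ord0 (1 - \sum_j u 0 j) u)) -
  simplex_integralC (fun u : 'rV[R]_k => G (ins i 0 u)).
Proof.
move=> cG cg dG; apply: complex_ext.
  rewrite reCB /=; apply: (@simplex_FTC_on k i (fun t => reC (G t)) (fun t => reC (g t))).
  - by move=> t /cG[].
  - by move=> t /cg[].
  - by move=> t /dG[].
rewrite imCB /=; apply: (@simplex_FTC_on k i (fun t => imC (G t)) (fun t => imC (g t))).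
- by move=> t /cG[].
- by move=> t /cg[].
- by move=> t /dG[].
Qed.

End CornerIntegral.

Lemma eq_of_dist (R : realType) (a b : R) :
  (forall eps, 0 < eps -> `|a - b| <= eps) -> a = b.
Proof.
move=> h; apply/eqP; rewrite -subr_eq0 -normr_le0; apply/ler_addgt0Pl => eps eps0.
by rewrite addr0; exact: h.
Qed.

(** * Symmetry of second derivatives, and derivatives along differences of axes *)

Section SecondOrder.
Variables (R : realType) (k : nat).
Implicit Types (h : 'rV[R]_k -> R) (U : set 'rV[R]_k).

Lemma Ck_on_cont U r h t : Ck_on U r h -> U t -> {for t, continuous h}.
Proof. by case: r => [|r] [+ _]; exact. Qed.

Lemma Ck_on_D U r h i : Ck_on U r.+1 h -> Ck_on U r (fun x => 'D_(delta_mx 0 i) h x).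
Proof. by case=> _ /(_ i) []. Qed.

Lemma Ck_on_derivable U r h i t : Ck_on U r.+1 h -> U t -> derivable h t (delta_mx 0 i).
Proof. by case=> _ /(_ i) [+ _]; exact. Qed.

Lemma Ck_on_is_derive U r h i t : Ck_on U r.+1 h -> U t ->
  is_derive t (delta_mx 0 i) h ('D_(delta_mx 0 i) h t).
Proof. by move=> ch Ut; apply: DeriveDef => //; exact: Ck_on_derivable ch Ut. Qed.

Lemma Ck_onW U r h : Ck_on U r.+1 h -> Ck_on U r h.
Proof.
elim: r h => [|r IH] h /=; first by case=> ch _; split.
case=> ch dh; split=> // i; have [d1 d2] := dh i; split=> //; exact: IH.
Qed.

Lemma Ck_on_le U r s h : (r <= s)%N -> Ck_on U s h -> Ck_on U r h.
Proof.
elim: s => [|s IH]; first by rewrite leqn0 => /eqP ->.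
by rewrite leq_eqVlt => /predU1P[->//|rs /Ck_onW]; exact: IH.
Qed.

Lemma mean_value (phi d : R -> R) a b : a < b ->
  (forall x : R, a <= x <= b -> is_derive x 1 phi (d x)) ->
  exists2 c, a <= c <= b & phi b - phi a = d c * (b - a).
Proof.
move=> ab dphi.
have d1 x : x \in `]a, b[ -> is_derive x (1 : R) phi (d x).
  by rewrite in_itv /= => /andP[ax xb]; apply: dphi; rewrite !ltW.
have d2 : {within `[a, b], continuous phi}.
  apply: derivable_within_continuous => x; rewrite in_itv /= => xab.
  by have [] := dphi x xab.
have [c + E] := MVT ab d1 d2.
by rewrite in_itv /= => /andP[ac cb]; exists c; rewrite ?ltW.
Qed.

Lemma is_derive_along h (x v : 'rV[R]_k) (s d : R) :
  is_derive (x + s *: v) v h d -> is_derive s 1 (fun s => h (x + s *: v)) d.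
Proof.
apply: is_derive_line => // e; by rewrite scalerDl addrA [in RHS]addrC -addrA [e *: v + _]addrC addrA.
Qed.

(** Mean value theorem in the direction [e], then in the direction [f]: the second difference over a
    square of side [s] is a mixed derivative at some point of the square. *)
Lemma second_difference h (x e f : 'rV[R]_k) (he : 'rV[R]_k -> R) (hfe : 'rV[R]_k -> R) (s : R) :
  0 < s ->
  (forall a b, 0 <= a <= s -> 0 <= b <= s ->
     is_derive (x + a *: e + b *: f) e h (he (x + a *: e + b *: f)) /\
     is_derive (x + a *: e + b *: f) f he (hfe (x + a *: e + b *: f))) ->
  exists a b, [/\ 0 <= a <= s, 0 <= b <= s &
    h (x + s *: e + s *: f) - h (x + s *: e) - h (x + s *: f) + h x
     = hfe (x + a *: e + b *: f) * s * s].
Proof.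
move=> s0 H.
have ss : 0 <= s <= s by rewrite lexx ltW.
have s00 : 0 <= (0 : R) <= s by rewrite lexx ltW.
have sw (a b : R) : x + a *: e + b *: f = x + b *: f + a *: e by rewrite addrAC.
pose phi (a : R) := h (x + s *: f + a *: e) - h (x + a *: e).
have dphi a : 0 <= a <= s -> is_derive a 1 phi
    (he (x + a *: e + s *: f) - he (x + a *: e)).
  move=> ha; apply: is_deriveB.
    by apply: is_derive_along; rewrite -sw; case: (H a s ha ss).
  by apply: is_derive_along; have [] := H a 0 ha s00; rewrite scale0r addr0.
have [a ha] := mean_value s0 dphi; rewrite subr0 => Ephi.
have dpsi b : 0 <= b <= s -> is_derive b 1 (fun b => he (x + a *: e + b *: f))
    (hfe (x + a *: e + b *: f)).
  by move=> hb; apply: is_derive_along; case: (H a b ha hb).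
have [b hb] := mean_value s0 dpsi; rewrite subr0 scale0r addr0 => Epsi.
exists a, b; split=> //.
rewrite -Epsi -Ephi /phi !scale0r !addr0 -sw; ring.
Qed.

(** The second difference is symmetric in the two directions. Read in both orders, it equates a
    value of [A] with a value of [B] at points as close to [t] as desired. *)
Lemma schwarz_aux U h t (e f : 'rV[R]_k) (he hf A B : 'rV[R]_k -> R) : open U -> U t ->
  (forall u, U u -> is_derive u e h (he u)) -> (forall u, U u -> is_derive u f h (hf u)) ->
  (forall u, U u -> is_derive u e hf (A u)) -> (forall u, U u -> is_derive u f he (B u)) ->
  {for t, continuous A} -> {for t, continuous B} -> A t = B t.
Proof.
move=> oU Ut He Hf HA HB cA cB; apply: eq_of_dist => eps eps0.
have nU : \forall u \near t, U u by exact: open_nbhs_nbhs.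
have n2 : 0 < eps / 2 by rewrite divr_gt0.
have nA : \forall u \near t, `|A t - A u| < eps / 2 by move/cvgrPdist_lt : cA; exact.
have nB : \forall u \near t, `|B t - B u| < eps / 2 by move/cvgrPdist_lt : cB; exact.
have cg : {for (0 : R, 0 : R), continuous (fun p : R * R => t + p.1 *: e + p.2 *: f)}.
  apply: cvgD; first apply: cvgD; first exact: cvg_cst.
    by apply: cvgZr_tmp; exact: cont_fst.
  by apply: cvgZr_tmp; exact: cont_snd.
have nAll : nbhs t [set u | [/\ U u, `|A t - A u| < eps / 2 & `|B t - B u| < eps / 2]].
  by near=> u; split; near: u.
have := cg [set u | [/\ U u, `|A t - A u| < eps / 2 & `|B t - B u| < eps / 2]].
rewrite /= !scale0r !addr0 => /(_ nAll) /nbhs_ballP[d /= d0 hd].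
pose s := d / 2.
have s0 : 0 < s by rewrite divr_gt0.
have inb a b : 0 <= a <= s -> 0 <= b <= s ->
   [/\ U (t + a *: e + b *: f), `|A t - A (t + a *: e + b *: f)| < eps / 2 &
     `|B t - B (t + a *: e + b *: f)| < eps / 2].
  have sd : s < d by rewrite /s ltr_pdivrMr // ltr_pMr // ltr1n.
  move=> /andP[a0 as_] /andP[b0 bs]; apply: (hd (a, b)); split; rewrite /ball /= sub0r normrN ger0_norm //.
    exact: le_lt_trans sd.
  exact: le_lt_trans sd.
have [a [b [ha hb E1]]] := @second_difference h t e f he B s s0
  (fun a b ha hb => let: And3 Uab _ _ := inb a b ha hb in
     conj (He _ Uab) (HB _ Uab)).
have [a' [b' [ha' hb' E2]]] := @second_difference h t f e hf A s s0
  (fun a b ha hb => let: And3 Uab _ _ := inb b a hb ha in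
     eq_ind _ (fun y => is_derive y f h (hf y) /\ is_derive y e hf (A y))
     (conj (Hf _ Uab) (HA _ Uab)) _ (addrAC _ _ _)).
have [_ _ nb] := inb a b ha hb; have [_ na _] := inb b' a' hb' ha'.
have E : B (t + a *: e + b *: f) = A (t + a' *: f + b' *: e).
  have sn : s != 0 by rewrite gt_eqF.
  apply: (mulIf sn (mulIf sn _)); rewrite -E1 -E2 (addrAC t (s *: f)); ring.
rewrite addrAC -E in na.
apply/ltW; apply: (@le_lt_trans _ _ (`|A t - B (t + a *: e + b *: f)| + `|B t - B (t + a *: e + b *: f)|)).
  by rewrite (distrC (B t)) -[A t - B t](subrKA (B (t + a *: e + b *: f))) ler_normD.
have -> : eps = eps / 2 + eps / 2 by field.
exact: ltrD.
Unshelve. all: by end_near. Qed.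

Lemma schwarz U h t i j : open U -> Ck_on U 2 h -> U t ->
  'D_(delta_mx 0 i) (fun x => 'D_(delta_mx 0 j) h x) t =
  'D_(delta_mx 0 j) (fun x => 'D_(delta_mx 0 i) h x) t.
Proof.
move=> oU ch Ut.
have H l : Ck_on U 1 (fun x => 'D_(delta_mx 0 l) h x) by exact: Ck_on_D.
apply: (@schwarz_aux U h t (delta_mx 0 i) (delta_mx 0 j)
  (fun x => 'D_(delta_mx 0 i) h x) (fun x => 'D_(delta_mx 0 j) h x)
  (fun x => 'D_(delta_mx 0 i) (fun x => 'D_(delta_mx 0 j) h x) x)
  (fun x => 'D_(delta_mx 0 j) (fun x => 'D_(delta_mx 0 i) h x) x) oU Ut).
- by move=> u; exact: Ck_on_is_derive ch.
- by move=> u; exact: Ck_on_is_derive ch.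
- by move=> u; exact: Ck_on_is_derive (H j).
- by move=> u; exact: Ck_on_is_derive (H i).
- exact: Ck_on_cont (Ck_on_D i (H j)) Ut.
- exact: Ck_on_cont (Ck_on_D j (H i)) Ut.
Qed.

(* The difference quotient is split at [x + s (e - f)], [x + s e], [x]; the
   mean value theorem turns the first increment into a derivative along [f]. *)
Lemma derive_dir_sub U h t i j : open U -> Ck_on U 1 h -> U t ->
  is_derive t (delta_mx 0 i - delta_mx 0 j) h
    ('D_(delta_mx 0 i) h t - 'D_(delta_mx 0 j) h t).
Proof.
move=> oU ch Ut.
set e : 'rV[R]_k := delta_mx 0 i; set f : 'rV[R]_k := delta_mx 0 j.
have nU : \forall u \near t, U u by exact: open_nbhs_nbhs.
have cB : {for t, continuous (fun x => 'D_f h x)} by apply: Ck_on_cont Ut; exact: Ck_on_D ch.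
have cg : {for (0 : R, 0 : R), continuous (fun p : R * R => t + p.1 *: e + p.2 *: f)}.
  apply: cvgD; first apply: cvgD; first exact: cvg_cst.
    by apply: cvgZr_tmp; exact: cont_fst.
  by apply: cvgZr_tmp; exact: cont_snd.
have L1 : s^-1 *: (h (s *: e + t) - h t) @[s --> (0 : R)^'] --> 'D_e h t.
  by have := Ck_on_derivable (i:=i) ch Ut.
have L2 : s^-1 *: (h (s *: e + t) - h (s *: (e - f) + t)) @[s --> (0 : R)^'] --> 'D_f h t.
  apply/cvgrPdist_lt => eps eps0.
  have nAll : nbhs t [set u | U u /\ `|'D_f h t - 'D_f h u| < eps].
    have nB : \forall u \near t, `|'D_f h t - 'D_f h u| < eps by move/cvgrPdist_lt : cB; exact.
    by near=> u; split; near: u.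
  have := cg [set u | U u /\ `|'D_f h t - 'D_f h u| < eps].
  rewrite /= !scale0r !addr0 => /(_ nAll) /nbhs_ballP[d /= d0 hd].
  have H s b : `|s| < d -> `|b| < d -> U (t + s *: e + b *: f) /\ `|'D_f h t - 'D_f h (t + s *: e + b *: f)| < eps.
    by move=> sd bd; apply: (hd (s, b)); split; rewrite /ball /= sub0r normrN.
  exists d => // s /=; rewrite sub0r normrN => sd s0.
  pose phi (b : R) := h (t + s *: e + b *: f).
  have dphi (b : R) : `|b| < d -> is_derive b (1 : R) phi ('D_f h (t + s *: e + b *: f)).
    move=> bd; apply: is_derive_along; have [Uab _] := H s b sd bd.
    exact: Ck_on_is_derive ch Uab.
  have E1 : h (s *: e + t) = phi 0 by rewrite /phi scale0r addr0 addrC.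
  have E2 : h (s *: (e - f) + t) = phi (- s) by rewrite /phi scalerBr scaleNr addrC addrA.
  rewrite E1 E2.
  have [b bd ->] : exists2 b, `|b| < d & s^-1 *: (phi 0 - phi (- s)) = 'D_f h (t + s *: e + b *: f).
    have aux (a c : R) : a < c -> `|a| < d -> `|c| < d -> exists2 b, `|b| < d & phi c - phi a = 'D_f h (t + s *: e + b *: f) * (c - a).
      move=> ac ad cd.
      have inab b : a <= b <= c -> `|b| < d.
        move=> /andP[ab bc]; move: ad cd; rewrite !ltr_norml => /andP[? ?] /andP[? ?]; lra.
      have [b hb E] := mean_value ac (fun b hb => dphi b (inab b hb)).
      by exists b => //; exact: inab.
    have d00 : `|0 : R| < d by rewrite normr0.
    have sd' : `|- s| < d by rewrite normrN.
    have [sn|sp|sz] := ltgtP s 0; last by rewrite sz eqxx in s0.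
      have [|b bd E] := aux 0 (- s) _ d00 sd'; first by rewrite oppr_gt0.
      exists b => //; rewrite subr0 in E; rewrite -opprB E mulrN opprK /GRing.scale /= mulrC mulfK //.
    have [|b bd E] := aux (- s) 0 _ sd' d00; first by rewrite oppr_lt0.
    exists b => //; rewrite sub0r opprK in E; rewrite E /GRing.scale /= mulrC mulfK //.
  by have [] := H s b sd bd.
have L : s^-1 *: (h (s *: (e - f) + t) - h t) @[s --> (0 : R)^'] --> 'D_e h t - 'D_f h t.
  apply: cvg_trans (cvgB L1 L2); apply: near_eq_cvg; near=> s.
  transitivity (s^-1 * (h (s *: e + t) - h t)
    - s^-1 * (h (s *: e + t) - h (s *: (e - f) + t))); first by [].
  by rewrite -mulrBr; congr (_ * _); ring.
by apply: DeriveDef; [apply/cvg_ex; exists ('D_e h t - 'D_f h t)|apply: cvg_lim => //; exact: L].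
Unshelve. all: by end_near. Qed.

End SecondOrder.

(** * Algebra of functions of class C^r *)

Section CkAlgebra.
Variables (R : realType) (k : nat).
Implicit Types (f g : 'rV[R]_k -> R) (U : set 'rV[R]_k).

Lemma near_line U (x v : 'rV[R]_k) : open U -> U x -> \forall h \near (0 : R), U (h *: v + x).
Proof.
move=> oU Ux.
have c : {for (0 : R), continuous (fun h : R => h *: v + x)}.
  apply: cont_row => j; apply: (@cont_ext _ _ (fun h : R => h * v 0 j + x 0 j)) => [h|].
    by rewrite !mxE.
  by apply: contD; [apply: contM; [exact: cont_id|exact: cont_cst]|exact: cont_cst].
by apply: (c U); rewrite /= scale0r add0r; exact: open_nbhs_nbhs.
Qed.

Lemma is_derive_open U f g x v d : open U -> U x -> (forall y, U y -> f y = g y) ->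
  is_derive x v g d -> is_derive x v f d.
Proof.
move=> oU Ux fg; apply: is_derive_near; last exact: fg.
by apply: filterS (near_line v oU Ux) => h /fg.
Qed.

Lemma cont_open_ext U f g x : open U -> U x -> (forall y, U y -> f y = g y) ->
  {for x, continuous f} -> {for x, continuous g}.
Proof.
move=> oU Ux fg cf; have nU : \forall y \near x, U y by exact: open_nbhs_nbhs.
have E : {near x, f =1 g} by apply: filterS nU => y /fg.
move: cf; rewrite /prop_for /continuous_at -fg // => cf.
exact: (cvg_trans (near_eq_cvg E) cf).
Qed.

Lemma Ck_on_ext U r f g : open U -> (forall x, U x -> f x = g x) ->
  Ck_on U r f -> Ck_on U r g.
Proof.
move=> oU; elim: r f g => [|r IH] f g fg [cf df]; split.
- by move=> x Ux; apply: (@cont_open_ext U f) => //; exact: cf.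
- by [].
- by move=> x Ux; apply: (@cont_open_ext U f) => //; exact: cf.
move=> i; have [d1 d2] := df i.
have E x : U x -> is_derive x (delta_mx 0 i) g ('D_(delta_mx 0 i) f x).
  move=> Ux; apply: (@is_derive_open U g f) => // [y /fg//|].
  by apply: DeriveDef => //; exact: d1.
split=> [x Ux|]; first by case: (E x Ux).
by apply: IH d2 => x /E [_ <-].
Qed.

(* Derivatives that are known pointwise on [U] suffice to climb one order. *)
Lemma Ck_on_S U r f (df : 'I_k -> 'rV[R]_k -> R) : open U ->
  (forall x, U x -> {for x, continuous f}) ->
  (forall i x, U x -> is_derive x (delta_mx 0 i) f (df i x)) ->
  (forall i, Ck_on U r (df i)) -> Ck_on U r.+1 f.
Proof.
move=> oU cf Hd Hr; split=> // i; split=> [x Ux|]; first by case: (Hd i x Ux).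
by apply: Ck_on_ext (Hr i) => // x /(Hd i) [_ ->].
Qed.

Lemma Ck_on_cst U r (c : R) : open U -> Ck_on U r (fun=> c).
Proof.
move=> oU; elim: r c => [|r IH] c; first by split=> // x _; exact: cont_cst.
apply: (@Ck_on_S _ _ _ (fun _ _ => 0)) => // x _; exact: cont_cst.
Qed.

Lemma Ck_on_add U r f g : open U -> Ck_on U r f -> Ck_on U r g ->
  Ck_on U r (fun x => f x + g x).
Proof.
move=> oU; elim: r f g => [|r IH] f g cf cg.
  by split=> // x Ux; apply: contD; [exact: Ck_on_cont cf Ux|exact: Ck_on_cont cg Ux].
apply: (@Ck_on_S _ _ _ (fun i x => 'D_(delta_mx 0 i) f x + 'D_(delta_mx 0 i) g x)) => //.
- by move=> x Ux; apply: contD; [exact: Ck_on_cont cf Ux|exact: Ck_on_cont cg Ux].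
- by move=> i x Ux; apply: is_deriveD; [exact: Ck_on_is_derive cf Ux|exact: Ck_on_is_derive cg Ux].
- by move=> i; apply: IH; exact: Ck_on_D.
Qed.

Lemma Ck_on_mul U r f g : open U -> Ck_on U r f -> Ck_on U r g ->
  Ck_on U r (fun x => f x * g x).
Proof.
move=> oU; elim: r f g => [|r IH] f g cf cg.
  by split=> // x Ux; apply: contM; [exact: Ck_on_cont cf Ux|exact: Ck_on_cont cg Ux].
apply: (@Ck_on_S _ _ _ (fun i x => f x * 'D_(delta_mx 0 i) g x + g x * 'D_(delta_mx 0 i) f x)) => //.
- by move=> x Ux; apply: contM; [exact: Ck_on_cont cf Ux|exact: Ck_on_cont cg Ux].
- by move=> i x Ux; apply: is_deriveM; [exact: Ck_on_is_derive cf Ux|exact: Ck_on_is_derive cg Ux].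
- move=> i; apply: Ck_on_add => //; apply: IH.
  + exact: Ck_onW.
  + exact: Ck_on_D.
  + exact: Ck_onW.
  + exact: Ck_on_D.
Qed.

Lemma Ck_on_opp U r f : open U -> Ck_on U r f -> Ck_on U r (fun x => - f x).
Proof.
move=> oU cf; apply: (@Ck_on_ext _ _ (fun x => -1 * f x)) => // [x _|]; first by rewrite mulN1r.
by apply: Ck_on_mul => //; exact: Ck_on_cst.
Qed.

Lemma Ck_on_sub U r f g : open U -> Ck_on U r f -> Ck_on U r g ->
  Ck_on U r (fun x => f x - g x).
Proof. by move=> oU cf cg; apply: Ck_on_add => //; exact: Ck_on_opp. Qed.

Lemma Ck_on_sum U r (I : Type) (s : seq I) (P : pred I) (f : I -> 'rV[R]_k -> R) : open U ->
  (forall i, P i -> Ck_on U r (f i)) -> Ck_on U r (fun x => \sum_(i <- s | P i) f i x).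
Proof.
move=> oU cf; elim: s => [|i s IH].
  by apply: (@Ck_on_ext _ _ (fun=> 0)) => // [x _|]; rewrite ?big_nil //; exact: Ck_on_cst.
case Pi : (P i); last first.
  by apply: Ck_on_ext IH => // x _; rewrite big_cons Pi.
apply: (@Ck_on_ext _ _ (fun x => f i x + \sum_(j <- s | P j) f j x)) => // [x _|].
  by rewrite big_cons Pi.
by apply: Ck_on_add => //; exact: cf.
Qed.

Lemma is_derive_comp1 (F : R -> R) f x v a d : is_derive (f x) 1 F a -> is_derive x v f d ->
  is_derive x v (fun y => F (f y)) (a * d).
Proof.
move=> dF df.
have dl : is_derive (0 : R) 1 (fun h : R => f (h *: v + x)) d.
  apply: (is_derive_line (x := x) (e := v)) df; first by rewrite scale0r add0r.
  by move=> h; rewrite addr0.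
have [d1 d2] : is_derive (0 : R) 1 (F \o (fun h : R => f (h *: v + x))) (a * d).
  by apply: is_derive1_comp => //; rewrite scale0r add0r.
have E : (fun h : R => h^-1 *: (((F \o (fun h : R => f (h *: v + x))) \o shift (0 : R)) (h *: (1 : R)) - (F \o (fun h : R => f (h *: v + x))) 0)) =
  (fun h : R => h^-1 *: (((fun y => F (f y)) \o shift x) (h *: v) - F (f x))).
  by apply/funext => h /=; rewrite [h *: 1]mulr1 addr0 scale0r add0r.
by apply: DeriveDef; [rewrite /derivable -E|rewrite /derive -E].
Qed.

Lemma is_derive_inv f x v d : f x != 0 -> is_derive x v f d ->
  is_derive x v (fun y => (f y)^-1) (- (d * ((f x)^-1 * (f x)^-1))).
Proof.
move=> fx df.
have dI : is_derive (f x) (1 : R) (fun y : R => y^-1) (- ((f x)^-1 * (f x)^-1)).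
  have := @is_deriveV R id (f x) 1 1 fx (is_derive_id _ _).
  by rewrite /GRing.scale /= mulr1 expr2 invfM.
apply: (is_derive_eq (is_derive_comp1 dI df)); rewrite mulNr; congr (- _).
by rewrite mulrC.
Qed.

Lemma Ck_on_inv U r f : open U -> (forall x, U x -> f x != 0) -> Ck_on U r f ->
  Ck_on U r (fun x => (f x)^-1).
Proof.
move=> oU f0; elim: r => [|r IH] cf.
  by split=> // x Ux; apply: contV; [exact: f0|exact: Ck_on_cont cf Ux].
apply: (@Ck_on_S _ _ _ (fun i x => - ('D_(delta_mx 0 i) f x * ((f x)^-1 * (f x)^-1)))) => //.
- by move=> x Ux; apply: contV; [exact: f0|exact: Ck_on_cont cf Ux].
- by move=> i x Ux; apply: is_derive_inv; [exact: f0|exact: Ck_on_is_derive cf Ux].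
- move=> i; have ci := IH (Ck_onW cf); apply: Ck_on_opp => //.
  by apply: Ck_on_mul => //; [exact: Ck_on_D|exact: Ck_on_mul].
Qed.

(** Order 2 is what Stokes' formula requires of the lifts, and what two explicit derivatives of the
    elliptic integral provide. *)
Lemma Ck_on_comp2 U f (F F1 F2 : R -> R) : open U -> Ck_on U 2 f ->
  (forall x : R, is_derive x (1 : R) F (F1 x)) -> (forall x : R, is_derive x (1 : R) F1 (F2 x)) ->
  continuous F2 -> Ck_on U 2 (fun x => F (f x)).
Proof.
move=> oU cf dF dF1 cF2.
have cc (G G' : R -> R) : (forall x : R, is_derive x (1 : R) G (G' x)) -> continuous G.
  by move=> dG x; apply/differentiable_continuous/derivable1_diffP; case: (dG x).
have cfx x : U x -> {for x, continuous f} by move=> Ux; exact: Ck_on_cont cf Ux.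
have cGf (G : R -> R) x : continuous G -> U x -> {for x, continuous (fun x => G (f x))}.
  by move=> cG Ux; apply: (@cont_cmp _ _ _ f G); [exact: cfx|exact: cG].
apply: (@Ck_on_S _ _ _ (fun i x => F1 (f x) * 'D_(delta_mx 0 i) f x)) => //.
- by move=> x; apply: cGf; exact: cc dF.
- by move=> i x Ux; apply: is_derive_comp1 => //; exact: Ck_on_is_derive cf Ux.
move=> i; apply: Ck_on_mul => //; last exact: Ck_on_D.
apply: (@Ck_on_S _ _ _ (fun j x => F2 (f x) * 'D_(delta_mx 0 j) f x)) => //.
- by move=> x; apply: cGf; exact: cc dF1.
- by move=> j x Ux; apply: is_derive_comp1 => //; exact: Ck_on_is_derive cf Ux.
move=> j; apply: Ck_on_mul => //; first by split=> // x; exact: cGf.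
by apply: (@Ck_on_le _ _ _ _ 1) => //; exact: Ck_on_D.
Qed.

Lemma Ck_on_coord U r j : open U -> Ck_on U r (fun x : 'rV[R]_k => x 0 j).
Proof.
move=> oU; case: r => [|r]; first by split=> // x _; exact: cont_coord.
apply: (@Ck_on_S _ _ _ (fun i _ => (i == j)%:R)) => // [x _|i x _|i].
- exact: cont_coord.
- have E : (fun h : R => h^-1 *: (((fun x : 'rV[R]_k => x 0 j) \o shift x) (h *: delta_mx 0 i) - x 0 j)) @ (0 : R)^' --> ((i == j)%:R : R).
    have : (cst ((i == j)%:R : R)) @ (0 : R)^' --> ((i == j)%:R : R) by exact: cvg_cst.
    apply: cvg_trans; apply: near_eq_cvg; near=> h.
    rewrite /= !mxE eqxx addrK eq_sym /GRing.scale /= mulrA mulVf ?mul1r //.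
    by near: h; exact: nbhs_dnbhs_neq.
  by apply: DeriveDef; [apply/cvg_ex; exists (i == j)%:R|apply: cvg_lim => //; exact: E].
- exact: Ck_on_cst.
Unshelve. all: by end_near. Qed.

End CkAlgebra.

Lemma Ck_on_sub_set (R : realType) k (U V : set 'rV[R]_k) r h : V `<=` U -> Ck_on U r h -> Ck_on V r h.
Proof.
move=> VU; elim: r h => [|r IH] h [ch dh]; split=> //; try by move=> x /VU; exact: ch.
move=> i; have [d1 d2] := dh i; split=> [x /VU|]; [exact: d1|exact: IH].
Qed.

(** Abstract chain rule: [D i h] stands for the derivative of [h] in the direction to which [c]
    sends the [i]-th axis. It is meant for affine maps such as the faces of a simplex. *)
Lemma Ck_on_comp_line (R : realType) k l (U : set 'rV[R]_k) r h (c : 'rV[R]_l -> 'rV[R]_k)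
    (D : 'I_l -> ('rV[R]_k -> R) -> 'rV[R]_k -> R) :
  open U -> continuous c ->
  (forall h i u, Ck_on U 1 h -> U (c u) -> is_derive u (delta_mx 0 i) (fun u => h (c u)) (D i h (c u))) ->
  (forall r h i, Ck_on U r.+1 h -> Ck_on U r (D i h)) ->
  Ck_on U r h -> Ck_on (c @^-1` U) r (fun u => h (c u)).
Proof.
move=> oU cc Dd Dr; have oV : open (c @^-1` U) by apply: open_comp => // x _; exact: cc.
elim: r h => [|r IH] h ch.
  by split=> // u Uu; apply: (@cont_cmp _ _ _ c h); [exact: cc|exact: Ck_on_cont ch Uu].
apply: (@Ck_on_S _ _ _ _ _ (fun i u => D i h (c u))) => //.
- by move=> u Uu; apply: (@cont_cmp _ _ _ c h); [exact: cc|exact: Ck_on_cont ch Uu].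
- by move=> i u Uu; apply: Dd => //; exact: Ck_on_le _ ch.
- by move=> i; apply: IH; exact: Dr.
Qed.

Lemma bump_max n (i : 'I_n) : bump n i = i.
Proof. by rewrite /bump leqNgt ltn_ord. Qed.

Section AlternatingSums.
Variable F : numDomainType.

(** Composition with the transposition pairs each permutation with one of opposite sign, so the sum
    equals its opposite. This yields below the vanishing of divergences, of exterior derivatives and
    of the boundary of the torus. *)
Lemma alternating_sum_eq0 n (c m : 'I_n) (f : 'S_n -> F) : c != m ->
  (forall s, f (tperm c m * s)%g = f s) -> \sum_(s : 'S_n) (-1) ^+ s * f s = 0.
Proof.
move=> cm fs; set X := \sum_s _.
suff : X = - X by move=> /esym/eqP; rewrite eqNr => /eqP.
rewrite {1}/X (reindex_inj (mulgI (tperm c m))) /= -sumrN; apply: eq_bigr => s _.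
by rewrite fs odd_permM odd_tperm cm addTb signrN mulNr.
Qed.

(** The sum of the cofactors is the determinant with the last row replaced by ones. Subtracting
    column 0 from the others, which is multiplication by [P], leaves in that row a single 1, in
    column 0. In Stokes' formula the remaining entries are derivatives along the slanted face. *)
Lemma sum_cofactor_last k (A : 'M[F]_k.+1) :
  \sum_i cofactor A ord_max i = (-1) ^+ k *
    \det (\matrix_(j < k, i < k) (A (widen_ord (leqnSn k) j) (lift ord0 i)
                                  - A (widen_ord (leqnSn k) j) ord0)).
Proof.
pose A1 : 'M[F]_k.+1 := \matrix_(j, i) (if j == ord_max then 1 else A j i).
pose P : 'M[F]_k.+1 := \matrix_(j, i) (if j == i then 1 else if (j == ord0) then -1 else 0).
have dP : \det P = 1.
  rewrite -det_tr det_trig; last first.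
    apply/is_trig_mxP => i j ij; rewrite !mxE.
    by rewrite -!val_eqE /= (gtn_eqF ij) (gtn_eqF (leq_ltn_trans (leq0n _) ij)).
  by rewrite big1 // => i _; rewrite !mxE eqxx.
have A1P j i : (A1 *m P) j i = if i == ord0 then A1 j ord0 else A1 j i - A1 j ord0.
  rewrite mxE; have [->|i0] := eqVneq i ord0.
    rewrite (bigD1 ord0) //= big1 ?addr0 => [|l l0]; first by rewrite !mxE eqxx mulr1.
    by rewrite [P _ _]mxE (negbTE l0) mulr0.
  rewrite (bigD1 i) //= (bigD1 ord0) /= 1?eq_sym // big1 ?addr0 => [|l /andP[li l0]].
    by rewrite [P i i]mxE eqxx mulr1 [P ord0 i]mxE eq_sym (negbTE i0) eqxx mulrN1.
  by rewrite [P _ _]mxE (negbTE li) (negbTE l0) mulr0.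
transitivity (\det A1).
  rewrite (expand_det_row _ ord_max); apply: eq_bigr => i _.
  rewrite mxE eqxx mul1r /cofactor; congr (_ * \det _).
  by apply/matrixP => a b; rewrite !mxE eq_sym (negbTE (neq_lift _ _)).
transitivity (\det (A1 *m P)); first by rewrite det_mulmx dP mulr1.
rewrite (expand_det_row _ ord_max).
rewrite (bigD1 ord0) //= big1 ?addr0 => [|i i0]; last first.
  by rewrite A1P (negbTE i0) !mxE eqxx subrr mul0r.
rewrite A1P eqxx mxE eqxx mul1r /cofactor addn0; congr (_ * \det _).
apply/matrixP => a b; rewrite [LHS]mxE [LHS]mxE.
rewrite A1P /= !mxE eq_sym (negbTE (neq_lift _ _)).
by rewrite (_ : lift ord_max a = widen_ord (leqnSn k) a) //; apply: val_inj; rewrite /= bump_max.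
Qed.

End AlternatingSums.

(** * Stokes' formula on a simplex *)

Section Stokes.
Variable R : realType.
Local Notation C := (CC R).
Local Notation ee i := (delta_mx 0 i).

Definition CkC k (U : set 'rV[R]_k) r (f : 'rV[R]_k -> C) : Prop :=
  Ck_on U r (fun x => reC (f x)) /\ Ck_on U r (fun x => imC (f x)).

Section Facts.
Variables (k : nat) (U : set 'rV[R]_k).

Lemma CkC_is_dC r f i t : CkC U r.+1 f -> U t -> is_dC (ee i) f t (dC (ee i) f t).
Proof. by move=> [f1 f2] Ut; split; [exact: (Ck_on_is_derive i f1 Ut)|exact: (Ck_on_is_derive i f2 Ut)]. Qed.

Lemma CkC_D r f i : CkC U r.+1 f -> CkC U r (dC (ee i) f).
Proof. by case=> [f1 f2]; split; exact: Ck_on_D. Qed.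

Lemma CkC_contC r f t : CkC U r f -> U t -> contC f t.
Proof. by move=> [f1 f2] Ut; split; [exact: Ck_on_cont f1 Ut|exact: Ck_on_cont f2 Ut]. Qed.

Lemma CkC_le r s f : (r <= s)%N -> CkC U s f -> CkC U r f.
Proof. by move=> rs [f1 f2]; split; exact: Ck_on_le rs _. Qed.

Lemma schwarzC f t i j : open U -> CkC U 2 f -> U t ->
  dC (ee i) (dC (ee j) f) t = dC (ee j) (dC (ee i) f) t.
Proof.
move=> oU [f1 f2] Ut.
exact: (congr2 (@mkC R) (schwarz i j oU f1 Ut) (schwarz i j oU f2 Ut)).
Qed.

End Facts.

Lemma contC_comp (S T : topologicalType) (c : S -> T) (f : T -> C) u :
  {for u, continuous c} -> contC f (c u) -> contC (fun v => f (c v)) u.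
Proof. by move=> cc [f1 f2]; split; [exact: (cont_cmp cc f1)|exact: (cont_cmp cc f2)]. Qed.

(* The i-th face of the standard simplex, in the coordinates of [corner]. *)
Definition fcoord k (i : 'I_k.+2) (u : 'rV[R]_k) : 'rV[R]_k.+1 :=
  if unlift ord0 i is Some i' then ins i' 0 u else ins ord0 (1 - \sum_j u 0 j) u.

Lemma fcoord0 k (u : 'rV[R]_k) : fcoord ord0 u = ins ord0 (1 - \sum_j u 0 j) u.
Proof. by rewrite /fcoord unlift_none. Qed.

Lemma fcoordS k (i : 'I_k.+1) (u : 'rV[R]_k) : fcoord (lift ord0 i) u = ins i 0 u.
Proof. by rewrite /fcoord liftK. Qed.

Lemma fcoord_corner k (i : 'I_k.+2) (u : 'rV[R]_k) : corner u -> corner (fcoord i u).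
Proof.
move=> [u0 u1]; case: (unliftP ord0 i) => [i' ->|->]; rewrite ?fcoordS ?fcoord0.
  split=> [j|]; last by rewrite ins_sum add0r.
  by case: (unliftP i' j) => [j' ->|->]; rewrite ?ins_lift ?ins_at.
split=> [j|]; last by rewrite ins_sum subrK.
by case: (unliftP ord0 j) => [j' ->|->]; rewrite ?ins_lift ?ins_at ?subr_ge0.
Qed.

Lemma fcoord_cont k (i : 'I_k.+2) : continuous (@fcoord k i).
Proof.
move=> u; case: (unliftP ord0 i) => [i' ->|->].
  apply: (@cont_ext 'rV[R]_k 'rV[R]_k.+1 (fun u => ins i' 0 u) (fcoord (lift ord0 i')) u) => [v|]; first by rewrite fcoordS.
  by apply: cont_ins; [exact: cont_cst|exact: cont_id].
apply: (@cont_ext 'rV[R]_k 'rV[R]_k.+1 (fun u : 'rV[R]_k => ins ord0 (1 - \sum_j u 0 j) u) (fcoord ord0) u) => [v|].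
  by rewrite fcoord0.
apply: cont_ins; last exact: cont_id.
by apply: contB; [exact: cont_cst|apply: cont_sum => j; exact: cont_coord].
Qed.

(** The direction to which the [i]-th face map sends the [l]-th axis; on the slanted face it is an
    edge that starts at vertex 1, hence a difference of two axes. *)
Definition fdir k (i : 'I_k.+2) (l : 'I_k) : 'rV[R]_k.+1 :=
  if unlift ord0 i is Some i' then ee (lift i' l) else ee (lift ord0 l) - ee ord0.

Lemma fcoord_add k (i : 'I_k.+2) l x (u : 'rV[R]_k) :
  fcoord i (x *: ee l + u) = x *: fdir i l + fcoord i u.
Proof.
rewrite /fdir; case: (unliftP ord0 i) => [i' ->|->]; rewrite ?fcoordS ?fcoord0 ?ins_addr //.
have -> : \sum_j (x *: ee l + u) 0 j = x + \sum_j u 0 j.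
  under eq_bigr do rewrite mxE; rewrite big_split /=; congr (_ + _).
  rewrite (bigD1 l) //= !mxE !eqxx mulr1 big1 ?addr0 // => j /negbTE jl.
  by rewrite !mxE jl mulr0.
rewrite scalerBr -addrA [- _ + _]addrC addrA ins_addr -scaleNr addrC ins_addl.
by congr ins; ring.
Qed.

Lemma dC_fcoord k (i : 'I_k.+2) l (U : set 'rV[R]_k.+1) f u : open U -> CkC U 1 f ->
  U (fcoord i u) ->
  is_dC (ee l) (fun u => f (fcoord i u)) u
    (if unlift ord0 i is Some i' then dC (ee (lift i' l)) f (fcoord i u)
     else dC (ee (lift ord0 l)) f (fcoord i u) - dC (ee ord0) f (fcoord i u)).
Proof.
move=> oU cf Uu; have H := fcoord_add i l ^~ u.
suff [d1 d2] : is_dC (fdir i l) f (fcoord i u)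
    (if unlift ord0 i is Some i' then dC (ee (lift i' l)) f (fcoord i u)
     else dC (ee (lift ord0 l)) f (fcoord i u) - dC (ee ord0) f (fcoord i u)).
  by split; apply: is_derive_affine.
rewrite /fdir; case: (unliftP ord0 i) => [i' _|_]; first exact: CkC_is_dC cf Uu.
case: cf => [f1 f2]; split; rewrite ?reCB ?imCB.
  exact: derive_dir_sub oU f1 Uu.
exact: derive_dir_sub oU f2 Uu.
Qed.

Lemma CkC_fcoord k (i : 'I_k.+2) (U : set 'rV[R]_k.+1) r f : open U -> CkC U r f ->
  CkC (fcoord i @^-1` U) r (fun u => f (fcoord i u)).
Proof.
move=> oU.
suff H h : Ck_on U r h -> Ck_on (fcoord i @^-1` U) r (fun u => h (fcoord i u)).
  by case=> [f1 f2]; split; [exact: (H _ f1)|exact: (H _ f2)].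
pose D (l : 'I_k) (h : 'rV[R]_k.+1 -> R) (x : 'rV[R]_k.+1) : R :=
  if unlift ord0 i is Some i' then 'D_(ee (lift i' l)) h x
  else 'D_(ee (lift ord0 l)) h x - 'D_(ee ord0) h x.
apply: (@Ck_on_comp_line _ _ _ _ _ _ _ D) => //; first exact: fcoord_cont.
  move=> {}h l u ch Uu; apply: is_derive_affine (fun x => fcoord_add i l x u) _.
  rewrite /D /fdir; case: (unliftP ord0 i) => [i' _|_]; first exact: Ck_on_is_derive ch Uu.
  exact: derive_dir_sub oU ch Uu.
move=> {}r {}h l ch; rewrite /D; case: (unlift ord0 i) => [i'|]; first exact: Ck_on_D.
by apply: Ck_on_sub => //; exact: Ck_on_D.
Qed.

Definition jac k (h : nat -> 'rV[R]_k -> C) (t : 'rV[R]_k) : 'M[C]_k :=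
  \matrix_(j < k, i < k) dC (ee i) (h j) t.

Lemma jac_cornerC k (U : set 'rV[R]_k) (h : nat -> 'rV[R]_k -> C) :
  (forall t, corner t -> U t) -> (forall j, (j < k)%N -> CkC U 1 (h j)) ->
  cornerC (fun t => \det (jac h t)).
Proof.
move=> cU ch t /cU Ut; apply: contC_det => i j.
apply: (@contC_ext _ _ (dC (ee j) (h i))) => [u|]; first by rewrite mxE.
exact: CkC_contC (CkC_D _ (ch _ (ltn_ord i))) Ut.
Qed.

(** Stokes for [h_k dh_0 .. dh_(k-1)], whose differential is [(-1)^k dh_0 .. dh_k]. The Jacobian
    determinant is expanded along the row of [h_k]; since the cofactors form a field without
    divergence, it is the divergence of [h_k] times this field, and each partial derivative is
    integrated along its axis. *)
Theorem stokes k (U : set 'rV[R]_k.+1) (h : nat -> 'rV[R]_k.+1 -> C) :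
  open U -> (forall t, corner t -> U t) -> (forall j, (j < k.+1)%N -> CkC U 2 (h j)) ->
  simplex_integralC (fun t => \det (jac h t)) =
  (-1) ^+ k * \sum_(i < k.+2) (-1) ^+ i *
    simplex_integralC (fun u => h k (fcoord i u) * \det (jac (fun j u => h j (fcoord i u)) u)).
Proof.
move=> oU cU ch.
have ch1 j : (j < k.+1)%N -> CkC U 1 (h j) by move=> /ch; exact: CkC_le.
have chd (j : 'I_k.+1) i : CkC U 1 (dC (ee i) (h j)) by exact: CkC_D (ch _ (ltn_ord j)).
pose m : 'I_k.+1 := ord_max.
pose cof i t : C := \sum_(s : 'S_k.+1 | s m == i) (-1) ^+ s *
  \prod_(j | m != j) dC (ee (s j)) (h j) t.
have cofE i t : cofactor (jac h t) m i = cof i t.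
  rewrite expand_cofactor; apply: eq_bigr => s _; congr (_ * _).
  by apply: eq_bigr => j _; rewrite mxE.
(* Leibniz rule: [c] is the row whose entry is differentiated once more. *)
pose dcofs (s : 'S_k.+1) i t : C := \sum_(c | m != c) \prod_(j | m != j)
  (if j == c then dC (ee i) (dC (ee (s c)) (h c)) t else dC (ee (s j)) (h j) t).
pose dcof i t : C := \sum_(s : 'S_k.+1 | s m == i) (-1) ^+ s * dcofs s i t.
have dcofP i t : U t -> is_dC (ee i) (cof i) t (dcof i t).
  move=> Ut; apply: is_dC_sum => s; apply: is_dC_scale.
  apply: is_dC_prod; first exact: index_enum_uniq.
  by move=> j; exact: CkC_is_dC (chd _ _) Ut.
have cont_cof i t : U t -> contC (cof i) t.
  move=> Ut; apply: contC_sum => s; apply: contC_mul; first exact: contC_cst.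
  by apply: contC_prod => j; exact: CkC_contC (chd _ _) Ut.
have cont_dcof i t : U t -> contC (dcof i) t.
  move=> Ut; apply: contC_sum => s; apply: contC_mul; first exact: contC_cst.
  apply: contC_sum => c; apply: contC_prod => j; case: eqP => _.
    exact: CkC_contC (CkC_D _ (chd _ _)) Ut.
  exact: CkC_contC (chd _ _) Ut.
(* For fixed [c], exchanging the images of [c] and [m] preserves the product, because second
   derivatives commute, and changes the sign of the permutation. *)
have div0 t : U t -> \sum_i dcof i t = 0.
  move=> Ut; rewrite /dcof (exchange_big_dep xpredT) //=.
  transitivity (\sum_(s : 'S_k.+1) (-1) ^+ s * dcofs s (s m) t).
    by apply: eq_bigr => s _; rewrite (big_pred1 (s m)) // => i; rewrite eq_sym.
  rewrite /dcofs; under eq_bigr do rewrite mulr_sumr.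
  rewrite exchange_big /= big1 // => c mc.
  apply: (@alternating_sum_eq0 _ _ c m) => [|s]; first by rewrite eq_sym.
  apply: eq_bigr => j mj; rewrite !permM tpermR tpermL; case: eqP => [_|/eqP jc].
    exact: schwarzC (ch _ (ltn_ord c)) Ut.
  by rewrite tpermD // eq_sym.
pose G i t : C := h k t * cof i t.
pose g i t : C := dC (ee i) (h k) t * cof i t + h k t * dcof i t.
have Gg i t : corner t -> is_dC (ee i) (G i) t (g i t).
  move=> /cU Ut; apply: is_dC_mul (dcofP i t Ut).
  exact: CkC_is_dC (ch1 _ (ltnSn k)) Ut.
have contG i t : U t -> contC (G i) t.
  move=> Ut; apply: contC_mul (cont_cof i t Ut); exact: CkC_contC (ch _ (ltnSn k)) Ut.
have contg i t : U t -> contC (g i) t.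
  move=> Ut; apply: contC_add; apply: contC_mul.
  - exact: CkC_contC (CkC_D _ (ch1 _ (ltnSn k))) Ut.
  - exact: cont_cof.
  - exact: CkC_contC (ch _ (ltnSn k)) Ut.
  - exact: cont_dcof.
transitivity (simplex_integralC (fun t => \sum_i g i t)).
  apply: simplex_integralC_eq => t /cU Ut.
  rewrite (expand_det_row _ m) big_split /= -mulr_sumr div0 // mulr0 addr0.
  by apply: eq_bigr => i _; rewrite cofE mxE.
rewrite simplex_integralC_sum; last by move=> i t /cU; exact: contg.
transitivity (\sum_i (simplex_integralC (fun u : 'rV[R]_k => G i (fcoord ord0 u))
    - simplex_integralC (fun u : 'rV[R]_k => G i (fcoord (lift ord0 i) u)))).
  apply: eq_bigr => i _; rewrite (@simplex_FTC_C _ _ i (G i)).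
  - by congr (_ - _); apply: simplex_integralC_eq => u _; rewrite ?fcoord0 ?fcoordS.
  - by move=> t /cU; exact: contG.
  - by move=> t /cU; exact: contg.
  - exact: Gg.
have cf i u : corner u -> U (fcoord i u) by move=> cu; apply: cU; exact: fcoord_corner.
rewrite sumrB -simplex_integralC_sum; last first.
  move=> i u cu; apply: contC_comp; first exact: fcoord_cont.
  exact/contG/cf.
have oV i : open (fcoord i @^-1` U) by apply: open_comp => // x _; exact: fcoord_cont.
have cjac i : cornerC (fun u : 'rV[R]_k => h k (fcoord i u) * \det (jac (fun j u => h j (fcoord i u)) u)).
  move=> u cu; apply: contC_mul.
    apply: contC_comp; first exact: fcoord_cont.
    exact: CkC_contC (ch _ (ltnSn k)) (cf _ _ cu).
  apply: (@jac_cornerC _ (fcoord i @^-1` U)) cu => [t ct|j jk]; first exact: cf.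
  by apply: CkC_fcoord => //; apply: ch1; exact: ltnW.
(* The face opposite to vertex 0 receives the upper ends of all coordinate integrations, hence the
   sum of all cofactors. *)
rewrite [in RHS]big_ord_recl expr0 mul1r mulrDr; congr (_ + _).
  rewrite -simplex_integralC_scale //.
  apply: simplex_integralC_eq => u cu; rewrite -mulr_sumr mulrCA; congr (_ * _).
  under eq_bigr do rewrite -cofE.
  rewrite sum_cofactor_last; congr (_ * \det _); apply/matrixP => j l; rewrite !mxE.
  have := dC_fcoord (i:=ord0) l oU (ch1 j (ltnW (ltn_ord j))) (cf ord0 u cu).
  by rewrite unlift_none => /is_dC_val ->.
(* The face [t_i = 0] receives a single cofactor, the minor without column [i], which is the
   Jacobian of the restricted functions. *)
rewrite -sumrN mulr_sumr; apply: eq_bigr => i _.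
rewrite lift0 mulrA -exprD -[in RHS]simplex_integralC_scale //.
rewrite -[LHS]mulN1r -simplex_integralC_scale; last first.
  move=> u cu; apply: contC_comp; [exact: fcoord_cont|exact/contG/cf].
apply: simplex_integralC_eq => u cu; rewrite /G -cofE /cofactor.
rewrite mulrCA [in RHS]mulrCA; congr (_ * _).
rewrite mulrA -exprS addnS exprS mulN1r /m /=; congr (- _ * \det _).
apply/matrixP => j l; rewrite !mxE.
have := dC_fcoord (i:=lift ord0 i) l oU (ch1 j (ltnW (ltn_ord j))) (cf (lift ord0 i) u cu).
rewrite liftK => /is_dC_val ->; rewrite (_ : val (lift ord_max j) = j) //.
by rewrite /= bump_max.
Qed.

End Stokes.

(** * Cup products and integrals of lifts *)

Lemma bump_lt i n : (n < i)%N -> bump i n = n.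
Proof. by move=> ni; rewrite /bump leqNgt ni. Qed.

Lemma bump_ge i n : (i <= n)%N -> bump i n = n.+1.
Proof. by move=> ni; rewrite /bump ni. Qed.

Lemma bump_leS i n : (bump i n <= n.+1)%N.
Proof. by rewrite /bump -add1n leq_add2r leq_b1. Qed.

(** * Faces and vertices in barycentric coordinates *)

Section SimplexCoordinates.
Variable R : realType.

Lemma bary_simplex k (t : 'rV[R]_k) :
  std_simplex R k (ins ord0 (1 - \sum_j corner_retr t 0 j) (corner_retr t)).
Proof.
have [t0 t1] := corner_retr_in t; split=> [i|]; last by rewrite ins_sum subrK.
by case: (unliftP ord0 i) => [j ->|->]; rewrite ?ins_lift ?ins_at ?subr_ge0.
Qed.

(** [corner_retr] makes this total; on the simplex it only adds the missing barycentric
    coordinate. *)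
Definition bary k (t : 'rV[R]_k) : std_simplex R k := SigSub (mem_set (bary_simplex t)).

Lemma bary_val k (t : 'rV[R]_k) : corner t -> set_val (bary t) = ins ord0 (1 - \sum_j t 0 j) t.
Proof. by move=> ct; rewrite /set_val /= /bary /= corner_retr_id. Qed.

Lemma cont_simplex (V : topologicalType) k (f : V -> std_simplex R k) :
  continuous (fun v => \val (f v) : 'rV[R]_k.+1) -> continuous f.
Proof.
move=> cf; exact: (@continuous_comp_initial (std_simplex R k) V 'rV[R]_k.+1 (@set_val _ (std_simplex R k)) f cf).
Qed.

Lemma bary_cont k : continuous (@bary k).
Proof.
apply: cont_simplex => t /=.
have cr : {for t, continuous (@corner_retr R k)} by exact: corner_retr_cont.
apply: (@cont_cmp _ _ _ (@corner_retr R k) (fun t : 'rV[R]_k => ins ord0 (1 - \sum_j t 0 j) t)) => //.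
apply: cont_ins; last exact: cont_id.
by apply: contB; [exact: cont_cst|apply: cont_sum => j; exact: cont_coord].
Qed.

Lemma bary_coord k (s : std_simplex R k) :
  corner (rsubmx (set_val s : 'rV[R]_(1 + k))) /\ s = bary (rsubmx (set_val s : 'rV[R]_(1 + k))).
Proof.
have [s0 s1] := set_valP s.
have E j : rsubmx (set_val s : 'rV[R]_(1 + k)) 0 j = set_val s 0 (lift ord0 j).
  by rewrite mxE; congr (set_val s 0 _); exact: val_inj.
rewrite (bigD1_ord ord0) //= in s1.
have cs : corner (rsubmx (set_val s : 'rV[R]_(1 + k))).
  split=> [i|]; first by rewrite E.
  under eq_bigr do rewrite E.
  by rewrite -s1 lerDr.
split=> //; apply: val_inj; rewrite [RHS](bary_val cs).
apply: (row_eq (i:=ord0)) => [|j]; rewrite ?ins_at ?ins_lift ?E //.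
by under eq_bigr do rewrite E; rewrite -s1 addrK.
Qed.

Lemma bary_face k (i : 'I_k.+2) (u : 'rV[R]_k) : corner u ->
  face i (bary u) = bary (fcoord i u).
Proof.
move=> cu; apply: val_inj; rewrite [RHS](bary_val (fcoord_corner i cu)).
have -> : \val (face i (bary u)) = ins i 0 (ins ord0 (1 - \sum_j u 0 j) u).
  rewrite /face /= -[X in face_row _ X]/(set_val (bary u)) bary_val //.
case: (unliftP ord0 i) => [i' ->|->]; rewrite ?fcoordS ?fcoord0 !ins_sum.
  by rewrite ins0_ins add0r.
by rewrite subrK subrr.
Qed.

(** Vertex 0 is the origin, so the basis vector [j] is vertex [j + 1]. *)
Definition vtx k (n : nat) : 'rV[R]_k := \row_j (j.+1 == n)%:R.

Lemma vtx_sum k n : (n <= k)%N -> \sum_j vtx k n 0 j = (n != 0%N)%:R.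
Proof.
case: n => [|n] nk; first by rewrite big1 // => j _; rewrite mxE.
rewrite (bigD1 (Ordinal nk)) //= mxE eqxx big1 ?addr0 // => j.
by rewrite mxE eqSS -val_eqE /= => /negbTE ->.
Qed.

Lemma vtx_corner k n : (n <= k)%N -> corner (vtx k n).
Proof.
by move=> nk; split=> [i|]; rewrite ?vtx_sum ?mxE ?ler0n // lern1 leq_b1.
Qed.

Lemma fcoord_vtx k (i : 'I_k.+2) n : (n <= k)%N -> fcoord i (vtx k n) = vtx k.+1 (bump i n).
Proof.
move=> nk; case: (unliftP ord0 i) => [i' ->|->]; rewrite ?fcoordS ?fcoord0.
  have bS m : bump (lift ord0 i') m.+1 = (bump i' m).+1.
    by rewrite /bump lift0 ltnS addnS.
  apply: (row_eq (i:=i')) => [|j]; rewrite ?ins_at ?ins_lift !mxE.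
    rewrite [_ == bump _ _]eq_sym (_ : i'.+1 = lift ord0 i') ?lift0 //.
    by rewrite eq_sym (negbTE (neq_bump _ _)).
  rewrite (_ : (lift i' j).+1 = bump (lift ord0 i') j.+1); last by rewrite bS.
  by rewrite (inj_eq (can_inj (bumpK _))).
apply: (row_eq (i:=ord0)) => [|j]; rewrite ?ins_at ?ins_lift.
  by rewrite vtx_sum // mxE /= /bump /= add1n eqSS; case: n nk => [|n] _; rewrite ?subr0 ?subrr.
by rewrite !mxE lift0 /bump /= add1n eqSS.
Qed.

End SimplexCoordinates.

(** The cup product of the 1-cocycles [a j y - a j x] is closed. In the induction, the faces up to
    [k] share the last edge, from [k + 1] to [k + 2], and the last two faces share their first [k]
    factors. The edge from [k] to [k + 2] being the sum of the two others, the induction hypothesis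
    cancels everything. *)
Lemma alternating_cup (F : comPzRingType) (a : nat -> nat -> F) k :
  \sum_(i < k.+2) (-1) ^+ i * \prod_(j < k) (a j (bump i j.+1) - a j (bump i j)) = 0.
Proof.
elim: k => [|k IH].
  by rewrite !big_ord_recl !big_ord0 /= expr0 expr1 !mulr1 addr0 subrr.
rewrite 2!big_ord_recr /=; move: IH; rewrite big_ord_recr /=.
have E (i : nat) : (k < i)%N -> \prod_(j < k) (a j (bump i j.+1) - a j (bump i j)) =
    \prod_(j < k) (a j j.+1 - a j j).
  move=> ki; apply: eq_bigr => j _.
  have jk := ltn_ord j.
  by rewrite !bump_lt //; lia.
rewrite E // => IH.
have P (i : nat) : \prod_(j < k.+1) (a j (bump i j.+1) - a j (bump i j)) =
    \prod_(j < k) (a j (bump i j.+1) - a j (bump i j)) * (a k (bump i k.+1) - a k (bump i k)).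
  by rewrite big_ord_recr.
rewrite !P (E k.+1) // (E k.+2) // (@bump_ge k.+1 k.+1) // (@bump_lt k.+1 k) // !(@bump_lt k.+2) //.
rewrite (eq_bigr (fun i : 'I_k.+1 => (-1) ^+ i * \prod_(j < k) (a j (bump i j.+1) - a j (bump i j))
   * (a k k.+2 - a k k.+1))); last first.
  by move=> i _; have := ltn_ord i => ik; rewrite P !bump_ge ?mulrA //; lia.
rewrite -mulr_suml; move: IH; set S := \sum_(i < k.+1) _; set Q := \prod_(j < k) _ => IH.
have -> : S = - ((-1) ^+ k.+1 * Q) by apply/eqP; rewrite -addr_eq0 IH.
rewrite !exprS; ring.
Qed.

Section SimplicialIdentity.
Variables (R : realType) (T : topologicalType).

Lemma ins_max_comm k (i : 'I_k.+1) (t : 'rV[R]_k) :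
  ins (widen_ord (leqnSn k.+1) i) 0 (ins ord_max 0 t) = ins ord_max 0 (ins i 0 t).
Proof.
apply: (row_eq (i:=ord_max)) => [|j]; rewrite ?ins_at ?ins_lift.
  have -> : ord_max = lift (widen_ord (leqnSn k.+1) i) (ord_max : 'I_k.+1).
    by apply: val_inj; rewrite /= /bump -ltnS ltn_ord add1n.
  by rewrite ins_lift ins_at.
case: (unliftP i j) => [j' ->|->].
  have -> : lift ord_max (lift i j') = lift (widen_ord (leqnSn k.+1) i) (lift ord_max j').
    apply: val_inj; rewrite /= !bump_max; rewrite /bump leqNgt.
    by rewrite (_ : (i <= j') + j' < k.+1)%N // -[(_ + _)%N]/(val (lift i j')) ltn_ord.
  by rewrite !ins_lift.
have -> : lift ord_max i = widen_ord (leqnSn k.+1) i by apply: val_inj; rewrite /= bump_max.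
by rewrite !ins_at.
Qed.

Lemma sing_face_max k (i : 'I_k.+2) (s : singular_simplex R T k.+2) :
  sing_face (ord_max : 'I_k.+2) (sing_face (widen_ord (leqnSn k.+2) i) s) =
  sing_face i (sing_face (ord_max : 'I_k.+3) s).
Proof.
apply: eq_exist; apply/funext => t /=; congr (sval s _); apply: val_inj => /=.
exact: ins_max_comm.
Qed.

Definition spoint k (s : singular_simplex R T k) (t : 'rV[R]_k) : T := sval s (bary t).

Lemma spoint_cont k (s : singular_simplex R T k) : continuous (spoint s).
Proof.
move=> t; apply: (@cont_cmp _ _ _ (@bary R k) (sval s)); first exact: bary_cont.
exact: (svalP s).
Qed.

Lemma spoint_face k (i : 'I_k.+2) (s : singular_simplex R T k.+1) (u : 'rV[R]_k) :
  corner u -> spoint (sing_face i s) u = spoint s (fcoord i u).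
Proof. by move=> cu; rewrite /spoint /= bary_face. Qed.

(** Leibniz rule for the cup product of [b] with the 1-cocycle of differences of [w]: this factor
    being closed, only the coboundary of [b] remains. *)
Lemma coboundary_cup (F : comPzRingType) k (b : cochain R T F k) (w : nat -> F)
    (s : singular_simplex R T k.+2) :
  \sum_(i < k.+3) (-1) ^+ i * (b (sing_face (ord_max : 'I_k.+2) (sing_face i s))
     * (w (bump i k.+1) - w (bump i k))) =
  (w k.+2 - w k.+1) * coboundary b (sing_face (ord_max : 'I_k.+3) s).
Proof.
rewrite big_ord_recr /=; under eq_bigr do rewrite sing_face_max.
rewrite big_ord_recr /= /coboundary [in RHS]big_ord_recr /=.
rewrite (@bump_ge k.+1 k.+1) // (@bump_lt k.+1 k) // !(@bump_lt k.+2) //.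
rewrite (eq_bigr (fun i : 'I_k.+1 => (-1) ^+ i * b (sing_face (widen_ord (leqnSn k.+1) i)
   (sing_face ord_max s)) * (w k.+2 - w k.+1))); last first.
  by move=> i _; have := ltn_ord i => ik; rewrite !bump_ge ?mulrA //; lia.
rewrite -mulr_suml !exprS; ring.
Qed.

End SimplicialIdentity.

(** * Derivatives determined by the values on the closed simplex *)

Section CornerUniqueness.
Variables (R : realType) (k : nat).

(* A corner point is the limit of interior points, which move to it along the
   segment from the barycenter. *)
Lemma corner_interior_limit (f : 'rV[R]_k -> R) t : corner t -> {for t, continuous f} ->
  (forall u : 'rV[R]_k, (forall j, 0 < u 0 j) -> \sum_j u 0 j < 1 -> f u = 0) -> f t = 0.
Proof.
move=> [t0 t1] cf f0.
pose b : 'rV[R]_k := const_mx (k.+1%:R^-1).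
pose c (s : R) := t + s *: (b - t).
have cc : continuous c.
  move=> s; apply: cont_row => j; apply: (@cont_ext _ _ (fun s : R => t 0 j + s * (b 0 j - t 0 j))) => [x|].
    by rewrite !mxE.
  apply: contD; first exact: cont_cst.
  by apply: contM; [exact: cont_id|exact: cont_cst].
have c0 : c 0 = t by rewrite /c scale0r addr0.
have L : f (c s) @[s --> (0 : R)^'+] --> f t.
  rewrite -c0; apply: cvg_at_right_filter.
  by apply: (@cont_cmp _ _ _ c f (0 : R)); [exact: cc|rewrite c0].
apply: (cvg_unique _ L) => //.
have E : {near (0 : R)^'+, (fun=> 0 : R) =1 (fun s => f (c s))}.
  near=> s; have s0 : 0 < s by near: s; exact: nbhs_right_gt.
  have s1 : s < 1 by near: s; exact: nbhs_right_lt.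
  have k0 : 0 < (k.+1%:R : R)^-1 by rewrite invr_gt0 ltr0n.
  rewrite f0 // => [j|].
    rewrite !mxE (_ : _ + _ = (1 - s) * t 0 j + s * k.+1%:R^-1); last by ring.
    by apply: ltr_wpDl; [rewrite mulr_ge0 // subr_ge0 ltW|rewrite mulr_gt0].
  rewrite (eq_bigr (fun j => (1 - s) * t 0 j + s * k.+1%:R^-1)); last first.
    by move=> j _; rewrite !mxE; ring.
  rewrite big_split /= -mulr_sumr sumr_const card_ord.
  have kk : (k.+1%:R : R)^-1 *+ k < 1.
    by rewrite -[_ *+ _]mulr_natl ltr_pdivrMr ?ltr0n // mul1r ltr_nat.
  rewrite -mulrnAr.
  have : (1 - s) * (\sum_j t 0 j) <= (1 - s) * 1 by rewrite ler_wpM2l // subr_ge0 ltW.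
  have : s * (k.+1%:R^-1 *+ k) < s * 1 by rewrite ltr_pM2l.
  move: (s * (_ *+ _)) ((1 - s) * \sum_j _) => x y; lra.
by apply: cvg_trans (near_eq_cvg E) _; exact: cvg_cst.
Unshelve. all: by end_near. Qed.

Lemma open_interior : open [set u : 'rV[R]_k | (forall j, 0 < u 0 j) /\ \sum_j u 0 j < 1].
Proof.
rewrite openE => u [u0 u1]; apply: filterI.
  apply: (@filter_forall _ 'I_k (fun j (x : 'rV[R]_k) => 0 < x 0 j) (nbhs u) (nbhs_filter u)) => j.
  by apply: (@cvgr_gt _ _ (nbhs u) _ (fun u : 'rV[R]_k => u 0 j) (u 0 j)) => //; exact: cont_coord.
apply: (@cvgr_lt _ _ (nbhs u) _ (fun u : 'rV[R]_k => \sum_j u 0 j) (\sum_j u 0 j)) => //.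
by apply: cont_sum => j; exact: cont_coord.
Qed.

(** A lift is known on the closed simplex only. Its derivatives at boundary points are nevertheless
    determined, as limits of derivatives at interior points. *)
Lemma corner_derive_eq0 (U : set 'rV[R]_k) f t i : open U -> (forall t, corner t -> U t) ->
  Ck_on U 1 f -> (forall t, corner t -> f t = 0) -> corner t -> 'D_(delta_mx 0 i) f t = 0.
Proof.
move=> oU cU cf f0 ct.
apply: (@corner_interior_limit (fun t => 'D_(delta_mx 0 i) f t)) => //.
  exact: Ck_on_cont (Ck_on_D i cf) (cU _ ct).
move=> u u0 u1.
have [] : is_derive u (delta_mx 0 i) f (0 : R) => //.
apply: (@is_derive_open _ _ [set u : 'rV[R]_k | (forall j, 0 < u 0 j) /\ \sum_j u 0 j < 1] f (fun=> 0)).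
- exact: open_interior.
- by [].
- by move=> y [y0 y1]; apply: f0; split; [move=> j; exact: ltW|exact: ltW].
Qed.

End CornerUniqueness.

Lemma signr_sqr (F : pzRingType) n : (-1) ^+ n * (-1) ^+ n = 1 :> F.
Proof. by rewrite -exprD addnn -signr_odd odd_double. Qed.

(** * The homotopy between integrals of wedge products and cup products *)

Section Homotopy.
Variables (R : realType) (T : topologicalType).
Local Notation C := (CC R).
Local Notation sing := (singular_simplex R T).
Local Notation ee i := (delta_mx 0 i).

(* Multivalued functions on [T]: a lift to every simplex, well defined up to
   constants, together with a (discontinuous) branch. *)
Variable Z : nat -> forall k, sing k -> 'rV[R]_k -> C.
Variable br : nat -> T -> C.
Hypothesis Z_face : forall n k (i : 'I_k.+2) (s : sing k.+1), exists c : C,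
  forall u, corner u -> Z n s (fcoord i u) = Z n (sing_face i s) u + c.

(** The jump between lift and branch at vertex [i]. Differences of periods between two vertices do
    not depend on the constant in the lift. *)
Definition period n k (s : sing k) (i : nat) : C :=
  Z n s (vtx R k i) - br n (spoint s (vtx R k i)).

Lemma period_face n k (i : 'I_k.+2) (s : sing k.+1) a b : (a <= k)%N -> (b <= k)%N ->
  period n (sing_face i s) a - period n (sing_face i s) b =
  period n s (bump i a) - period n s (bump i b).
Proof.
move=> ak bk; have [c Hc] := Z_face n i s; rewrite /period.
have E m : (m <= k)%N -> Z n (sing_face i s) (vtx R k m) = Z n s (vtx R k.+1 (bump i m)) - c.
  by move=> mk; rewrite -fcoord_vtx // Hc ?addrK //; exact: vtx_corner.
rewrite !E // !spoint_face; try exact: vtx_corner.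
rewrite !fcoord_vtx //; ring.
Qed.

(* The cup product of the 1-cocycles that measure the jump of the branch along
   an edge. *)
Definition cup k (s : sing k) : C := \prod_(j < k) (period j s j.+1 - period j s j).

Lemma cup_face k (i : 'I_k.+2) (s : sing k.+1) :
  cup (sing_face i s) = \prod_(j < k) (period j s (bump i j.+1) - period j s (bump i j)).
Proof. by apply: eq_bigr => j _; rewrite period_face // ltnW. Qed.

Lemma cup_cocycle k : @coboundary R T C k (@cup k) = 0.
Proof.
apply/funext => s; rewrite /coboundary /=.
under eq_bigr do rewrite cup_face.
exact: (alternating_cup (fun j n => period j s n)).
Qed.

(** Stokes' formula needs functions on an open neighbourhood, whereas the lift counts on the simplex
    only and up to a constant; this is an extension that is smooth enough. *)
Definition rep n k (s : sing k) (h : 'rV[R]_k -> C) : Prop :=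
  exists U, [/\ open U, forall t, corner t -> U t, CkC U 2 h &
    exists c, forall t, corner t -> h t = Z n s t + c].

Lemma rep_face n k (i : 'I_k.+2) (s : sing k.+1) h : rep n s h ->
  rep n (sing_face i s) (fun u => h (fcoord i u)).
Proof.
move=> [U [oU cU ch [c hc]]]; exists (fcoord i @^-1` U); split.
- by apply: open_comp => // x _; exact: fcoord_cont.
- by move=> t ct; apply: cU; exact: fcoord_corner.
- exact: CkC_fcoord.
have [d Hd] := Z_face n i s; exists (d + c) => t ct.
by rewrite hc ?Hd ?addrA //; exact: fcoord_corner.
Qed.

Lemma rep_uniq n k (s : sing k) h h' : rep n s h -> rep n s h' ->
  (exists c, forall t, corner t -> h' t = h t + c) /\
  forall i t, corner t -> dC (ee i) h' t = dC (ee i) h t.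
Proof.
move=> [U [oU cU ch [c hc]]] [U' [oU' cU' ch' [c' hc']]].
have E t : corner t -> h' t = h t + (c' - c) by move=> ct; rewrite hc // hc' //; ring.
split=> [|i t ct]; first by exists (c' - c).
have oV := openI oU oU'.
have cV t' : corner t' -> (U `&` U') t' by move=> ct'; split; [exact: cU|exact: cU'].
have main (p : C -> R) : (forall x y, p (x + y) = p x + p y) ->
    Ck_on U 2 (fun x => p (h x)) -> Ck_on U' 2 (fun x => p (h' x)) ->
    'D_(ee i) (fun x => p (h' x)) t = 'D_(ee i) (fun x => p (h x)) t.
  move=> pD c1 c2.
  have {}c1 : Ck_on (U `&` U') 1 (fun x => p (h x)).
    by apply: Ck_onW; apply: Ck_on_sub_set c1 => x [].
  have {}c2 : Ck_on (U `&` U') 1 (fun x => p (h' x)).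
    by apply: Ck_onW; apply: Ck_on_sub_set c2 => x [].
  pose f x := p (h' x) - p (h x) - p (c' - c).
  have cf : Ck_on (U `&` U') 1 f.
    apply: (@Ck_on_sub _ _ _ _ (fun x => p (h' x) - p (h x)) (fun=> p (c' - c)) oV); last exact: Ck_on_cst.
    exact: (Ck_on_sub oV c2 c1).
  have f0 x : corner x -> f x = 0 by move=> cx; rewrite /f E // pD; ring.
  have := corner_derive_eq0 i oV cV cf f0 ct.
  have d1 := Ck_on_is_derive i c1 (cV _ ct); have d2 := Ck_on_is_derive i c2 (cV _ ct).
  have [_ ->] : is_derive t (ee i) f ('D_(ee i) (fun x => p (h' x)) t - 'D_(ee i) (fun x => p (h x)) t - 0).
    exact: (is_deriveB (is_deriveB d2 d1) (is_derive_cst _ _ _)).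
  by rewrite subr0 => /eqP; rewrite subr_eq0 => /eqP.
rewrite /dC; congr mkC; apply: main.
- exact: reCD.
- by case: ch.
- by case: ch'.
- exact: imCD.
- by case: ch.
- by case: ch'.
Qed.

(** The default 0 makes the cochains below total: on a simplex without representative their value is
    arbitrary, and no identity is claimed there. *)
Definition hsel n k (s : sing k) : 'rV[R]_k -> C := xget (fun=> 0) (rep n s).

Definition has_reps m k (s : sing k) : Prop := forall n, (n < m)%N -> exists h, rep n s h.

Lemma hselP m k (s : sing k) n : has_reps m s -> (n < m)%N -> rep n s (hsel n s).
Proof. by move=> hm /hm [h rh]; apply: xgetPex; exists h. Qed.

Lemma has_reps_face m k (i : 'I_k.+2) (s : sing k.+1) : has_reps m s -> has_reps m (sing_face i s).
Proof. by move=> hm n /hm [h rh]; exists (fun u => h (fcoord i u)); exact: rep_face. Qed.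

Lemma has_reps_le m m' k (s : sing k) : (m' <= m)%N -> has_reps m s -> has_reps m' s.
Proof. by move=> mm hm n nm; apply: hm; exact: leq_trans nm mm. Qed.

(** Adjusted to the branch at the last vertex, which removes the ambiguity of the constant in
    [h]. *)
Definition normal n k (s : sing k) (h : 'rV[R]_k -> C) (t : 'rV[R]_k) : C :=
  h t - h (vtx R k k) + br n (spoint s (vtx R k k)).

(* The integral over [s] of the wedge product of the differentials of the
   lifts 0, .., k - 1. *)
Definition Lam k (s : sing k) : C := simplex_integralC (fun t => \det (jac (fun j => hsel j s) t)).

(** The integral of [z_k dz_0 .. dz_(k-1)], a primitive of [Lam] up to the change of normalisation
    between faces; the sign is that of Stokes' formula. *)
Definition prim k (s : sing k) : C := (-1) ^+ k * simplex_integralC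
  (fun t => normal k s (hsel k s) t * \det (jac (fun j => hsel j s) t)).

(** Each step trades one differential for a 1-cocycle: [prim] replaces the last differential by its
    jump along the last edge, and the recursion treats the front face, the one without the last
    vertex, in the same way. *)
Fixpoint homot k : sing k -> C :=
  match k with
  | 0 => fun s => prim s
  | k'.+1 => fun s => prim s +
      homot (sing_face ord_max s) * (period k'.+1 s k'.+1 - period k'.+1 s k')
  end.

Lemma jac_rep k (s : sing k) (h : nat -> 'rV[R]_k -> C) t : has_reps k s ->
  (forall j, (j < k)%N -> rep j s (h j)) -> corner t ->
  jac (fun j => hsel j s) t = jac h t.
Proof.
move=> hs rh ct; apply/matrixP => j i; rewrite !mxE.
by have [_ ->] := rep_uniq (rh j (ltn_ord j)) (hselP hs (ltn_ord j)).
Qed.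

Lemma normal_rep n k (s : sing k) h h' t : rep n s h -> rep n s h' -> corner t ->
  normal n s h t = normal n s h' t.
Proof.
move=> rh rh' ct; have [[c E] _] := rep_uniq rh rh'.
by rewrite /normal !E //; [ring|exact: vtx_corner].
Qed.

Lemma reps_open m k (s : sing k) : has_reps m s -> exists U, [/\ open U,
  forall t, corner t -> U t & forall j, (j < m)%N -> CkC U 2 (hsel j s)].
Proof.
elim: m => [_|m IH hm]; first by exists setT; split => //; exact: openT.
have [U [oU cU ch]] := IH (has_reps_le (leqnSn m) hm).
have [V [oV cV ch' _]] := hselP hm (ltnSn m).
exists (U `&` V); split; [exact: openI|by move=> t ct; split; [exact: cU|exact: cV]|].
have sub (W W' : set 'rV[R]_k) f : W' `<=` W -> CkC W 2 f -> CkC W' 2 f.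
  by move=> WW [f1 f2]; split; exact: Ck_on_sub_set WW _.
move=> j; rewrite ltnS leq_eqVlt => /predU1P[->|jm]; first by apply: sub ch' => x [].
by apply: sub (ch j jm) => x [].
Qed.

Lemma Lam_rep k (s : sing k) (h : nat -> 'rV[R]_k -> C) : has_reps k s ->
  (forall j, (j < k)%N -> rep j s (h j)) ->
  Lam s = simplex_integralC (fun t => \det (jac h t)).
Proof.
by move=> hs rh; apply: simplex_integralC_eq => t ct; rewrite (jac_rep hs rh ct).
Qed.

(** Stokes' formula with the constant 1 as last function: the Jacobian has a zero row, and the
    boundary integrals are the values of [Lam]. *)
Lemma Lam_closed k (s : sing k.+1) : has_reps k s ->
  \sum_(i < k.+2) (-1) ^+ i * Lam (sing_face i s) = 0.
Proof.
move=> hs; have [U [oU cU ch]] := reps_open hs.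
pose h j := if (j < k)%N then hsel j s else (fun=> 1 : C).
have ch2 j : (j < k.+1)%N -> CkC U 2 (h j).
  move=> _; rewrite /h; case: ifP => [/ch//|_].
  by split; exact: Ck_on_cst.
have := stokes oU cU ch2.
have -> : simplex_integralC (fun t => \det (jac h t)) = 0.
  transitivity (0 * simplex_integralC (fun _ : 'rV[R]_k.+1 => 0 : C)); last by rewrite mul0r.
  rewrite -simplex_integralC_scale; last by move=> t _; exact: contC_cst.
  apply: simplex_integralC_eq => t _; rewrite mul0r.
  rewrite (expand_det_row _ ord_max) big1 // => i _; rewrite mxE /h /= ltnn.
  by rewrite (is_dC_val (is_dC_cst _ _ _)) mul0r.
move=> /esym/eqP; rewrite mulf_eq0 signr_eq0 /= => /eqP S0; rewrite -[RHS]S0.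
apply: eq_bigr => i _; congr (_ * _).
rewrite (@Lam_rep _ (sing_face i s) (fun j u => hsel j s (fcoord i u))); last 2 first.
- exact: has_reps_face.
- by move=> j jk; apply: rep_face; exact: hselP hs jk.
apply: simplex_integralC_eq => t ct; rewrite /h ltnn mul1r; congr (\det _).
by apply/matrixP => a b; rewrite !mxE ltn_ord.
Qed.

(** On the [i]-th face, the restricted representative of [z_k] differs from the normalised one by
    the period at the last vertex of that face, up to a common constant. This vertex is [k + 1] for
    all faces but the last, for which it is [k]. As the signed sum of [Lam] over the faces vanishes,
    only the difference of the two periods survives, on the front face. *)
Lemma prim_stokes k (s : sing k.+1) : has_reps k.+1 s ->
  Lam s = @coboundary R T C k (@prim k) s +
    (period k s k.+1 - period k s k) * Lam (sing_face ord_max s).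
Proof.
move=> hs; have [U [oU cU ch]] := reps_open hs.
have hs' := has_reps_le (leqnSn k) hs.
rewrite {1}/Lam (stokes oU cU ch).
pose m (i : 'I_k.+2) : C := hsel k s (vtx R k.+1 (bump i k)) - br k (spoint s (vtx R k.+1 (bump i k))).
have E (i : 'I_k.+2) : simplex_integralC (fun u => hsel k s (fcoord i u) *
     \det (jac (fun j u => hsel j s (fcoord i u)) u)) =
   (-1) ^+ k * prim (sing_face i s) + m i * Lam (sing_face i s).
  have rf j : (j < k.+1)%N -> rep j (sing_face i s) (fun u => hsel j s (fcoord i u)).
    by move=> jk; apply: rep_face; exact: hselP hs jk.
  have hf := has_reps_face i hs.
  have [V [oV cV chV]] := reps_open hf.
  have cL : cornerC (fun t => \det (jac (fun j => hsel j (sing_face i s)) t)).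
    by apply: jac_cornerC cV _ => j jk; apply: (@CkC_le _ _ _ 1 2) => //; exact/chV/ltnW.
  have cN : cornerC (fun t => normal k (sing_face i s) (hsel k (sing_face i s)) t).
    move=> t ct; apply: contC_add; last exact: contC_cst.
    apply: contC_add; last exact: contC_cst.
    exact: CkC_contC (chV _ (ltnSn k)) (cV _ ct).
  rewrite /prim mulrA signr_sqr mul1r.
  rewrite -simplex_integralC_scale // -simplex_integralC_add; last 2 first.
  - by move=> t ct; apply: contC_mul; [exact: cN|exact: cL].
  - by move=> t ct; apply: contC_mul; [exact: contC_cst|exact: cL].
  apply: simplex_integralC_eq => t ct.
  rewrite -(normal_rep (rf k (ltnSn k)) (hselP hf (ltnSn k)) ct).
  rewrite (jac_rep (has_reps_le (leqnSn k) hf) (fun j jk => rf j (ltnW jk)) ct) -mulrDl.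
  congr (_ * _); rewrite /normal /m spoint_face; last exact: vtx_corner.
  rewrite fcoord_vtx //; ring.
have [c Hc] : exists c : C, forall n, (n <= k.+1)%N -> hsel k s (vtx R k.+1 n) = Z k s (vtx R k.+1 n) + c.
  have [_ [_ _ _ [c Hc]]] := hselP hs (ltnSn k); exists c => n nk.
  by apply: Hc; exact: vtx_corner.
have mE (i : 'I_k.+2) : m i = period k s (bump i k) + c.
  rewrite /m /period Hc; first by ring.
  exact: bump_leS.
under eq_bigr do rewrite E mE.
rewrite /coboundary (eq_bigr (fun i : 'I_k.+2 => (-1) ^+ k * ((-1) ^+ i * prim (sing_face i s)) +
   (-1) ^+ i * ((period k s (bump i k) + c) * Lam (sing_face i s)))); last by move=> i _; ring.
rewrite big_split /= -mulr_sumr mulrDr mulrA signr_sqr mul1r.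
congr (_ + _).
have := Lam_closed hs'; rewrite big_ord_recr [in X in _ -> X]big_ord_recr /= => L0.
rewrite bump_lt // (eq_bigr (fun i : 'I_k.+1 => (period k s k.+1 + c) *
    ((-1) ^+ i * Lam (sing_face (widen_ord (leqnSn k.+1) i) s)))); last first.
  by move=> i _; rewrite bump_ge; [ring|rewrite -ltnS].
rewrite -mulr_sumr; move: L0; set S := \sum_(i < k.+1) _; set L := Lam _ => L0.
have -> : S = - ((-1) ^+ k.+1 * L) by apply/eqP; rewrite -addr_eq0 L0.
transitivity ((-1) ^+ k * (-1) ^+ k * ((period k s k.+1 - period k s k) * L)).
  by rewrite exprS; ring.
by rewrite signr_sqr mul1r.
Qed.

(** Iterates [prim_stokes]; the Leibniz rule for cup products carries the homotopy of the front face
    through the multiplication by the last jump. *)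
Theorem Lam_homotopy k (s : sing k.+1) : has_reps k.+1 s ->
  Lam s = cup s + @coboundary R T C k (@homot k) s.
Proof.
elim: k s => [|k IH] s hs.
  rewrite (prim_stokes hs) addrC; congr (_ + _).
  rewrite /cup big_ord1 (_ : Lam _ = 1) ?mulr1 //.
  by rewrite /Lam /simplex_integralC /= !det_mx00.
rewrite (prim_stokes hs) (IH (sing_face ord_max s)); last first.
  by apply: has_reps_face; exact: has_reps_le hs.
have -> : cup s = (period k.+1 s k.+2 - period k.+1 s k.+1) * cup (sing_face ord_max s).
  rewrite cup_face {1}/cup big_ord_recr /= mulrC; congr (_ * _).
  apply: eq_bigr => j _; have := ltn_ord j => jk.
  by rewrite !bump_lt //; lia.
rewrite mulrDr addrCA; congr (_ + _).
rewrite -coboundary_cup /coboundary -big_split /=; apply: eq_bigr => i _.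
by rewrite -mulrDr period_face //.
Qed.

End Homotopy.

(** * The elliptic integral and polar angles *)

Section EllipticIntegral.
Variable R : realType.

Definition ell_integrand (x : R) : R := (Num.sqrt (1 + sin x ^+ 2))^-1.

Lemma ell_radicand_gt0 (x : R) : 0 < 1 + sin x ^+ 2.
Proof. by rewrite ltr_pwDl // sqr_ge0. Qed.

Lemma ell_integrand_gt0 x : 0 < ell_integrand x.
Proof. by rewrite invr_gt0 sqrtr_gt0 ell_radicand_gt0. Qed.

Lemma is_derive_radicand (x : R) :
  is_derive x (1 : R) (fun x => 1 + sin x ^+ 2) (2 * sin x * cos x).
Proof.
have -> : (fun x : R => 1 + sin x ^+ 2) = (fun=> 1) + (sin * sin).
  by apply/funext => y; rewrite expr2.
apply: is_derive_eq; rewrite /GRing.scale /=; ring.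
Qed.

Definition ell_integrand' (x : R) : R :=
  - (sin x * cos x) * (ell_integrand x * ell_integrand x * ell_integrand x).

Lemma is_derive_ell_integrand (x : R) : is_derive x (1 : R) ell_integrand (ell_integrand' x).
Proof.
have s0 := ell_radicand_gt0 x.
have d1 : is_derive x (1 : R) (Num.sqrt \o (fun x => 1 + sin x ^+ 2))
    ((2 * Num.sqrt (1 + sin x ^+ 2))^-1 * (2 * sin x * cos x)).
  by apply: is_derive1_comp; [exact: is_derive1_sqrt|exact: is_derive_radicand].
have n0 : Num.sqrt (1 + sin x ^+ 2) != 0 by rewrite gt_eqF // sqrtr_gt0.
apply: (is_derive_eq (@is_deriveV R (Num.sqrt \o (fun x => 1 + sin x ^+ 2)) x _ 1 n0 d1)).
rewrite /ell_integrand' /ell_integrand /GRing.scale /=; field.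
by rewrite n0.
Qed.

Lemma derivable_cont (f : R -> R) (f' : R -> R) :
  (forall x : R, is_derive x (1 : R) f (f' x)) -> continuous f.
Proof. by move=> df x; apply/differentiable_continuous/derivable1_diffP; case: (df x). Qed.

Lemma ell_integrand_cont : continuous ell_integrand.
Proof. exact: derivable_cont is_derive_ell_integrand. Qed.

Lemma ell_integrand'_cont : continuous ell_integrand'.
Proof.
move=> x; have ce : {for x, continuous ell_integrand} by exact: ell_integrand_cont.
have cs : {for x, continuous (@sin R)} by exact: continuous_sin.
have cc : {for x, continuous (@cos R)} by exact: continuous_cos.
apply: (@cont_ext _ _ (fun x => (-1 * (sin x * cos x)) * (ell_integrand x * ell_integrand x * ell_integrand x))).
  by move=> y; rewrite /ell_integrand' mulN1r.
apply: contM; last by apply: contM => //; exact: contM.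
by apply: contM; [exact: cont_cst|exact: contM].
Qed.

(** The integral from 0 to [y], written with a base point [a] to the left of both so as to cover
    negative [y]. *)
Let loc (a y : R) : R := \int[lebesgue_measure]_(t in `[a, y]) ell_integrand t
  - \int[lebesgue_measure]_(t in `[a, 0]) ell_integrand t.

Let loc_eq a b y : a <= b -> b < y -> b < 0 -> loc a y = loc b y.
Proof.
move=> ab bly bl0.
have H z : b < z -> \int[lebesgue_measure]_(t in `[a, z]) ell_integrand t =
   \int[lebesgue_measure]_(t in `[a, b]) ell_integrand t +
   \int[lebesgue_measure]_(t in `]b, z]) ell_integrand t.
  move=> bz; apply/eqP; rewrite addrC -subr_eq; apply/eqP.
  apply: Rintegral_itvB; rewrite ?bnd_simp //; last exact: ltW.
  exact: cont_integrable ell_integrand_cont.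
have K z : b < z -> \int[lebesgue_measure]_(t in `[b, z]) ell_integrand t =
   \int[lebesgue_measure]_(t in `]b, z]) ell_integrand t.
  move=> bz; rewrite Rintegral_itv_obnd_cbnd //.
  apply: integrableS (cont_integrable b z ell_integrand_cont) => //.
  by apply: subset_itvr; rewrite bnd_simp.
by rewrite /loc (H y) // (H 0) // (K y) // (K 0) // opprD addrACA subrr add0r.
Qed.

(** The base point moves with [x] to stay to the left of 0 and of [x]; near a given point it can be
    replaced by a fixed one. *)
Definition ell_int (x : R) : R := loc (- `|x| - 1) x.

Lemma is_derive_ell_int (x : R) : is_derive x (1 : R) ell_int (ell_integrand x).
Proof.
pose a := - `|x| - 2.
have nx : - x <= `|x| by rewrite -normrN ler_norm.
have ax : a < x by rewrite /a; lra.
have [d1 d2] : derivable (loc a) x 1 /\ (loc a)^`()%classic x = ell_integrand x.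
  have xx1 : x < x + 1 by rewrite ltrDl.
  have [e1 e2] := @continuous_FTC1_closed R ell_integrand a x (x + 1)
    xx1 (cont_integrable a (x + 1) ell_integrand_cont) ax (ell_integrand_cont (x:=x)).
  have D : is_derive x (1 : R) (loc a) (ell_integrand x).
    rewrite -[ell_integrand x]subr0 -e2 derive1E; apply: is_deriveB.
    exact: DeriveDef.
  by case: D => D1 D2; rewrite derive1E.
have E : {near x, loc a =1 ell_int}.
  near=> y; have yx : `|x - y| < 1.
    by near: y; apply: (@cvgr_dist_lt _ _ _ (nbhs x) _ id x); [exact: cvg_id|].
  rewrite /ell_int; have ny : - y <= `|y| by rewrite -normrN ler_norm.
  have y0 : 0 <= `|y| by []. have x0 : 0 <= `|x| by [].
  have : `|y| < `|x| + 1.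
    by rewrite -[y](subrK x) addrC; apply: le_lt_trans (ler_normD _ _) _; rewrite ltrD2l distrC.
  move=> yx1; apply: loc_eq; rewrite /a; lra.
have c2 : 'D_1 (loc a) x = ell_integrand x by rewrite -derive1E.
rewrite -c2; apply: DeriveDef; first by move: d1; apply: near_eq_derivable.
by symmetry; apply: near_eq_derive.
Unshelve. all: by end_near. Qed.

Definition ell_period : R := ell_int (pi *+ 2) - ell_int 0.

Lemma ell_integrand_period x : ell_integrand (x + pi *+ 2) = ell_integrand x.
Proof. by rewrite /ell_integrand sinD2pi. Qed.

Lemma ell_int_period x : ell_int (x + pi *+ 2) = ell_int x + ell_period.
Proof.
pose f y := ell_int (y + pi *+ 2) - ell_int y.
suff -> : ell_period = f x by rewrite /f [RHS]addrC subrK.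
rewrite /ell_period -[pi *+ 2 in LHS]add0r -/(f 0).
apply: is_derive_0_is_cst => y.
have d1 : is_derive y (1 : R) (ell_int \o (fun y => y + pi *+ 2)) (ell_integrand (y + pi *+ 2) * 1).
  apply: is_derive1_comp; first exact: is_derive_ell_int.
  by apply: is_derive_eq; rewrite addr0.
by apply: (is_derive_eq (is_deriveB d1 (is_derive_ell_int y))); rewrite mulr1 ell_integrand_period subrr.
Qed.

Lemma ell_period_gt0 : 0 < ell_period.
Proof.
have p0 : (0 : R) < pi *+ 2 by rewrite mulrn_wgt0 // pi_gt0.
have [c _] := mean_value p0 (fun x _ => is_derive_ell_int x).
by rewrite /ell_period => ->; rewrite subr0 mulr_gt0 // ell_integrand_gt0.
Qed.

(* Normalised so that [2 pi] is mapped to 1. *)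
Definition ell (x : R) : R := ell_int x / ell_period.

Lemma ellD2pi x : ell (x + pi *+ 2) = ell x + 1.
Proof. by rewrite /ell ell_int_period mulrDl divff // gt_eqF // ell_period_gt0. Qed.

Lemma ellD2pin x (n : int) : ell (x + pi *+ 2 *~ n) = ell x + n%:~R.
Proof.
have H y m : ell (y + pi *+ 2 *+ m) = ell y + m%:R.
  elim: m => [|m IH]; first by rewrite mulr0n !addr0.
  by rewrite mulrSr addrA ellD2pi IH -addrA -natr1.
case: n => n; first exact: H.
rewrite NegzE !mulrNz; apply/eqP; rewrite eq_sym subr_eq -H subrK //.
Qed.

Lemma is_derive_ell (x : R) : is_derive x (1 : R) ell (ell_integrand x / ell_period).
Proof.
have -> : ell = (fun x => ell_period^-1 * ell_int x) by apply/funext => y; rewrite /ell mulrC.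
have := @is_deriveZ R _ _ _ (ell_period^-1) _ _ _ (is_derive_ell_int x).
by move=> d; apply: (is_derive_eq d); rewrite /GRing.scale /= mulrC.
Qed.

Lemma is_derive_ell2 (x : R) :
  is_derive x (1 : R) (fun x => ell_integrand x / ell_period) (ell_integrand' x / ell_period).
Proof.
have -> : (fun x => ell_integrand x / ell_period) = (fun x => ell_period^-1 * ell_integrand x).
  by apply/funext => y; rewrite mulrC.
have := @is_deriveZ R _ _ _ (ell_period^-1) _ _ _ (is_derive_ell_integrand x).
by move=> d; apply: (is_derive_eq d); rewrite /GRing.scale /= mulrC.
Qed.

Lemma Ck_on_ell k (U : set 'rV[R]_k) f : open U -> Ck_on U 2 f -> Ck_on U 2 (fun x => ell (f x)).
Proof.
move=> oU cf; apply: (Ck_on_comp2 oU cf is_derive_ell is_derive_ell2).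
by move=> x; apply: contM; [exact: ell_integrand'_cont|exact: cont_cst].
Qed.

End EllipticIntegral.

(** * Arguments of nonzero complex numbers *)

Section PolarAngle.
Variable R : realType.
Local Notation C := (CC R).
Implicit Types (z w : C) (a b : R).

(** A relation rather than a function, since arguments are determined up to multiples of [2 pi] and
    no branch is continuous. *)
Definition polar z a : Prop := exists2 r : R, 0 < r & reC z = r * cos a /\ imC z = r * sin a.

Lemma polarM z w a b : polar z a -> polar w b -> polar (z * w) (a + b).
Proof.
move=> [r r0 [z1 z2]] [s s0 [w1 w2]]; exists (r * s); first exact: mulr_gt0.
by rewrite reCM imCM z1 z2 w1 w2 cosD sinD; split; ring.
Qed.

Lemma polar_conj z a : polar z a -> polar z^* (- a).
Proof.
move=> [r r0 [z1 z2]]; exists r => //.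
by rewrite reC_conj imC_conj cosN sinN z1 z2 mulrN.
Qed.

Lemma polar_scale z a c : 0 < c -> polar z a -> polar (mkC c 0 * z) a.
Proof.
move=> c0 [r r0 [z1 z2]]; exists (c * r); first exact: mulr_gt0.
by rewrite reCM imCM /= z1 z2; split; ring.
Qed.

Lemma polar_neq0 z a : polar z a -> 0 < reC z ^+ 2 + imC z ^+ 2.
Proof.
move=> [r r0 [-> ->]]; rewrite !exprMn -mulrDr cos2Dsin2 mulr1; exact: exprn_gt0.
Qed.

Lemma polar_step z w a b : polar w a -> polar (z * w^*) b -> polar z (a + b).
Proof.
move=> pw pz; have := polarM pw pz.
have n0 : 0 < (reC w ^+ 2 + imC w ^+ 2)^-1 by rewrite invr_gt0; exact: polar_neq0 pw.
move/(polar_scale n0); congr polar.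
apply: complex_ext;
  rewrite !(reCM, imCM, reC_conj, imC_conj) /=; field; rewrite gt_eqF //; exact: polar_neq0 pw.
Qed.

Lemma polar_atan z : 0 < reC z -> polar z (atan (imC z / reC z)).
Proof.
move=> z0; set x := imC z / reC z.
have s0 : 0 < Num.sqrt (1 + x ^+ 2) by rewrite sqrtr_gt0 ltr_pwDl // sqr_ge0.
have ca := cos_atan x.
have sa : sin (atan x) = x / Num.sqrt (1 + x ^+ 2).
  have := atanK x; rewrite /tan ca => /(congr1 (fun y => y * (Num.sqrt (1 + x ^+ 2))^-1)).
  by rewrite divfK // invr_eq0 gt_eqF.
exists (reC z * Num.sqrt (1 + x ^+ 2)); first exact: mulr_gt0.
rewrite ca sa; split; first by rewrite mulfK // gt_eqF.
rewrite /x; field; by rewrite !gt_eqF.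
Qed.

Lemma polar_exists z : z != 0 -> exists a, polar z a.
Proof.
move=> z0.
have neg a w : polar (- w) a -> polar w (a + pi).
  move=> [r r0 [w1 w2]]; exists r => //; move: w1 w2; rewrite reCN imCN cosDpi sinDpi !mulrN.
  by move=> /eqP; rewrite eqr_oppLR => /eqP -> /eqP; rewrite eqr_oppLR => /eqP ->.
have [p|n|e] := ltgtP 0 (reC z).
- by eexists; exact: polar_atan p.
- by eexists; apply/neg/polar_atan; rewrite reCN oppr_gt0.
have up w : reC w = 0 -> 0 < imC w -> polar w (pi / 2).
  by move=> w0 w1; exists (imC w) => //; rewrite cos_pihalf sin_pihalf mulr0 mulr1.
have [p|n|e'] := ltgtP 0 (imC z).
- by exists (pi / 2); apply: up.
- by exists (pi / 2 + pi); apply/neg/up; rewrite ?reCN ?imCN -?e ?oppr0 // oppr_gt0.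
- by move: z0; rewrite (_ : z = 0) ?eqxx //; apply: complex_ext; rewrite -?e -?e'.
Qed.

(** After reduction to [b] in [[0, 2 pi[], the half angle has sine 0 and lies in [[0, pi[], so it
    vanishes. *)
Lemma cos_eq1 a : cos a = 1 -> exists n : int, a = pi *+ 2 *~ n.
Proof.
have p0 : (0 : R) < pi *+ 2 by rewrite mulrn_wgt0 // pi_gt0.
pose n := Num.floor (a / (pi *+ 2)); pose b := a - pi *+ 2 *~ n.
have bE : b = (a / (pi *+ 2) - n%:~R) * (pi *+ 2).
  by rewrite mulrBl divfK ?gt_eqF // /b -mulrzl.
have /andP[n1 n2] := floor_itv (a / (pi *+ 2)).
have b0 : 0 <= b by rewrite bE mulr_ge0 ?(ltW p0) // subr_ge0.
have b1 : b < pi *+ 2.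
  by rewrite bE -[X in _ < X]mul1r ltr_pM2r // ltrBlDr addrC -(intrD _ n 1).
have cb : cos b = cos a.
  have H (y : R) m : cos (y + pi *+ 2 *+ m) = cos y.
    by elim: m => [|m IH]; [rewrite mulr0n addr0|rewrite mulrSr addrA cosD2pi].
  rewrite /b; case: (n) => m; rewrite ?NegzE ?mulrNz ?opprK ?H //.
  by rewrite -(H _ m) subrK.
rewrite -cb -{1}[b](@divfK _ 2) ?pnatr_eq0 // mulr_natr cos_mulr2n => cb1.
have c2 : cos (b / 2) ^+ 2 = 1 by lra.
have s2 : sin (b / 2) = 0.
  by apply/eqP; rewrite -sqrf_eq0; have := cos2Dsin2 (b / 2); rewrite c2 => h; apply/eqP; lra.
exists n; apply/eqP; rewrite -subr_eq0 -/b; apply: contraT => bn0.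
have bp : 0 < b by rewrite lt_def bn0.
have := @sin_gt0_pi _ (b / 2); rewrite s2 ltxx; apply.
rewrite divr_gt0 //= ltr_pdivrMr // mulr_natr //.
Qed.

Lemma polar_uniq z a b : polar z a -> polar z b -> exists n : int, a = b + pi *+ 2 *~ n.
Proof.
move=> pa pb; have [r r0] := polarM pa (polar_conj pb).
rewrite reCM imCM reC_conj imC_conj => -[c s].
have h := polar_neq0 pa.
have s0 : sin (a - b) = 0.
  by apply/eqP; move: s => /esym/eqP; rewrite [X in _ == X](_ : _ = 0); [rewrite mulf_eq0 gt_eqF|ring].
have c0 : 0 < cos (a - b).
  by rewrite -(pmulr_rgt0 _ r0) -c; move: h; congr (0 < _); ring.
have [n E] : exists n : int, a - b = pi *+ 2 *~ n.
  apply: cos_eq1; have := cos2Dsin2 (a - b); rewrite s0 expr0n addr0 => /eqP.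
  rewrite -[X in _ == X](expr1n _ 2) eqrXn2 ?ler01 ?(ltW c0) // => /eqP //.
by exists n; rewrite -E addrC subrK.
Qed.

End PolarAngle.

(** * Lifting and differentiating arguments along simplices *)

Section AngleLifts.
Variable R : realType.
Local Notation C := (CC R).

Lemma atan_mul_conj (z w : C) a : polar w a -> 0 < reC (z * w^*) ->
  polar z (a + atan (imC (z * w^*) / reC (z * w^*))).
Proof. by move=> pw zw; apply: polar_step pw _; exact: polar_atan. Qed.

Lemma mul_conj_gt0 (z : C) : z != 0 -> 0 < reC (z * z^*).
Proof.
move=> /polar_exists [a /polar_neq0]; rewrite reCM reC_conj imC_conj; congr (0 < _); ring.
Qed.

Lemma contC_reC (T : topologicalType) (f : T -> C) t : contC f t -> {for t, continuous (fun x => reC (f x))}.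
Proof. by case. Qed.

Lemma contC_conj (T : topologicalType) (f : T -> C) t : contC f t -> contC (fun x => (f x)^*) t.
Proof.
move=> [c1 c2]; split; first by apply: cont_ext c1 => x; rewrite reC_conj.
apply: (@cont_ext _ _ (fun x => -1 * imC (f x))) => [x|]; first by rewrite imC_conj mulN1r.
by apply: contM c2; exact: cont_cst.
Qed.

Lemma cont_atan_ratio (T : topologicalType) (z : T -> C) t : contC z t -> reC (z t) != 0 ->
  {for t, continuous (fun x => atan (imC (z x) / reC (z x)))}.
Proof.
move=> [c1 c2] z0; apply: (@cont_cmp _ _ _ (fun x => imC (z x) / reC (z x)) (@atan R)).
  by apply: contM => //; exact: contV.
exact: continuous_atan.
Qed.

Lemma unit_cube_compact k : compact [set t : 'rV[R]_k | forall i, `[0, 1]%classic (t 0 i)].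
Proof. by apply: (@rV_compact R k (fun=> `[0, 1]%classic)) => i; exact: segment_compact. Qed.

Lemma cont_scale_row (T : topologicalType) k (a : T -> R) (u : T -> 'rV[R]_k) t :
  {for t, continuous a} -> {for t, continuous u} -> {for t, continuous (fun x => a x *: u x)}.
Proof.
move=> ca cu; apply: cont_row => j; apply: (@cont_ext _ _ (fun x => a x * u x 0 j)).
  by move=> x; rewrite mxE.
by apply: contM => //; apply: (@cont_cmp _ _ _ u (fun v : 'rV[R]_k => v 0 j)) => //; exact: cont_coord.
Qed.

Section Lift.
Variables (k : nat) (e : 'rV[R]_k -> C).
Hypothesis ce : forall t, contC e t.
Hypothesis e0 : forall t, e t != 0.

Let contC_line (T : topologicalType) (a : T -> R) (u : T -> 'rV[R]_k) t :
  {for t, continuous a} -> {for t, continuous u} -> contC (fun x => e (a x *: u x)) t.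
Proof. by move=> ca cu; exact: (contC_comp (cont_scale_row ca cu) (ce _)). Qed.

(** For step 0 the quantity is the squared modulus of [e], which is positive; positivity for small
    steps is uniform in [x] and [t] by compactness. *)
Lemma small_turns : exists N : nat, forall (x : R) (t : 'rV[R]_k), corner t -> 0 <= x <= 1 ->
  0 < reC (e ((x + N.+1%:R^-1) *: t) * (e (x *: t))^*).
Proof.
pose K : set (R * 'rV[R]_k) := `[0, 1] `*` [set t : 'rV[R]_k | forall i, `[0, 1]%classic (t 0 i)].
have cK : compact K by apply: compact_setX; [exact: segment_compact|exact: unit_cube_compact].
pose P (h : R) (y : R * 'rV[R]_k) := 0 < reC (e ((y.1 + h) *: y.2) * (e (y.1 *: y.2))^*).
have /compact_near_coveringP/(_ R (nbhs (0 : R)) P) := cK.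
case.
  move=> [x t] _ /=.
  pose g (y : (R * 'rV[R]_k) * R) := reC (e ((y.1.1 + y.2) *: y.1.2) * (e (y.1.1 *: y.1.2))^*).
  have c11 (y : (R * 'rV[R]_k) * R) : {for y, continuous (fun y : (R * 'rV[R]_k) * R => y.1.1)}.
    by apply: (@cont_cmp _ _ _ fst fst); exact: cont_fst.
  have c12 (y : (R * 'rV[R]_k) * R) : {for y, continuous (fun y : (R * 'rV[R]_k) * R => y.1.2)}.
    by apply: (@cont_cmp _ _ _ fst snd); [exact: cont_fst|exact: cont_snd].
  have cg y : {for y, continuous g}.
    apply: contC_reC; apply: contC_mul.
      by apply: contC_line; [apply: contD; [exact: c11|exact: cont_snd]|exact: c12].
    by apply: contC_conj; apply: contC_line; [exact: c11|exact: c12].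
  have g0 : 0 < g (x, t, 0) by rewrite /g /= addr0 mul_conj_gt0.
  have /= := cg (x, t, 0) _ (open_nbhs_nbhs (conj (@open_gt R 0) g0)).
  by move=> h; exact: h.
move=> d /= d0 Hd.
have [N HN] : exists N : nat, (N.+1%:R^-1 : R) < d.
  by have [m _ hm] := near_infty_natSinv_lt (PosNum d0); exists m; exact: (hm m (leqnn m)).
exists N => x t ct x01.
have nd : ball_ [eta Num.Def.normr] (0 : R) d N.+1%:R^-1 by rewrite /ball_ /= sub0r normrN ger0_norm ?invr_ge0.
apply: (Hd _ nd (x, t)); split; rewrite /= ?in_itv //= => i; rewrite in_itv /=; case: ct => c0 c1.
by rewrite c0 /=; apply: le_trans c1; rewrite (bigD1 i) //= lerDl sumr_ge0.
Qed.

(* Subdivide the segment from 0 to [t] so finely that [e] turns by less than a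
   quarter of a circle on each piece, and add up the turning angles. *)
Lemma angle_exists : exists phi : 'rV[R]_k -> R, continuous phi /\
  forall t, corner t -> polar (e t) (phi t).
Proof.
have [N HN] := small_turns; have [a0 p0] := polar_exists (e0 0).
pose z j t := e ((j.+1%:R / N.+1%:R) *: t) * (e ((j%:R / N.+1%:R) *: t))^*.
pose phi m t := a0 + \sum_(j < m) atan (imC (z j t) / reC (z j t)).
have zp j t : (j <= N)%N -> corner t -> 0 < reC (z j t).
  move=> jN ct; have := HN (j%:R / N.+1%:R) t ct; rewrite /z.
  have -> : j.+1%:R / N.+1%:R = j%:R / N.+1%:R + N.+1%:R^-1 :> R by rewrite -[j.+1%:R]natr1 mulrDl mul1r.
  apply.
  by rewrite divr_ge0 //= ler_pdivrMr // mul1r ler_nat ltnW.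
have cz j t : contC (z j) t.
  apply: contC_mul; first by apply: contC_line; [exact: cont_cst|exact: cont_id].
  by apply: contC_conj; apply: contC_line; [exact: cont_cst|exact: cont_id].
have ph m t : (m <= N.+1)%N -> corner t -> polar (e ((m%:R / N.+1%:R) *: t)) (phi m t).
  elim: m => [|m IH] mN ct; first by rewrite /phi big_ord0 addr0 mul0r scale0r.
  rewrite /phi big_ord_recr /= addrA; apply: atan_mul_conj; first exact: IH (ltnW mN) ct.
  exact: zp.
exists (fun t => phi N.+1 (corner_retr t)); split.
  apply: cornerC_retr => t ct; apply: contD; first exact: cont_cst.
  apply: cont_sum => j; apply: cont_atan_ratio; first exact: cz.
  by rewrite gt_eqF //; apply: zp => //; rewrite -ltnS.
move=> t ct; rewrite corner_retr_id //.
by have := ph N.+1 t (leqnn _) ct; rewrite divff ?pnatr_eq0 // scale1r.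
Qed.

End Lift.

Lemma corner_segment k (t : 'rV[R]_k) x : corner t -> 0 <= x <= 1 -> corner (x *: t).
Proof.
move=> [t0 t1] /andP[x0 x1]; split=> [i|]; first by rewrite mxE mulr_ge0.
under eq_bigr do rewrite mxE.
by rewrite -mulr_sumr mulr_ile1 // sumr_ge0.
Qed.

(** Along the segment from 0 to [t], the function [d / (2 pi)] is continuous with integral values;
    if its ends differed, it would take a value halfway between two consecutive integers. *)
Lemma discrete_const k (d : 'rV[R]_k -> R) : continuous d ->
  (forall t, corner t -> exists n : int, d t = pi *+ 2 *~ n) ->
  exists n : int, forall t, corner t -> d t = pi *+ 2 *~ n.
Proof.
move=> cd dn; have c0 : corner (0 : 'rV[R]_k).
  by split=> [i|]; rewrite ?mxE // big1 // => i _; rewrite mxE.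
have [n0 E0] := dn 0 c0; exists n0 => t ct; have [n E] := dn t ct.
rewrite E; case: (eqVneq n n0) => [-> //|nn]; exfalso.
have pz : pi *+ 2 != 0 :> R by rewrite gt_eqF // mulrn_wgt0 // pi_gt0.
have dv (m : int) : pi *+ 2 *~ m / (pi *+ 2) = m%:~R :> R by rewrite -mulrzl mulfK.
pose f (x : R) := d (x *: t) / (pi *+ 2).
have cf : continuous f.
  move=> x; apply: (@contM _ _ (fun x : R => d (x *: t)) (fun=> (pi *+ 2)^-1)); last exact: cont_cst.
  apply: (@cont_cmp _ _ _ (fun x : R => x *: t) d); last exact: cd.
  by apply: cont_scale_row; [exact: cont_id|exact: cont_cst].
have f0 : f 0 = n0%:~R by rewrite /f scale0r E0 dv.
have f1 : f 1 = n%:~R by rewrite /f scale1r E dv.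
pose s : int := if n0 < n then 1 else -1.
have [|x x01] := @IVT R f 0 1 (n0%:~R + s%:~R / 2) ler01 (continuous_subspaceT cf).
  rewrite f0 f1 ge_min le_max /s; move: nn; rewrite neq_lt => /orP[nn|nn].
    have : n%:~R + 1 <= n0%:~R :> R by rewrite -[1]/(1%:~R) -intrD ler_int; lia.
    rewrite ltNge (ltW nn) /= => h; apply/andP; split; apply/orP; [right|left]; lra.
  have : n0%:~R + 1 <= n%:~R :> R by rewrite -[1]/(1%:~R) -intrD ler_int; lia.
  rewrite nn => h; apply/andP; split; apply/orP; [left|right]; lra.
rewrite /f; have [m ->] := dn (x *: t) (corner_segment ct x01); rewrite dv => h.
have : (m * 2)%:~R = (n0 * 2 + s)%:~R :> R.
  by rewrite intrD !intrM h (_ : (2 : int)%:~R = 2 :> R) //; field.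
by move/intr_inj; rewrite /s; case: ifP; lia.
Qed.

Section Derivative.
Variable k : nat.
Implicit Types (U : set 'rV[R]_k) (e : 'rV[R]_k -> C).

(** Both sides are arguments of [e y], so they differ by a multiple of [2 pi]; near [x] continuity
    keeps the difference below [pi], hence it is 0. *)
Lemma polar_near e U x phi : open U -> U x -> contC e x -> {for x, continuous phi} ->
  (forall y, U y -> polar (e y) (phi y)) ->
  \forall y \near x, phi y = phi x + atan (imC (e y * (e x)^*) / reC (e y * (e x)^*)).
Proof.
move=> oU Ux ce cp pe; have px := pe x Ux.
have ex0 : 0 < reC (e x * (e x)^*).
  by apply: mul_conj_gt0; apply/eqP => e0; have := polar_neq0 px; rewrite e0 !expr0n /= addr0 ltxx.
have cz : contC (fun y => e y * (e x)^*) x by apply: contC_mul => //; exact: contC_cst.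
pose psi y := atan (imC (e y * (e x)^*) / reC (e y * (e x)^*)).
have cpsi : {for x, continuous psi} by apply: cont_atan_ratio => //; rewrite gt_eqF.
have psi0 : psi x = 0.
  by rewrite /psi (_ : imC _ = 0) ?mul0r ?atan0 // imCM reC_conj imC_conj; ring.
have p0 : (0 : R) < pi by exact: pi_gt0.
have n1 : \forall y \near x, 0 < reC (e y * (e x)^*).
  by case: cz => c1 _; exact: (c1 _ (open_nbhs_nbhs (conj (@open_gt R 0) ex0))).
have cd : {for x, continuous (fun y => phi y - phi x + (-1) * psi y)}.
  apply: contD; first by apply: contD => //; exact: cont_cst.
  by apply: contM => //; exact: cont_cst.
have n2 : \forall y \near x, `|phi y - phi x + (-1) * psi y| < pi.
  have cx : phi x - phi x + -1 * psi x = 0 by rewrite psi0 mulr0 addr0 subrr.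
  have h1 : \forall y \near x, phi y - phi x + (-1) * psi y < pi.
    by apply: (cd _ (open_nbhs_nbhs (conj (@open_lt R pi) _))); rewrite /= cx.
  have h2 : \forall y \near x, - pi < phi y - phi x + (-1) * psi y.
    by apply: (cd _ (open_nbhs_nbhs (conj (@open_gt R (- pi)) _))); rewrite /= cx oppr_lt0.
  by apply: filterS2 h1 h2 => y a b; rewrite ltr_norml b.
apply: filterS2 n2 (filterI n1 (open_nbhs_nbhs (conj oU Ux))) => y h [ey Uy].
have [n E] := polar_uniq (pe y Uy) (atan_mul_conj px ey).
move: h; rewrite E -/(psi y) => h; case: (eqVneq n 0) => [-> //|n0]; first by rewrite mulr0z addr0.
exfalso; move: h; rewrite (_ : _ + _ = pi *+ 2 *~ n); last by ring.
rewrite -mulrzl mulr2n ltr_norml => /andP[h1 h2].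
have [n1'|n1'] : (1 : R) <= n%:~R \/ n%:~R <= (-1 : R).
  rewrite -[1]/(1%:~R) -rmorphN /= !ler_int; lia.
- by have := ler_wpM2r (ltW p0) n1'; lra.
- by have := ler_wpM2r (ltW p0) n1'; lra.
Qed.

(** The formula is [Im (de / e)]. Locally the angle is a constant plus the arctangent of a quotient
    that vanishes at [x], so a merely continuous choice of the argument is differentiable. *)
Lemma is_derive_angle e U x v phi d : open U -> U x -> contC e x -> {for x, continuous phi} ->
  (forall y, U y -> polar (e y) (phi y)) -> is_dC v e x d ->
  is_derive x v phi (imC ((e x)^* * d) / reC (e x * (e x)^*)).
Proof.
move=> oU Ux ce cp pe de.
have px := pe x Ux.
have ex0 : 0 < reC (e x * (e x)^*).
  by apply: mul_conj_gt0; apply/eqP => e0; have := polar_neq0 px; rewrite e0 !expr0n /= addr0 ltxx.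
have [V nV HV] : exists2 V, open_nbhs x V & forall y, V y -> phi y = phi x + atan (imC (e y * (e x)^*) / reC (e y * (e x)^*)).
  have : nbhs x (fun y => phi y = phi x + atan (imC (e y * (e x)^*) / reC (e y * (e x)^*))) := polar_near oU Ux ce cp pe.
  by rewrite nbhsE => -[V nV VH]; exists V.
case: nV => oV Vx; apply: (is_derive_open oV Vx HV).
have [d1 d2] : is_dC v (fun y => e y * (e x)^*) x (d * (e x)^*).
  by apply: (is_dC_eq (is_dC_mul de (is_dC_cst _ _ _))); rewrite mulr0 ?add0r ?addr0 // mulrC.
have dv := is_derive_inv (f := fun y => reC (e y * (e x)^*)) (lt0r_neq0 ex0) d1.
have dq := is_deriveM d2 dv.
have im0 : imC (e x * (e x)^*) = 0 by rewrite imCM reC_conj imC_conj; ring.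
have dat : is_derive (imC (e x * (e x)^*) / reC (e x * (e x)^*)) (1 : R) (@atan R) 1.
  by rewrite im0 mul0r; apply: (is_derive_eq (is_derive1_atan 0)); rewrite expr0n /= addr0 invr1.
have := is_derive_comp1 dat dq => da.
apply: (is_derive_eq (is_deriveD (is_derive_cst (phi x) x v) da)).
by rewrite add0r mul1r im0 scale0r add0r /GRing.scale /= mulrC (mulrC d).
Qed.

End Derivative.

End AngleLifts.

Section GaussIntegers.
Variable R : realType.
Local Notation C := (CC R).

Definition gauss (z : C) : Prop := exists m n : int, z = mkC m%:~R n%:~R.

Lemma gauss1 : gauss 1. Proof. by exists 1, 0. Qed.

Lemma gaussB z w : gauss z -> gauss w -> gauss (z - w).
Proof.
move=> [a [b ->]] [c [d ->]]; exists (a - c), (b - d).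
by apply: complex_ext; rewrite ?reCB ?imCB /= intrB.
Qed.

Lemma gaussM z w : gauss z -> gauss w -> gauss (z * w).
Proof.
move=> [a [b ->]] [c [d ->]]; exists (a * c - b * d), (a * d + b * c).
by apply: complex_ext; rewrite ?reCM ?imCM /= ?intrB ?intrD !intrM.
Qed.

Lemma gauss_prod (I : finType) (f : I -> C) : (forall i, gauss (f i)) -> gauss (\prod_i f i).
Proof. by move=> gf; elim/big_rec: _ => [|i x _ gx]; [exact: gauss1|exact: gaussM]. Qed.

Lemma reC_intr (n : int) : reC (n%:~R : C) = n%:~R /\ imC (n%:~R : C) = 0.
Proof.
have H (m : nat) : reC (m%:R : C) = m%:R /\ imC (m%:R : C) = 0.
  by elim: m => [//|m [IH1 IH2]]; rewrite -natr1 reCD imCD IH1 IH2 /= addr0 natr1.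
case: n => m; first exact: H.
by rewrite NegzE !rmorphN /= reCN imCN; have [-> ->] := H m.+1; rewrite oppr0.
Qed.

Lemma ratr_floor (x : R) (n : int) : x = n%:~R ->
  ratr ((Num.floor x)%:~R : rat) = mkC x 0 :> C.
Proof.
by move=> ->; rewrite ratr_int intrKfloor; have [e1 e2] := reC_intr n; exact: complex_ext.
Qed.

End GaussIntegers.

(** * Lifts of the elliptic coordinate and integrality of their periods *)

Section Lifts.
Variables (R : realType) (T : topologicalType).
Local Notation C := (CC R).
Local Notation sing := (singular_simplex R T).
Local Notation ee i := (delta_mx 0 i).

Variables (e : nat -> bool -> T -> C) (cj : nat -> bool).
Hypothesis e_cont : forall n b x, contC (e n b) x.
Hypothesis e_neq0 : forall n b x, e n b x != 0.

Definition angle_spec n b k (s : sing k) (phi : 'rV[R]_k -> R) : Prop :=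
  continuous phi /\ forall t, corner t -> polar (e n b (spoint s t)) (phi t).

Definition angle n b k (s : sing k) : 'rV[R]_k -> R := xget (fun=> 0) (angle_spec n b s).

Lemma angleP n b k (s : sing k) : angle_spec n b s (angle n b s).
Proof.
apply: xgetPex; apply: angle_exists => t; last exact: e_neq0.
exact: (contC_comp (@spoint_cont _ _ _ s t) (e_cont n b _)).
Qed.

Lemma angle_uniq n b k (s : sing k) phi : angle_spec n b s phi ->
  exists m : int, forall t, corner t -> phi t = angle n b s t + pi *+ 2 *~ m.
Proof.
move=> [cp pp]; have [ca pa] := angleP n b s.
have [|t ct|m Hm] := @discrete_const R k (fun t => phi t + (-1) * angle n b s t).
- move=> t; apply: (@contD _ _ phi (fun t => -1 * angle n b s t)); first exact: cp.
  by apply: contM; [exact: cont_cst|exact: ca].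
- have [m E] := polar_uniq (pp t ct) (pa t ct); exists m; rewrite E; ring.
- by exists m => t ct; rewrite -(Hm t ct); ring.
Qed.

(** The angles of [e n false] and [e n true] give the real and the imaginary part of the [n]-th
    coordinate; [cj n] selects its complex conjugate. *)
Definition zlift n k (s : sing k) (t : 'rV[R]_k) : C :=
  mkC (ell (angle n false s t)) ((-1) ^+ cj n * ell (angle n true s t)).

Definition arg (z : C) : R := xget 0 (polar z).

Lemma argP z : z != 0 -> polar z (arg z).
Proof. by move=> z0; apply: xgetPex; exact: polar_exists. Qed.

(** The arguments are chosen point by point, without continuity. Lift and branch are elliptic
    integrals of arguments of the same numbers, so their difference at a vertex is a Gaussian
    integer. *)
Definition zbranch n (x : T) : C :=
  mkC (ell (arg (e n false x))) ((-1) ^+ cj n * ell (arg (e n true x))).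

Lemma angle_spec_face n b k (i : 'I_k.+2) (s : sing k.+1) :
  angle_spec n b (sing_face i s) (fun u => angle n b s (fcoord i u)).
Proof.
have [ca pa] := angleP n b s; split.
  by move=> u; apply: (@cont_cmp _ _ _ (fcoord i) (angle n b s)); [exact: fcoord_cont|exact: ca].
by move=> u cu; rewrite spoint_face //; apply: pa; exact: fcoord_corner.
Qed.

Lemma zlift_face n k (i : 'I_k.+2) (s : sing k.+1) : exists c : C,
  forall u, corner u -> zlift n s (fcoord i u) = zlift n (sing_face i s) u + c.
Proof.
have [m0 H0] := angle_uniq (angle_spec_face n false i s).
have [m1 H1] := angle_uniq (angle_spec_face n true i s).
exists (mkC m0%:~R ((-1) ^+ cj n * m1%:~R)) => u cu.
by apply: complex_ext; rewrite ?reCD ?imCD /= ?H0 ?H1 // ellD2pin ?mulrDr.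
Qed.

Lemma period_gauss n k (s : sing k) i : (i <= k)%N -> gauss (period zlift zbranch n s i).
Proof.
move=> ik; have cv := @vtx_corner R k i ik.
have H b : exists m : int, ell (angle n b s (vtx R k i)) = ell (arg (e n b (spoint s (vtx R k i)))) + m%:~R.
  have [_ pa] := angleP n b s.
  have [m E] := polar_uniq (pa _ cv) (argP (e_neq0 n b _)).
  by exists m; rewrite E ellD2pin.
have [m0 E0] := H false; have [m1 E1] := H true.
exists m0, ((-1) ^+ cj n * m1); apply: complex_ext; rewrite ?reCB ?imCB /= ?E0 ?E1; first by ring.
rewrite intrM rmorphXn /= rmorphN1; ring.
Qed.

Lemma cup_gauss k (s : sing k) : gauss (cup zlift zbranch s).
Proof.
apply: gauss_prod => j; apply: gaussB; apply: period_gauss => //; exact: ltnW.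
Qed.

Lemma open_pos k (U : set 'rV[R]_k) (g : 'rV[R]_k -> R) : open U ->
  (forall x, U x -> {for x, continuous g}) -> open (U `&` [set x | 0 < g x]).
Proof.
move=> oU cg; rewrite openE => x [Ux gx]; apply: filterI.
  exact: open_nbhs_nbhs.
exact: (cg x Ux _ (open_nbhs_nbhs (conj (@open_gt R 0) gx))).
Qed.

(** [angle] is tied to points of the simplex, whereas a function on a neighbourhood is wanted. The
    angle at the retracted point is corrected by the arctangent that measures the turn of [E] from
    there; being a continuous argument of a function of class C^2, the result is of class C^2. *)
Lemma angle_smooth n b k (s : sing k) U (E : 'rV[R]_k -> C) : open U ->
  (forall t, corner t -> U t) -> CkC U 2 E ->
  (forall t, corner t -> exists2 r, 0 < r & E t = mkC r 0 * e n b (spoint s t)) ->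
  exists V phi, [/\ open V, (forall t, corner t -> V t), V `<=` U, Ck_on V 2 phi &
    (forall t, V t -> polar (E t) (phi t)) /\ forall t, corner t -> phi t = angle n b s t].
Proof.
move=> oU cU cE HE; have [ca pa] := angleP n b s.
have pE t : corner t -> polar (E t) (angle n b s t).
  by move=> ct; have [r r0 ->] := HE t ct; apply: polar_scale => //; exact: pa.
have cEr t : contC (fun t => E (corner_retr t)) t.
  apply: (contC_comp (@corner_retr_cont _ _ t)).
  by apply: (CkC_contC cE); apply: cU; exact: corner_retr_in.
pose z t := E t * (E (corner_retr t))^*.
have cz t : U t -> contC z t.
  by move=> Ut; apply: contC_mul; [exact: CkC_contC cE Ut|exact: contC_conj].
pose V := U `&` [set t | 0 < reC (z t)].
have oV : open V by apply: open_pos => // t /cz [].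
pose phi t := angle n b s (corner_retr t) + atan (imC (z t) / reC (z t)).
have pV t : V t -> polar (E t) (phi t).
  by move=> [Ut zt]; apply: atan_mul_conj => //; apply: pE; exact: corner_retr_in.
have cphi t : V t -> {for t, continuous phi}.
  move=> [Ut zt]; apply: contD.
    by apply: (@cont_cmp _ _ _ (@corner_retr R k) (angle n b s)); [exact: corner_retr_cont|exact: ca].
  by apply: cont_atan_ratio; [exact: cz|rewrite gt_eqF].
have n0 t : V t -> E t != 0.
  by move=> [_]; rewrite /= /z; apply: contraTneq => ->; rewrite mul0r ltxx.
have n1 t : V t -> reC (E t * (E t)^*) != 0 by move=> /n0 /mul_conj_gt0; exact: lt0r_neq0.
have cEV : CkC V 2 E by case: cE => e1 e2; split; [move: e1|move: e2]; apply: Ck_on_sub_set => x [].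
exists V, phi; split; [exact: oV| |by move=> x []| |].
- move=> t ct; split; first exact: cU.
  by rewrite /= /z corner_retr_id //; apply: mul_conj_gt0; have [r r0 ->] := HE t ct; rewrite mulf_neq0 // eq_complex /= eqxx andbT gt_eqF.
- apply: (@Ck_on_S _ _ _ _ _ (fun i t => imC ((E t)^* * dC (ee i) E t) / reC (E t * (E t)^*))) => //.
    move=> i t Vt; apply: (is_derive_angle oV Vt) => //; [exact: CkC_contC cEV Vt|exact: cphi|].
    by apply: (CkC_is_dC (r := 1)) Vt.
  move=> i; have [d1 d2] := CkC_D i cEV; have [c1 c2] := CkC_le (leqnSn 1) cEV.
  have nz t : V t -> reC (E t) * reC (E t) + imC (E t) * imC (E t) != 0.
    by move=> Vt; have := n1 t Vt; rewrite reCM reC_conj imC_conj; congr (_ != _); ring.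
  have cn := Ck_on_mul oV (Ck_on_sub oV (Ck_on_mul oV c1 d2) (Ck_on_mul oV c2 d1))
    (Ck_on_inv oV nz (Ck_on_add oV (Ck_on_mul oV c1 c1) (Ck_on_mul oV c2 c2))).
  apply: (Ck_on_ext oV _ cn) => t _.
  by rewrite imCM reCM reC_conj imC_conj; congr (_ / _); ring.
- split => // t ct; rewrite /phi corner_retr_id // (_ : imC (z t) = 0) ?mul0r ?atan0 ?addr0 //.
  by rewrite /z corner_retr_id // imCM reC_conj imC_conj; ring.
Qed.

(** The normalised integrand at an argument of [z], written without the argument by means of
    [sin^2 = (Im z)^2 / |z|^2]. *)
Definition ell_speed (z : C) : R :=
  (Num.sqrt (1 + imC z ^+ 2 / reC (z * z^*)))^-1 / ell_period R.

Lemma ell_integrand_polar z a : polar z a -> ell_integrand a / ell_period R = ell_speed z.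
Proof.
move=> [r r0 [h1 h2]]; rewrite /ell_speed /ell_integrand; congr ((Num.sqrt (1 + _))^-1 / _).
rewrite reCM reC_conj imC_conj h1 h2.
have -> : r * cos a * (r * cos a) - r * sin a * - (r * sin a) = r ^+ 2 * (cos a ^+ 2 + sin a ^+ 2) by ring.
rewrite cos2Dsin2 mulr1 exprMn mulrAC divff ?mul1r // expf_eq0 /= gt_eqF //.
Qed.

(** The derivative of [ell] of the argument of [z] when [z] moves with velocity [d]. *)
Definition zslope (z d : C) : R := ell_speed z * (imC (z^* * d) / reC (z * z^*)).

Lemma zlift_rep n k (s : sing k) U (E : bool -> 'rV[R]_k -> C) : open U ->
  (forall t, corner t -> U t) -> (forall b, CkC U 2 (E b)) ->
  (forall b t, corner t -> exists2 r, 0 < r & E b t = mkC r 0 * e n b (spoint s t)) ->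
  exists h, rep zlift n s h /\ forall i t, corner t -> dC (ee i) h t =
    mkC (zslope (E false t) (dC (ee i) (E false) t))
        ((-1) ^+ cj n * zslope (E true t) (dC (ee i) (E true) t)).
Proof.
move=> oU cU cE HE.
have [V0 [f0 [oV0 cV0 sV0 c0 [p0 a0]]]] := angle_smooth oU cU (cE false) (HE false).
have [V1 [f1 [oV1 cV1 sV1 c1 [p1 a1]]]] := angle_smooth oU cU (cE true) (HE true).
pose V := V0 `&` V1; have oV : open V by exact: openI.
have {}c0 : Ck_on V 2 f0 by apply: Ck_on_sub_set c0 => x [].
have {}c1 : Ck_on V 2 f1 by apply: Ck_on_sub_set c1 => x [].
have cV t : corner t -> V t by move=> ct; split; [exact: cV0|exact: cV1].
exists (fun t => mkC (ell (f0 t)) ((-1) ^+ cj n * ell (f1 t))); split.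
  exists V; split; [exact: oV|exact: cV| |].
    split; first exact: Ck_on_ell.
    exact: (Ck_on_mul oV (Ck_on_cst 2 _ oV) (Ck_on_ell oV c1)).
  by exists 0 => t ct; rewrite addr0 /zlift a0 ?a1.
have dE b i t W phi : W `<=` V -> open W -> W t -> Ck_on V 2 phi -> (forall t, W t -> polar (E b t) (phi t)) ->
    is_derive t (ee i) (fun t => ell (phi t)) (zslope (E b t) (dC (ee i) (E b) t)).
  move=> WV oW Wt cphi pW; have Ut : U t by apply: sV0; case: (WV t Wt).
  rewrite /zslope -(ell_integrand_polar (pW t Wt)).
  apply: is_derive_comp1; first exact: is_derive_ell.
  apply: (is_derive_angle oW Wt) => //.
  - exact: CkC_contC (cE b) Ut.
  - by apply: (Ck_on_cont cphi); exact: WV.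
  - exact: (CkC_is_dC (r := 1) _ (cE b) Ut).
move=> i t /cV Vt.
have d0 : is_derive t (ee i) (fun t => ell (f0 t)) (zslope (E false t) (dC (ee i) (E false) t)).
  by apply: (dE false i t V) => // x [x0 _]; exact: p0.
have d1 : is_derive t (ee i) (fun t => ell (f1 t)) (zslope (E true t) (dC (ee i) (E true) t)).
  by apply: (dE true i t V) => // x [_ x1]; exact: p1.
apply: is_dC_val; split; first exact: d0.
have := is_deriveM (is_derive_cst ((-1) ^+ cj n : R) t (ee i)) d1.
by move=> d; apply: (is_derive_eq d); rewrite scaler0 addr0.
Qed.

End Lifts.

(** * An elliptic curve with complex multiplication *)

Section EllipticIdentities.
Variable F : comPzRingType.
Variables W S C D w s c d : F.
Hypotheses (hC : C * C - (W * W - S * S) = 0) (hD : D * D - (W * W + S * S) = 0).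
Hypotheses (hc : c * c - (w * w - s * s) = 0) (hd : d * d - (w * w + s * s) = 0).

(** With [W, S, C, D] the coordinates at [z] and [w, s, c, d] those at [z'], the quotients of [kap],
    [sig], [tau] by [Del] are cn, sn, dn of [z + z'], by Jacobi's addition formulas with [k^2 = -1].
    The identities below thus say that [cn^2 + sn^2 = 1], that [dn^2 = 1 + sn^2], and that the
    amplitude has derivative dn. *)
Let kap := C * c * W * w - S * s * D * d.
Let sig := S * W * c * d + s * w * C * D.
Let Del := W * W * w * w + S * S * s * s.
Let tau := D * d * W * w + S * s * C * c.

(* The cofactors in these three proofs come from a division by the four
   relations. *)
Lemma elliptic_norm : kap * kap + sig * sig = Del * Del.
Proof.
rewrite /kap /sig /Del; apply/eqP; rewrite -subr_eq0; apply/eqP.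
transitivity ((W * W * w * w * c * c + D * D * w * w * s * s) * (C * C - (W * W - S * S)) + (S * S * s * s * d * d + W * W * w * w * s * s - S * S * w * w * s * s) * (D * D - (W * W + S * S)) + (W * W * S * S * d * d + W * W * W * W * w * w - W * W * S * S * w * w) * (c * c - (w * w - s * s)) + (S * S * S * S * s * s + W * W * S * S * w * w) * (d * d - (w * w + s * s))); first by ring.
by rewrite hC hD hc hd !mulr0 !addr0.
Qed.

Lemma elliptic_speed : Del * Del + sig * sig = tau * tau.
Proof.
rewrite /tau /sig /Del; apply/eqP; rewrite -subr_eq0; apply/eqP.
transitivity ((D * D * w * w * s * s - S * S * s * s * c * c) * (C * C - (W * W - S * S)) + (- W * W * w * w * d * d + W * W * w * w * s * s - S * S * w * w * s * s) * (D * D - (W * W + S * S)) + (W * W * S * S * d * d - W * W * S * S * s * s + S * S * S * S * s * s) * (c * c - (w * w - s * s)) + (- W * W * S * S * s * s - W * W * W * W * w * w) * (d * d - (w * w + s * s))); first by ring.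
by rewrite hC hD hc hd !mulr0 !addr0.
Qed.

Lemma elliptic_slope :
  kap * - (S * c * d * C * D + s * w * (D * W * D + C * C * W)) +
  sig * (D * W * c * W * w + C * c * w * C * D - S * s * d * C * W) = S * (tau * Del).
Proof.
rewrite /kap /tau /sig /Del; apply/eqP; rewrite -subr_eq0; apply/eqP.
transitivity ((- W * W * C * w * w * s * c + C * D * D * w * w * s * c) * (C * C - (W * W - S * S)) + (S * S * C * s * c * d * d + W * S * D * w * s * s * d + W * W * C * w * w * s * c - S * S * C * w * w * s * c) * (D * D - (W * W + S * S)) + (W * W * W * S * D * w * d) * (c * c - (w * w - s * s)) + (S * S * S * S * C * s * c) * (d * d - (w * w + s * s))); first by ring.
by rewrite hC hD hc hd !mulr0 !addr0.
Qed.

End EllipticIdentities.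

Section EllipticCurve.
Variable R : realType.
Local Notation C := (CC R).

Definition qW : 'I_4 := @Ordinal 4 0 isT.
Definition qS : 'I_4 := @Ordinal 4 1 isT.
Definition qC : 'I_4 := @Ordinal 4 2 isT.
Definition qD : 'I_4 := @Ordinal 4 3 isT.

Lemma forall_I4 (P : 'I_4 -> Prop) : P qW -> P qS -> P qC -> P qD -> forall i, P i.
Proof.
move=> pW pS pC pD [[|[|[|[|//]]]] i].
- by rewrite (_ : Ordinal i = qW) //; apply: val_inj.
- by rewrite (_ : Ordinal i = qS) //; apply: val_inj.
- by rewrite (_ : Ordinal i = qC) //; apply: val_inj.
- by rewrite (_ : Ordinal i = qD) //; apply: val_inj.
Qed.

Implicit Types x u : 'I_4 -> C.

(* The cone over the elliptic curve with coordinates (W : S : C : D) =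
   (1 : sn : cn : dn) for the modulus k^2 = -1, on which Z[i] acts. *)
Definition quadA x u : C := x qS * u qS + x qC * u qC - x qW * u qW.
Definition quadB x u : C := x qS * u qS + x qW * u qW - x qD * u qD.

Definition on_E x : Prop := quadA x x = 0 /\ quadB x x = 0.

(* The invariant differential is [eM a x dx / eN a x], for each [a] such that
   [eN a x] does not vanish. *)
Definition eN (a : 'I_3) x : C :=
  if a == 0 then x qC * x qD else if a == 1 then x qD * x qW else x qC * x qW.
Definition eM (a : 'I_3) x u : C :=
  let y := x (if a == 0 then qW else if a == 1 then qC else qD) in
  let v := u (if a == 0 then qW else if a == 1 then qC else qD) in y * u qS - x qS * v.

Lemma forall_I3 (P : 'I_3 -> Prop) : P 0 -> P 1 -> P (1 + 1) -> forall i, P i.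
Proof.
move=> p0 p1 p2 [[|[|[|//]]] i].
- by rewrite (_ : Ordinal i = 0) //; apply: val_inj.
- by rewrite (_ : Ordinal i = 1) //; apply: val_inj.
- by rewrite (_ : Ordinal i = 1 + 1) //; apply: val_inj.
Qed.

Section Point.
Variable x : 'I_4 -> C.
Hypotheses (Ex : on_E x) (x0 : exists i, x i != 0).

Lemma on_E_C : x qC * x qC = x qW * x qW - x qS * x qS.
Proof. by case: Ex => /eqP; rewrite /quadA subr_eq0 => /eqP <- _; ring. Qed.

Lemma on_E_D : x qD * x qD = x qW * x qW + x qS * x qS.
Proof. by case: Ex => _ /eqP; rewrite /quadB subr_eq0 => /eqP <-; ring. Qed.

Let zero : x qW = 0 -> x qS = 0 -> False.
Proof.
move=> W0 S0; have [j /negP[]] := x0; move: j; apply: forall_I4; rewrite ?W0 ?S0 //;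
  by rewrite -sqrf_eq0 expr2 ?on_E_C ?on_E_D W0 S0 !mul0r ?subr0 ?addr0.
Qed.

Lemma on_E_CD : x qC = 0 -> x qD = 0 -> False.
Proof.
move=> C0 D0; have := on_E_C; have := on_E_D; rewrite C0 D0 mul0r => h1 h2.
have two : (1 + 1 : C) != 0 by rewrite -mulr2n pnatr_eq0.
have W0 : (1 + 1) * (x qW * x qW) = 0 by rewrite -[RHS]addr0 {1}h1 h2; ring.
have S0 : (1 + 1) * (x qS * x qS) = 0 by rewrite -[RHS]subr0 {1}h1 h2; ring.
have {}W0 : x qW * x qW = 0 by apply: (mulfI two); rewrite W0 mulr0.
have {}S0 : x qS * x qS = 0 by apply: (mulfI two); rewrite S0 mulr0.
by apply: zero; apply/eqP; rewrite -sqrf_eq0 expr2 ?W0 ?S0.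
Qed.

Lemma on_E_CW : x qC = 0 -> x qW = 0 -> False.
Proof.
move=> C0 W0; have := on_E_C; rewrite C0 W0 !mul0r sub0r => /eqP.
by rewrite eq_sym oppr_eq0 mulf_eq0 orbb => /eqP; exact: zero.
Qed.

Lemma on_E_DW : x qD = 0 -> x qW = 0 -> False.
Proof.
move=> D0 W0; have := on_E_D; rewrite D0 W0 !mul0r add0r => /eqP.
by rewrite eq_sym mulf_eq0 orbb => /eqP; exact: zero.
Qed.

(** If all three products vanished, two of [C], [D], [W] would be 0, which the quadrics exclude. *)
Lemma eN_neq0 : exists a, eN a x != 0.
Proof.
case: (eqVneq (x qC) 0) => [C0|C0].
  exists 1; rewrite /eN /= mulf_neq0 //; apply/eqP; [exact: on_E_CD|exact: on_E_CW].
case: (eqVneq (x qD) 0) => [D0|D0]; last by exists 0; rewrite /eN /= mulf_neq0.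
by exists (1 + 1); rewrite /eN /= mulf_neq0 //; apply/eqP; exact: on_E_DW.
Qed.

Definition vec4 (a b c d : C) (i : 'I_4) : C := nth 0 [:: a; b; c; d] i.

(* The value at [x] of an invariant vector field. *)
Definition ttan : 'I_4 -> C :=
  if x qS == 0 then vec4 0 (x qC * x qD / x qW) 0 0
  else vec4 (- (x qC * x qD) / x qS) 0 (- (x qD * x qW) / x qS) (- (x qC * x qW) / x qS).

Lemma S_eq0 : x qS = 0 -> [/\ x qW != 0, x qC != 0 & x qD != 0].
Proof.
move=> S0; have W0 : x qW != 0 by apply/eqP => W0; exact: zero.
split=> //; apply/eqP => e.
  by have := on_E_C; rewrite e S0 !mul0r subr0 => /eqP; rewrite eq_sym mulf_eq0 orbb (negbTE W0).
by have := on_E_D; rewrite e S0 !mul0r addr0 => /eqP; rewrite eq_sym mulf_eq0 orbb (negbTE W0).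
Qed.

(** In each of its three expressions, the invariant differential takes the value 1 on [ttan]. *)
Lemma eM_ttan a : eM a x ttan = eN a x.
Proof.
rewrite /ttan; case: (eqVneq (x qS) 0) => S0; last first.
  by move: a; apply: forall_I3; rewrite /eM /eN /vec4 /=; field.
have [W0 C0 D0] := S_eq0 S0.
have hC : x qC * x qC = x qW * x qW by rewrite on_E_C S0 mul0r subr0.
have hD : x qD * x qD = x qW * x qW by rewrite on_E_D S0 mul0r addr0.
move: a; apply: forall_I3; rewrite /eM /eN /vec4 /= S0 mul0r subr0.
- by field.
- have -> : x qC * (x qC * x qD / x qW) = x qC * x qC * x qD / x qW by ring.
  by rewrite hC; field.
- have -> : x qD * (x qC * x qD / x qW) = x qD * x qD * x qC / x qW by ring.
  by rewrite hD; field.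
Qed.

(** The common kernel of the two differentials is spanned by the radial vector and [ttan], also
    where some coordinate vanishes, whence the cases. *)
Lemma tangent_param u : quadA x u = 0 -> quadB x u = 0 ->
  exists a th : C, forall i, u i = a * x i + th * ttan i.
Proof.
rewrite /quadA /quadB /ttan => /eqP; rewrite subr_eq0 => /eqP hA /eqP; rewrite subr_eq0 => /eqP hB.
case: (eqVneq (x qS) 0) => S0.
  have [W0 C0 D0] := S_eq0 S0; move: hA hB; rewrite S0 mul0r !add0r => hA hB.
  have hC : x qC * x qC = x qW * x qW by rewrite on_E_C S0 mul0r subr0.
  have hD : x qD * x qD = x qW * x qW by rewrite on_E_D S0 mul0r addr0.
  exists (u qW / x qW), (u qS * x qW / (x qC * x qD)); apply: forall_I4; rewrite /vec4 /= ?S0.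
  - by rewrite mulr0 addr0 divfK.
  - by field; rewrite ?S0 ?C0 ?D0 ?W0.
  - apply: (mulfI C0); rewrite hA mulr0 addr0 mulrCA hC; field; exact: W0.
  - apply: (mulfI D0); rewrite -hB mulr0 addr0 mulrCA hD; field; exact: W0.
(* Subtracting [a] times [x] removes the [S] coordinate; the two linear equations then fix the rest
   up to the factor [th]. *)
pose a := u qS / x qS.
pose w' := u qW - a * x qW; pose c' := u qC - a * x qC; pose d' := u qD - a * x qD.
have h1 : x qC * c' = x qW * w'.
  rewrite /c' /w' !mulrBr !(mulrCA _ a) on_E_C.
  have -> : x qC * u qC = x qW * u qW - x qS * u qS by rewrite -hA; ring.
  rewrite /a; field; exact: S0.
have h2 : x qD * d' = x qW * w'.
  rewrite /d' /w' !mulrBr !(mulrCA _ a) on_E_D -hB /a; field; exact: S0.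
suff [th [e1 e2 e3]] : exists th, [/\ w' = - (th * (x qC * x qD)) / x qS,
    c' = - (th * (x qD * x qW)) / x qS & d' = - (th * (x qC * x qW)) / x qS].
  exists a, th; apply: forall_I4; rewrite /vec4 /=.
  - by rewrite -[u qW](subrK (a * x qW)) -/w' e1; field.
  - by rewrite /a; field.
  - by rewrite -[u qC](subrK (a * x qC)) -/c' e2; field.
  - by rewrite -[u qD](subrK (a * x qD)) -/d' e3; field.
case: (eqVneq (x qC) 0) => [C0|C0].
  have D0 : x qD != 0 by apply/eqP; exact: on_E_CD.
  have W0 : x qW != 0 by apply/eqP; exact: on_E_CW.
  have w0 : w' = 0 by apply: (mulfI W0); rewrite -h1 C0 mul0r mulr0.
  have d0 : d' = 0 by apply: (mulfI D0); rewrite h2 w0 !mulr0.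
  exists (- (c' * x qS) / (x qD * x qW)); split; rewrite ?w0 ?d0 ?C0; first by ring.
    by field; rewrite ?S0 ?C0 ?D0 ?W0.
  by ring.
case: (eqVneq (x qD) 0) => [D0|D0].
  have W0 : x qW != 0 by apply/eqP; exact: on_E_DW.
  have w0 : w' = 0 by apply: (mulfI W0); rewrite -h2 D0 mul0r mulr0.
  have c0 : c' = 0 by apply: (mulfI C0); rewrite h1 w0 !mulr0.
  exists (- (d' * x qS) / (x qC * x qW)); split; rewrite ?w0 ?c0 ?D0; try by ring.
  by field; rewrite ?S0 ?C0 ?D0 ?W0.
exists (- (w' * x qS) / (x qC * x qD)); split.
- by field; rewrite ?S0 ?C0 ?D0 ?W0.
- by apply: (mulfI C0); rewrite h1; field; rewrite ?S0 ?C0 ?D0 ?W0.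
- by apply: (mulfI D0); rewrite h2; field; rewrite ?S0 ?C0 ?D0 ?W0.
Qed.

End Point.

Section CircleMap.
Variable x : 'I_4 -> C.

(* On the curve [ek + i es] has modulus [edel], and its argument phi satisfies
   [d phi / sqrt (1 + sin^2 phi) = 2 Re w], w the invariant differential. *)
Definition ek : C := x qC * (x qC)^* * x qW * (x qW)^* - x qS * (x qS)^* * x qD * (x qD)^*.
Definition es : C := x qS * x qW * (x qC)^* * (x qD)^* + (x qS)^* * (x qW)^* * x qC * x qD.
Definition edel : C := x qW * x qW * (x qW)^* * (x qW)^* + x qS * x qS * (x qS)^* * (x qS)^*.
Definition etau : C := x qD * (x qD)^* * x qW * (x qW)^* + x qS * (x qS)^* * x qC * (x qC)^*.
(* The holomorphic parts of the differentials of [ek] and [es]. *)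
Definition epk (u : 'I_4 -> C) : C :=
  u qC * (x qC)^* * x qW * (x qW)^* + x qC * (x qC)^* * u qW * (x qW)^*
  - u qS * (x qS)^* * x qD * (x qD)^* - x qS * (x qS)^* * u qD * (x qD)^*.
Definition eps (u : 'I_4 -> C) : C :=
  u qS * x qW * (x qC)^* * (x qD)^* + x qS * u qW * (x qC)^* * (x qD)^*
  + (x qS)^* * (x qW)^* * u qC * x qD + (x qS)^* * (x qW)^* * x qC * u qD.

End CircleMap.

Lemma conj_ek x : (ek x)^* = ek x.
Proof. rewrite /ek rmorphB !rmorphM /= !conjCK; ring. Qed.

Lemma conj_es x : (es x)^* = es x.
Proof. rewrite /es rmorphD !rmorphM /= !conjCK; ring. Qed.

Lemma conj_edel x : (edel x)^* = edel x.
Proof. rewrite /edel rmorphD !rmorphM /= !conjCK; ring. Qed.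

Lemma conj_etau x : (etau x)^* = etau x.
Proof. rewrite /etau rmorphD !rmorphM /= !conjCK; ring. Qed.

Section Slope.
Variable x : 'I_4 -> C.
Hypotheses (Ex : on_E x) (x0 : exists i, x i != 0).

Let hC : x qC * x qC - (x qW * x qW - x qS * x qS) = 0.
Proof. by rewrite on_E_C // subrr. Qed.
Let hD : x qD * x qD - (x qW * x qW + x qS * x qS) = 0.
Proof. by rewrite on_E_D // subrr. Qed.
Let hc : (x qC)^* * (x qC)^* - ((x qW)^* * (x qW)^* - (x qS)^* * (x qS)^*) = 0.
Proof. by rewrite -!rmorphM on_E_C // -rmorphB subrr. Qed.
Let hd : (x qD)^* * (x qD)^* - ((x qW)^* * (x qW)^* + (x qS)^* * (x qS)^*) = 0.
Proof. by rewrite -!rmorphM on_E_D // -rmorphD subrr. Qed.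

Lemma ek_es_norm : ek x * ek x + es x * es x = edel x * edel x.
Proof. exact: elliptic_norm hC hD hc hd. Qed.

Lemma es_edel_speed : edel x * edel x + es x * es x = etau x * etau x.
Proof. exact: elliptic_speed hC hD hc hd. Qed.

(** Multiplication by [S] clears the denominators of [ttan] and gives [elliptic_slope]; where [S]
    vanishes, [ttan] has a single nonzero coordinate. *)
Lemma ek_eps_ttan : ek x * eps x (ttan x) - es x * epk x (ttan x) = etau x * edel x.
Proof.
rewrite /ttan; case: (eqVneq (x qS) 0) => S0; last first.
  apply: (mulfI S0); rewrite -(elliptic_slope hC hD hc hd) /ek /es /epk /eps /vec4 /=.
  by field.
have [W0 C0 D0] := S_eq0 Ex x0 S0.
have hW : x qC * x qC * ((x qC)^* * (x qC)^*) = x qW * x qW * ((x qW)^* * (x qW)^*).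
  by rewrite -!rmorphM on_E_C // S0 mul0r subr0.
rewrite /ek /es /epk /eps /etau /edel /vec4 /= S0 rmorph0.
transitivity (x qC * x qC * ((x qC)^* * (x qC)^*) * (x qW * (x qW)^* * x qD * (x qD)^*)); first by field.
by rewrite hW; ring.
Qed.

End Slope.

Definition rC (z : C) : Prop := z^* = z.

Lemma rC_im z : rC z -> imC z = 0.
Proof. by move=> /(congr1 (@imC R)); rewrite imC_conj; lra. Qed.

Lemma rC_reM z w : rC z -> rC w -> reC (z * w) = reC z * reC w.
Proof. by move=> /rC_im z0 _; rewrite reCM z0 mul0r subr0. Qed.

Lemma rC_mk z : rC z -> z = mkC (reC z) 0.
Proof. by move=> z0; apply: complex_ext => //=; exact: rC_im. Qed.

Lemma reC_normsq (z : C) : 0 <= reC (z * z^*).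
Proof. by rewrite reCM reC_conj imC_conj mulrN opprK addr_ge0 // -expr2 sqr_ge0. Qed.

Lemma reC_normsq_gt0 (z : C) : z != 0 -> 0 < reC (z * z^*).
Proof. exact: mul_conj_gt0. Qed.

Lemma rC_normsq (z : C) : rC (z * z^*).
Proof. by rewrite /rC rmorphM /= conjCK mulrC. Qed.

Lemma edel_gt0 x : on_E x -> (exists i, x i != 0) -> 0 < reC (edel x).
Proof.
move=> Ex x0; have -> : edel x = (x qW * x qW) * (x qW * x qW)^* + (x qS * x qS) * (x qS * x qS)^*.
  by rewrite /edel !rmorphM /=; ring.
rewrite reCD; case: (eqVneq (x qS) 0) => S0.
  by have [W0 _ _] := S_eq0 Ex x0 S0; rewrite ltr_wpDr ?reC_normsq // reC_normsq_gt0 // mulf_neq0.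
by rewrite ltr_wpDl ?reC_normsq // reC_normsq_gt0 // mulf_neq0.
Qed.

Lemma etau_gt0 x : on_E x -> (exists i, x i != 0) -> 0 < reC (etau x).
Proof.
move=> Ex x0; have d0 := edel_gt0 Ex x0.
have t0 : 0 <= reC (etau x).
  have -> : etau x = (x qD * x qW) * (x qD * x qW)^* + (x qS * x qC) * (x qS * x qC)^*.
    by rewrite /etau !rmorphM /=; ring.
  by rewrite reCD addr_ge0 // reC_normsq.
rewrite lt_def t0 andbT; apply/eqP => e.
have h : reC (edel x) * reC (edel x) + reC (es x) * reC (es x) = reC (etau x) * reC (etau x).
  have := congr1 (@reC R) (es_edel_speed Ex); rewrite reCD !rC_reM //;
    by [exact: conj_etau|exact: conj_es|exact: conj_edel].
have : 0 < reC (edel x) * reC (edel x) by rewrite mulr_gt0.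
by have := sqr_ge0 (reC (es x)); move: h; rewrite e mul0r expr2; lra.
Qed.

Section TensorSlices.
Variables (J : finType) (x : 'I_4 -> C) (y : J -> C).
Hypotheses (Ex : on_E x) (x0 : exists i, x i != 0) (y0 : exists j, y j != 0).

(** The sum runs over all slices of a tensor in the direction of one factor. They are multiples
    [y j * x] of one point of the curve, so the sum is [ek x + i es x] times a positive number
    [lam], and it does not vanish although single slices may. *)
Definition circle (Z : J -> 'I_4 -> C) : C :=
  \sum_j ek (Z j) + mkC 0 1 * \sum_j es (Z j).
Definition dcircle (Z U : J -> 'I_4 -> C) : C :=
  \sum_j (epk (Z j) (U j) + (epk (Z j) (U j))^*) +
  mkC 0 1 * \sum_j (eps (Z j) (U j) + (eps (Z j) (U j))^*).

Let lam : C := \sum_j y j * y j * ((y j)^* * (y j)^*).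

Let lamR : rC lam.
Proof.
rewrite /rC rmorph_sum; apply: eq_bigr => j _.
by rewrite /= !rmorphM /= conjCK; ring.
Qed.

Let lam_gt0 : 0 < reC lam.
Proof.
have [j yj] := y0; rewrite /lam reC_sum (bigD1 j) //= ltr_wpDr //.
  by apply: sumr_ge0 => i _; rewrite -rmorphM reC_normsq.
by rewrite -rmorphM reC_normsq_gt0 // mulf_neq0.
Qed.

Variable Z : J -> 'I_4 -> C.
Hypothesis HZ : forall j i, Z j i = y j * x i.

Let sum_ek : \sum_j ek (Z j) = lam * ek x.
Proof.
by rewrite mulr_suml; apply: eq_bigr => j _; rewrite /ek !HZ !rmorphM /=; ring.
Qed.

Let sum_es : \sum_j es (Z j) = lam * es x.
Proof.
by rewrite mulr_suml; apply: eq_bigr => j _; rewrite /es !HZ !rmorphM /=; ring.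
Qed.

Let reC_circle : reC (circle Z) = reC lam * reC (ek x) /\ imC (circle Z) = reC lam * reC (es x).
Proof.
rewrite /circle sum_ek sum_es reCD imCD !(reCM, imCM) /= (rC_im lamR).
rewrite (rC_im (conj_ek x)) (rC_im (conj_es x)); split; ring.
Qed.

Let E : reC (ek x) ^+ 2 + reC (es x) ^+ 2 = reC (edel x) ^+ 2.
Proof.
have := congr1 (@reC R) (ek_es_norm Ex); rewrite reCD !rC_reM ?expr2 //;
  by [exact: conj_ek|exact: conj_es|exact: conj_edel].
Qed.

Let T : reC (edel x) ^+ 2 + reC (es x) ^+ 2 = reC (etau x) ^+ 2.
Proof.
have := congr1 (@reC R) (es_edel_speed Ex); rewrite reCD !rC_reM ?expr2 //;
  by [exact: conj_etau|exact: conj_es|exact: conj_edel].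
Qed.

Let circle_normsq : reC (circle Z * (circle Z)^*) = (reC lam * reC (edel x)) ^+ 2.
Proof.
have -> : reC (circle Z * (circle Z)^*) = reC (circle Z) ^+ 2 + imC (circle Z) ^+ 2.
  by rewrite reCM reC_conj imC_conj; ring.
by have [-> ->] := reC_circle; rewrite !exprMn -mulrDr E.
Qed.

Lemma circle_neq0 : circle Z != 0.
Proof.
apply/eqP => c0; have := circle_normsq; rewrite c0 mul0r => /eqP.
rewrite eq_sym expf_eq0 /= mulf_eq0 !gt_eqF ?lam_gt0 //; exact: edel_gt0.
Qed.

(** To first order the component of the velocity along [x] rescales the circle by a real factor and
    does not turn it; the component along [ttan] turns it at the speed [2 Re th]. *)
Lemma zslope_circle U p th :
  (forall j i, U j i = p j * x i + y j * th * ttan x i) ->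
  zslope (circle Z) (dcircle Z U) = 2 * reC th / ell_period R.
Proof.
move=> HU.
have d0 := edel_gt0 Ex x0; have t0 := etau_gt0 Ex x0.
pose m := \sum_j y j * p j * ((y j)^* * (y j)^*) * 2%:R.
have hk : \sum_j epk (Z j) (U j) = lam * (th * epk x (ttan x)) + m * ek x.
  rewrite !mulr_suml -big_split; apply: eq_bigr => j _ /=.
  by rewrite /ek /epk !HZ !HU !rmorphM /=; ring.
have hs : \sum_j eps (Z j) (U j) = lam * (th * eps x (ttan x)) + m * es x.
  rewrite !mulr_suml -big_split; apply: eq_bigr => j _ /=.
  by rewrite /es /eps !HZ !HU !rmorphM /=; ring.
pose dk := \sum_j epk (Z j) (U j); pose ds := \sum_j eps (Z j) (U j).
have DE : dcircle Z U = (dk + dk^*) + mkC 0 1 * (ds + ds^*).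
  by rewrite /dk /ds !rmorph_sum -!big_split.
have reD : reC (dcircle Z U) = 2 * reC dk.
  by rewrite DE !(reCD, reCM, reC_conj, imCD, imC_conj) /=; ring.
have imD : imC (dcircle Z U) = 2 * reC ds.
  by rewrite DE !(reCD, imCM, reC_conj, imCD, imC_conj) /=; ring.
have key : reC (ek x) * reC ds - reC (es x) * reC dk = reC lam * (reC th * (reC (etau x) * reC (edel x))).
  have : ek x * ds - es x * dk = lam * (th * (etau x * edel x)).
    by rewrite /ds hs /dk hk -(ek_eps_ttan Ex x0); ring.
  move/(congr1 (@reC R)); rewrite reCB !(reCM, imCM) (rC_im (conj_ek x)) (rC_im (conj_es x)).
  by rewrite (rC_im lamR) (rC_im (conj_edel x)) (rC_im (conj_etau x)) !(mul0r, mulr0, subr0, addr0).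
have spd : ell_speed (circle Z) = reC (edel x) / reC (etau x) / ell_period R.
  rewrite /ell_speed circle_normsq; have [_ ->] := reC_circle.
  have -> : 1 + (reC lam * reC (es x)) ^+ 2 / (reC lam * reC (edel x)) ^+ 2 = (reC (etau x) / reC (edel x)) ^+ 2.
    by rewrite expr_div_n -T; field; rewrite !gt_eqF.
  rewrite sqrtr_sqr ger0_norm ?invf_div // divr_ge0 //; exact: ltW.
rewrite /zslope spd circle_normsq imCM reC_conj imC_conj.
have [-> ->] := reC_circle; rewrite reD imD.
have -> : reC lam * reC (ek x) * (2 * reC ds) + - (reC lam * reC (es x)) * (2 * reC dk) =
   2 * reC lam * (reC (ek x) * reC ds - reC (es x) * reC dk) by ring.
rewrite key; field; rewrite !gt_eqF //; exact: ell_period_gt0.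
Qed.

End TensorSlices.

End EllipticCurve.

(** * The automorphism of order four and the imaginary part *)

Section TwistedCircle.
Variable R : realType.
Local Notation C := (CC R).
Implicit Types x u : 'I_4 -> C.

(* An automorphism of the cone over the curve; it multiplies the invariant
   differential by [-i], hence exchanges its real and imaginary parts. *)
Definition swE x : 'I_4 -> C := vec4 (x qW) (mkC 0 (-1) * x qS) (x qD) (x qC).

Lemma sqr_mi : mkC 0 (-1) * mkC 0 (-1) = -1 :> C.
Proof. by apply: complex_ext; rewrite ?reCM ?imCM ?reCN ?imCN /=; ring. Qed.

Lemma mi_neq0 : mkC 0 (-1) != 0 :> C.
Proof. by rewrite eq_complex /= oppr_eq0 oner_eq0 andbF. Qed.

Lemma swE_lin x a b v w : (forall i, x i = a * v i + b * w i) ->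
  forall i, swE x i = a * swE v i + b * swE w i.
Proof. by move=> E; apply: forall_I4; rewrite /swE /vec4 /= E //; ring. Qed.

Lemma swE_scale x a v : (forall i, x i = a * v i) -> forall i, swE x i = a * swE v i.
Proof. by move=> E; apply: forall_I4; rewrite /swE /vec4 /= E //; ring. Qed.

Lemma on_E_sw x : on_E x -> on_E (swE x).
Proof.
move=> Ex; have hC := on_E_C Ex; have hD := on_E_D Ex.
split; rewrite /quadA /quadB /swE /vec4 /= mulrACA sqr_mi ?hC ?hD; ring.
Qed.

Lemma swE_neq0 x : (exists i, x i != 0) -> exists i, swE x i != 0.
Proof.
case=> i; move: i; apply: forall_I4 => x0.
- by exists qW.
- by exists qS; rewrite /swE /vec4 /= mulf_neq0 // mi_neq0.
- by exists qD.
- by exists qC.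
Qed.

Lemma swE_ttan x i : swE (ttan x) i = mkC 0 (-1) * ttan (swE x) i.
Proof.
have mi0 := mi_neq0; have := sqr_mi; set k := mkC 0 (-1) => kk.
have S0 : (swE x qS == 0) = (x qS == 0) by rewrite /swE /vec4 /= mulf_eq0 (negbTE mi0).
rewrite /ttan S0; case: (eqVneq (x qS) 0) => xS; move: i; apply: forall_I4; rewrite /swE /vec4 /= -/k;
  rewrite ?mulr0 //; try (by field; rewrite ?xS ?mi0).
by rewrite [x qD * x qC]mulrC.
Qed.

Section Slices.
Variables (J : finType) (x : 'I_4 -> C) (y : J -> C).
Hypotheses (Ex : on_E x) (x0 : exists i, x i != 0) (y0 : exists j, y j != 0).
Variable Z : J -> 'I_4 -> C.
Hypothesis HZ : forall j i, Z j i = y j * x i.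

Definition twist (b : bool) (Z : J -> 'I_4 -> C) (j : J) : 'I_4 -> C :=
  if b then swE (Z j) else Z j.

Lemma circle_twist_neq0 b : circle (twist b Z) != 0.
Proof.
case: b.
  apply: (circle_neq0 (x := swE x) (y := y)) => //; [exact: on_E_sw|exact: swE_neq0|].
  by move=> j i; apply: swE_scale; exact: HZ.
exact: (circle_neq0 (x := x) (y := y)).
Qed.

Lemma zslope_twist b U p th :
  (forall j i, U j i = p j * x i + y j * th * ttan x i) ->
  zslope (circle (twist b Z)) (dcircle (twist b Z) (twist b U)) =
  2 * (if b then imC th else reC th) / ell_period R.
Proof.
move=> HU; case: b.
  (* The automorphism turns [th] into [-i th], whose real part is [Im th]. *)
  have tw j i : twist true U j i = p j * swE x i + y j * (mkC 0 (-1) * th) * ttan (swE x) i.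
    rewrite /twist (swE_lin (a := p j) (b := y j * th) (v := x) (w := ttan x)); last exact: HU.
    by rewrite swE_ttan; ring.
  rewrite (zslope_circle (on_E_sw Ex) (swE_neq0 x0) y0 _ tw).
    by rewrite reCM /=; congr (2 * _ / _); ring.
  by move=> j i; apply: swE_scale; exact: HZ.
exact: (zslope_circle Ex x0 y0 HZ HU).
Qed.

End Slices.
End TwistedCircle.

(** * Extension of the invariant differential off the curve *)

Section InvariantForm.
Variables (R : realType) (J : finType).
Local Notation C := (CC R).
Implicit Types (x u : 'I_4 -> C) (Z U W : J -> 'I_4 -> C).

(** [eDN], [dnum] and [dden] are the derivatives of [eN], [onum] and [oden] in the direction [u] or
    [U]. *)
Definition eDN (a : 'I_3) x u : C :=
  if a == 0 then u qC * x qD + x qC * u qD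
  else if a == 1 then u qD * x qW + x qD * u qW else u qC * x qW + x qC * u qW.

(* [sum conj(eN) eM / sum |eN|^2] glues the expressions of the invariant
   differential; the quadrics keep the denominator positive off the curve. *)
Definition onum Z U : C := \sum_j \sum_a (eN a (Z j))^* * eM a (Z j) (U j).
Definition oden Z : C := \sum_j (\sum_a eN a (Z j) * (eN a (Z j))^* +
  (quadA (Z j) (Z j) * (quadA (Z j) (Z j))^* + quadB (Z j) (Z j) * (quadB (Z j) (Z j))^*)).
Definition dnum Z U W : C := \sum_j \sum_a
  ((eDN a (Z j) (U j))^* * eM a (Z j) (W j) + (eN a (Z j))^* * eM a (U j) (W j)).
Definition dden Z U : C := \sum_j (\sum_a (eDN a (Z j) (U j) * (eN a (Z j))^* + eN a (Z j) * (eDN a (Z j) (U j))^*) +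
  (2%:R * quadA (Z j) (U j) * (quadA (Z j) (Z j))^* + quadA (Z j) (Z j) * (2%:R * quadA (Z j) (U j))^* +
  (2%:R * quadB (Z j) (U j) * (quadB (Z j) (Z j))^* + quadB (Z j) (Z j) * (2%:R * quadB (Z j) (U j))^*))).

Lemma oden_rC Z : rC (oden Z).
Proof.
have rD (a b : C) : rC a -> rC b -> rC (a + b) by rewrite /rC rmorphD /= => -> ->.
have rS (I : finType) (f : I -> C) : (forall i, rC (f i)) -> rC (\sum_i f i).
  by move=> h; rewrite /rC rmorph_sum; apply: eq_bigr => i _; exact: h.
apply: (rS) => j; apply: (rD); first by apply: (rS) => a; exact: rC_normsq.
by apply: rD; exact: rC_normsq.
Qed.

(** If the sum of squares vanished at a nonzero slice, both quadrics and all [eN] would vanish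
    there, against [eN_neq0]. *)
Lemma oden_gt0 Z : (exists j i, Z j i != 0) -> 0 < reC (oden Z).
Proof.
move=> [j Zj]; rewrite reC_sum (bigD1 j) //=.
have pos i : 0 <= reC (\sum_a eN a (Z i) * (eN a (Z i))^* +
  (quadA (Z i) (Z i) * (quadA (Z i) (Z i))^* + quadB (Z i) (Z i) * (quadB (Z i) (Z i))^*)).
  rewrite !reCD reC_sum !addr_ge0 ?reC_normsq //.
  by apply: sumr_ge0 => a _; exact: reC_normsq.
apply: ltr_wpDr; first by apply: sumr_ge0 => i _; exact: pos.
rewrite lt_def pos andbT !reCD reC_sum; apply/eqP => h.
have n1 : 0 <= \sum_a reC (eN a (Z j) * (eN a (Z j))^*) by apply: sumr_ge0 => a _; exact: reC_normsq.
have n2 := reC_normsq (quadA (Z j) (Z j)); have n3 := reC_normsq (quadB (Z j) (Z j)).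
have zero (z : C) : reC (z * z^*) = 0 -> z = 0.
  by move=> z0; apply/eqP; apply: contraT => /reC_normsq_gt0; rewrite z0 ltxx.
have Ej : on_E (Z j) by split; apply: zero; lra.
have [a /reC_normsq_gt0] := eN_neq0 Ej Zj; rewrite ltNge => /negP[].
have s0 : \sum_a reC (eN a (Z j) * (eN a (Z j))^*) = 0 by lra.
by rewrite -s0 (bigD1 a) //= lerDl sumr_ge0 // => i _; exact: reC_normsq.
Qed.

Section Tangents.
Variables (x : 'I_4 -> C) (y : J -> C).
Hypotheses (Ex : on_E x) (x0 : exists i, x i != 0).
Variable Z : J -> 'I_4 -> C.
Hypothesis HZ : forall j i, Z j i = y j * x i.

Let EZ j : on_E (Z j).
Proof.
have [e1 e2] := Ex; split.
- by transitivity (y j * y j * quadA x x); [rewrite /quadA !HZ; ring|rewrite e1 mulr0].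
- by transitivity (y j * y j * quadB x x); [rewrite /quadB !HZ; ring|rewrite e2 mulr0].
Qed.

Definition tangent_datum U (p : J -> C) (th : C) :=
  forall j i, U j i = p j * x i + y j * th * ttan x i.

Lemma eM_datum U p th a j : tangent_datum U p th -> eM a (Z j) (U j) = th * eN a (Z j).
Proof.
move=> HU; have := eM_ttan Ex x0 a; move: a; apply: forall_I3; rewrite /eM /eN /= !HZ !HU => h.
- by transitivity (y j * y j * th * (x qC * x qD)); [rewrite -h|]; ring.
- by transitivity (y j * y j * th * (x qD * x qW)); [rewrite -h|]; ring.
- by transitivity (y j * y j * th * (x qC * x qW)); [rewrite -h|]; ring.
Qed.

Lemma onum_datum U p th : tangent_datum U p th -> onum Z U = th * oden Z.
Proof.
move=> HU; rewrite mulr_sumr; apply: eq_bigr => j _.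
have [-> ->] := EZ j; rewrite !mul0r !addr0 mulr_sumr; apply: eq_bigr => a _.
by rewrite (eM_datum _ _ HU); ring.
Qed.

(** Divided by [oden], the left side is the derivative along [U] of the quotient [onum / oden] at
    [W]; its symmetry in [U] and [W] says that the form is closed on tangent vectors. Term by term,
    the difference is a multiple of the relation [eM_ttan]. *)
Lemma closed_datum U W p th q et : tangent_datum U p th -> tangent_datum W q et ->
  dnum Z U W - et * dden Z U = dnum Z W U - th * dden Z W.
Proof.
move=> HU HW.
have red V V' p' th' q' et' : tangent_datum V p' th' -> tangent_datum V' q' et' ->
   dnum Z V V' - et' * dden Z V =
   \sum_j \sum_a (eN a (Z j))^* * (eM a (V j) (V' j) - et' * eDN a (Z j) (V j)).
  move=> HV HV'; rewrite mulr_sumr -sumrB; apply: eq_bigr => j _.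
  have [-> ->] := EZ j; rewrite rmorph0 !mul0r !mulr0 !addr0 mulr_sumr -sumrB; apply: eq_bigr => a _.
  by rewrite (eM_datum _ _ HV'); ring.
rewrite (red _ _ _ _ _ _ HU HW) (red _ _ _ _ _ _ HW HU).
apply: eq_bigr => j _; apply: eq_bigr => a _; congr (_ * _); apply/eqP; rewrite -subr_eq0; apply/eqP.
have := eM_ttan Ex x0 a; move: a; apply: forall_I3; rewrite /eM /eN /eDN /= !HZ !HU !HW => h;
  set T := _ - _ in h.
- by transitivity ((1 + 1) * y j * (p j * et - q j * th) * (T - x qC * x qD)); [rewrite /T; ring|rewrite h subrr mulr0].
- by transitivity ((1 + 1) * y j * (p j * et - q j * th) * (T - x qD * x qW)); [rewrite /T; ring|rewrite h subrr mulr0].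
- by transitivity ((1 + 1) * y j * (p j * et - q j * th) * (T - x qC * x qW)); [rewrite /T; ring|rewrite h subrr mulr0].
Qed.

End Tangents.

Lemma slices_rank1 Z j0 : (exists i, Z j0 i != 0) ->
  (forall j i i', Z j i * Z j0 i' = Z j i' * Z j0 i) ->
  exists2 y : J -> C, y j0 = 1 & forall j i, Z j i = y j * Z j0 i.
Proof.
move=> [i0 zi] H; exists (fun j => Z j i0 / Z j0 i0); first by rewrite divff.
by move=> j i; rewrite mulrAC -H mulfK.
Qed.

(** The linearised minors force every slice of [U] to follow the slice [j0], up to multiples of
    [Z j0]; the linearised quadrics put that one slice into the tangent plane of the cone over the
    curve. *)
Lemma slices_tangent Z U j0 (y : J -> C) : on_E (Z j0) -> (exists i, Z j0 i != 0) ->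
  (forall j i, Z j i = y j * Z j0 i) ->
  (forall j i i', U j i * Z j0 i' + Z j i * U j0 i' = U j i' * Z j0 i + Z j i' * U j0 i) ->
  quadA (Z j0) (U j0) = 0 -> quadB (Z j0) (U j0) = 0 ->
  exists p th, tangent_datum (Z j0) y U p th.
Proof.
move=> E0 z0 HZ HU qA qB; have [al [th Hth]] := tangent_param E0 z0 qA qB.
have [i0 zi] := z0.
exists (fun j => (U j i0 - y j * th * ttan (Z j0) i0) / Z j0 i0), th => j i.
apply: (mulIf zi); rewrite mulrDl mulrAC divfK // -[LHS](addrK (Z j i * U j0 i0)) HU !Hth (HZ j i) (HZ j i0); ring.
Qed.

End InvariantForm.

(** * Powers of the curve in projective space *)

Section QuadricPolynomials.
Variables (R : realType) (n : nat).
Local Notation C := (CC R).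
Local Notation idx := 'I_n.+1.
Implicit Types (s : seq (C * (idx * idx))) (v u : 'rV[C]_n.+1).

Definition linpoly (a : idx) : mpoly.mpoly n.+1 C := mpoly.mpolyX C (mpoly.mnm1 a).

(** Quadrics are kept as lists of coefficients and index pairs, which makes their values and
    differentials explicit sums. *)
Definition qpoly s : mpoly.mpoly n.+1 C :=
  \sum_(t <- s) t.1 *: (linpoly t.2.1 * linpoly t.2.2).

Definition qval s v : C := \sum_(t <- s) t.1 * (v 0 t.2.1 * v 0 t.2.2).
Definition qdiff s v u : C :=
  \sum_(t <- s) t.1 * (u 0 t.2.1 * v 0 t.2.2 + v 0 t.2.1 * u 0 t.2.2).

Lemma homogeneous_linpoly a : homogeneous (linpoly a).
Proof. by exists 1%N; rewrite mpoly.dhomogX /= mpoly.mdeg1. Qed.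

Lemma peval_linpoly a v : peval (linpoly a) v = v 0 a.
Proof. exact: mpoly.mevalXU. Qed.

Lemma homogeneous_qpoly s : homogeneous (qpoly s).
Proof.
exists 2%N; rewrite /qpoly; apply: rpred_sum => t _; apply: rpredZ.
by apply: (@mpoly.dhomogM _ _ _ 1 _ 1); rewrite mpoly.dhomogX /= mpoly.mdeg1.
Qed.

Lemma peval_qpoly s v : peval (qpoly s) v = qval s v.
Proof.
rewrite /peval /qpoly rmorph_sum; apply: eq_bigr => t _ /=.
by rewrite mpoly.mevalZ mpoly.mevalM !mpoly.mevalXU.
Qed.

Lemma meval_deriv_linpoly a v j : mpoly.meval (v 0) (mpoly.mderiv j (linpoly a)) = (a == j)%:R.
Proof.
rewrite /linpoly mpoly.mderivX mpoly.mnm1E mpoly.mevalZ.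
case: eqP => [->|_]; last by rewrite mul0r.
by rewrite mpoly.mevalX big1 ?mulr1 // => i _; rewrite mpoly.mnmBE subnn expr0.
Qed.

Lemma pgrad_qpoly s v u : \sum_j pgrad (qpoly s) v 0 j * u 0 j = qdiff s v u.
Proof.
transitivity (\sum_j \sum_(t <- s) t.1 *
    ((t.2.1 == j)%:R * v 0 t.2.2 + v 0 t.2.1 * (t.2.2 == j)%:R) * u 0 j).
  apply: eq_bigr => j _; rewrite mxE -mulr_suml; congr (_ * _).
  rewrite /qpoly raddf_sum /peval rmorph_sum; apply: eq_bigr => t _ /=.
  rewrite mpoly.mderivZ mpoly.mevalZ mpoly.mderivM mpoly.mevalD !mpoly.mevalM.
  by rewrite !meval_deriv_linpoly !mpoly.mevalXU.
rewrite exchange_big /=; apply: eq_bigr => t _.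
have D (a : idx) : \sum_j (a == j)%:R * u 0 j = u 0 a.
  rewrite (bigD1 a) //= eqxx mul1r big1 ?addr0 // => j ja.
  by rewrite eq_sym (negbTE ja) mul0r.
rewrite -{1}(D t.2.1) -{1}(D t.2.2) mulr_suml mulr_sumr -big_split mulr_sumr.
by apply: eq_bigr => j _ /=; ring.
Qed.

Lemma hom_coord_neq0 (x : proj_space R n) v : hom_coord x v -> v != 0.
Proof. by case=> w <- _; exact: (set_valP w). Qed.

Lemma hom_coord_scale (x : proj_space R n) v w : hom_coord x v -> hom_coord x w ->
  exists2 a : C, a != 0 & w = a *: v.
Proof.
move=> [v' <- vx] [w' <- wx].
have : (\pi_({eq_quot collinear_equiv R n}) v' == \pi_({eq_quot collinear_equiv R n}) w')%qT.
  by rewrite vx wx.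
rewrite eqmodE => /asboolP [a E]; exists a => //.
by apply/eqP => a0; have := set_valP w' : set_val w' != 0; rewrite E a0 scale0r eqxx.
Qed.

End QuadricPolynomials.

(** * The Segre image of a power of the curve and its smoothness *)

Section SegreVariety.
Variables (R : realType) (Ix : finType).
Local Notation C := (CC R).
Local Notation T := {ffun Ix -> 'I_4}.

Definition segN : nat := #|{: T}|.-1.

Lemma segN_card : #|{: T}| = segN.+1.
Proof. by rewrite /segN prednK //; apply/card_gt0P; exists [ffun=> qW]. Qed.

Definition tidx (I : T) : 'I_segN.+1 := cast_ord segN_card (enum_rank I).
Definition tinv (a : 'I_segN.+1) : T := enum_val (cast_ord (esym segN_card) a).

Lemma tidxK : cancel tidx tinv.
Proof. by move=> I; rewrite /tidx /tinv cast_ordK enum_rankK. Qed.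

Lemma tinvK : cancel tinv tidx.
Proof. by move=> a; rewrite /tidx /tinv enum_valK cast_ordKV. Qed.

Definition upd (J : T) (l : Ix) (a : 'I_4) : T := [ffun i => if i == l then a else J i].

Lemma upd_id J l : upd J l (J l) = J.
Proof. by apply/ffunP => i; rewrite ffunE; case: eqP => [->|]. Qed.

Lemma upd_at J l a : upd J l a l = a. Proof. by rewrite ffunE eqxx. Qed.

Definition slice (v : 'rV[C]_segN.+1) (l : Ix) (J : T) : 'I_4 -> C := fun a => v 0 (tidx (upd J l a)).

(** The minors, taken for one factor against all others, make the vector a pure tensor, and the
    quadrics put each factor on the curve. *)
Definition segre (v : 'rV[C]_segN.+1) : Prop := forall l,
  (forall J K a b, slice v l J a * slice v l K b = slice v l J b * slice v l K a) /\
  forall J, on_E (slice v l J).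

Lemma segreZ v c : segre v -> segre (c *: v).
Proof.
move=> sv l; have [h1 h2] := sv l; have E J a : slice (c *: v) l J a = c * slice v l J a by rewrite /slice mxE.
split=> [J K a b|J].
  by rewrite !E mulrACA h1; ring.
have [q1 q2] := h2 J; split.
- by transitivity (c * c * quadA (slice v l J) (slice v l J)); [rewrite /quadA !E; ring|rewrite q1 mulr0].
- by transitivity (c * c * quadB (slice v l J) (slice v l J)); [rewrite /quadB !E; ring|rewrite q2 mulr0].
Qed.

Definition segreX : set (proj_space R segN) := [set x | exists2 v, hom_coord x v & segre v].

Lemma segreXP x v : hom_coord x v -> segreX x <-> segre v.
Proof.
move=> xv; split=> [[w xw sw]|sv]; last by exists v.
by have [a a0 ->] := hom_coord_scale xw xv; exact: segreZ.
Qed.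

Local Notation cT := (C * ('I_segN.+1 * 'I_segN.+1))%type.

Definition minor_eq l J K a b : seq cT :=
  [:: (1, (tidx (upd J l a), tidx (upd K l b))); (-1, (tidx (upd J l b), tidx (upd K l a)))].
Definition quad_eq (B : bool) l J : seq cT :=
  let t q (c : C) := (c, (tidx (upd J l q), tidx (upd J l q))) in
  if B then [:: t qS 1; t qW 1; t qD (-1)] else [:: t qS 1; t qC 1; t qW (-1)].

Lemma qval_minor v l J K a b :
  qval (minor_eq l J K a b) v = slice v l J a * slice v l K b - slice v l J b * slice v l K a.
Proof. by rewrite /qval !big_cons big_nil /= /slice; ring. Qed.

Lemma qval_quad v B l J :
  qval (quad_eq B l J) v = (if B then quadB (slice v l J) (slice v l J) else quadA (slice v l J) (slice v l J)).
Proof. by rewrite /qval; case: B; rewrite !big_cons big_nil /= /quadA /quadB /slice; ring. Qed.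

Lemma qdiff_minor v u l J K a b : qdiff (minor_eq l J K a b) v u =
  (slice u l J a * slice v l K b + slice v l J a * slice u l K b) -
  (slice u l J b * slice v l K a + slice v l J b * slice u l K a).
Proof. by rewrite /qdiff !big_cons big_nil /= /slice; ring. Qed.

Lemma qdiff_quad v u B l J :
  qdiff (quad_eq B l J) v u = 2%:R * (if B then quadB (slice v l J) (slice u l J) else quadA (slice v l J) (slice u l J)).
Proof. by rewrite /qdiff; case: B; rewrite !big_cons big_nil /= /quadA /quadB /slice; ring. Qed.

Definition segre_eqs : set (seq cT) := [set s | (exists l J K a b, s = minor_eq l J K a b) \/
  exists B l J, s = quad_eq B l J].

Lemma segre_eqsP v : segre v <-> forall s, segre_eqs s -> qval s v = 0.
Proof.
split=> [sv s [[l [J [K [a [b ->]]]]]|[B [l [J ->]]]]|H l].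
- by rewrite qval_minor; have [-> _] := sv l; rewrite subrr.
- by rewrite qval_quad; have [_ /(_ J) [q1 q2]] := sv l; case: B.
split=> [J K a b|J].
  apply/eqP; rewrite -subr_eq0 -qval_minor; apply/eqP/H; left.
  by exists l, J, K, a, b.
split; [have := H (quad_eq false l J)|have := H (quad_eq true l J)]; rewrite qval_quad; apply; right.
  by exists false, l, J.
by exists true, l, J.
Qed.

Lemma zariski_closed_segreX : zariski_closed segreX.
Proof.
exists [set F | exists2 s, segre_eqs s & F = qpoly s]; split.
  by move=> F [s _ ->]; exact: homogeneous_qpoly.
move=> x v xv; rewrite (segreXP xv) segre_eqsP; split=> [H F [s ss ->]|H s ss].
  by rewrite peval_qpoly; exact: H.
by rewrite -peval_qpoly; apply: H; exists s.
Qed.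

Definition segre_tangent (v u : 'rV[C]_segN.+1) : Prop :=
  forall s, segre_eqs s -> qdiff s v u = 0.

Lemma cone_tangent_segre v u : cone_tangent segreX v u -> segre_tangent v u.
Proof.
move=> H s ss; rewrite -pgrad_qpoly; apply: H; first exact: homogeneous_qpoly.
move=> y w Xy yw; rewrite peval_qpoly; move: s ss; apply/segre_eqsP.
exact/(segreXP yw).
Qed.

Section PureTensors.
Variables (c : C) (x : Ix -> 'I_4 -> C) (v : 'rV[C]_segN.+1).
Hypothesis Hv : forall I, v 0 (tidx I) = c * \prod_l x l (I l).

Lemma slice_tensor l J a : slice v l J a = (c * \prod_(l' | l' != l) x l' (J l')) * x l a.
Proof.
rewrite /slice Hv (bigD1 l) //= upd_at -mulrA [x l a * _]mulrC; congr (_ * (_ * _)).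
by apply: eq_bigr => l' nl; rewrite ffunE (negbTE nl).
Qed.

Lemma segre_tensor : (forall l, on_E (x l)) -> segre v.
Proof.
move=> Ex l; split=> [J K a b|J]; first by rewrite !slice_tensor; ring.
have [q1 q2] := Ex l; set k := c * \prod_(l' | l' != l) x l' (J l').
have E a : slice v l J a = k * x l a by rewrite slice_tensor.
split.
- by transitivity (k * k * quadA (x l) (x l)); [rewrite /quadA !E; ring|rewrite q1 mulr0].
- by transitivity (k * k * quadB (x l) (x l)); [rewrite /quadB !E; ring|rewrite q2 mulr0].
Qed.

End PureTensors.

Section LocalEquations.
Variables (v0 : 'rV[C]_segN.+1) (I0 : T).
Hypothesis (v0X : segre v0) (vI0 : v0 0 (tidx I0) != 0).

Definition hdist (I : T) : nat := #|[pred l | I l != I0 l]|.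

(** Where the coordinate [I0] is nonzero, each coordinate at Hamming distance at least 2 from [I0]
    is eliminated by one minor, and two quadrics remain for each factor. Their number is exactly the
    codimension, as [smooth_at] asks for independent equations. *)
Definition loc_eqs : finType := ({I : T | (1 < hdist I)%N} + (Ix * bool))%type.

Definition hpick (I : T) : option Ix := [pick l | I l != I0 l].

Definition loc_eq (e : loc_eqs) : seq cT :=
  match e with
  | inl K => if hpick (sval K) is Some l then minor_eq l (sval K) I0 (sval K l) (I0 l) else [::]
  | inr lB => quad_eq lB.2 lB.1 I0
  end.

Lemma loc_eq_segre e : segre_eqs (loc_eq e).
Proof.
case: e => [[I hI]|[l B]] /=; last by right; exists B, l, I0.
rewrite /hpick; case: pickP => [l _|I0I]; first by left; exists l, I, I0, (I l), (I0 l).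
by move: hI; rewrite /hdist eq_card0 // => l; rewrite inE I0I.
Qed.

Lemma hdist0 (I : T) : hdist I = 0%N -> I = I0.
Proof.
move=> /card0_eq H; apply/ffunP => l; apply/eqP; apply: contraT => nl.
by have := H l; rewrite !inE nl.
Qed.

Lemma hdist_upd (I : T) l : I l != I0 l -> hdist I = (hdist (upd I l (I0 l))).+1.
Proof.
move=> nl; rewrite /hdist (cardD1 l) inE /= nl add1n; congr _.+1.
by apply: eq_card => l'; rewrite !inE ffunE; case: (eqVneq l' l) => [->|//]; rewrite eqxx.
Qed.

Lemma hdist_upd0 l a : (hdist (upd I0 l a) <= 1)%N.
Proof.
rewrite -(card1 l); apply: subset_leq_card; apply/fintype.subsetP => l'.
by rewrite !inE ffunE; case: (eqVneq l' l) => // _; rewrite eqxx.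
Qed.

(** Induction on the distance to [I0]: the minor chosen by [hpick] expresses a coordinate through
    one that is a step closer. So [w] is a multiple of the pure tensor of its slices through
    [I0]. *)
Lemma loc_segre (w : 'rV[C]_segN.+1) : w 0 (tidx I0) != 0 -> (forall e, qval (loc_eq e) w = 0) -> segre w.
Proof.
move=> w0 H; pose x l a := w 0 (tidx (upd I0 l a)) / w 0 (tidx I0).
have tensor I : w 0 (tidx I) = w 0 (tidx I0) * \prod_l x l (I l).
  elim: {I}(hdist I) {-2}I (erefl (hdist I)) => [|d IH] I hI.
    by rewrite (hdist0 hI) big1 ?mulr1 // => l _; rewrite /x upd_id divff.
  have [l nl rel] : exists2 l, I l != I0 l & w 0 (tidx I) * w 0 (tidx I0) =
      w 0 (tidx (upd I0 l (I l))) * w 0 (tidx (upd I l (I0 l))).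
    case: (ltnP 1 (hdist I)) => h1.
      have := H (inl (exist _ I h1)); rewrite /= /hpick; case: pickP => [l nl|I0I].
        rewrite qval_minor /slice !upd_id => /eqP; rewrite subr_eq0 => /eqP E.
        by exists l => //; rewrite E mulrC.
      by move: h1; rewrite /hdist eq_card0 // => l; rewrite inE I0I.
    have d0 : d = 0%N by move: h1; rewrite hI ltnS leqn0 => /eqP.
    have /card_gt0P [l] : (0 < hdist I)%N by rewrite hI.
    rewrite inE => nl; exists l => //.
    have E : upd I l (I0 l) = I0 by apply: hdist0; have := hdist_upd nl; rewrite hI d0 => -[<-].
    rewrite E; congr (w 0 (tidx _) * _); apply/ffunP => l'; rewrite ffunE.
    by case: eqP => [->//|/eqP n']; rewrite -E ffunE (negbTE n').
  have hI' : hdist (upd I l (I0 l)) = d by have := hdist_upd nl; rewrite hI => -[].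
  apply: (mulIf w0); rewrite rel (IH _ hI') (bigD1 l) //= [in RHS](bigD1 l) //= upd_at.
  rewrite (eq_bigr (fun l' => x l' (I l'))); last by move=> l' n'; rewrite ffunE (negbTE n').
  rewrite {1}/x upd_id divff // mul1r /x; field.
  by [].
apply: (segre_tensor tensor) => l.
have q B := H (inr (l, B)); split; [have := q false|have := q true]; rewrite qval_quad => E.
- have : w 0 (tidx I0) * w 0 (tidx I0) * quadA (x l) (x l) = 0.
    by rewrite -[RHS]E /quadA /x /slice; field.
  by move/eqP; rewrite !mulf_eq0 !(negbTE w0) /= => /eqP.
- have : w 0 (tidx I0) * w 0 (tidx I0) * quadB (x l) (x l) = 0.
    by rewrite -[RHS]E /quadB /x /slice; field.
  by move/eqP; rewrite !mulf_eq0 !(negbTE w0) /= => /eqP.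
Qed.

Definition tvec (I : T) : 'rV[C]_segN.+1 := \row_a (tinv a == I)%:R.

Lemma slice_tvec I l J a : slice (tvec I) l J a = (upd J l a == I)%:R.
Proof. by rewrite /slice mxE tidxK. Qed.

Lemma hdist_I0 : hdist I0 = 0%N.
Proof. by apply: eq_card0 => l; rewrite !inE eqxx. Qed.

(** A relation between the two differentials would make two of [W], [C], [D] vanish at a point of
    the curve. *)
Lemma quad_independent (al be : C) (z : 'I_4 -> C) : on_E z -> (exists i, z i != 0) ->
  (forall b, al * quadA z (fun a => (a == b)%:R) + be * quadB z (fun a => (a == b)%:R) = 0) ->
  al = 0 /\ be = 0.
Proof.
move=> Ez z0 H.
have hW : (be - al) * z qW = 0 by rewrite -[RHS](H qW) /quadA /quadB /=; ring.
have hC : al * z qC = 0 by rewrite -[RHS](H qC) /quadA /quadB /=; ring.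
have hD : be * z qD = 0 by rewrite -[RHS]oppr0 -[in RHS](H qD) /quadA /quadB /=; ring.
have a0 : al = 0.
  apply/eqP; apply: contraT => al0.
  have zC : z qC = 0 by apply: (mulfI al0); rewrite hC mulr0.
  have b0 : be = 0.
    apply/eqP; apply: contraT => be0; exfalso; apply: (on_E_CD Ez z0 zC).
    by apply: (mulfI be0); rewrite hD mulr0.
  exfalso; apply: (on_E_CW Ez z0 zC).
  by apply: (mulfI al0); move: hW; rewrite b0 sub0r mulNr => /eqP; rewrite oppr_eq0 mulr0 => /eqP.
split=> //; apply/eqP; apply: contraT => be0; exfalso; apply: (on_E_DW Ez z0).
  by apply: (mulfI be0); rewrite hD mulr0.
by apply: (mulfI be0); rewrite mulr0 -[RHS]hW a0 subr0.
Qed.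

(* Descending induction on the distance to [I0] kills the coefficients of the
   minors; the quadrics are then handled one factor at a time, Euler's relation
   supplying the missing coordinate. *)
Lemma loc_eqs_independent (c : loc_eqs -> C) :
  (forall u, \sum_e c e * qdiff (loc_eq e) v0 u = 0) -> forall e, c e = 0.
Proof.
move=> H.
have quad0 (I : T) lB : (forall b, upd I0 lB.1 b != I) -> qdiff (quad_eq lB.2 lB.1 I0) v0 (tvec I) = 0.
  move=> nI; rewrite qdiff_quad /quadA /quadB !slice_tvec !(negbTE (nI _)) !mulr0.
  by rewrite !addr0 subrr if_same mulr0.
have step (e : {I : T | (1 < hdist I)%N}) :
    (forall e' : {I : T | (1 < hdist I)%N}, (hdist (sval e) < hdist (sval e'))%N -> c (inl e') = 0) -> c (inl e) = 0.
  case: e => [K hK] /= IH.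
  (* On the basis vector [K], the minor of [K] gives the coordinate [I0] of [v0], which is nonzero;
     another minor contributes only if its index is one step farther from [I0], and such
     coefficients already vanish. *)
  have big0 := H (tvec K); rewrite (bigD1 (inl (exist _ K hK) : loc_eqs)) //= in big0.
  have I0K : I0 == K = false by apply/eqP => e; have := hK; rewrite -e hdist_I0.
  have far l a : upd I0 l a == K = false.
    by apply/eqP => e; have := hdist_upd0 l a; rewrite e leqNgt hK.
  have [l lp nl] : exists2 l, hpick K = Some l & K l != I0 l.
    rewrite /hpick; case: pickP => [l nl|no]; first by exists l.
    by exfalso; have := hK; rewrite /hdist eq_card0 // => l; rewrite inE no.
  have upK : upd K l (I0 l) == K = false.
    by apply/eqP => e; move: nl; rewrite -{1}e upd_at eqxx.
  move: big0; rewrite lp qdiff_minor !slice_tvec !upd_id eqxx I0K far upK.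
  rewrite big1 ?addr0 => [|e' ne'].
    rewrite !mulr0 !mul0r !addr0 subr0 mul1r /slice upd_id => /eqP.
    by rewrite mulf_eq0 (negbTE vI0) orbF => /eqP.
  case: e' ne' => [[K' hK']|lB] ne' /=; last by rewrite quad0 ?mulr0 // => b; rewrite far.
  rewrite /hpick; case: pickP => [l' nl'|no]; last by rewrite /qdiff big_nil mulr0.
  have K'K : K' == K = false.
    by apply/eqP => e; case/eqP: ne'; congr inl; apply: val_inj.
  rewrite qdiff_minor !slice_tvec !upd_id K'K I0K far.
  case: eqP => [e|_]; last by rewrite !(mul0r, mulr0, addr0, subr0).
  by rewrite (IH (exist _ K' hK')) ?mul0r //= (hdist_upd nl') e.
have cl e : c (inl e) = 0.
  move: {2}(#|Ix| - hdist (sval e))%N (leqnn (#|Ix| - hdist (sval e))) => d.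
  elim: d e => [|d IH] e he; apply: step => e' ee'.
    have hc : (hdist (sval e') <= #|Ix|)%N by exact: max_card.
    by exfalso; have := leq_trans ee' hc; rewrite ltnNge -subn_eq0 -leqn0 he.
  apply: IH; rewrite leq_subLR; apply: (leq_trans (n := hdist (sval e) + d.+1)); first by rewrite -leq_subLR.
  by rewrite addnS -addSn leq_add2r.
case=> [//|[l B]].
pose z := slice v0 l I0.
have zI0 : z (I0 l) != 0 by rewrite /z /slice upd_id.
have Hl b : b != I0 l -> c (inr (l, false)) * quadA z (fun a => (a == b)%:R) +
    c (inr (l, true)) * quadB z (fun a => (a == b)%:R) = 0.
  move=> nb; have two : (2%:R : C) != 0 by rewrite pnatr_eq0.
  pose g (e : loc_eqs) := c e * qdiff (loc_eq e) v0 (tvec (upd I0 l b)).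
  have gE B' : g (inr (l, B')) = c (inr (l, B')) * (2%:R *
      (if B' then quadB z (fun a => (a == b)%:R) else quadA z (fun a => (a == b)%:R))).
    have E a : slice (tvec (upd I0 l b)) l I0 a = (a == b)%:R.
      rewrite slice_tvec; congr (_%:R); congr nat_of_bool; apply/eqP/eqP => [e|->//].
      by have := congr1 (fun f : T => f l) e; rewrite !upd_at.
    rewrite /g -[loc_eq (inr (l, B'))]/(quad_eq B' l I0) qdiff_quad -/z.
    by congr (_ * (_ * _)); case: (B'); rewrite /quadA /quadB !E.
  have tail0 : \sum_(e : loc_eqs | (e != inr (l, false)) && (e != inr (l, true))) g e = 0.
    apply: big1 => e /andP[n1 n2].
    case: e n1 n2 => [e _ _|[l' B'] n1 n2]; first by rewrite /g cl mul0r.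
    rewrite /g quad0 ?mulr0 //= => b'; apply/eqP => e.
    have ll : l' = l.
      apply/eqP; apply: contraT => nl; have := congr1 (fun f : T => f l) e.
      by rewrite upd_at ffunE eq_sym (negbTE nl) => eb; move: nb; rewrite -eb eqxx.
    by move: n1 n2; rewrite ll; case: (B'); rewrite eqxx.
  have : \sum_e g e = 0 := H _.
  rewrite (bigD1 (inr (l, false) : loc_eqs)) //=.
  rewrite (bigD1 (inr (l, true) : loc_eqs)) /=; last by apply/eqP => -[].
  rewrite tail0 addr0 !gE => g0.
  by apply: (mulfI two); rewrite mulr0 -[RHS]g0; ring.
have [Ez1 Ez2] : on_E z by have [_ h] := v0X l; exact: h.
have Hall b : c (inr (l, false)) * quadA z (fun a => (a == b)%:R) +
    c (inr (l, true)) * quadB z (fun a => (a == b)%:R) = 0.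
  case: (eqVneq b (I0 l)) => [->|/Hl //].
  pose f b := c (inr (l, false)) * quadA z (fun a => (a == b)%:R) + c (inr (l, true)) * quadB z (fun a => (a == b)%:R).
  have sum0 : \sum_b z b * f b = 0.
    rewrite (bigD1 qW) //= (bigD1 qS) //= (bigD1 qC) //= (bigD1 qD) //= big1 ?addr0; last first.
      by move=> i; move: i; apply: forall_I4.
    transitivity (c (inr (l, false)) * quadA z z + c (inr (l, true)) * quadB z z).
      by rewrite /f /quadA /quadB /=; ring.
    by rewrite Ez1 Ez2 !mulr0 addr0.
  apply: (mulfI zI0); rewrite mulr0 -[RHS]sum0 (bigD1 (I0 l)) //= big1 ?addr0 // => b' nb'.
  by rewrite /f Hl ?mulr0.
have [a0 b0] := quad_independent (conj Ez1 Ez2) (ex_intro (fun i => is_true (z i != 0)) _ zI0) Hall.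
by case: B.
Qed.

Lemma smooth_at_segreX : smooth_at (@segreX) v0.
Proof.
pose F (i : 'I_#|loc_eqs|) := qpoly (loc_eq (enum_val i)).
exists #|loc_eqs|, F, (linpoly R (tidx I0)); split.
- by move=> i; exact: homogeneous_qpoly.
- exact: homogeneous_linpoly.
- by rewrite peval_linpoly.
- move=> y w yw; rewrite peval_linpoly => w0; rewrite (segreXP yw); split=> [sw i|H].
    by rewrite peval_qpoly; move/segre_eqsP: sw; apply; exact: loc_eq_segre.
  apply: loc_segre w0 _ => e; have := H (enum_rank e).
  by rewrite /F peval_qpoly enum_rankK.
apply/eqP; rewrite -/(row_free _) -kermx_eq0; apply/rowV0P => a /sub_kermxP H.
pose c (e : loc_eqs) := a 0 (enum_rank e).
suff c0 e : c e = 0 by apply/rowP => i; rewrite mxE -(enum_valK i); exact: c0.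
apply: loc_eqs_independent e => u.
have : \sum_j (a *m \matrix_(i < #|loc_eqs|) pgrad (F i) v0) 0 j * u 0 j = 0.
  by rewrite H big1 // => j _; rewrite mxE mul0r.
under eq_bigr do rewrite mxE mulr_suml.
rewrite exchange_big /= => E; rewrite -[RHS]E (reindex (@enum_val loc_eqs predT)) /=; last first.
  by apply: onW_bij; exists enum_rank; [exact: enum_valK|exact: enum_rankK].
apply: eq_bigr => i _; rewrite /c enum_valK -pgrad_qpoly mulr_sumr; apply: eq_bigr => j _.
by rewrite !mxE mulrA.
Qed.

End LocalEquations.

Lemma smooth_projective_segreX : smooth_projective segreX.
Proof.
split; first exact: zariski_closed_segreX.
move=> x v Xx xv; have sv : segre v by apply/(segreXP xv).
have /rV0Pn [a va] := hom_coord_neq0 xv.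
by apply: (smooth_at_segreX (I0 := tinv a)) => //; rewrite tinvK.
Qed.

End SegreVariety.

(** * Continuity on complex projective space *)

Section ComplexTopology.
Variable R : realType.
Local Notation C := (CC R).

Lemma norm_re_im (z : C) : (mkC `|reC z| 0 <= `|z|) /\ (mkC `|imC z| 0 <= `|z|).
Proof.
have H (a b : R) : `|a| <= Num.sqrt (a ^+ 2 + b ^+ 2).
  by rewrite -sqrtr_sqr ler_sqrt ?lerDl ?sqr_ge0 // addr_ge0 // sqr_ge0.
case: z => a b; rewrite /Num.norm /= /mkC !lecE /= !eqxx /=; split; first exact: H.
by rewrite addrC; exact: H.
Qed.

Lemma cont_reC_imC (z : C) : {for z, continuous (@reC R)} /\ {for z, continuous (@imC R)}.
Proof.
have main (p : C -> R) : (forall z w, p (z - w) = p z - p w) -> (forall z, mkC `|p z| 0 <= `|z|) ->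
    {for z, continuous p}.
  move=> pB pn A /nbhs_ballP[e /= e0 eA].
  have e0' : (0 : C) < mkC e 0 by rewrite ltcE /= eqxx e0.
  apply/nbhs_ballP; exists (mkC e 0) => // w; rewrite /ball /= => zw.
  apply: eA; have := le_lt_trans (pn _) zw; rewrite pB ltcE /= => /andP[_].
  by [].
split; apply: main.
- exact: reCB.
- by move=> w; have [] := norm_re_im w.
- exact: imCB.
- by move=> w; have [] := norm_re_im w.
Qed.

(** Reconciles continuity of the real and imaginary parts with the topology of the norm of [R[i]],
    on which the topology of projective space is built. *)
Lemma contC_continuous (T : topologicalType) (f : T -> C) t : contC f t <-> {for t, continuous f}.
Proof.
split=> [[c1 c2]|cf]; last first.
  have [c1 c2] := cont_reC_imC (f t); split.
    exact: (@cont_cmp _ _ _ f (@reC R)).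
  exact: (@cont_cmp _ _ _ f (@imC R)).
move=> A /nbhs_ballP[e /=]; rewrite ltcE /= => /andP[/eqP e1 e0] eA.
have e2 : 0 < complex.Re e / 2 by rewrite divr_gt0.
have h1 : \forall x \near t, ball (reC (f t)) (complex.Re e / 2) (reC (f x)).
  by apply: c1; apply/nbhs_ballP; exists (complex.Re e / 2).
have h2 : \forall x \near t, ball (imC (f t)) (complex.Re e / 2) (imC (f x)).
  by apply: c2; apply/nbhs_ballP; exists (complex.Re e / 2).
apply: filterS2 h1 h2 => x; rewrite /ball /= => h1 h2; apply: eA; rewrite /ball /=.
have -> : f t - f x = mkC (reC (f t - f x)) 0 + mkC 0 1 * mkC (imC (f t - f x)) 0.
  by apply: complex_ext; rewrite ?reCD ?imCD ?reCM ?imCM /=; ring.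
apply: le_lt_trans (ler_normD _ _) _; rewrite normrM.
have nr (a : R) : `|mkC a 0 : C| = mkC `|a| 0.
  by apply: complex_ext; rewrite /Num.norm /= // expr0n /= addr0 sqrtr_sqr.
have n1 : `|mkC 0 1 : C| = 1.
  by apply: complex_ext; rewrite /Num.norm /= // expr0n expr1n /= add0r sqrtr1.
rewrite !nr n1 mul1r reCB imCB ltcE /= addr0 e1 eqxx /=; lra.
Qed.

Lemma cont_set_val (T : topologicalType) (A : set T) (w : A) : {for w, continuous (@set_val T A)}.
Proof. exact: (@initial_continuous _ _ (@set_val T A) w). Qed.

Lemma contC_entry n (w : @nonzero_vec R n) a : contC (fun w : @nonzero_vec R n => set_val w 0 a) w.
Proof.
apply/contC_continuous.
apply: (@cont_cmp _ _ _ (@set_val _ (@nonzero_vec R n)) (fun v : 'rV[C]_n.+1 => v 0 a)).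
  exact: cont_set_val.
exact: coord_continuous.
Qed.

Definition rep_vec n (x : proj_space R n) : 'rV[C]_n.+1 :=
  set_val (repr (x : {eq_quot collinear_equiv R n}%qT)).

Lemma rep_vecP n (x : proj_space R n) : hom_coord x (rep_vec x).
Proof. by exists (repr (x : {eq_quot collinear_equiv R n}%qT)) => //; exact: reprK. Qed.

(** A function invariant under scaling descends to the quotient, although the representatives
    themselves are chosen without continuity. *)
Lemma proj_fun_cont n (g : 'rV[C]_n.+1 -> R) :
  (forall w : @nonzero_vec R n, {for w, continuous (fun w : @nonzero_vec R n => g (set_val w))}) ->
  (forall c v, c != 0 -> v != 0 -> g (c *: v) = g v) ->
  continuous (fun x : proj_space R n => g (rep_vec x)).
Proof.
move=> cg hg; apply: (@repr_comp_continuous _ _ _ (fun w : @nonzero_vec R n => g (set_val w))) => [w|v w E].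
  exact: cg.
pose x : proj_space R n := (\pi_{eq_quot collinear_equiv R n} w)%qT.
have xw : hom_coord x (set_val w) by exists w.
move/eqP: E => E; have xv : hom_coord x (set_val v) by exists v => //; exact: E.
have [a a0 ->] := hom_coord_scale xv xw.
by rewrite hg // (hom_coord_neq0 xv).
Qed.

End ComplexTopology.

Section SmoothComplex.
Variables (R : realType) (k : nat) (U : set 'rV[R]_k).
Local Notation C := (CC R).
Hypothesis oU : open U.

Lemma CkC_cst r (c : C) : CkC U r (fun=> c).
Proof. by split; exact: Ck_on_cst. Qed.

Lemma CkC_add r (f g : 'rV[R]_k -> C) : CkC U r f -> CkC U r g -> CkC U r (fun x => f x + g x).
Proof.
move=> [f1 f2] [g1 g2]; split.
  by apply: (Ck_on_ext oU _ (Ck_on_add oU f1 g1)) => x _; rewrite reCD.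
by apply: (Ck_on_ext oU _ (Ck_on_add oU f2 g2)) => x _; rewrite imCD.
Qed.

Lemma CkC_mul r (f g : 'rV[R]_k -> C) : CkC U r f -> CkC U r g -> CkC U r (fun x => f x * g x).
Proof.
move=> [f1 f2] [g1 g2]; split.
  by apply: (Ck_on_ext oU _ (Ck_on_sub oU (Ck_on_mul oU f1 g1) (Ck_on_mul oU f2 g2))) => x _; rewrite reCM.
by apply: (Ck_on_ext oU _ (Ck_on_add oU (Ck_on_mul oU f1 g2) (Ck_on_mul oU f2 g1))) => x _; rewrite imCM.
Qed.

Lemma CkC_ext r (f g : 'rV[R]_k -> C) : f =1 g -> CkC U r f -> CkC U r g.
Proof. by move=> /funext ->. Qed.

Lemma CkC_conj r (f : 'rV[R]_k -> C) : CkC U r f -> CkC U r (fun x => (f x)^*).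
Proof.
move=> [f1 f2]; split; first by apply: (Ck_on_ext oU _ f1) => x _; rewrite reC_conj.
by apply: (Ck_on_ext oU _ (Ck_on_opp oU f2)) => x _; rewrite imC_conj.
Qed.

Lemma CkC_sub r (f g : 'rV[R]_k -> C) : CkC U r f -> CkC U r g -> CkC U r (fun x => f x - g x).
Proof.
move=> cf cg; apply: (@CkC_ext _ (fun x => f x + -1 * g x)) => [x|]; first by rewrite mulN1r.
by apply: CkC_add => //; apply: CkC_mul => //; exact: CkC_cst.
Qed.

Lemma CkC_sum r (I : Type) (s : seq I) (P : pred I) (f : I -> 'rV[R]_k -> C) :
  (forall i, P i -> CkC U r (f i)) -> CkC U r (fun x => \sum_(i <- s | P i) f i x).
Proof.
move=> cf; split.
  have H i : P i -> Ck_on U r (fun x => reC (f i x)) by case/cf.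
  by apply: (Ck_on_ext oU _ (Ck_on_sum s oU H)) => x _; rewrite reC_sum.
have H i : P i -> Ck_on U r (fun x => imC (f i x)) by case/cf.
by apply: (Ck_on_ext oU _ (Ck_on_sum s oU H)) => x _; rewrite imC_sum.
Qed.

Lemma CkC_prod r (I : Type) (s : seq I) (P : pred I) (f : I -> 'rV[R]_k -> C) :
  (forall i, P i -> CkC U r (f i)) -> CkC U r (fun x => \prod_(i <- s | P i) f i x).
Proof.
move=> cf; elim: s => [|i s IH].
  by apply: (@CkC_ext _ (fun=> 1)) (CkC_cst _ _) => x; rewrite big_nil.
case Pi : (P i); last by apply: CkC_ext IH => x; rewrite big_cons Pi.
apply: (@CkC_ext _ (fun x => f i x * \prod_(j <- s | P j) f j x)) => [x|]; first by rewrite big_cons Pi.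
by apply: CkC_mul => //; exact: cf.
Qed.

End SmoothComplex.

Section ComplexDerivative.
Variables (R : realType) (k : nat).
Local Notation C := (CC R).
Implicit Types (f g : 'rV[R]_k -> C).

Lemma is_dC_conj v f t d : is_dC v f t d -> is_dC v (fun u => (f u)^*) t d^*.
Proof.
move=> [d1 d2]; rewrite /is_dC reC_conj imC_conj.
have -> : (fun u => reC (f u)^*) = (fun u => reC (f u)) by apply/funext => u; rewrite reC_conj.
have -> : (fun u => imC (f u)^*) = (fun u => - imC (f u)) by apply/funext => u; rewrite imC_conj.
by split=> //; exact: is_deriveN.
Qed.

Lemma is_dC_sub v f g t d e : is_dC v f t d -> is_dC v g t e -> is_dC v (fun u => f u - g u) t (d - e).
Proof.
move=> df dg; apply: (@is_dC_ext _ _ _ (fun u => f u + -1 * g u)) => [u|]; first by rewrite mulN1r.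
by apply: (is_dC_eq (is_dC_add df (is_dC_scale _ dg))); rewrite mulN1r.
Qed.

Variables (J : finType) (v : 'rV[R]_k) (t : 'rV[R]_k).
Variables (Z : 'rV[R]_k -> J -> 'I_4 -> C) (dZ : J -> 'I_4 -> C).
Hypothesis HZ : forall j i, is_dC v (fun u => Z u j i) t (dZ j i).

Lemma is_dC_circle : is_dC v (fun u => circle (Z u)) t (dcircle (Z t) dZ).
Proof.
have c j i := is_dC_conj (HZ j i).
apply: is_dC_add; last first.
  apply: is_dC_scale; apply: is_dC_sum => j.
  apply: (is_dC_eq (is_dC_add
    (is_dC_mul (is_dC_mul (is_dC_mul (HZ j qS) (HZ j qW)) (c j qC)) (c j qD))
    (is_dC_mul (is_dC_mul (is_dC_mul (c j qS) (c j qW)) (HZ j qC)) (HZ j qD)))).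
  by rewrite /eps !rmorphD !rmorphM /= !conjCK; ring.
apply: is_dC_sum => j.
apply: (is_dC_eq (is_dC_sub
  (is_dC_mul (is_dC_mul (is_dC_mul (HZ j qC) (c j qC)) (HZ j qW)) (c j qW))
  (is_dC_mul (is_dC_mul (is_dC_mul (HZ j qS) (c j qS)) (HZ j qD)) (c j qD)))).
by rewrite /epk !rmorphB rmorphD !rmorphM /= !conjCK; ring.
Qed.

Lemma is_dC_twist b j i : is_dC v (fun u => twist b (Z u) j i) t (twist b dZ j i).
Proof.
case: b => //; move: i; apply: forall_I4; rewrite /twist /swE /vec4 /=; try exact: HZ.
exact: is_dC_scale.
Qed.

End ComplexDerivative.

Section NormSquare.
Variables (R : realType) (n : nat).
Implicit Types (v : 'rV[CC R]_n).

Definition vnorm v : R := \sum_a reC (v 0 a * (v 0 a)^*).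

Lemma vnorm_gt0 v : v != 0 -> 0 < vnorm v.
Proof.
move=> /rV0Pn [a va]; rewrite /vnorm (bigD1 a) //= ltr_wpDr ?reC_normsq_gt0 //.
by apply: sumr_ge0 => b _; exact: reC_normsq.
Qed.

Lemma vnormZ c v : vnorm (c *: v) = reC (c * c^*) * vnorm v.
Proof.
rewrite /vnorm mulr_sumr; apply: eq_bigr => a _.
have -> : (c *: v) 0 a * ((c *: v) 0 a)^* = (c * c^*) * (v 0 a * (v 0 a)^*) by rewrite mxE rmorphM /=; ring.
exact: (rC_reM (rC_normsq c) (rC_normsq (v 0 a))).
Qed.

End NormSquare.

(** * Nonvanishing functions and invariant forms of the factors *)

Section SegreCircles.
Variables (R : realType) (Ix : finType).
Local Notation C := (CC R).
Local Notation T := {ffun Ix -> 'I_4}.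
Local Notation N := (segN Ix).
Local Notation X := (@segreX R Ix).
Local Notation ee i := (delta_mx 0 i).
Implicit Types (v u : 'rV[C]_N.+1) (l : Ix).

Definition vcirc l b v : C := circle (twist b (slice v l)).

Lemma twist_scale b (Z : T -> 'I_4 -> C) (Z' : T -> 'I_4 -> C) c :
  (forall j i, Z' j i = c * Z j i) -> forall j i, twist b Z' j i = c * twist b Z j i.
Proof. by move=> E j i; case: b => /=; [apply: swE_scale|]; exact: E. Qed.

Lemma circle_scale (Z Z' : T -> 'I_4 -> C) c : (forall j i, Z' j i = c * Z j i) ->
  circle Z' = c * c * (c^* * c^*) * circle Z.
Proof.
move=> E; rewrite /circle; set K := c * c * _.
have -> : \sum_j ek (Z' j) = K * \sum_j ek (Z j).
  by rewrite mulr_sumr; apply: eq_bigr => j _; rewrite /K /ek !E !rmorphM /=; ring.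
have -> : \sum_j es (Z' j) = K * \sum_j es (Z j).
  by rewrite mulr_sumr; apply: eq_bigr => j _; rewrite /K /es !E !rmorphM /=; ring.
ring.
Qed.

(** [circle] is homogeneous of bidegree (2, 2), so division by the fourth power of the norm makes it
    invariant under all complex scalings. *)
Definition ncirc l b v : C := mkC (vnorm v * vnorm v)^-1 0 * vcirc l b v.

Lemma ncircZ l b c v : c != 0 -> v != 0 -> ncirc l b (c *: v) = ncirc l b v.
Proof.
move=> c0 v0; rewrite /ncirc vnormZ.
have E : vcirc l b (c *: v) = c * c * (c^* * c^*) * vcirc l b v.
  by apply: circle_scale; apply: twist_scale => j i; rewrite /slice mxE.
have n0 := vnorm_gt0 v0.
rewrite E (_ : c * c * (c^* * c^*) = mkC (reC (c * c^*) * reC (c * c^*)) 0); last first.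
  rewrite -rC_reM; last exact: rC_normsq.
    rewrite -rC_mk; first by ring.
    by rewrite /rC !rmorphM /= !conjCK; ring.
  exact: rC_normsq.
have := reC_normsq_gt0 c0; set k := reC (c * c^*) => k0.
rewrite mulrA; congr (_ * _); apply: complex_ext; rewrite ?reCM ?imCM /=; last by ring.
by rewrite mulr0 subr0; field; rewrite (gt_eqF k0) (gt_eqF n0).
Qed.

Lemma contC_slice (S : topologicalType) (f : S -> 'rV[C]_N.+1) x b l :
  (forall a, contC (fun y => f y 0 a) x) ->
  forall j i, contC (fun y => twist b (slice (f y) l) j i) x.
Proof.
move=> cf j i; case: b; last exact: cf.
move: i; apply: forall_I4; rewrite /twist /swE /vec4 /=; try exact: cf.
by apply: contC_mul; [exact: contC_cst|exact: cf].
Qed.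

Lemma contC_circle (S : topologicalType) (Z : S -> T -> 'I_4 -> C) x :
  (forall j i, contC (fun y => Z y j i) x) -> contC (fun y => circle (Z y)) x.
Proof.
move=> cZ; have cc j i := contC_conj (cZ j i).
apply: contC_add.
  apply: contC_sum => j.
  exact: (contC_add
    (contC_mul (contC_mul (contC_mul (cZ j qC) (cc j qC)) (cZ j qW)) (cc j qW))
    (contC_opp (contC_mul (contC_mul (contC_mul (cZ j qS) (cc j qS)) (cZ j qD)) (cc j qD)))).
apply: contC_mul; first exact: contC_cst.
apply: contC_sum => j.
exact: (contC_add
  (contC_mul (contC_mul (contC_mul (cZ j qS) (cZ j qW)) (cc j qC)) (cc j qD))
  (contC_mul (contC_mul (contC_mul (cc j qS) (cc j qW)) (cZ j qC)) (cZ j qD))).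
Qed.

Definition xcirc l b (x : proj_space R N) : C := ncirc l b (rep_vec x).

Lemma xcirc_cont l b x : contC (xcirc l b) x.
Proof.
have cn (w : @nonzero_vec R N) : contC (fun w : @nonzero_vec R N => ncirc l b (set_val w)) w.
  apply: contC_mul; last first.
    apply: (@contC_circle _ (fun w : @nonzero_vec R N => twist b (slice (set_val w) l))).
    by apply: contC_slice => a; exact: contC_entry.
  split; last exact: cont_cst.
  have cv : {for w, continuous (fun w : @nonzero_vec R N => vnorm (set_val w))}.
    apply: cont_sum => a; apply: contC_reC; apply: contC_mul; first exact: contC_entry.
    by apply: contC_conj; exact: contC_entry.
  apply: contV; last exact: contM.
  have w0 : set_val w != 0 := set_valP w.
  by rewrite mulf_neq0 // gt_eqF // vnorm_gt0.
split.
- apply: (@proj_fun_cont R N (fun v => reC (ncirc l b v))) => [w|c v c0 v0]; first by case: (cn w).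
  by rewrite ncircZ.
- apply: (@proj_fun_cont R N (fun v => imC (ncirc l b v))) => [w|c v c0 v0]; first by case: (cn w).
  by rewrite ncircZ.
Qed.

(** A slice with a nonzero entry serves as the point [x]; the vanishing minors make all other slices
    multiples of it. *)
Lemma segre_datum v l : segre v -> v != 0 -> exists x (y : T -> C),
  [/\ on_E x, exists i, x i != 0, exists j, y j != 0, forall j i, slice v l j i = y j * x i &
    forall u, segre_tangent v u -> exists p th, tangent_datum x y (slice u l) p th].
Proof.
move=> sv /rV0Pn [a va]; have [h1 h2] := sv l.
pose j0 := tinv a.
have z0 : exists i, slice v l j0 i != 0 by exists (j0 l); rewrite /slice upd_id /j0 tinvK.
have [y y1 Hy] := slices_rank1 z0 (fun j i i' => h1 j j0 i i').
exists (slice v l j0), y; split => //.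
- by exists j0; rewrite y1 oner_eq0.
move=> u tu; have two : (2%:R : C) != 0 by rewrite pnatr_eq0.
apply: slices_tangent => //.
- move=> j i i'; apply/eqP; rewrite -subr_eq0 -qdiff_minor tu //.
  by left; exists l, j, j0, i, i'.
- apply: (mulfI two); rewrite mulr0; have := qdiff_quad v u false l j0 => <-.
  by apply: tu; right; exists false, l, j0.
- apply: (mulfI two); rewrite mulr0; have := qdiff_quad v u true l j0 => <-.
  by apply: tu; right; exists true, l, j0.
Qed.

Lemma vcirc_neq0 l b v : segre v -> v != 0 -> vcirc l b v != 0.
Proof.
move=> sv v0; have [x [y [Ex x0 y0 Hy _]]] := segre_datum l sv v0.
exact: (circle_twist_neq0 Ex x0 y0 Hy).
Qed.

Lemma xcirc_neq0 l b x : X x -> xcirc l b x != 0.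
Proof.
move=> Xx; have xv := rep_vecP x; have v0 := hom_coord_neq0 xv.
rewrite mulf_neq0 //; last by apply: vcirc_neq0 => //; exact/(segreXP xv).
by rewrite eq_complex /= eqxx andbT invr_eq0 mulf_neq0 // gt_eqF // vnorm_gt0.
Qed.

Lemma xcirc_hom l b x v : hom_coord x v ->
  exists2 r : R, 0 < r & vcirc l b v = mkC r 0 * xcirc l b x.
Proof.
move=> xv; have [a a0 va] := hom_coord_scale (rep_vecP x) xv.
have v0 := hom_coord_neq0 (rep_vecP x).
have n0 := vnorm_gt0 (hom_coord_neq0 xv).
exists (vnorm v * vnorm v); first exact: mulr_gt0.
rewrite /xcirc -(ncircZ l b a0 v0) -va /ncirc mulrA.
rewrite [X in X * _](_ : _ = 1) ?mul1r //.
by apply: complex_ext; rewrite ?reCM ?imCM /=; [field; rewrite gt_eqF|ring].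
Qed.

(** The form of one factor on the whole cone; on tangent vectors it is the coefficient [th] along
    [ttan]. *)
Definition omega l v u : C := mkC (reC (oden (slice v l)))^-1 0 * onum (slice v l) (slice u l).

Lemma omega_datum l v u x y p th : v != 0 -> on_E x -> (exists i, x i != 0) ->
  (forall j i, slice v l j i = y j * x i) -> tangent_datum x y (slice u l) p th ->
  omega l v u = th.
Proof.
move=> /rV0Pn [a va] Ex x0 Hy Hu; rewrite /omega (onum_datum Ex x0 Hy Hu).
have d0 : 0 < reC (oden (slice v l)).
  by apply: oden_gt0; exists (tinv a), (tinv a l); rewrite /slice upd_id tinvK.
rewrite {2}(rC_mk (oden_rC _)) mulrCA.
rewrite [X in _ * X](_ : _ = 1) ?mulr1 //.
by apply: complex_ext; rewrite ?reCM ?imCM /=; [field; rewrite gt_eqF|ring].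
Qed.

End SegreCircles.

Section CoboundaryTwice.
Variables (R : realType) (T : topologicalType) (F : comPzRingType).

Lemma sing_face_sing_face k (i : 'I_k.+2) (j : 'I_k.+3) (i' : 'I_k.+3) (j' : 'I_k.+2)
    (s : singular_simplex R T k.+2) : (j <= i)%N -> i' = i.+1 :> nat -> j' = j :> nat ->
  sing_face i (sing_face j s) = sing_face j' (sing_face i' s).
Proof.
move=> ji hi hj; apply: eq_exist => /=; apply/funext => t /=; congr (sval s _).
apply: val_inj => /=; apply/rowP => l; rewrite !mxE.
have nz m (x y : 'I_m.+1) : unlift x y = None -> x = y :> nat.
  by case: unliftP => // ->.
have nl m (x y : 'I_m.+1) z : unlift x y = Some z -> y = bump x z :> nat.
  by case: unliftP => // w -> [->].
case E1: (unlift j l) => [l1|]; case E2: (unlift i' l) => [l2|] //.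
- rewrite !mxE; case E3: (unlift i l1) => [l3|]; case E4: (unlift j' l2) => [l4|] //.
  + congr (set_val t 0 _); apply: val_inj.
    have := nl _ _ _ _ E1; have := nl _ _ _ _ E2; have := nl _ _ _ _ E3; have := nl _ _ _ _ E4.
    rewrite /bump /= hi hj; lia.
  + have := nl _ _ _ _ E1; have := nl _ _ _ _ E2; have := nl _ _ _ _ E3; have := nz _ _ _ E4.
    by rewrite /bump /= hi hj => *; exfalso; lia.
  + have := nl _ _ _ _ E1; have := nl _ _ _ _ E2; have := nz _ _ _ E3; have := nl _ _ _ _ E4.
    by rewrite /bump /= hi hj => *; exfalso; lia.
- rewrite !mxE; case E3: (unlift i l1) => [l3|] //.
  have := nl _ _ _ _ E1; have := nz _ _ _ E2; have := nl _ _ _ _ E3.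
  by rewrite /bump /= hi => *; exfalso; lia.
- rewrite !mxE; case E4: (unlift j' l2) => [l4|] //.
  have := nz _ _ _ E1; have := nl _ _ _ _ E2; have := nl _ _ _ _ E4.
  by rewrite /bump /= hi hj => *; exfalso; lia.
Qed.

(** The double faces with [j <= i] and those with [i < j] are matched by the simplicial identity,
    with opposite signs. *)
Lemma coboundary_coboundary k (c : cochain R T F k) : coboundary (coboundary c) = 0.
Proof.
apply/funext => s; rewrite /coboundary.
pose G (j : 'I_k.+3) (i : 'I_k.+2) : F := (-1) ^+ (j + i) * c (sing_face i (sing_face j s)).
have -> : \sum_(j < k.+3) (-1) ^+ j * (\sum_(i < k.+2) (-1) ^+ i * c (sing_face i (sing_face j s))) =
    \sum_(p : 'I_k.+3 * 'I_k.+2) G p.1 p.2.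
  rewrite -(pair_bigA _ G); apply: eq_bigr => j _; rewrite mulr_sumr; apply: eq_bigr => i _.
  by rewrite /G mulrA exprD.
rewrite (bigID (fun p : 'I_k.+3 * 'I_k.+2 => (p.1 <= p.2)%N)) /=.
apply/eqP; rewrite addr_eq0 -sumrN; apply/eqP.
pose f (p : 'I_k.+3 * 'I_k.+2) : 'I_k.+3 * 'I_k.+2 := (lift ord0 p.2, inord p.1).
pose g (p : 'I_k.+3 * 'I_k.+2) : 'I_k.+3 * 'I_k.+2 := (widen_ord (leqnSn _) p.2, inord p.1.-1).
rewrite (reindex_onto g f) /=; last first.
  move=> [j i] /= ji; rewrite /g /f; congr pair; apply: val_inj => /=.
    by rewrite inordK //; have := ltn_ord i; lia.
  by rewrite inordK ?lift0 //=; have := ltn_ord i; lia.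
apply: eq_big => [[j i]|[j i]] /=.
  have hj := ltn_ord j; have hi := ltn_ord i.
  case: (ltnP i j) => ij.
    have E : (inord j.-1 : 'I_k.+2) = j.-1 :> nat by rewrite (@inordK k.+1) //; lia.
    apply/andP; split; first by rewrite E; lia.
    apply/eqP; rewrite /f /g /=; congr pair; apply: val_inj => /=; last by rewrite inordK.
    by rewrite E /bump; lia.
  apply/negbTE; apply/negP => /andP[h1 /eqP].
  have E : (inord j.-1 : 'I_k.+2) = j.-1 :> nat by rewrite (@inordK k.+1) //; lia.
  by rewrite /f /= => -[/(congr1 val) /=]; rewrite E /bump; lia.
move=> /andP[h1 /eqP [h2 _]]; have hj := ltn_ord j; have hi := ltn_ord i.
have E : (inord j.-1 : 'I_k.+2) = j.-1 :> nat by rewrite (@inordK k.+1) //; lia.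
move/(congr1 val): h2; rewrite /= E /bump => h2.
rewrite /G /= -mulNr; congr (_ * c _).
  rewrite E (_ : (j + i)%N = (i + j.-1).+1); last by lia.
  by rewrite exprS mulN1r opprK.
by apply: sing_face_sing_face => //=; rewrite E //; lia.
Qed.

End CoboundaryTwice.

(** * Smooth simplices and differential forms *)

Section SmoothLifts.
Variables (R : realType) (Ix : finType).
Local Notation C := (CC R).
Local Notation T := {ffun Ix -> 'I_4}.
Local Notation N := (segN Ix).
Local Notation X := (@segreX R Ix).
Local Notation ee i := (delta_mx 0 i).

Lemma CkC_circle k (U : set 'rV[R]_k) r (Z : 'rV[R]_k -> T -> 'I_4 -> C) : open U ->
  (forall j i, CkC U r (fun u => Z u j i)) -> CkC U r (fun u => circle (Z u)).
Proof.
move=> oU cZ; have cc j i := CkC_conj oU (cZ j i).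
apply: (CkC_add oU); last apply: (CkC_mul oU (CkC_cst oU _ _)).
  apply: (CkC_sum oU) => j _.
  exact: (CkC_sub oU
    (CkC_mul oU (CkC_mul oU (CkC_mul oU (cZ j qC) (cc j qC)) (cZ j qW)) (cc j qW))
    (CkC_mul oU (CkC_mul oU (CkC_mul oU (cZ j qS) (cc j qS)) (cZ j qD)) (cc j qD))).
apply: (CkC_sum oU) => j _.
exact: (CkC_add oU
  (CkC_mul oU (CkC_mul oU (CkC_mul oU (cZ j qS) (cZ j qW)) (cc j qC)) (cc j qD))
  (CkC_mul oU (CkC_mul oU (CkC_mul oU (cc j qS) (cc j qW)) (cZ j qC)) (cZ j qD))).
Qed.

Lemma CkC_twist k (U : set 'rV[R]_k) r b (Z : 'rV[R]_k -> T -> 'I_4 -> C) j i : open U ->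
  (forall j i, CkC U r (fun u => Z u j i)) -> CkC U r (fun u => twist b (Z u) j i).
Proof.
move=> oU cZ; case: b; last exact: cZ.
move: i; apply: forall_I4; rewrite /twist /swE /vec4 /=; try exact: cZ.
exact: (CkC_mul oU (CkC_cst oU _ _)).
Qed.

Variables (lf : nat -> Ix) (cj : nat -> bool).

Definition xe (n : nat) (b : bool) (x : X) : C := xcirc (lf n) b (set_val x).

Lemma xe_cont n b x : contC (xe n b) x.
Proof. exact: (contC_comp (@cont_set_val _ X x) (xcirc_cont (lf n) b (set_val x))). Qed.

Lemma xe_neq0 n b x : xe n b x != 0.
Proof. exact: (xcirc_neq0 (lf n) b (set_valP x)). Qed.

Definition cjC n (z : C) : C := if cj n then z^* else z.

Section Lift.
Variables (k : nat) (sg : singular_simplex R X k) (s : 'rV[R]_k -> 'rV[C]_N.+1).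
Hypothesis sl : smooth_lift sg s.

Lemma smooth_lift_hom t : corner t -> hom_coord (set_val (spoint sg t)) (s t).
Proof.
move=> ct; have [_ h] := sl; have := h (bary t).
congr (hom_coord _ (s _)); rewrite bary_val //; apply/rowP => j.
by rewrite mxE (_ : rshift 1 j = lift ord0 j) ?ins_lift //; apply: val_inj.
Qed.

Lemma smooth_lift_segre t : corner t -> segre (s t).
Proof. by move=> ct; apply/(segreXP (smooth_lift_hom ct)); exact: (set_valP (spoint sg t)). Qed.

Lemma smooth_lift_dC U t i a : open U -> U t -> (forall j, smooth_on U (fun t => s t 0 j)) ->
  is_dC (ee i) (fun u => s u 0 a) t (row i (Defs.jacobian s t) 0 a).
Proof.
move=> oU Ut cs; have ca : CkC U 1 (fun u => s u 0 a) by exact: cs.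
by apply: (is_dC_eq (CkC_is_dC i ca Ut)); rewrite !mxE.
Qed.

(** The equations of the variety vanish along the lift on the simplex, hence so do their
    derivatives, boundary points included. *)
Lemma smooth_lift_tangent t i : corner t -> segre_tangent (s t) (row i (Defs.jacobian s t)).
Proof.
move=> ct q qs; have [[U [oU cU cs]] _] := sl.
have d a := smooth_lift_dC i a oU (cU _ ct) cs.
have dq : is_dC (ee i) (fun u => qval q (s u)) t (qdiff q (s t) (row i (Defs.jacobian s t))).
  apply: is_dC_sum => e; apply: is_dC_scale.
  by apply: (is_dC_eq (is_dC_mul (d e.2.1) (d e.2.2))); ring.
have cq : CkC U 1 (fun u => qval q (s u)).
  apply: (CkC_sum oU) => e _; apply: (CkC_mul oU (CkC_cst oU _ _)).
  by apply: (CkC_mul oU); exact: cs.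
have z u : corner u -> qval q (s u) = 0.
  by move=> cu; have /segre_eqsP H := smooth_lift_segre cu; exact: H.
case: cq => c1 c2; rewrite -(is_dC_val dq) /dC.
rewrite (corner_derive_eq0 i oU cU c1) ?(corner_derive_eq0 i oU cU c2) // => u cu; by rewrite z.
Qed.

(** Positive factors do not change arguments, so the circles of the lifted vectors may replace those
    of the points of projective space. The angles then move at the speed given by the invariant form
    on the velocity of the lift, with the factor 2 of the amplitude of [2 Re z]. *)
Lemma smooth_lift_rep n : exists h, rep (zlift xe cj) n sg h /\
  forall i t, corner t -> dC (ee i) h t =
    mkC (2 / ell_period R) 0 * cjC n (omega (lf n) (s t) (row i (Defs.jacobian s t))).
Proof.
have [[U [oU cU cs]] _] := sl; set l := lf n.
pose E b t := vcirc l b (s t).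
have cZ r b j i : CkC U r (fun u => twist b (slice (s u) l) j i).
  by apply: (CkC_twist _ _ _ oU) => j' i'; exact: cs.
have cE b : CkC U 2 (E b) by apply: (CkC_circle oU) => j i; exact: cZ.
have HE b t : corner t -> exists2 r, 0 < r & E b t = mkC r 0 * xe n b (spoint sg t).
  by move=> ct; exact: (xcirc_hom l b (smooth_lift_hom ct)).
have [h [rh dh]] := zlift_rep cj xe_cont xe_neq0 oU cU cE HE.
exists h; split => // i t ct; rewrite dh //.
have dE b : dC (ee i) (E b) t = dcircle (twist b (slice (s t) l)) (twist b (slice (row i (Defs.jacobian s t)) l)).
  apply: is_dC_val; apply: (is_dC_circle (Z := fun u => twist b (slice (s u) l))) => j a.
  apply: (is_dC_twist (Z := fun u => slice (s u) l)) => j' a'.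
  exact: (smooth_lift_dC i _ oU (cU _ ct) cs).
have sv := smooth_lift_segre ct; have v0 := hom_coord_neq0 (smooth_lift_hom ct).
have [x [y [Ex x0 y0 Hy Hu]]] := segre_datum l sv v0.
have [p [th Ht]] := Hu _ (smooth_lift_tangent i ct).
rewrite !dE /E !(zslope_twist Ex x0 y0 Hy _ Ht) (omega_datum v0 Ex x0 Hy Ht) /cjC.
by case: (cj n); apply: complex_ext; rewrite ?reCM ?imCM ?reC_conj ?imC_conj /= ?expr0 ?expr1; ring.
Qed.

Lemma smooth_lift_reps m : has_reps (zlift xe cj) m sg.
Proof. by move=> n _; have [h [rh _]] := smooth_lift_rep n; exists h. Qed.

End Lift.

Section Form.
Variables (k p : nat).

Definition ocoef l (v : 'rV[C]_N.+1) (a : 'I_N.+1) : C := mkC (2 / ell_period R) 0 * omega l v (ee a).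

(** The wedge product of the forms of the factors [lf 0, .., lf (k - 1)], the first [p] of them
    holomorphic and the others conjugated. *)
Definition fform : diff_form R N k := fun m v =>
  \prod_(j < k) (if (j < p)%N then ocoef (lf j) v (m j) else (ocoef (lf j) v (m j))^*).

Lemma omega_lin l (v u : 'rV[C]_N.+1) : omega l v u = \sum_a u 0 a * omega l v (ee a).
Proof.
rewrite /omega; under eq_bigr do rewrite mulrCA; rewrite -mulr_sumr; congr (_ * _).
have S I : u 0 (tidx I) = \sum_a u 0 a * (ee a : 'rV[C]_N.+1) 0 (tidx I).
  rewrite (bigD1 (tidx I)) //= mxE !eqxx mulr1 big1 ?addr0 // => a na.
  by rewrite mxE eq_sym (negbTE na) andbF mulr0.
transitivity (\sum_j \sum_c \sum_a u 0 a * ((eN c (slice v l j))^* * eM c (slice v l j) (slice (ee a) l j))).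
  apply: eq_bigr => j _; apply: eq_bigr => c _.
  by rewrite /eM /slice !S !mulr_sumr -sumrB mulr_sumr; apply: eq_bigr => a _; ring.
under eq_bigr do rewrite exchange_big /=.
rewrite exchange_big /=; apply: eq_bigr => a _; rewrite /onum mulr_sumr; apply: eq_bigr => j _.
by rewrite mulr_sumr.
Qed.

(** Multilinearity in the columns; it identifies the sum over multi-indices in [form_val] with one
    determinant of values of 1-forms. *)
Lemma det_sum_cols (n : nat) (I : finType) (c : 'I_n -> I -> C) (B : 'I_n -> 'I_n -> I -> C) :
  \det (\matrix_(i, j) \sum_a c j a * B i j a) =
  \sum_(m : {ffun 'I_n -> I}) (\prod_j c j (m j)) * \det (\matrix_(i, j) B i j (m j)).
Proof.
transitivity (\sum_(s : 'S_n) (-1) ^+ s * \sum_(m : {ffun 'I_n -> I}) \prod_j (c j (m j) * B (s j) j (m j))).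
  rewrite -det_tr /determinant; apply: eq_bigr => s _; congr (_ * _); rewrite -(bigA_distr_bigA (fun j a => c j a * B (s j) j a)) /=.
  by apply: eq_bigr => j _; rewrite !mxE.
under eq_bigr do rewrite mulr_sumr; rewrite exchange_big /=; apply: eq_bigr => m _.
rewrite -det_tr mulr_sumr; apply: eq_bigr => s _; rewrite big_split /= mulrCA; congr (_ * (_ * _)).
by apply: eq_bigr => j _; rewrite !mxE.
Qed.

Lemma form_val_fform v (V : 'M[C]_(k, N.+1)) : form_val p fform v V =
  \det (\matrix_(i < k, j < k) (if (j < p)%N then mkC (2 / ell_period R) 0 * omega (lf j) v (row i V)
     else (mkC (2 / ell_period R) 0 * omega (lf j) v (row i V))^*)).
Proof.
rewrite /form_val /fform.
pose c (j : 'I_k) a : C := if (j < p)%N then ocoef (lf j) v a else (ocoef (lf j) v a)^*.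
pose B (i j : 'I_k) a : C := if (j < p)%N then V i a else (V i a)^*.
rewrite -(det_sum_cols c B); congr (\det _); apply/matrixP => i j; rewrite !mxE /c /B.
have E : mkC (2 / ell_period R) 0 * omega (lf j) v (row i V) = \sum_a ocoef (lf j) v a * V i a.
  by rewrite omega_lin mulr_sumr; apply: eq_bigr => a _; rewrite mxE /ocoef; ring.
case: ifP => _; rewrite E //; rewrite rmorph_sum; apply: eq_bigr => a _; by rewrite rmorphM.
Qed.

End Form.

End SmoothLifts.

(** * Derivatives of the invariant forms along lines *)

Section FormCalculus.
Variables (R : realType) (k : nat).
Local Notation C := (CC R).

Lemma is_dC_inv_re (v : 'rV[R]_k) (f : 'rV[R]_k -> C) t d : reC (f t) != 0 -> is_dC v f t d ->
  is_dC v (fun u => mkC (reC (f u))^-1 0) t (mkC (- (reC d * ((reC (f t))^-1 * (reC (f t))^-1))) 0).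
Proof.
move=> f0 [d1 _]; split; first exact: (is_derive_inv f0 d1).
exact: is_derive_cst.
Qed.

Variables (J : finType) (v : 'rV[R]_k) (t : 'rV[R]_k).
Variables (Z : 'rV[R]_k -> J -> 'I_4 -> C) (dZ : J -> 'I_4 -> C).
Hypothesis HZ : forall j i, is_dC v (fun u => Z u j i) t (dZ j i).

Lemma is_dC_eN a j : is_dC v (fun u => eN a (Z u j)) t (eDN a (Z t j) (dZ j)).
Proof.
move: a; apply: forall_I3; rewrite /eN /eDN /=.
- by apply: (is_dC_eq (is_dC_mul (HZ j qC) (HZ j qD))); ring.
- by apply: (is_dC_eq (is_dC_mul (HZ j qD) (HZ j qW))); ring.
- by apply: (is_dC_eq (is_dC_mul (HZ j qC) (HZ j qW))); ring.
Qed.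

Lemma is_dC_onum U : is_dC v (fun u => onum (Z u) U) t (dnum (Z t) dZ U).
Proof.
apply: is_dC_sum => j; apply: is_dC_sum => a.
have dM : is_dC v (fun u => eM a (Z u j) (U j)) t (eM a (dZ j) (U j)).
  rewrite /eM; apply: is_dC_sub.
    by apply: (is_dC_eq (is_dC_mul (HZ j _) (is_dC_cst v _ t))); ring.
  by apply: (is_dC_eq (is_dC_mul (HZ j qS) (is_dC_cst v _ t))); ring.
by apply: (is_dC_eq (is_dC_mul (is_dC_conj (is_dC_eN a j)) dM)); ring.
Qed.

Lemma is_dC_oden : is_dC v (fun u => oden (Z u)) t (dden (Z t) dZ).
Proof.
have dQ (q : ('I_4 -> C) -> ('I_4 -> C) -> C) :
    (forall j, is_dC v (fun u => q (Z u j) (Z u j)) t (2%:R * q (Z t j) (dZ j))) ->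
    forall j, is_dC v (fun u => q (Z u j) (Z u j) * (q (Z u j) (Z u j))^*) t
      (2%:R * q (Z t j) (dZ j) * (q (Z t j) (Z t j))^* + q (Z t j) (Z t j) * (2%:R * q (Z t j) (dZ j))^*).
  by move=> H j; apply: (is_dC_eq (is_dC_mul (H j) (is_dC_conj (H j)))).
apply: is_dC_sum => j; apply: is_dC_add.
  apply: is_dC_sum => a.
  exact: (is_dC_mul (is_dC_eN a j) (is_dC_conj (is_dC_eN a j))).
apply: is_dC_add; apply: dQ => i.
- apply: (is_dC_eq (is_dC_sub (is_dC_add (is_dC_mul (HZ i qS) (HZ i qS)) (is_dC_mul (HZ i qC) (HZ i qC)))
    (is_dC_mul (HZ i qW) (HZ i qW)))).
  by rewrite /quadA; ring.
- apply: (is_dC_eq (is_dC_sub (is_dC_add (is_dC_mul (HZ i qS) (HZ i qS)) (is_dC_mul (HZ i qW) (HZ i qW)))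
    (is_dC_mul (HZ i qD) (HZ i qD)))).
  by rewrite /quadB; ring.
Qed.

End FormCalculus.

Lemma is_derive_coord (R : realType) k (x v : 'rV[R]_k) j : is_derive x v (fun w : 'rV[R]_k => w 0 j) (v 0 j).
Proof.
have E : (fun h : R => h^-1 *: (((fun w : 'rV[R]_k => w 0 j) \o shift x) (h *: v) - x 0 j)) @ (0 : R)^' --> v 0 j.
  have : (cst (v 0 j)) @ (0 : R)^' --> v 0 j by exact: cvg_cst.
  apply: cvg_trans; apply: near_eq_cvg; near=> h.
  rewrite /= !mxE addrK /GRing.scale /= mulrA mulVf ?mul1r //.
  by near: h; exact: nbhs_dnbhs_neq.
by apply: DeriveDef; [apply/cvg_ex; exists (v 0 j)|apply: cvg_lim => //; exact: E].
Unshelve. all: by end_near. Qed.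

Section Line.
Variables (R : realType) (N : nat).
Local Notation C := (CC R).

Definition cline (x v : 'rV[C]_N) (w : 'rV[R]_1) : 'rV[C]_N := x + mkC (w 0 0) 0 *: v.

Lemma dir_deriv_cline (f : 'rV[C]_N -> C) x v d :
  is_dC (const_mx 1) (fun w => f (cline x v w)) 0 d -> dir_deriv f x v = d.
Proof.
move=> [d1 d2]; rewrite /dir_deriv.
have main (p : C -> R) e : is_derive (0 : 'rV[R]_1) (const_mx 1) (fun w => p (f (cline x v w))) e ->
    derive1 (fun t : R => p (f (x + mkC t 0 *: v))) 0 = e.
  move=> de; rewrite derive1E.
  have -> : (fun t : R => p (f (x + mkC t 0 *: v))) = (fun t : R => p (f (cline x v (t *: const_mx 1)))).
    by apply/funext => t; rewrite /cline !mxE mulr1.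
  have [|h|_ ->//] := is_derive_line (c := fun h : R => h *: const_mx 1) (t := 0) _ _ de.
    by rewrite scale0r.
  by rewrite !addr0.
by rewrite (main _ _ d1) (main _ _ d2) mkCK.
Qed.

Lemma cline0 x v : cline x v 0 = x.
Proof. by rewrite /cline mxE; apply/rowP => a; rewrite !mxE (_ : mkC 0 0 = 0) // mul0r addr0. Qed.

Lemma is_dC_cline x v a : is_dC (const_mx 1) (fun w => cline x v w 0 a) 0 (v 0 a).
Proof.
have dw : is_dC (const_mx 1 : 'rV[R]_1) (fun w : 'rV[R]_1 => mkC (w 0 0) 0) 0 1.
  split; last exact: is_derive_cst.
  by apply: (is_derive_eq (is_derive_coord 0 (const_mx 1) 0)); rewrite mxE.
apply: (@is_dC_ext _ _ _ (fun w => x 0 a + mkC (w 0 0) 0 * v 0 a)) => [w|]; first by rewrite !mxE.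
by apply: (is_dC_eq (is_dC_add (is_dC_cst _ _ _) (is_dC_mul dw (is_dC_cst _ _ _)))); ring.
Qed.

End Line.

(* Closedness, with the differentiability that makes it stable under linear
   combinations. *)
Definition line_closed (R : realType) n (X : set (proj_space R n)) k p (f : diff_form R n k) : Prop :=
  forall x v (V : 'M[CC R]_(k.+1, n.+1)), X x -> hom_coord x v ->
  (forall i, cone_tangent X v (row i V)) -> exists2 D : 'I_k.+1 -> CC R,
    forall i, is_dC (const_mx 1) (fun t => form_val p f (cline v (row i V) t) (row' i V)) 0 (D i) &
    \sum_(i < k.+1) (-1) ^+ i * D i = 0.

Section ClosedForms.
Variables (R : realType) (Ix : finType) (lf : nat -> Ix) (k p : nat).
Local Notation C := (CC R).
Local Notation N := (segN Ix).
Local Notation X := (@segreX R Ix).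
Local Notation f := (@fform R Ix lf k p).
Local Notation kap := (mkC (2 / ell_period R) 0).

Lemma is_dC_omega l (x v w : 'rV[C]_N.+1) : x != 0 ->
  is_dC (const_mx 1) (fun t => omega l (cline x v t) w) 0
    (mkC (- (reC (dden (slice x l) (slice v l)) *
       ((reC (oden (slice x l)))^-1 * (reC (oden (slice x l)))^-1))) 0 * onum (slice x l) (slice w l) +
     mkC (reC (oden (slice x l)))^-1 0 * dnum (slice x l) (slice v l) (slice w l)).
Proof.
move=> /rV0Pn [a xa].
have d0 : reC (oden (slice x l)) != 0.
  by rewrite gt_eqF //; apply: oden_gt0; exists (tinv a), (tinv a l); rewrite /slice upd_id tinvK.
have HZ j i : is_dC (const_mx 1) (fun t => slice (cline x v t) l j i) 0 (slice v l j i) by exact: is_dC_cline.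
have dd := is_dC_oden (Z := fun t => slice (cline x v t) l) HZ.
have dn := is_dC_onum (Z := fun t => slice (cline x v t) l) HZ (slice w l).
have c0 : cline x v 0 = x by exact: cline0.
have d0' : reC (oden (slice (cline x v 0) l)) != 0 by rewrite c0.
by apply: (is_dC_eq (is_dC_mul (is_dC_inv_re d0' dd) dn)); rewrite c0; ring.
Qed.

Definition domega l (x v w : 'rV[C]_N.+1) : C :=
  dC (const_mx 1) (fun t => omega l (cline x v t) w) 0.

(** The exterior derivative of [omega] vanishes on tangent vectors: this is [closed_datum] after the
    quotient rule. *)
Lemma domega_sym l x v w : segre x -> x != 0 -> segre_tangent x v -> segre_tangent x w ->
  domega l x v w = domega l x w v.
Proof.
move=> sx x0 tv tw; have [z [y [Ez z0 y0 Hy Hu]]] := segre_datum l sx x0.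
have [q [th Hv]] := Hu _ tv; have [q' [et Hw]] := Hu _ tw.
rewrite /domega (is_dC_val (is_dC_omega l v w x0)) (is_dC_val (is_dC_omega l w v x0)).
rewrite (onum_datum Ez z0 Hy Hv) (onum_datum Ez z0 Hy Hw).
have d0 : reC (oden (slice x l)) != 0.
  have /rV0Pn [a xa] := x0; rewrite gt_eqF //; apply: oden_gt0.
  by exists (tinv a), (tinv a l); rewrite /slice upd_id tinvK.
have rdd u : mkC (reC (dden (slice x l) (slice u l))) 0 = dden (slice x l) (slice u l).
  have cross (a b : C) : rC (a * b^* + b * a^*) by rewrite /rC rmorphD !rmorphM /= !conjCK; ring.
  have rD (a b : C) : rC a -> rC b -> rC (a + b) by rewrite /rC rmorphD /= => -> ->.
  have rS (I : finType) (g : I -> C) : (forall i, rC (g i)) -> rC (\sum_i g i).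
    by move=> h; rewrite /rC rmorph_sum; apply: eq_bigr => i _; exact: h.
  symmetry; apply: rC_mk; apply: (rS) => j; apply: (rD); first by apply: (rS) => a; exact: cross.
  by apply: (rD); exact: cross.
have K u c : mkC (- (reC (dden (slice x l) (slice u l)) *
     ((reC (oden (slice x l)))^-1 * (reC (oden (slice x l)))^-1))) 0 * (c * oden (slice x l)) =
   mkC (reC (oden (slice x l)))^-1 0 * - (c * dden (slice x l) (slice u l)).
  rewrite (rC_mk (oden_rC _)) -(rdd u).
  by apply: complex_ext; rewrite !(reCM, imCM, reCN, imCN) /=; field.
rewrite !K -!mulrDr; congr (_ * _); have := closed_datum Ez z0 Hy Hv Hw.
by rewrite addrC => ->; rewrite addrC.
Qed.

Definition wform j (x w : 'rV[C]_N.+1) : C :=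
  if (j < p)%N then kap * omega (lf j) x w else (kap * omega (lf j) x w)^*.

Definition dwform j (x v w : 'rV[C]_N.+1) : C :=
  if (j < p)%N then kap * domega (lf j) x v w else (kap * domega (lf j) x v w)^*.

Lemma is_dC_wform j (x v w : 'rV[C]_N.+1) : x != 0 ->
  is_dC (const_mx 1) (fun t => wform j (cline x v t) w) 0 (dwform j x v w).
Proof.
move=> x0; rewrite /wform /dwform /domega.
have d := is_dC_omega (lf j) v w x0; rewrite (is_dC_val d).
have dk := is_dC_scale kap d.
case: ifP => _; first exact: dk.
exact: (is_dC_conj dk).
Qed.

(** The same cancellation as for the divergence in Stokes' formula, with [domega_sym] in place of
    the symmetry of second derivatives. *)
Lemma line_closed_fform : line_closed X p f.
Proof.
move=> x v V Xx xv tV; have sx : segre v by apply/(segreXP xv).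
have v0 := hom_coord_neq0 xv.
have tan i : segre_tangent v (row i V) by exact/cone_tangent_segre/tV.
pose m : 'I_k.+1 := ord_max.
pose M (y : 'rV[C]_N.+1) : 'M[C]_k.+1 := \matrix_(j, i) wform j y (row i V).
(* Omitting the [i]-th vector leaves a cofactor of the last row of a square matrix of size [k + 1],
   so that all terms are indexed by permutations. *)
have fE (i : 'I_k.+1) y : form_val p f y (row' i V) = (-1) ^+ (k + i) * cofactor (M y) m i.
  rewrite form_val_fform /cofactor mulrA -exprD addnn -mul2n exprM sqrrN expr1n expr1n mul1r.
  rewrite -det_tr; congr (\det _); apply/matrixP => a b; rewrite !mxE /wform.
  rewrite (_ : row b (row' i V) = row (lift i b) V); last by apply/rowP => c; rewrite !mxE.
  by rewrite (_ : val (lift m a) = a) // /m /= bump_max.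
pose dcofs (s : 'S_k.+1) : C := \sum_(c | m != c) \prod_(j | m != j)
  (if j == c then dwform c v (row (s m) V) (row (s c) V) else wform j v (row (s j) V)).
exists (fun i : 'I_k.+1 => (-1) ^+ (k + i) * \sum_(s : 'S_k.+1 | s m == i) (-1) ^+ s * dcofs s) => [i|].
  apply: (@is_dC_ext _ _ _ (fun t => (-1) ^+ (k + i) * \sum_(s : 'S_k.+1 | s m == i)
     (-1) ^+ s * \prod_(j | m != j) wform j (cline v (row i V) t) (row (s j) V))).
    move=> t; rewrite fE expand_cofactor; congr (_ * _); apply: eq_bigr => s _; congr (_ * _).
    by apply: eq_bigr => j _; rewrite mxE.
  apply: is_dC_scale; under [X in is_dC _ _ _ X]eq_bigr => s /eqP si do rewrite /dcofs si.
  apply: is_dC_sum => s; apply: is_dC_scale.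
  apply: is_dC_eq.
    apply: is_dC_prod; first exact: index_enum_uniq.
    by move=> j; exact: (is_dC_wform j (row i V) (row (s j) V) v0).
  by apply: eq_bigr => c _; apply: eq_bigr => j _; rewrite cline0.
transitivity ((-1) ^+ k * \sum_(i < k.+1) \sum_(s : 'S_k.+1 | s m == i) (-1) ^+ s * dcofs s).
  rewrite mulr_sumr; apply: eq_bigr => i _; rewrite mulrA -exprD addnCA addnn -mul2n exprD exprM sqrrN.
  by rewrite !expr1n mulr1.
rewrite (exchange_big_dep xpredT) //= (eq_bigr (fun s : 'S_k.+1 => (-1) ^+ s * dcofs s)); last first.
  by move=> s _; rewrite (big_pred1 (s m)) // => i; rewrite eq_sym.
rewrite /dcofs; under eq_bigr do rewrite mulr_sumr.
rewrite exchange_big /= big1 ?mulr0 // => c mc.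
apply: (@alternating_sum_eq0 _ _ c m) => [|s]; first by rewrite eq_sym.
apply: eq_bigr => j mj; rewrite !permM tpermR tpermL; case: eqP => [_|/eqP jc].
  by rewrite /dwform (domega_sym (lf c) sx v0 (tan (s c)) (tan (s m))).
by rewrite tpermD // eq_sym.
Qed.

End ClosedForms.

(** * Smoothness and invariance of the forms *)

Section FormOnP.
Variables (R : realType) (Ix : finType) (lf : nat -> Ix) (k p : nat).
Local Notation C := (CC R).
Local Notation N := (segN Ix).
Local Notation T := {ffun Ix -> 'I_4}.
Local Notation f := (@fform R Ix lf k p).
Local Notation kap := (mkC (2 / ell_period R) 0).

Lemma of_real_neq0 n (u : 'rV[R]_(n + n)) : u != 0 -> of_real u != 0.
Proof.
move=> /rV0Pn [i ui]; apply/eqP => h; case/negP: ui; apply/eqP.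
have e j : mkC (lsubmx u 0 j) (rsubmx u 0 j) = 0 by have := congr1 (fun M : 'rV[C]_n => M 0 j) h; rewrite !mxE.
by case: (split_ordP i) => j ->; [have := congr1 (@reC R) (e j)|have := congr1 (@imC R) (e j)]; rewrite /= mxE.
Qed.

Lemma CkC_of_real n (U : set 'rV[R]_(n + n)) r j : open U -> CkC U r (fun u => of_real u 0 j).
Proof.
move=> oU; split.
  by apply: (Ck_on_ext oU _ (Ck_on_coord r (lshift n j) oU)) => u _; rewrite mxE /= mxE.
by apply: (Ck_on_ext oU _ (Ck_on_coord r (rshift n j) oU)) => u _; rewrite mxE /= mxE.
Qed.

Lemma open_neq0 n : open [set u : 'rV[R]_n | u != 0].
Proof.
rewrite openE => u /rV0Pn [i ui].
have nu := @cont_coord _ _ i u _ (open_nbhs_nbhs (conj (@open_neq R 0) ui)).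
have {}nu : nbhs u (fun v : 'rV[R]_n => v 0 i != 0) := nu.
by rewrite /interior /=; apply: filterS nu => v vi; apply/rV0Pn; exists i.
Qed.

Section Smooth.
Variables (n : nat) (U : set 'rV[R]_n) (r : nat) (Z : 'rV[R]_n -> T -> 'I_4 -> C).
Hypothesis oU : open U.
Hypothesis cZ : forall j i, CkC U r (fun u => Z u j i).

Lemma CkC_eN a j : CkC U r (fun u => eN a (Z u j)).
Proof. by move: a; apply: forall_I3; exact: (CkC_mul oU). Qed.

Lemma CkC_onum W : CkC U r (fun u => onum (Z u) W).
Proof.
apply: (CkC_sum oU) => j _; apply: (CkC_sum oU) => a _; apply: (CkC_mul oU).
  exact: (CkC_conj oU (CkC_eN a j)).
by apply: (CkC_sub oU); apply: (CkC_mul oU) => //; exact: (CkC_cst oU).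
Qed.

Lemma CkC_oden : CkC U r (fun u => oden (Z u)).
Proof.
have nsq (g : 'rV[R]_n -> C) : CkC U r g -> CkC U r (fun u => g u * (g u)^*).
  by move=> cg; exact: (CkC_mul oU cg (CkC_conj oU cg)).
apply: (CkC_sum oU) => j _; apply: (CkC_add oU).
  by apply: (CkC_sum oU) => a _; apply: nsq; exact: CkC_eN.
apply: (CkC_add oU); apply: nsq.
- exact: (CkC_sub oU (CkC_add oU (CkC_mul oU (cZ j qS) (cZ j qS)) (CkC_mul oU (cZ j qC) (cZ j qC)))
    (CkC_mul oU (cZ j qW) (cZ j qW))).
- exact: (CkC_sub oU (CkC_add oU (CkC_mul oU (cZ j qS) (cZ j qS)) (CkC_mul oU (cZ j qW) (cZ j qW)))
    (CkC_mul oU (cZ j qD) (cZ j qD))).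
Qed.

End Smooth.

Lemma smooth_form_fform : smooth_form f.
Proof.
move=> m r; have oU : open [set u : 'rV[R]_(N.+1 + N.+1) | u != 0] := @open_neq0 _.
apply: (CkC_prod oU) => j _.
have co : CkC [set u : 'rV[R]_(N.+1 + N.+1) | u != 0] r (fun u => ocoef (lf j) (of_real u) (m j)).
  have cZ J i : CkC [set u : 'rV[R]_(N.+1 + N.+1) | u != 0] r (fun u => slice (of_real u) (lf j) J i).
    exact: CkC_of_real.
  apply: (CkC_mul oU (CkC_cst oU _ _)); apply: (CkC_mul oU); last exact: (CkC_onum oU cZ).
  split; last exact: Ck_on_cst.
  have [c1 _] := CkC_oden oU cZ; apply: (Ck_on_inv oU _ c1) => u /of_real_neq0 /rV0Pn [a ua].
  by rewrite gt_eqF //; apply: oden_gt0; exists (tinv a), (tinv a (lf j)); rewrite /slice upd_id tinvK.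
by case: (j < p)%N; [exact: co|exact: (CkC_conj oU co)].
Qed.

Lemma omegaZ l (x u : 'rV[C]_N.+1) a : a != 0 -> omega l (a *: x) (a *: u) = omega l x u.
Proof.
move=> a0; have S (v : 'rV[C]_N.+1) J i : slice (a *: v) l J i = a * slice v l J i by rewrite /slice mxE.
pose K := a * a * (a^* * a^*).
have KR : rC K by rewrite /rC /K !rmorphM /= !conjCK; ring.
have K0 : reC K != 0.
  have -> : K = (a * a) * (a * a)^* by rewrite /K rmorphM.
  by rewrite gt_eqF // reC_normsq_gt0 // mulf_neq0.
have NE c J : eN c (slice (a *: x) l J) = a * a * eN c (slice x l J).
  by move: c; apply: forall_I3; rewrite /eN /= !S; ring.
have h1 : onum (slice (a *: x) l) (slice (a *: u) l) = K * onum (slice x l) (slice u l).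
  rewrite /onum mulr_sumr; apply: eq_bigr => J _; rewrite mulr_sumr; apply: eq_bigr => c _.
  have -> : eM c (slice (a *: x) l J) (slice (a *: u) l J) = a * a * eM c (slice x l J) (slice u l J).
    by rewrite /eM !S; ring.
  by rewrite NE !rmorphM /= /K; ring.
have h2 : oden (slice (a *: x) l) = K * oden (slice x l).
  rewrite /oden mulr_sumr; apply: eq_bigr => J _.
  have -> : quadA (slice (a *: x) l J) (slice (a *: x) l J) = a * a * quadA (slice x l J) (slice x l J).
    by rewrite /quadA !S; ring.
  have -> : quadB (slice (a *: x) l J) (slice (a *: x) l J) = a * a * quadB (slice x l J) (slice x l J).
    by rewrite /quadB !S; ring.
  rewrite [in RHS]mulrDr mulr_sumr; congr (_ + _); last by rewrite !rmorphM /= /K; ring.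
  by apply: eq_bigr => c _; rewrite NE !rmorphM /= /K; ring.
clearbody K; rewrite /omega h1 h2 rC_reM //; last exact: oden_rC.
rewrite {2}(rC_mk KR) invfM mulrA.
(* [x] may be 0; then the inverse of the denominator is 0 by convention and both sides vanish. *)
case: (eqVneq (reC (oden (slice x l))) 0) => [->|d0].
  by rewrite invr0 mulr0 (_ : mkC 0 0 = 0) // !mul0r.
congr (_ * _); apply: complex_ext; rewrite !(reCM, imCM) /=; last by ring.
by field; rewrite d0 K0.
Qed.

Lemma omega_radial l (x : 'rV[C]_N.+1) a : omega l x (a *: x) = 0.
Proof.
rewrite /omega (_ : onum _ _ = 0) ?mulr0 // /onum big1 // => J _; rewrite big1 // => c _.
by rewrite /eM /slice !mxE; ring.
Qed.

Lemma basic_form_fform : basic_form p f.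
Proof.
split=> [x V a x0 a0|x V a i x0 Vi]; rewrite !form_val_fform.
  congr (\det _); apply/matrixP => i j; rewrite !mxE.
  by rewrite (_ : row i (a *: V) = a *: row i V) ?omegaZ //; apply/rowP => b; rewrite !mxE.
rewrite (expand_det_row _ i) big1 // => j _; rewrite mxE Vi omega_radial mulr0 rmorph0 if_same.
by rewrite mul0r.
Qed.

Lemma is_form_on_P_fform : is_form_on_P p f.
Proof. by split; [exact: smooth_form_fform|exact: basic_form_fform]. Qed.

End FormOnP.

(** * Cohomology classes *)

Section Classes.
Variables (R : realType) (T : topologicalType) (F : comPzRingType) (k : nat).
Implicit Types (c d : cocycle R T F k).

Lemma coh_class_lin a c d : coh_class (a *: c + d) = a *: coh_class c + coh_class d.
Proof. by rewrite /coh_class pi_lmod_quotD pi_lmod_quot_scale. Qed.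

Lemma coh_class_eq0 c : coh_class c = 0 <-> is_coboundary (cocycle_val c).
Proof.
have E : (coh_class c == 0) = (c \in @coboundary_pred R T F k).
  have -> : (0 : cohomology R T F k) = coh_class 0 by rewrite /coh_class raddf0.
  by rewrite /coh_class piE Quotient.equivE subr0.
split=> [/eqP|h]; first by rewrite E => /asboolP.
by apply/eqP; rewrite E; exact/asboolP.
Qed.

Lemma coh_classD c d : coh_class (c + d) = coh_class c + coh_class d.
Proof. by have := coh_class_lin 1 c d; rewrite !scale1r. Qed.

Lemma coh_class0 : coh_class (0 : cocycle R T F k) = 0.
Proof. by apply/coh_class_eq0; case: k => //= k'; exists 0; rewrite coboundary0. Qed.

Lemma coh_classZ a c : coh_class (a *: c) = a *: coh_class c.
Proof. by have := coh_class_lin a c 0; rewrite addr0 coh_class0 addr0. Qed.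

Lemma coh_class_eqP c d : is_coboundary (fun s => cocycle_val c s - cocycle_val d s) ->
  coh_class c = coh_class d.
Proof.
move=> h; apply/eqP; rewrite -subr_eq0 -[- coh_class d]scaleN1r -coh_classZ -coh_classD; apply/eqP.
apply/coh_class_eq0; move: h; congr is_coboundary; apply/funext => s /=.
by rewrite scaleN1r.
Qed.

Lemma coh_class_repr (x : cohomology R T F k) : coh_class (coh_repr x) = x.
Proof. exact: reprK. Qed.

Lemma cocycleP (c : cochain R T F k) : coboundary c = 0 -> c \in @cocycle_pred R T F k.
Proof. by move=> h; apply/asboolP. Qed.

End Classes.

Section RationalClasses.
Variables (R : realType) (T : topologicalType) (k : nat).
Local Notation C := (CC R).
Implicit Types (c : cocycle R T rat k).

Lemma ratr_inj_C : injective (ratr : rat -> C).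
Proof. exact: fmorph_inj. Qed.

Definition ratr_cocycle c : cocycle R T C k := Cocycle (ratr_cocycle_subproof c).

Lemma ratr_coboundary m (b : cochain R T rat m) :
  (fun s => ratr (coboundary b s) : C) = coboundary (fun s => ratr (b s) : C).
Proof.
apply/funext => s; rewrite /coboundary [LHS]rmorph_sum; apply: eq_bigr => i _.
by rewrite [LHS]rmorphM rmorphXn rmorphN1.
Qed.

Lemma coh_ratr_class c : coh_ratr (coh_class c) = coh_class (ratr_cocycle c).
Proof.
apply: coh_class_eqP => /=; set d := coh_repr _.
have dc : coh_class (d - c) = 0.
  by rewrite coh_classD -scaleN1r coh_classZ coh_class_repr scaleN1r subrr.
have {dc} : is_coboundary (cocycle_val (d - c)) by apply/coh_class_eq0.
rewrite (_ : (fun s => _ - _) = (fun s => ratr (cocycle_val (d - c) s) : C)); last first.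
  by apply/funext => s; rewrite -[LHS]rmorphB.
case: (k) (cocycle_val (d - c)) => [|k'] x /=.
  by move=> ->; apply/funext => s; exact: rmorph0.
by move=> [b ->]; exists (fun s => ratr (b s)); exact: ratr_coboundary.
Qed.

Section GaussCocycles.
Variable c : cochain R T C k.
Hypotheses (gc : forall s, gauss (c s)) (dc : coboundary c = 0).

(** The real and imaginary parts of Gaussian integers are integers, so the floor recovers them
    exactly and makes them rational. *)
Let part (p : C -> R) : cochain R T rat k := fun s => (Num.floor (p (c s)))%:~R.

Let partE p : (forall z, gauss z -> exists n : int, p z = n%:~R) ->
  (fun s => ratr (part p s) : C) = fun s => mkC (p (c s)) 0.
Proof. by move=> h; apply/funext => s; have [n E] := h _ (gc s); exact: ratr_floor E. Qed.

Let part_cocycle p : (forall z, gauss z -> exists n : int, p z = n%:~R) ->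
  (forall z w, p (z + w) = p z + p w) -> (forall z, p (- z) = - p z) -> coboundary (part p) = 0.
Proof.
move=> h pD pN; apply/funext => s; apply: ratr_inj_C.
have -> : ratr (coboundary (part p) s) = coboundary (fun s => ratr (part p s) : C) s.
  exact: (congr1 (fun f => f s) (ratr_coboundary (part p))).
rewrite (partE h) [RHS]rmorph0.
have p0 : p 0 = 0 by have /eqP := pD 0 0; rewrite addr0 eq_sym -subr_eq0 addrK => /eqP.
have pS (m : nat) z : p ((-1) ^+ m * z) = (-1) ^+ m * p z.
  by elim: m => [|m IH]; [rewrite !expr0 !mul1r|rewrite !exprS -!mulrA !mulN1r pN IH].
have kS (m : nat) (x : R) : (-1) ^+ m * mkC x 0 = mkC ((-1) ^+ m * x) 0 :> C.
  elim: m => [|m IH]; first by rewrite !expr0 !mul1r.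
  by rewrite !exprS -!mulrA !mulN1r IH; apply: complex_ext; rewrite ?reCN ?imCN //= oppr0.
have e : coboundary (fun s => mkC (p (c s)) 0) s = mkC (p (coboundary c s)) 0.
  rewrite /coboundary; elim/big_rec2: _ => [|i y z _ ->]; first by rewrite p0.
  by rewrite pD (kS i) pS; apply: complex_ext; rewrite ?reCD ?imCD //= addr0.
by rewrite e dc p0.
Qed.

Let re_int z : gauss z -> exists n : int, @reC R z = n%:~R.
Proof. by move=> [m [n ->]]; exists m. Qed.
Let im_int z : gauss z -> exists n : int, @imC R z = n%:~R.
Proof. by move=> [m [n ->]]; exists n. Qed.

Definition re_cocycle : cocycle R T rat k :=
  Cocycle (cocycleP (part_cocycle re_int (@reCD R) (@reCN R))).
Definition im_cocycle : cocycle R T rat k :=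
  Cocycle (cocycleP (part_cocycle im_int (@imCD R) (@imCN R))).
Definition gcocycle : cocycle R T C k := Cocycle (cocycleP dc).

Lemma re_cocycle_val s : ratr (cocycle_val re_cocycle s) = mkC (reC (c s)) 0 :> C.
Proof. exact: (congr1 (fun f => f s) (partE re_int)). Qed.

Lemma im_cocycle_val s : ratr (cocycle_val im_cocycle s) = mkC (imC (c s)) 0 :> C.
Proof. exact: (congr1 (fun f => f s) (partE im_int)). Qed.

Lemma conj_coboundary0 : coboundary (fun s => (c s)^*) = 0 :> cochain R T C k.+1.
Proof.
apply/funext => s; have := congr1 (fun f => (f s)^*) dc; rewrite /coboundary [X in _ = X]rmorph0 => e.
rewrite -[RHS]e [RHS]rmorph_sum; apply: eq_bigr => i _.
by rewrite [RHS]rmorphM /= rmorphXn rmorphN1.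
Qed.

Definition conj_gcocycle : cocycle R T C k := Cocycle (cocycleP conj_coboundary0).

Lemma gcocycle_re_im :
  coh_class gcocycle = coh_ratr (coh_class re_cocycle) + mkC 0 1 *: coh_ratr (coh_class im_cocycle).
Proof.
rewrite !coh_ratr_class -coh_classZ -coh_classD; congr coh_class; apply: val_inj; apply/funext => s.
transitivity (ratr (cocycle_val re_cocycle s) + mkC 0 1 * ratr (cocycle_val im_cocycle s) : C); last by [].
rewrite re_cocycle_val im_cocycle_val /=; apply: complex_ext; rewrite ?reCD ?imCD ?reCM ?imCM /=; ring.
Qed.

Lemma conj_gcocycle_re_im :
  coh_class conj_gcocycle = coh_ratr (coh_class re_cocycle) - mkC 0 1 *: coh_ratr (coh_class im_cocycle).
Proof.
rewrite !coh_ratr_class -scaleNr -coh_classZ -coh_classD; congr coh_class; apply: val_inj; apply/funext => s.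
transitivity (ratr (cocycle_val re_cocycle s) + (- mkC 0 1) * ratr (cocycle_val im_cocycle s) : C); last by [].
rewrite re_cocycle_val im_cocycle_val /=; apply: complex_ext;
  rewrite ?reCD ?imCD ?reCM ?imCM ?reCN ?imCN ?reC_conj ?imC_conj /=; ring.
Qed.

End GaussCocycles.
End RationalClasses.

(** * Classes represented by closed forms of a given type *)

Section HodgeClasses.
Variables (R : realType) (n : nat) (X : set (proj_space R n)) (k p : nat).
Local Notation C := (CC R).
Local Notation N := n.+1.
Implicit Types (f g : diff_form R n k).

Lemma line_closed_on f : line_closed X p f -> closed_on X p f.
Proof.
move=> lf x v V Xx xv tV; have [D dD s0] := lf x v V Xx xv tV.
by rewrite /ext_deriv -[RHS]s0; apply: eq_bigr => i _; rewrite (dir_deriv_cline (dD i)).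
Qed.

Definition form_lin (a b : C) f g : diff_form R n k := fun m v => a * f m v + b * g m v.

Lemma form_val_lin a b f g v V :
  form_val p (form_lin a b f g) v V = a * form_val p f v V + b * form_val p g v V.
Proof. by rewrite /form_val !mulr_sumr -big_split; apply: eq_bigr => m _ /=; rewrite /form_lin; ring. Qed.

Lemma line_closed_lin a b f g : line_closed X p f -> line_closed X p g -> line_closed X p (form_lin a b f g).
Proof.
move=> lf lg x v V Xx xv tV; have [D dD sD] := lf x v V Xx xv tV; have [E dE sE] := lg x v V Xx xv tV.
exists (fun i => a * D i + b * E i) => [i|].
  apply: (@is_dC_ext _ _ _ (fun t => a * form_val p f (cline v (row i V) t) (row' i V) +
     b * form_val p g (cline v (row i V) t) (row' i V))) => [t|]; first by rewrite form_val_lin.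
  exact: (is_dC_add (is_dC_scale a (dD i)) (is_dC_scale b (dE i))).
transitivity (a * (\sum_(i < k.+1) (-1) ^+ i * D i) + b * (\sum_(i < k.+1) (-1) ^+ i * E i)).
  by rewrite !mulr_sumr -big_split; apply: eq_bigr => i _ /=; ring.
by rewrite sD sE !mulr0 addr0.
Qed.

Lemma is_form_on_P_lin a b f g : is_form_on_P p f -> is_form_on_P p g ->
  is_form_on_P p (form_lin a b f g).
Proof.
move=> [sf [bf1 bf2]] [sg [bg1 bg2]]; split; last first.
  split=> [x V c x0 c0|x V c i x0 Vi]; first by rewrite !form_val_lin bf1 ?bg1.
  by rewrite form_val_lin (bf2 _ _ _ _ x0 Vi) (bg2 _ _ _ _ x0 Vi) !mulr0 addr0.
move=> m r; have oU : open [set u : 'rV[R]_(N + N) | u != 0] := @open_neq0 _ _.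
exact: (CkC_add oU (CkC_mul oU (CkC_cst oU _ _) (sf m r)) (CkC_mul oU (CkC_cst oU _ _) (sg m r))).
Qed.

Definition to_real (v : 'rV[C]_N) : 'rV[R]_(N + N) :=
  row_mx (\row_j reC (v 0 j)) (\row_j imC (v 0 j)).

Lemma to_realK : cancel to_real (@of_real R N).
Proof. by move=> v; apply/rowP => j; rewrite mxE row_mxKl row_mxKr !mxE mkCK. Qed.

(** Additivity of integrals asks for continuous integrands. The coefficients are factored through
    real coordinates, in which smoothness of forms is expressed. *)
Lemma smooth_lift_cornerC f (sg : singular_simplex R X k) s : smooth_form f -> smooth_lift sg s ->
  cornerC (fun t => form_val p f (s t) (Defs.jacobian s t)).
Proof.
move=> sf [[U [oU cU cs]] hs] t ct.
have cs1 j : contC (fun u => s u 0 j) t by apply: (@CkC_contC _ _ U 0); [exact: cs|exact: cU].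
have st0 : s t != 0.
  have [w <- _] : exists2 w : @nonzero_vec R n, set_val w = s t & True.
    have := hs (bary t); rewrite bary_val //.
    have -> : rsubmx (ins ord0 (1 - \sum_j t 0 j) t : 'rV_(1 + k)) = t.
      apply/rowP => j; rewrite mxE (_ : rshift 1 j = lift ord0 j) ?ins_lift //; exact: val_inj.
    by case=> w sw _; exists w.
  exact: (set_valP w).
apply: contC_sum => m; apply: contC_mul.
  have [c1 c2] : CkC [set u : 'rV[R]_(N + N) | u != 0] 0 (fun u => f m (of_real u)) by exact: sf.
  apply: (@contC_ext _ _ (fun u => f m (of_real (to_real (s u))))) => [u|]; first by rewrite to_realK.
  apply: (@contC_comp _ _ _ (fun u => to_real (s u)) (fun u => f m (of_real u))).
    apply: cont_row => j; case: (split_ordP j) => i ->.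
      apply: (@cont_ext _ _ (fun u => reC (s u 0 i))) => [u|]; first by rewrite row_mxEl mxE.
      by case: (cs1 i).
    apply: (@cont_ext _ _ (fun u => imC (s u 0 i))) => [u|]; first by rewrite row_mxEr mxE.
    by case: (cs1 i).
  have r0 : to_real (s t) != 0.
    apply/eqP => h; have := to_realK (s t); rewrite h => e; case/negP: st0; apply/eqP.
    by rewrite -e; apply/rowP => j; rewrite !mxE.
  by split; [exact: (Ck_on_cont c1 r0)|exact: (Ck_on_cont c2 r0)].
apply: contC_det => i j.
have cJ : contC (fun u => Defs.jacobian s u i (m j)) t.
  apply: (@contC_ext _ _ (dC (delta_mx 0 i) (fun u => s u 0 (m j)))) => [u|]; first by rewrite mxE.
  apply: (@CkC_contC _ _ U 0); last exact: cU.
  apply: CkC_D; exact: cs.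
apply: (@contC_ext _ _ (fun u => if (j < p)%N then Defs.jacobian s u i (m j) else (Defs.jacobian s u i (m j))^*)).
  by move=> u; rewrite mxE.
by case: (j < p)%N; [exact: cJ|exact: contC_conj].
Qed.

(** The main case of [in_Hpq], with [line_closed] in place of [closed_on], so that linear
    combinations of classes of one type can be taken. *)
Definition hodge_class (a : cohomology R X C k) : Prop := exists f,
  [/\ is_form_on_P p f, line_closed X p f & exists2 c : cocycle R X C k, coh_class c = a &
    forall sg s, smooth_lift sg s -> cocycle_val c sg = integral_lift p f s].

Lemma hodge_class_lin (x y : C) a b : hodge_class a -> hodge_class b -> hodge_class (x *: a + y *: b).
Proof.
move=> [f [Pf cf [c <- Hc]]] [g [Pg cg [d <- Hd]]]; exists (form_lin x y f g); split.
- exact: is_form_on_P_lin.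
- exact: line_closed_lin.
exists (x *: c + y *: d); first by rewrite coh_classD !coh_classZ.
move=> sg s sl; have [sf _] := Pf; have [sgm _] := Pg.
transitivity (x * cocycle_val c sg + y * cocycle_val d sg); first by [].
have c1 := smooth_lift_cornerC sf sl; have c2 := smooth_lift_cornerC sgm sl.
rewrite (Hc _ _ sl) (Hd _ _ sl) /integral_lift -!simplex_integralC_scale // -simplex_integralC_add; first last.
- by move=> t ct; apply: contC_mul; [exact: contC_cst|exact: c2].
- by move=> t ct; apply: contC_mul; [exact: contC_cst|exact: c1].
by apply: simplex_integralC_eq => t _; rewrite form_val_lin.
Qed.

Lemma in_Hpq_hodge_class (q : nat) a : (p + q = k)%N -> hodge_class a -> in_Hpq (Posz p) (Posz q) a.
Proof.
move=> pq [f [Pf /line_closed_on cf [c ca Hc]]]; right; exists p, q; split => //.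
by exists f; split => //; exists c.
Qed.

End HodgeClasses.

(** * Cup products of lifts as classes of type (p, q) *)

Section SegreClasses.
Variables (R : realType) (Ix : finType).
Local Notation C := (CC R).
Local Notation N := (segN Ix).
Local Notation X := (@segreX R Ix).
Local Notation kap := (mkC (2 / ell_period R) 0).

Definition segre_cup (lf : nat -> Ix) (cj : nat -> bool) k : cochain R X C k :=
  @cup R X (zlift (xe (R:=R) lf) cj) (zbranch (xe lf) cj) k.

Lemma segre_cup_gauss lf cj k s : gauss (@segre_cup lf cj k s).
Proof. by apply: cup_gauss; [exact: xe_cont|exact: xe_neq0]. Qed.

Lemma segre_cup_cocycle lf cj k : coboundary (@segre_cup lf cj k) = 0.
Proof. by apply: cup_cocycle => n k' i s; apply: zlift_face; [exact: xe_cont|exact: xe_neq0]. Qed.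

Definition antihol p (n : nat) : bool := (p <= n)%N.

(** By [smooth_lift_rep] the Jacobian of the lifts is, up to transposition, the matrix of the
    1-forms of [fform] on the velocity vectors. *)
Lemma Lam_integral lf k p (sg : singular_simplex R X k) s : smooth_lift sg s ->
  Lam (zlift (xe (R:=R) lf) (antihol p)) sg = integral_lift p (@fform R Ix lf k p) s.
Proof.
move=> sl; have [h Hh] := choice (smooth_lift_rep lf (antihol p) sl).
rewrite (@Lam_rep _ _ _ k sg h); first last.
- by move=> j _; case: (Hh j).
- exact: (smooth_lift_reps lf (antihol p) sl).
apply: simplex_integralC_eq => t ct; rewrite form_val_fform -det_tr; congr (\det _).
apply/matrixP => i j; rewrite !mxE; have [_ ->//] := Hh j.
rewrite /cjC /antihol ltnNge; case: (p <= j)%N => //=.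
by apply: complex_ext; rewrite !(reC_conj, imC_conj, reCM, imCM) /= ?reC_conj ?imC_conj; ring.
Qed.

Section TopDegree.
Variables (lf : nat -> Ix) (k p : nat).

Let cup := @segre_cup lf (antihol p) k.+1.
Let dcup : coboundary cup = 0 := segre_cup_cocycle lf (antihol p) k.+1.

Definition cup_primitive : cochain R X C k :=
  @homot R X (zlift (xe (R:=R) lf) (antihol p)) (zbranch (xe lf) (antihol p)) k.

Lemma cup_integral (sg : singular_simplex R X k.+1) s : smooth_lift sg s ->
  cup sg + coboundary cup_primitive sg = integral_lift p (@fform R Ix lf k.+1 p) s.
Proof.
move=> sl; rewrite -(Lam_integral lf p sl) (Lam_homotopy (zbranch (xe lf) (antihol p))) //.
- by move=> m k' i s'; apply: zlift_face; [exact: xe_cont|exact: xe_neq0].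
- exact: (smooth_lift_reps lf (antihol p) sl).
Qed.

Lemma hodge_class_cup : hodge_class p (coh_class (gcocycle dcup)).
Proof.
exists (@fform R Ix lf k.+1 p); split.
- exact: is_form_on_P_fform.
- exact: line_closed_fform.
pose c : cochain R X C k.+1 := cup + coboundary cup_primitive.
have dc : coboundary c = 0.
  have := coboundary_linear 1 cup (coboundary cup_primitive).
  by rewrite !scale1r dcup coboundary_coboundary addr0.
exists (gcocycle dc); last by move=> sg s sl; exact: cup_integral.
apply: coh_class_eqP; exists cup_primitive; apply/funext => s.
by transitivity (cup s + coboundary cup_primitive s - cup s); [|rewrite addrAC subrr add0r].
Qed.

Variable q : nat.
Hypothesis pq : (p + q = k.+1)%N.

(** The block permutation that moves the [q] conjugated factors in front of the [p] others. *)
Let sw (j : 'I_k.+1) : nat := if (j < q)%N then (j + p)%N else (j - q)%N.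

Let sw_lt (j : 'I_k.+1) : (sw j < k.+1)%N.
Proof. by rewrite /sw; have jk := ltn_ord j; case: (ltnP j q); lia. Qed.

Let swo (j : 'I_k.+1) : 'I_k.+1 := Ordinal (sw_lt j).

Let swo_inj : injective swo.
Proof.
move=> i j /(congr1 val) /= h; apply: val_inj => /=; have ik := ltn_ord i; have jk := ltn_ord j.
by move: h; rewrite /sw; case: (ltnP i q); case: (ltnP j q); lia.
Qed.

Let swp : 'S_k.+1 := perm swo_inj.

(* Conjugation exchanges the two blocks of columns. *)
Lemma conj_form_val v (V : 'M[C]_(k.+1, N.+1)) : (form_val p (@fform R Ix lf k.+1 p) v V)^* =
  (-1) ^+ swp * form_val q (@fform R Ix (fun j => if (j < q)%N then lf (j + p)%N else lf (j - q)%N) k.+1 q) v V.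
Proof.
rewrite !form_val_fform -det_map_mx.
set A := \matrix_(i, j) _; set B := \matrix_(i, j) _.
have -> : B = col_perm swp (map_mx Num.conj A).
  apply/matrixP => i j; rewrite !mxE permE /swo /= /sw; have jk := ltn_ord j.
  case: (ltnP j q) => jq.
    by rewrite ltnNge (_ : (p <= j + p)%N) //=; [rewrite conjCK|lia].
  by rewrite (_ : (j - q < p)%N) //; lia.
by rewrite col_permE det_mulmx det_perm odd_permV mulrCA -signr_addb addbb mulr1.
Qed.

Lemma simplex_integralC_conj m (g : 'rV[R]_m -> C) : cornerC g ->
  (simplex_integralC g)^* = simplex_integralC (fun t => (g t)^*).
Proof.
move=> cg; have c2 : cornerC (fun t : 'rV[R]_m => mkC (imC (g t)) 0 : C).
  by move=> t ct; have [_ h] := cg t ct; split; [exact: h|exact: cont_cst].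
have := simplex_integralC_scale (-1) c2 => /(congr1 (@reC R)).
rewrite mulN1r reCN /= => h; apply: complex_ext; rewrite ?reC_conj ?imC_conj /=.
  by congr simplex_integral; apply/funext => t; rewrite reC_conj.
rewrite -h; congr simplex_integral; apply/funext => t.
by rewrite imC_conj mulN1r mulr0 subr0.
Qed.

(** Up to the sign of the block permutation, the conjugate form is of the same kind, with type (q,
    p), for the rotated list of factors. *)
Lemma hodge_class_conj_cup : hodge_class q (coh_class (conj_gcocycle dcup)).
Proof.
pose f := @fform R Ix (fun j => if (j < q)%N then lf (j + p)%N else lf (j - q)%N) k.+1 q.
exists (form_lin ((-1) ^+ swp) 0 f f); split.
- by apply: is_form_on_P_lin; exact: is_form_on_P_fform.
- by apply: line_closed_lin; exact: line_closed_fform.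
pose b : cochain R X C k := fun s => (cup_primitive s)^*.
have db s : coboundary b s = (coboundary cup_primitive s)^*.
  rewrite /coboundary [RHS]rmorph_sum; apply: eq_bigr => i _.
  by rewrite [RHS]rmorphM /= rmorphXn rmorphN1.
pose c : cochain R X C k.+1 := cocycle_val (conj_gcocycle dcup) + coboundary b.
have dc : coboundary c = 0.
  have := coboundary_linear 1 (cocycle_val (conj_gcocycle dcup)) (coboundary b).
  have d1 : coboundary (cocycle_val (conj_gcocycle dcup)) = 0 := conj_coboundary0 dcup.
  by rewrite !scale1r d1 coboundary_coboundary addr0.
exists (gcocycle dc).
  apply: coh_class_eqP; exists b; apply/funext => s.
  transitivity ((cup s)^* + coboundary b s - (cup s)^*); [by []|by rewrite addrAC subrr add0r].
move=> sg s sl; transitivity ((cup sg)^* + coboundary b sg); first by [].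
rewrite db -rmorphD /= (cup_integral sl) /integral_lift simplex_integralC_conj; last first.
  by apply: smooth_lift_cornerC sl; exact: smooth_form_fform.
apply: simplex_integralC_eq => t _; rewrite form_val_lin mul0r addr0.
exact: conj_form_val.
Qed.

End TopDegree.

End SegreClasses.

(** * Torus cycles *)

Section Loops.
Variable R : realType.
Local Notation C := (CC R).
Implicit Types th : R.

Definition dn th : R := Num.sqrt (1 + sin th ^+ 2).

Lemma dn_gt0 th : 0 < dn th.
Proof. by rewrite sqrtr_gt0 ell_radicand_gt0. Qed.

Lemma dn_sqr th : dn th * dn th = 1 + sin th * sin th.
Proof. by rewrite -expr2 sqr_sqrtr ?expr2 // ltW // -expr2 ell_radicand_gt0. Qed.

(* The two generators of the first homology of the curve. *)
Definition loop (eps : bool) th : 'I_4 -> C :=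
  if eps then vec4 1 (mkC 0 (sin th)) (mkC (dn th) 0) (mkC (cos th) 0)
  else vec4 1 (mkC (sin th) 0) (mkC (cos th) 0) (mkC (dn th) 0).

Lemma cos_sqr th : cos th * cos th = 1 - sin th * sin th.
Proof. by rewrite -(cos2Dsin2 th) !expr2 addrK. Qed.

Lemma loop_on_E eps th : on_E (loop eps th).
Proof.
have c := cos_sqr th; have d := dn_sqr th.
by case: eps; split; apply: complex_ext;
  rewrite /quadA /quadB /loop /vec4 /= ?(reCD, imCD, reCN, imCN, reCM, imCM) /= ?c ?d; ring.
Qed.

(** The argument of [cos th + i sin th dn th] within a quarter circle of [th]; it equals [th] at the
    multiples of [2 pi]. The square of this number is, up to a positive factor, the circle along a
    loop, whence the doubled angle in [circle_angle]. *)
Definition loop_angle th : R :=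
  th + atan (imC (mkC (cos th) (sin th * dn th) * (mkC (cos th) (sin th) : C)^*) /
             reC (mkC (cos th) (sin th * dn th) * (mkC (cos th) (sin th) : C)^*)).

Lemma loop_turn_gt0 th : 0 < reC (mkC (cos th) (sin th * dn th) * (mkC (cos th) (sin th) : C)^*).
Proof.
rewrite reCM reC_conj imC_conj /= mulrN opprK mulrAC -!expr2.
have [s0|s0] := eqVneq (sin th) 0.
  by have := cos2Dsin2 th; rewrite s0 expr0n addr0 => ->; rewrite mul0r addr0.
by rewrite ltr_wpDl ?sqr_ge0 // mulr_gt0 ?dn_gt0 // lt_def sqr_ge0 sqrf_eq0 s0.
Qed.

Lemma loop_angle_polar th : polar (mkC (cos th) (sin th * dn th) : C) (loop_angle th).
Proof.
apply: atan_mul_conj; last exact: loop_turn_gt0.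
by exists 1; rewrite ?mul1r.
Qed.

Lemma loop_angle_cont : continuous loop_angle.
Proof.
have cs : continuous (@sin R) := @continuous_sin R; have cc : continuous (@cos R) := @continuous_cos R.
have cd : continuous dn.
  move=> x; apply: (@cont_cmp _ _ _ (fun x : R => 1 + sin x ^+ 2) (@Num.sqrt R)); last exact: sqrt_continuous.
  apply: contD; first exact: cont_cst.
  by apply: (@cont_ext _ _ (fun x : R => sin x * sin x)) => [y|]; [rewrite expr2|apply: contM; exact: cs].
move=> x; apply: contD; first exact: cont_id.
apply: cont_atan_ratio; last by rewrite gt_eqF // loop_turn_gt0.
apply: contC_mul; first by split; [exact: cc|apply: contM; [exact: cs|exact: cd]].
by apply: contC_conj; split; [exact: cc|exact: cs].
Qed.

Lemma loop_angle_vertex (m : nat) : loop_angle (pi *+ 2 *+ m) = pi *+ 2 *+ m.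
Proof.
have s0 : sin (pi *+ 2 *+ m) = 0 :> R.
  by elim: m => [|m IH]; [rewrite mulr0n sin0|rewrite mulrSr sinD2pi].
by rewrite /loop_angle imCM reC_conj imC_conj /= s0 !(mul0r, mulr0, oppr0, addr0, atan0).
Qed.

Definition circle_angle (eps b : bool) th : R := if eps == b then loop_angle th + loop_angle th else 0.

Lemma circle_angle_cont eps b : continuous (circle_angle eps b).
Proof.
rewrite /circle_angle; case: (eps == b) => x; last exact: cont_cst.
by apply: contD; exact: loop_angle_cont.
Qed.

Lemma polar_pos (z : C) : 0 < reC z -> imC z = 0 -> polar z 0.
Proof. by move=> z1 z2; exists (reC z); rewrite // cos0 sin0 mulr1 mulr0. Qed.

(** Along a loop, one of the two circles is a positive multiple of the square above and the other is
    a positive number: [z] moves either in the real or in the imaginary direction. *)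
Lemma circle_angle_polar eps b th (J : finType) (y : J -> C) (Z : J -> 'I_4 -> C) :
  (exists j, y j != 0) -> (forall j i, Z j i = y j * loop eps th i) ->
  polar (circle (twist b Z)) (circle_angle eps b th).
Proof.
move=> y0 HZ; pose x := if b then swE (loop eps th) else loop eps th.
have HT j i : twist b Z j i = y j * x i.
  by rewrite /twist /x; case: (b); [apply: swE_scale|]; exact: HZ.
pose lam := \sum_j y j * y j * ((y j)^* * (y j)^*).
have lamE : lam = mkC (reC lam) 0.
  by apply: rC_mk; rewrite /rC rmorph_sum; apply: eq_bigr => j _; rewrite /= !rmorphM /= conjCK; ring.
have lam0 : 0 < reC lam.
  have [j yj] := y0; rewrite /lam reC_sum (bigD1 j) //= ltr_wpDr //.
    by apply: sumr_ge0 => i _; rewrite -rmorphM reC_normsq.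
  by rewrite -rmorphM reC_normsq_gt0 // mulf_neq0.
have -> : circle (twist b Z) = mkC (reC lam) 0 * (ek x + mkC 0 1 * es x).
  rewrite -lamE /circle.
  have -> : \sum_j ek (twist b Z j) = lam * ek x.
    by rewrite mulr_suml; apply: eq_bigr => j _; rewrite /ek !HT !rmorphM /=; ring.
  have -> : \sum_j es (twist b Z j) = lam * es x.
    by rewrite mulr_suml; apply: eq_bigr => j _; rewrite /es !HT !rmorphM /=; ring.
  ring.
apply: polar_scale => //.
have c := cos_sqr th; have d := dn_sqr th.
rewrite /circle_angle; case: eqP => eb.
  have -> : ek x + mkC 0 1 * es x = mkC (cos th) (sin th * dn th) * mkC (cos th) (sin th * dn th).
    by rewrite /x -eb /ek /es; case: (eps); apply: complex_ext;
      rewrite /loop /swE /vec4 /= ?(reCD, imCD, reCN, imCN, reCM, imCM, reC_conj, imC_conj) /=; ring.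
  by apply: polarM; exact: loop_angle_polar.
have pos : 0 < dn th * dn th - sin th * sin th * (cos th * cos th).
  have -> : dn th * dn th - sin th * sin th * (cos th * cos th) = 1 + (sin th * sin th) ^+ 2.
    by rewrite d c; ring.
  by rewrite ltr_pwDl // sqr_ge0.
apply: polar_pos.
  rewrite (_ : reC _ = dn th * dn th - sin th * sin th * (cos th * cos th)) //.
  move: eb; rewrite /x /ek /es; case: (eps); case: (b) => // _;
      rewrite /loop /swE /vec4 /= ?(reCD, imCD, reCN, imCN, reCM, imCM, reC_conj, imC_conj) /=; ring.
move: eb; rewrite /x /ek /es; case: (eps); case: (b) => // _;
    rewrite /loop /swE /vec4 /= ?(reCD, imCD, reCN, imCN, reCM, imCM, reC_conj, imC_conj) /=; ring.
Qed.

End Loops.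

(** * Tori in the variety and their simplices *)

Section TorusSimplices.
Variables (R : realType) (J : finType) (K : nat) (b0 : J) (eps : 'I_K -> bool).
Local Notation C := (CC R).
Local Notation Ix := (J * 'I_K)%type.
Local Notation N := (segN Ix).
Local Notation X := (@segreX R Ix).

(** Only the factors of the block [b0] move, along the loops chosen by [eps]; all others stay at the
    base points of theirs. *)
Definition tfactor (th : 'rV[R]_K) (l : Ix) : 'I_4 -> C :=
  loop (eps l.2) (pi *+ 2 * (if l.1 == b0 then th 0 l.2 else 0)).

Definition tvecs (th : 'rV[R]_K) : 'rV[C]_N.+1 := \row_a \prod_l tfactor th l (tinv a l).

Lemma tvecsE th I : tvecs th 0 (tidx I) = 1 * \prod_l tfactor th l (I l).
Proof. by rewrite mxE tidxK mul1r. Qed.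

Lemma tvecs_segre th : segre (tvecs th).
Proof. by apply: (segre_tensor (tvecsE th)) => l; exact: loop_on_E. Qed.

Lemma tvecs_neq0 th : tvecs th != 0.
Proof.
apply/eqP => h; have := tvecsE th [ffun=> qW]; rewrite h mxE mul1r big1 => [/eqP|l _].
  by rewrite eq_sym oner_eq0.
by rewrite ffunE /tfactor /loop; case: eps.
Qed.

Lemma tvecs_nz th : @nonzero_vec R N (tvecs th).
Proof. exact: tvecs_neq0. Qed.

Definition tpoint (th : 'rV[R]_K) : proj_space R N :=
  (\pi_{eq_quot collinear_equiv R N} (SigSub (mem_set (tvecs_nz th)) : @nonzero_vec R N))%qT.

Lemma tpoint_hom th : hom_coord (tpoint th) (tvecs th).
Proof. by exists (SigSub (mem_set (tvecs_nz th)) : @nonzero_vec R N). Qed.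

Lemma tpoint_X th : X (tpoint th).
Proof. by exists (tvecs th); [exact: tpoint_hom|exact: tvecs_segre]. Qed.

Definition tmap (th : 'rV[R]_K) : X := SigSub (mem_set (tpoint_X th)).

Lemma contC_loop e i : forall th : R, contC (fun th : R => loop e th i) th.
Proof.
have cs : continuous (@sin R) := @continuous_sin R; have cc : continuous (@cos R) := @continuous_cos R.
have cd : continuous (@dn R).
  move=> x; apply: (@cont_cmp _ _ _ (fun x : R => 1 + sin x ^+ 2) (@Num.sqrt R)); last exact: sqrt_continuous.
  apply: contD; first exact: cont_cst.
  by apply: (@cont_ext _ _ (fun x : R => sin x * sin x)) => [y|]; [rewrite expr2|apply: contM; exact: cs].
move=> th; rewrite /loop; case: e; move: i; apply: forall_I4; rewrite /vec4 /=;
  by [exact: contC_cst|split => /=; by [exact: cont_cst|exact: cs|exact: cc|exact: cd]].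
Qed.

Lemma tmap_cont : continuous tmap.
Proof.
suff c1 : continuous (fun th => set_val (tmap th)).
  exact: (@continuous_comp_initial X 'rV[R]_K (proj_space R N) (@set_val _ X) tmap c1).
have c2 : continuous (fun th => SigSub (mem_set (tvecs_nz th)) : @nonzero_vec R N).
  suff c3 : continuous tvecs.
    exact: (@continuous_comp_initial (@nonzero_vec R N) 'rV[R]_K 'rV[C]_N.+1 (@set_val _ (@nonzero_vec R N))
      (fun th => SigSub (mem_set (tvecs_nz th)) : @nonzero_vec R N) c3).
  have ce a th : contC (fun th => tvecs th 0 a) th.
    apply: (@contC_ext _ _ (fun th => \prod_l tfactor th l (tinv a l))) => [u|]; first by rewrite mxE.
    apply: contC_prod => l.
    apply: (@contC_comp _ _ _ (fun th : 'rV[R]_K => pi *+ 2 * (if l.1 == b0 then th 0 l.2 else 0))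
      (fun x => loop (eps l.2) x (tinv a l))).
      apply: contM; first exact: cont_cst.
      by case: (l.1 == b0); [exact: cont_coord|exact: cont_cst].
    exact: contC_loop.
  move=> th A [B nB sBA].
  suff nP : forall a, nbhs th (fun u => B 0 a (tvecs u 0 a)).
    have : nbhs th (fun u => forall a, B 0 a (tvecs u 0 a)) by exact: filter_forall nP.
    apply: filterS => u Bu; apply: sBA => i a; rewrite (ord1 i); exact: Bu.
  move=> a; have /contC_continuous := ce a th; apply.
  exact: nB.
move=> th; apply: (@cont_cmp _ _ _ (fun th => SigSub (mem_set (tvecs_nz th)) : @nonzero_vec R N)
  (fun w => (\pi_{eq_quot collinear_equiv R N} w)%qT : proj_space R N)); first exact: c2.
exact: pi_continuous.
Qed.

Definition tsimplex m (Th : 'rV[R]_m -> 'rV[R]_K) (cT : continuous Th) : singular_simplex R X m.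
Proof.
exists (fun s : std_simplex R m => tmap (Th (rsubmx (set_val s : 'rV_(1 + m))))) => s.
apply: (@cont_cmp _ _ _ (fun s : std_simplex R m => Th (rsubmx (set_val s : 'rV_(1 + m)))) tmap); last exact: tmap_cont.
apply: (@cont_cmp _ _ _ (fun s : std_simplex R m => rsubmx (set_val s : 'rV_(1 + m))) Th); last exact: cT.
apply: cont_row => j.
apply: (@cont_ext _ _ (fun s : std_simplex R m => set_val s 0 (rshift 1 j))) => [u|]; first by rewrite mxE.
apply: (@cont_cmp _ _ _ (@set_val _ (std_simplex R m)) (fun v : 'rV[R]_m.+1 => v 0 (rshift 1 j))).
  exact: cont_set_val.
exact: cont_coord.
Defined.

End TorusSimplices.

Section TorusPairing.
Variables (R : realType) (J : finType) (k : nat) (b0 : J) (eps : 'I_k.+1 -> bool).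
Local Notation C := (CC R).
Local Notation K := k.+1.
Local Notation Ix := (J * 'I_K)%type.
Local Notation N := (segN Ix).
Local Notation X := (@segreX R Ix).
Local Notation tmap := (tmap b0 eps).
Local Notation tvecs := (tvecs b0 eps).

Lemma simplex_ext (T : topologicalType) m (s s' : singular_simplex R T m) :
  (forall u, corner u -> spoint s u = spoint s' u) -> s = s'.
Proof.
case: s => f cf; case: s' => f' cf' h; apply: eq_exist; apply/funext => x; have [cx ->] := bary_coord x.
exact: h.
Qed.

Lemma spoint_tsimplex m (Th : 'rV[R]_m -> 'rV[R]_K) (cT : continuous Th) u : corner u ->
  spoint (tsimplex b0 eps cT) u = tmap (Th u).
Proof.
move=> cu; rewrite /spoint /= bary_val //; congr (tmap (Th _)); apply/rowP => j.
by rewrite mxE (_ : rshift 1 j = lift ord0 j) ?ins_lift //; exact: val_inj.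
Qed.

Lemma sin_cos_int (x : R) (m : int) :
  sin (pi *+ 2 * (x + m%:~R)) = sin (pi *+ 2 * x) /\ cos (pi *+ 2 * (x + m%:~R)) = cos (pi *+ 2 * x).
Proof.
have H y (n : nat) : sin (pi *+ 2 * (y + n%:R)) = sin (pi *+ 2 * y) /\ cos (pi *+ 2 * (y + n%:R)) = cos (pi *+ 2 * y) :> R.
  elim: n => [|n [IH1 IH2]]; first by rewrite addr0.
  by rewrite -natr1 addrA [_ * (_ + 1)]mulrDr mulr1 sinD2pi cosD2pi.
case: m => n; first exact: H.
by rewrite NegzE rmorphN /=; have [<- <-] := H (x - n.+1%:R) n.+1; rewrite subrK.
Qed.

Lemma tmap_int (th th' : 'rV[R]_K) : (forall a, exists m : int, th 0 a = th' 0 a + m%:~R) ->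
  tmap th = tmap th'.
Proof.
move=> h; have E : tvecs th = tvecs th'.
  apply/rowP => a; rewrite !mxE; apply: eq_bigr => l _; rewrite /tfactor.
  case: ifP => // _; have [m ->] := h l.2; have [e1 e2] := sin_cos_int (th' 0 l.2) m.
  by rewrite /loop /dn e1 e2.
apply: val_inj => /=; rewrite /tpoint; congr (\pi_ _ _)%qT.
exact: val_inj.
Qed.

(* The simplices [1 >= x_(s 0) >= x_(s 1) >= ..] that triangulate the cube. *)
Definition tpath (s : 'S_K) (t : 'rV[R]_K) : 'rV[R]_K := \row_a \sum_(j < K | ((s^-1)%g a <= j)%N) t 0 j.

Lemma tpath_cont s : continuous (tpath s).
Proof.
move=> t; apply: cont_row => a; apply: (@cont_ext _ _ (fun t : 'rV[R]_K => \sum_(j < K | ((s^-1)%g a <= j)%N) t 0 j)) => [u|].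
  by rewrite mxE.
by apply: cont_sum => j; exact: cont_coord.
Qed.

Definition tcell (s : 'S_K) : singular_simplex R X K := tsimplex b0 eps (@tpath_cont s).

(** Evaluation on the fundamental cycle of the torus. *)
Definition pairing (F : comPzRingType) (c : cochain R X F K) : F := \sum_(s : 'S_K) (-1) ^+ s * c (tcell s).

Lemma tpath_max s a (u : 'rV[R]_k) : tpath s (ins ord_max 0 u) 0 a = \sum_(j < k | ((s^-1)%g a <= j)%N) u 0 j.
Proof.
rewrite mxE big_mkcond (bigD1_ord ord_max) //= ins_at if_same add0r [RHS]big_mkcond.
by apply: eq_bigr => j _; rewrite ins_lift /= bump_max.
Qed.

Lemma tpath_first s a (u : 'rV[R]_k) : tpath s (ins ord0 (1 - \sum_j u 0 j) u) 0 a =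
  if (s^-1)%g a is Ordinal n.+1 _ then \sum_(j < k | (n <= j)%N) u 0 j else 1.
Proof.
rewrite mxE big_mkcond (bigD1_ord ord0) //= ins_at; case: ((s^-1)%g a) => -[|n] ni /=.
  rewrite [X in _ + X](eq_bigr (fun j => u 0 j)) ?subrK // => j _; by rewrite ins_lift.
by rewrite add0r [RHS]big_mkcond; apply: eq_bigr => j _; rewrite ins_lift.
Qed.

Definition cyc : 'S_K := lift_perm ord_max ord0 1.

(** Opposite sides of the cube coincide in the torus; [cyc] moves the coordinate that is constantly
    1 from the first place to the last, where it is constantly 0. *)
Lemma face_first s : sing_face ord0 (tcell s) = sing_face ord_max (tcell (cyc * s)).
Proof.
apply: simplex_ext => u cu; rewrite !spoint_face // !spoint_tsimplex; try exact: fcoord_corner.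
apply: tmap_int => a.
have -> : ord_max = lift ord0 (ord_max : 'I_k.+1) by exact: val_inj.
rewrite fcoord0 fcoordS tpath_max tpath_first invMg permM.
case E: ((s^-1)%g a) => [[|n] ni].
  have -> : (cyc^-1)%g (Ordinal ni) = ord_max.
    by apply: (canLR (permK _)); rewrite lift_perm_id; exact: val_inj.
  by exists 1; rewrite big1 ?add0r // => j; rewrite leqNgt ltn_ord.
have nk : (n < k)%N by [].
have -> : (cyc^-1)%g (Ordinal ni) = lift ord_max (Ordinal nk).
  by apply: (canLR (permK _)); rewrite lift_perm_lift perm1; exact: val_inj.
by exists 0; rewrite addr0; apply: eq_bigl => j; rewrite (_ : lift _ _ = n :> nat) //= /bump leqNgt nk.
Qed.

(** On this face two consecutive coordinates agree, so exchanging them in the order leads to the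
    same face. *)
Lemma face_middle s (i : 'I_k) :
  let j := widen_ord (leqnSn k) i in
  sing_face (lift ord0 j) (tcell (tperm j (lift ord0 i) * s)) = sing_face (lift ord0 j) (tcell s).
Proof.
move=> j; apply: simplex_ext => u cu; rewrite !spoint_face // !spoint_tsimplex; try exact: fcoord_corner.
congr tmap; apply/rowP => a; rewrite !mxE fcoordS invMg permM tpermV.
have z : ins j 0 u 0 j = 0 by rewrite ins_at.
have S : \sum_(l < k.+1 | (i <= l)%N) ins j 0 u 0 l = \sum_(l < k.+1 | (i.+1 <= l)%N) ins j 0 u 0 l.
  rewrite (bigD1 j) //= z add0r; apply: eq_bigl => l.
  by rewrite ltn_neqAle andbC -val_eqE /= [i == _ :> nat]eq_sym.
by case: tpermP => [->|->|_ _] //=; rewrite /bump /= add1n S.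
Qed.

(** The torus is a cycle: inner faces cancel between neighbouring simplices, and the first faces
    cancel the last ones thanks to the sign [(-1)^k] of [cyc]. *)
Lemma pairing_coboundary (F : numDomainType) (c : cochain R X F k) : pairing (coboundary c) = 0.
Proof.
rewrite /pairing /coboundary; under eq_bigr do rewrite mulr_sumr; rewrite exchange_big /=.
pose f (i : 'I_k.+2) := \sum_(s : 'S_K) (-1) ^+ s * c (sing_face i (tcell s)).
transitivity (\sum_(i < k.+2) (-1) ^+ i * f i).
  by apply: eq_bigr => i _; rewrite /f mulr_sumr; apply: eq_bigr => s _; rewrite mulrCA.
rewrite big_ord_recl big_ord_recr /= [X in _ + (X + _)]big1 ?add0r; last first.
  move=> i _; rewrite /f -[lift ord0 (widen_ord _ _)]/(lift ord0 (widen_ord (leqnSn k) i)).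
  rewrite (@alternating_sum_eq0 F _ (widen_ord (leqnSn k) i) (lift ord0 i)) ?mulr0 //.
    by rewrite -val_eqE /= /bump /= add1n ltn_eqF.
  by move=> s; rewrite face_middle.
have -> : f ord0 = (-1) ^+ k * f ord_max.
  rewrite /f [in RHS](reindex_inj (mulgI cyc)) /= mulr_sumr; apply: eq_bigr => s _.
  rewrite face_first odd_permM signr_addb odd_lift_perm odd_perm1 /= !addbF !mulrA.
  by rewrite signr_odd -[(-1) ^+ k * (-1) ^+ k]exprD addnn -mul2n exprM sqrrN expr1n expr1n mul1r.
have -> : lift ord0 (ord_max : 'I_k.+1) = ord_max by exact: val_inj.
rewrite /bump /= add1n exprS mulN1r expr0 mul1r; ring.
Qed.

End TorusPairing.

(** * Periods of the cup products along the tori *)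

Section TorusPeriods.
Variables (R : realType) (J : finType) (k : nat) (b0 b : J) (eps : 'I_k.+1 -> bool) (cj : nat -> bool).
Local Notation C := (CC R).
Local Notation K := k.+1.
Local Notation Ix := (J * 'I_K)%type.
Local Notation X := (@segreX R Ix).
Local Notation tmap := (tmap b0 eps).
Local Notation tvecs := (tvecs b0 eps).

Definition row_factor (n : nat) : Ix := (b, inord n).
Local Notation e := (xe (R := R) row_factor).

Lemma slice_tvecs (th : 'rV[R]_K) (l : Ix) (I : {ffun Ix -> 'I_4}) i :
  slice (tvecs th) l I i = (\prod_(l' | l' != l) tfactor b0 eps th l' (I l')) * tfactor b0 eps th l i.
Proof.
rewrite /slice tvecsE mul1r (bigD1 l) //= mulrC ffunE eqxx; congr (_ * _).
by apply: eq_bigr => l' /negbTE nl; rewrite ffunE nl.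
Qed.

Definition tangle (s : 'S_K) n bb (t : 'rV[R]_K) : R :=
  circle_angle (eps (inord n)) bb (pi *+ 2 * (if b == b0 then tpath s t 0 (inord n) else 0)).

Lemma polar_xe (th : 'rV[R]_K) n bb :
  polar (e n bb (tmap th)) (circle_angle (eps (inord n)) bb (pi *+ 2 * (if b == b0 then th 0 (inord n) else 0))).
Proof.
have [r r0 E] := xcirc_hom (row_factor n) bb (tpoint_hom b0 eps th).
have -> : e n bb (tmap th) = mkC r^-1 0 * vcirc (row_factor n) bb (tvecs th).
  rewrite E mulrA (_ : mkC r^-1 0 * mkC r 0 = 1) ?mul1r //.
  by apply: complex_ext; rewrite ?reCM ?imCM /=; [field; rewrite gt_eqF|ring].
apply: polar_scale; rewrite ?invr_gt0 //.
apply: (circle_angle_polar _ (y := fun I : {ffun Ix -> 'I_4} =>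
  \prod_(l' | l' != row_factor n) tfactor b0 eps th l' (I l'))); last exact: slice_tvecs.
exists [ffun=> qW]; rewrite big1 ?oner_eq0 // => l _.
by rewrite ffunE /tfactor /loop; case: eps.
Qed.

Lemma tangle_spec s n bb : angle_spec e n bb (tcell R b0 eps s) (tangle s n bb).
Proof.
split=> [t|t ct].
  apply: (@cont_cmp _ _ _ (fun t => pi *+ 2 * (if b == b0 then tpath s t 0 (inord n) else 0)) (circle_angle (eps (inord n)) bb)); last exact: circle_angle_cont.
  apply: contM; first exact: cont_cst.
  case: (b == b0); last exact: cont_cst.
  apply: (@cont_cmp _ _ _ (tpath s) (fun v : 'rV[R]_K => v 0 (inord n))); [exact: tpath_cont|exact: cont_coord].
rewrite spoint_tsimplex //; exact: polar_xe.
Qed.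

Lemma tpath_vtx (s : 'S_K) n a : (n <= K)%N -> tpath s (vtx R K n) 0 a = ((s^-1)%g a < n)%N%:R.
Proof.
move=> nK; rewrite mxE; case: (ltnP ((s^-1)%g a) n) => h; last first.
  by rewrite big1 // => j hj; rewrite mxE gtn_eqF // ltnS (leq_trans h hj).
case: n nK h => // n nK h; rewrite (bigD1 (Ordinal nK)) //= mxE eqxx big1 ?addr0 // => j /andP[_ nj].
by rewrite mxE eqSS -[_ == _]/(j == Ordinal nK) (negbTE nj).
Qed.

Lemma circle_angle_turn ep bb (x : nat) :
  circle_angle ep bb (pi *+ 2 * x%:R) = 0 + pi *+ 2 *~ ((ep == bb) * x).*2 :> R.
Proof.
rewrite /circle_angle; case: eqP => _; last by rewrite mul0n addr0.
by rewrite mulr_natr loop_angle_vertex mul1n add0r -mulrnDr addnn.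
Qed.

(** From vertex [n] to vertex [n + 1] of the cell [s] only the coordinate [s n] moves, from 0 to 1.
    So the factor [n] turns only if [s n = n], and then its circle turns twice. *)
Lemma ell_tcell (s : 'S_K) (n : 'I_K) bb :
  ell (angle e n bb (tcell R b0 eps s) (vtx R K n.+1)) - ell (angle e n bb (tcell R b0 eps s) (vtx R K n)) =
  (if [&& eps n == bb, b == b0 & s n == n] then 2 else 0 : R).
Proof.
have nK := ltn_ord n; have nK' := ltnW nK.
have [m Hm] := angle_uniq (xe_cont row_factor) (xe_neq0 row_factor) (tangle_spec s n bb).
have E t : corner t -> ell (angle e n bb (tcell R b0 eps s) t) = ell (tangle s n bb t) - m%:~R.
  by move=> ct; rewrite Hm // ellD2pin addrK.
rewrite !E; try exact: vtx_corner.
have cancelB (x y z : R) : x - z - (y - z) = x - y by ring.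
rewrite cancelB /tangle !tpath_vtx // inord_val.
have B (x : bool) : (if b == b0 then x%:R else 0) = ((b == b0) * x)%N%:R :> R.
  by case: (b == b0); rewrite ?mul1n.
rewrite !B !circle_angle_turn !ellD2pin opprD addrACA subrr add0r -[s n == n](inj_eq (@perm_inj _ s^-1)) permK.
have [sn|ne] := eqVneq n ((s^-1)%g n); last first.
  rewrite (_ : ((s^-1)%g n < n.+1)%N = ((s^-1)%g n < n)%N) ?subrr.
    by rewrite !andbF.
  by rewrite ltnS leq_eqVlt -[_ == _ :> nat]/((s^-1)%g n == n) eq_sym (negbTE ne).
by rewrite -sn ltnn ltnSn; case: (eps n == bb); case: (b == b0); rewrite ?subr0.
Qed.

(** The period of the [n]-th differential along its loop: 2 for the real loop, [2 i] up to
    conjugation for the imaginary one. *)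
Definition turn (n : 'I_K) : C := if eps n then mkC 0 ((-1) ^+ cj n * 2) else mkC 2 0.

Lemma period_tcell (s : 'S_K) (n : 'I_K) :
  period (zlift e cj) (zbranch e cj) n (tcell R b0 eps s) n.+1 - period (zlift e cj) (zbranch e cj) n (tcell R b0 eps s) n =
  if (b == b0) && (s n == n) then turn n else 0.
Proof.
have nK := ltn_ord n; have nK' := ltnW nK.
have -> : period (zlift e cj) (zbranch e cj) n (tcell R b0 eps s) n.+1 - period (zlift e cj) (zbranch e cj) n (tcell R b0 eps s) n =
   zlift e cj n (tcell R b0 eps s) (vtx R K n.+1) - zlift e cj n (tcell R b0 eps s) (vtx R K n).
  rewrite /period !spoint_tsimplex; try exact: vtx_corner.
  rewrite (@tmap_int _ _ _ b0 eps (tpath s (vtx R K n.+1)) (tpath s (vtx R K n))); first ring.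
  move=> a; rewrite !tpath_vtx //.
  by case: (_ < n.+1)%N; case: (_ < n)%N; [exists 0|exists 1|exists (-1)|exists 0]; rewrite /=; ring.
have h0 := ell_tcell s n false; have h1 := ell_tcell s n true.
rewrite /zlift /turn; apply: complex_ext; rewrite ?reCB ?imCB /= ?h0 -?mulrBr ?h1;
  by case: (eps n) => /=; case: (_ && _) => /=; rewrite ?mulr0.
Qed.

(** A cell contributes only if its edge [n] turns the factor [n] for every [n], which leaves the
    identity permutation and the block [b0]. *)
Lemma pairing_cup : pairing b0 eps (@segre_cup R Ix row_factor cj K) =
  if b == b0 then \prod_n turn n else 0.
Proof.
have E s : @segre_cup R Ix row_factor cj K (tcell R b0 eps s) =
    \prod_(n < K) (if (b == b0) && (s n == n) then turn n else 0).
  by apply: eq_bigr => n _; exact: period_tcell.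
transitivity (\sum_(s : 'S_K) (-1) ^+ s * \prod_(n < K) (if (b == b0) && (s n == n) then turn n else 0)).
  by apply: eq_bigr => s _; congr (_ * _); exact: E.
have [_|ne] := eqVneq b b0; last first.
  by rewrite big1 // => s _; rewrite (bigD1 ord0) //= mul0r mulr0.
rewrite (bigD1 1%g) //= odd_perm1 expr0 mul1r [X in _ + X]big1 ?addr0.
  by apply: eq_bigr => n _; rewrite perm1 eqxx.
move=> s s1; have [n sn] : exists n, s n != n.
  by apply/existsP; apply: contraNT s1 => /existsPn h; apply/eqP/permP => n; rewrite perm1; apply/eqP/negPn.
by rewrite (bigD1 n) //= (negbTE sn) mul0r mulr0.
Qed.

End TorusPeriods.

(** * Hodge structures *)

Lemma span_ind (F : fieldType) (vT : vectType F) (S : seq vT) (P : vT -> Prop) : P 0 ->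
  (forall a u v, u \in S -> P v -> P (a *: u + v)) -> forall v, v \in <<S>>%VS -> P v.
Proof.
move=> P0; elim: S => [|x S IH] Pl v; first by rewrite span_nil memv0 => /eqP ->.
rewrite span_cons => /memv_addP[u /vlineP[a ->] [w wS ->]].
apply: (Pl); first exact: mem_head.
by apply: IH wS => b y z yS; apply: Pl; rewrite inE yS orbT.
Qed.

Section RealStructure.
Variables (R : realType) (V : vectType rat) (K : nat).
Local Notation C := (CC R).
Local Notation d := (\dim {:V}).
Local Notation VC := (complexification R V).
Local Notation ee i := (delta_mx 0 i : VC).
Local Notation ic := (mkC 0 1 : C).
Variables (tau : 'I_d -> nat) (rho : 'I_d -> 'I_d).
Hypotheses (rhoK : involutive rho) (tauK : forall j, (tau j + tau (rho j) = K)%N)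
  (rho_fix : forall j, tau (rho j) = tau j -> rho j = j).

(* If tau j < tau (rho j), the basis vectors j and rho j stand for the real and
   the imaginary part of a class of type (tau j, tau (rho j)). *)
Definition hvec j : VC :=
  if (tau j < tau (rho j))%N then ee j + ic *: ee (rho j)
  else if (tau (rho j) < tau j)%N then ee (rho j) - ic *: ee j
  else ee j.

Lemma conj_vec_lin a (u v : VC) : conj_vec (a *: u + v) = a^* *: conj_vec u + conj_vec v.
Proof. by apply/rowP => i; rewrite !mxE rmorphD rmorphM. Qed.

Lemma conj_vecK : involutive (@conj_vec R V).
Proof. by move=> v; apply/rowP => i; rewrite !mxE conjCK. Qed.

Lemma conj_vec_ee j : conj_vec (ee j) = ee j.
Proof. by apply/rowP => i; rewrite !mxE rmorph_nat. Qed.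

Lemma conj_ic : ic^* = - ic.
Proof. by apply: complex_ext; rewrite ?reC_conj ?imC_conj ?reCN ?imCN /= ?oppr0. Qed.

Lemma conj_hvec j : conj_vec (hvec j) = hvec (rho j).
Proof.
rewrite /hvec rhoK; case: ltngtP => h.
- by rewrite addrC conj_vec_lin !conj_vec_ee conj_ic addrC scaleNr.
- by rewrite -scaleNr addrC conj_vec_lin !conj_vec_ee rmorphN /= conj_ic opprK addrC.
- by rewrite conj_vec_ee rho_fix.
Qed.

Definition hvecs (P : pred 'I_d) : seq VC := [seq hvec j | j <- enum 'I_d & P j].

(** A real and an imaginary part are recovered from [hvec j] and its conjugate [hvec (rho j)]. *)
Lemma hvecs_full : <<hvecs predT>>%VS = fullv.
Proof.
apply/eqP; rewrite eqEsubv subvf /=; apply/subvP => v _.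
have H j : hvec j \in <<hvecs predT>>%VS.
  by apply: memv_span; apply: map_f; rewrite filter_predT mem_enum.
suff E j : ee j \in <<hvecs predT>>%VS.
  rewrite (row_sum_delta v); apply: memv_suml => i _; exact: memvZ.
have n2 : (2 : C) != 0 by rewrite pnatr_eq0.
have nc : ic != 0 by rewrite eq_complex /= oner_eq0 andbF.
have [Ej|[Ej|Ej]] : ee j = hvec j \/ ee j = 2^-1 *: (hvec j + hvec (rho j)) \/
    ee j = (2^-1 * ic^-1) *: (hvec (rho j) - hvec j).
  rewrite /hvec rhoK; case: ltngtP => h; [right; left|right; right|by left].
  - by apply/rowP => i; rewrite !mxE; field.
  - by apply/rowP => i; rewrite !mxE; field.
- by rewrite Ej.
- by rewrite Ej memvZ // memvD.
- by rewrite Ej memvZ // memvB.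
Qed.

Lemma hvecs_size : size (hvecs predT) = \dim {: VC}.
Proof. by rewrite size_map filter_predT size_enum_ord [RHS]dimvf /dim /= mul1n. Qed.

Lemma hvecs_free P : free (hvecs P).
Proof.
have fT : free (hvecs predT).
  have : basis_of fullv (hvecs predT) by rewrite basisEdim hvecs_full subvv hvecs_size leqnn.
  exact: basis_free.
have : free (hvecs P ++ hvecs (predC P)).
  apply: etrans fT; apply: perm_free; rewrite -map_cat perm_map // filter_predT.
  exact/permEl/perm_filterC.
exact: catl_free.
Qed.

Definition hpred (p q : int) : pred 'I_d := fun j => (tau j == p :> int) && (tau (rho j) == q :> int).

Definition hpiece (p q : int) : {vspace VC} := <<hvecs (hpred p q)>>%VS.

Lemma dim_hpiece p q : \dim (hpiece p q) = #|hpred p q|.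
Proof.
have /eqP -> := hvecs_free (hpred p q).
by rewrite size_map cardE /enum_mem -filter_predI; congr size; apply: eq_filter => j; rewrite /= andbC.
Qed.

Lemma hpiece_conj1 p q v : v \in hpiece p q -> conj_vec v \in hpiece q p.
Proof.
move: v; apply: span_ind => [|a u w uS Pw].
  by rewrite (_ : conj_vec _ = 0) ?mem0v //; apply/rowP => i; rewrite !mxE rmorph0.
rewrite conj_vec_lin memvD ?memvZ //; case/mapP: uS => j; rewrite mem_filter => /andP[/andP[jp jq] _] ->.
rewrite conj_hvec; apply/memv_span/map_f; rewrite mem_filter mem_enum andbT.
by rewrite /hpred rhoK jp jq.
Qed.

Lemma hpiece_conj p q v : v \in hpiece p q <-> conj_vec v \in hpiece q p.
Proof. by split=> [|h]; [|rewrite -(conj_vecK v)]; exact: hpiece_conj1. Qed.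

Lemma hpiece_decomp : exists s : seq (int * int),
    [/\ uniq s,
        forall p q, (p, q) \in s -> p + q = Posz K,
        forall p q, (p, q) \notin s -> hpiece p q = 0%VS,
        (\sum_(pq <- s) hpiece pq.1 pq.2)%VS = fullv
      & directv (\sum_(pq <- s) hpiece pq.1 pq.2)%VS].
Proof.
pose s : seq (int * int) := [seq (Posz p, Posz (K - p)) | p <- iota 0 K.+1].
have sP j : (Posz (tau j), Posz (tau (rho j))) \in s.
  apply/mapP; exists (tau j); first by rewrite mem_iota /=; have := tauK j; lia.
  by congr (_, Posz _); have := tauK j; lia.
have us : uniq s by rewrite map_inj_uniq ?iota_uniq // => x y [].
have full : (\sum_(pq <- s) hpiece pq.1 pq.2)%VS = fullv.
  apply/eqP; rewrite eqEsubv subvf /= -hvecs_full; apply/span_subvP => v /mapP[j _ ->].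
  have := sP j; set x := (_, _) => xs; rewrite (big_rem x) //=.
  apply: (subvP (addvSl _ _)); apply/memv_span/map_f.
  by rewrite mem_filter mem_enum /hpred !eqxx.
exists s; split => //.
- by move=> p q /mapP[x]; rewrite mem_iota => /= xK [-> ->]; rewrite -PoszD; congr Posz; lia.
- move=> p q; apply: contraNeq => h; have : hvecs (hpred p q) != [::].
    by apply: contraNneq h => h; rewrite /hpiece h span_nil.
  case E: (hvecs _) => [//|v vs] _; have : v \in hvecs (hpred p q) by rewrite E mem_head.
  by case/mapP => j; rewrite mem_filter => /andP[/andP[/eqP <- /eqP <-] _] _; exact: sP.
(* Directness by counting: each [j] contributes to exactly one piece, so the dimensions add up to at
   most the number of basis vectors. *)
rewrite directvEgeq /= full.
rewrite (eq_bigr (fun x => \sum_(j < d) hpred x.1 x.2 j)%N); last first.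
  by move=> x _; rewrite dim_hpiece -sum1_card [LHS]big_mkcond.
rewrite exchange_big /= -hvecs_size size_map filter_predT size_enum_ord.
rewrite -[X in (_ <= X)%N]muln1 -[X in (_ <= X * _)%N]card_ord -sum_nat_const.
apply: leq_sum => j _; rewrite (bigD1_seq _ (sP j) us) /= /hpred !eqxx /= big1 // => x nx.
apply/eqP; rewrite eqb0; apply: contraNN nx => /andP[/eqP -> /eqP ->].
by case: x.
Qed.

Definition real_hs : hodge_structure R (Posz K) := HodgeStructure hpiece_decomp hpiece_conj.

Section Geometric.
Variables (n : nat) (X : set (proj_space R n)) (alpha : 'I_d -> cohomology R X rat K).
Hypotheses (sX : smooth_projective X)
  (free_alpha : forall q : 'I_d -> rat, \sum_j q j *: alpha j = 0 -> forall j, q j = 0)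
  (hodge_alpha : forall j, hodge_class (tau j) (\sum_i hvec j 0 i *: coh_ratr (alpha i))).

Definition class_map (x : V) : cohomology R X rat K := \sum_j coord (vbasis {:V}) j x *: alpha j.

Lemma class_map_linear : linear class_map.
Proof.
move=> a x y; rewrite /class_map scaler_sumr -big_split /=; apply: eq_bigr => j _.
by rewrite linearP scalerDl scalerA.
Qed.

HB.instance Definition _ := GRing.isLinear.Build rat V (cohomology R X rat K) _ class_map class_map_linear.

Lemma class_map_basis (j : 'I_d) : class_map (vbasis {:V})`_j = alpha j.
Proof.
rewrite /class_map (bigD1 j) //= coord_free ?eqxx ?scale1r; last exact/basis_free/vbasisP.
rewrite big1 ?addr0 // => i ij; rewrite coord_free; last exact/basis_free/vbasisP.
by rewrite eq_sym (negbTE ij) scale0r.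
Qed.

Lemma class_map_inj : injective class_map.
Proof.
move=> x y /eqP; rewrite -subr_eq0 -linearB => /eqP/free_alpha h.
apply/eqP; rewrite -subr_eq0; apply/eqP.
by rewrite (coord_vbasis (memvf (x - y))) big1 // => j _; rewrite h scale0r.
Qed.

Lemma real_hs_geometric : geometric_hs real_hs.
Proof.
exists n, X; split => //; exists class_map; split; first exact: class_map_inj.
move=> p q v vpq; pose F := coh_complexify (class_map : V -> cohomology R X rat K) (R := R).
have FE u : F u = \sum_i u 0 i *: coh_ratr (alpha i).
  by apply: eq_bigr => i _; rewrite class_map_basis.
have Flin a u w : F (a *: u + w) = a *: F u + F w.
  rewrite !FE scaler_sumr -big_split /=; apply: eq_bigr => i _.
  by rewrite !mxE scalerDl scalerA.
have F0 : F 0 = 0 by rewrite FE big1 // => i _; rewrite mxE scale0r.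
(* The value 0 is kept apart: a pair [p, q] of integers that is not the type of a basis vector has a
   zero piece. *)
suff [z|[p' [q' [pE qE pq h]]]] : F v = 0 \/ exists p' q' : nat, [/\ p = p', q = q', (p' + q' = K)%N & hodge_class p' (F v)].
- by left.
- by rewrite pE qE; exact: in_Hpq_hodge_class.
move: v vpq; apply: span_ind => [|a u w uS Pw]; first by left.
right; case/mapP: uS => j; rewrite mem_filter => /andP[/andP[/eqP jp /eqP jq] _] uE.
exists (tau j), (tau (rho j)); split => //.
have hu : hodge_class (tau j) (F u) by rewrite FE uE; exact: hodge_alpha.
rewrite Flin; case: Pw => [->|[p' [q' [pE _ _ hw]]]].
  by rewrite -[0](scale0r (F u)); exact: (hodge_class_lin a 0 hu hu).
have {pE} pE : p' = tau j by move: pE; rewrite -jp => -[].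
by rewrite pE in hw; rewrite -[F w]scale1r; exact: (hodge_class_lin a 1 hu hw).
Qed.

End Geometric.

End RealStructure.

(** * Pairings of rational classes with tori *)

Section RationalPairing.
Variables (R : realType) (J : finType) (k : nat) (b0 : J) (eps : 'I_k.+1 -> bool).
Local Notation C := (CC R).
Local Notation X := (@segreX R (J * 'I_k.+1)%type).
Local Notation pairing := (pairing b0 eps).

Lemma coh_class_sum (I : finType) (q : I -> rat) (c : I -> cocycle R X rat k.+1) :
  coh_class (\sum_i q i *: c i) = \sum_i q i *: coh_class (c i).
Proof.
by elim/big_rec2: _ => [|i y x _ <-]; [exact: coh_class0|exact: coh_class_lin].
Qed.

Lemma cocycle_val_sum (I : finType) (q : I -> rat) (c : I -> cocycle R X rat k.+1) s :
  cocycle_val (\sum_i q i *: c i) s = \sum_i q i * cocycle_val (c i) s.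
Proof. by elim/big_rec2: _ => [//|i x y _ <-]. Qed.

Lemma pairing_relation (I : finType) (q : I -> rat) (c : I -> cocycle R X rat k.+1) :
  \sum_i q i *: coh_class (c i) = 0 -> \sum_i q i * pairing (cocycle_val (c i)) = 0.
Proof.
rewrite -coh_class_sum => /coh_class_eq0 [b E].
apply: etrans (pairing_coboundary b0 eps b); rewrite -E /pairing.
under eq_bigr do rewrite mulr_sumr; rewrite exchange_big /=; apply: eq_bigr => s _.
by rewrite cocycle_val_sum mulr_sumr; apply: eq_bigr => i _; rewrite mulrCA.
Qed.

Lemma reC_sign (s : bool) (z : C) : reC ((-1) ^+ s * z) = (-1) ^+ s * reC z.
Proof. by case: s; rewrite ?expr1 ?expr0 ?mul1r // !mulN1r reCN. Qed.

Lemma imC_sign (s : bool) (z : C) : imC ((-1) ^+ s * z) = (-1) ^+ s * imC z.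
Proof. by case: s; rewrite ?expr1 ?expr0 ?mul1r // !mulN1r imCN. Qed.

Lemma pairing_ratr (c : cochain R X rat k.+1) :
  ratr (pairing c) = pairing (fun s => ratr (c s) : C).
Proof.
rewrite /pairing rmorph_sum; apply: eq_bigr => s _.
by rewrite rmorphM rmorph_sign.
Qed.

Variables (c : cochain R X C k.+1) (gc : forall s, gauss (c s)) (dc : coboundary c = 0).

Lemma pairing_re : ratr (pairing (cocycle_val (re_cocycle gc dc))) = mkC (reC (pairing c)) 0 :> C.
Proof.
rewrite pairing_ratr /pairing reC_sum; apply: complex_ext; rewrite [RHS]/=.
  by rewrite reC_sum; apply: eq_bigr => s _; rewrite !reC_sign re_cocycle_val.
by rewrite imC_sum big1 // => s _; rewrite imC_sign re_cocycle_val /= mulr0.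
Qed.

Lemma pairing_im : ratr (pairing (cocycle_val (im_cocycle gc dc))) = mkC (imC (pairing c)) 0 :> C.
Proof.
rewrite pairing_ratr /pairing imC_sum; apply: complex_ext; rewrite [RHS]/=.
  by rewrite reC_sum; apply: eq_bigr => s _; rewrite reC_sign imC_sign im_cocycle_val.
by rewrite imC_sum big1 // => s _; rewrite imC_sign im_cocycle_val /= mulr0.
Qed.

End RationalPairing.

(** * Realisation of the Hodge numbers in positive weight *)

Section PositiveWeight.
Variables (R : realType) (k : nat) (g : nat -> nat -> nat).
Local Notation K := k.+1.
Local Notation C := (CC R).
Hypothesis g_sym : forall p q, (p + q = K)%N -> g p q = g q p.

Definition hodge_rank : nat := \sum_(p < K.+1) g p (K - p).

(** One index for each basis vector of type [(p, K - p)]; [hodge_rank] is a common bound for the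
    second components, which makes this a finite type. Each index also labels a block of [K]
    factors. *)
Definition hodge_index : finType := {x : 'I_K.+1 * 'I_hodge_rank | (x.2 < g x.1 (K - x.1))%N}.
Local Notation J := hodge_index.

Definition htype (b : J) : nat := (val b).1.

Lemma htype_le b : (htype b <= K)%N. Proof. exact: (ltn_ord (val b).1). Qed.

Lemma hodge_rev_subproof (b : J) : ((val b).2 < g (rev_ord (val b).1) (K - rev_ord (val b).1))%N.
Proof.
have h := htype_le b; rewrite /htype in h; rewrite /= subSS subKn // -g_sym ?subnKC //; exact: (valP b).
Qed.

Definition hodge_rev (b : J) : J := Sub (rev_ord (val b).1, (val b).2) (hodge_rev_subproof b).

Lemma hodge_revK : involutive hodge_rev.
Proof. by move=> b; apply: val_inj; rewrite /= rev_ordK; case: (val b). Qed.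

Lemma htype_rev b : (htype b + htype (hodge_rev b) = K)%N.
Proof. by rewrite /htype /= subSS subnKC // htype_le. Qed.

Lemma hodge_rev_fix b : htype (hodge_rev b) = htype b -> hodge_rev b = b.
Proof. by move=> h; apply: val_inj => /=; rewrite [RHS]surjective_pairing; congr (_, _); exact: val_inj. Qed.

Lemma card_htype p : (p <= K)%N -> #|[pred b : J | htype b == p]| = g p (K - p).
Proof.
move=> pK; have pK' : (p < K.+1)%N by []; pose o := Ordinal pK'.
have gM : (g p (K - p) <= hodge_rank)%N by rewrite /hodge_rank (bigD1 o) //= leq_addr.
have h (a : 'I_(g p (K - p))) : (widen_ord gM a < g o (K - o))%N by exact: (ltn_ord a).
pose f (a : 'I_(g p (K - p))) : J := Sub (o, widen_ord gM a) (h a).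
have fi : injective f by move=> a b /(congr1 val) [] e; apply: val_inj.
rewrite -[RHS]card_ord; apply: etrans (fintype.card_image fi 'I_(g p (K - p))).
apply: eq_card => b; rewrite inE.
apply/eqP/fintype.imageP => [hb|[a _ ->] //].
have lt : ((val b).2 < g p (K - p))%N by have := valP b; rewrite -[(val b).1 : nat]/(htype b) hb.
exists (Ordinal lt) => //; apply: val_inj => /=; rewrite [LHS]surjective_pairing.
by congr (_, _); apply: val_inj.
Qed.

Local Notation X := (@segreX R (J * 'I_K)%type).

Definition hcup (b : J) : cochain R X C K := @segre_cup R (J * 'I_K)%type (@row_factor J k b) (antihol (htype b)) K.
Definition hcup_gauss b s : gauss (hcup b s) := @segre_cup_gauss _ _ _ _ _ s.
Definition hcup_cocycle b : coboundary (hcup b) = 0 := @segre_cup_cocycle _ _ _ _ _.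

Definition hre b := re_cocycle (hcup_gauss b) (hcup_cocycle b).
Definition him b := im_cocycle (hcup_gauss b) (hcup_cocycle b).

(** A real part if [p <= K - p], and otherwise the imaginary part from the mirror block, so that
    both members of a conjugate pair come from one class. *)
Definition hbase (b : J) : cocycle R X rat K :=
  if (htype b <= htype (hodge_rev b))%N then hre b else him (hodge_rev b).

Lemma prod_turn_real cj : \prod_n @turn R k (fun=> false) cj n = mkC (2 ^+ K) 0.
Proof.
rewrite (eq_bigr (fun=> mkC 2 0)) // prodr_const card_ord.
elim: (K) => [|m IH]; rewrite ?expr0 // !exprS IH.
by apply: complex_ext; rewrite ?reCM ?imCM /= ?(mulr0, mul0r, subr0, addr0).
Qed.

Lemma prod_turn_imag cj : exists2 x : R, x != 0 & \prod_n @turn R k (fun n => n == ord0) cj n = mkC 0 x.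
Proof.
exists ((-1) ^+ cj 0%N * 2 ^+ K); first by rewrite mulf_neq0 ?signr_eq0 // expf_neq0 ?pnatr_eq0.
rewrite big_ord_recl (eq_bigr (fun=> mkC 2 0)) // prodr_const card_ord.
have -> : mkC 2 0 ^+ k = mkC (2 ^+ k) 0 :> C.
  elim: (k) => [|m IH]; rewrite ?expr0 // !exprS IH.
  by apply: complex_ext; rewrite ?reCM ?imCM /= ?(mulr0, mul0r, subr0, addr0).
by rewrite /turn /=; apply: complex_ext; rewrite ?reCM ?imCM /= ?exprS; ring.
Qed.

Lemma pairing_hre b0 eps b cj : cj = antihol (htype b) ->
  ratr (pairing b0 eps (cocycle_val (hre b))) = mkC (reC (if b == b0 then \prod_n turn R eps cj n else 0)) 0 :> C.
Proof. by move=> ->; rewrite pairing_re /hcup pairing_cup. Qed.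

Lemma pairing_him b0 eps b cj : cj = antihol (htype b) ->
  ratr (pairing b0 eps (cocycle_val (him b))) = mkC (imC (if b == b0 then \prod_n turn R eps cj n else 0)) 0 :> C.
Proof. by move=> ->; rewrite pairing_im /hcup pairing_cup. Qed.

(** The coefficient of a real part is isolated by the torus of its block with real loops, whose
    period is the real number [2^K]; that of an imaginary part by the torus with one imaginary loop,
    whose period is purely imaginary. All other basis classes pair to 0. *)
Lemma hbase_free (I : finType) (h : I -> J) (q : I -> rat) : injective h ->
  \sum_i q i *: coh_class (hbase (h i)) = 0 -> forall i, q i = 0.
Proof.
move=> hi E i; have inj := ratr_inj_C (R := R).
apply/eqP/negPn/negP => qi.
have key (b0 : J) eps : ratr (pairing b0 eps (cocycle_val (hbase (h i)))) != 0 :> C ->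
    (forall j, j != i -> ratr (pairing b0 eps (cocycle_val (hbase (h j)))) = 0 :> C) -> False.
  move=> /eqP h1 h2; apply: h1; have := pairing_relation b0 eps E.
  rewrite (bigD1 i) //= [X in _ + X]big1 ?addr0 => [/eqP|j ji].
    by rewrite mulf_eq0 (negbTE qi) /= => /eqP ->; rewrite rmorph0.
  by rewrite (_ : pairing b0 eps _ = 0) ?mulr0 //; apply: inj; rewrite [LHS](h2 j ji) rmorph0.
have [le|gt] := leqP (htype (h i)) (htype (hodge_rev (h i))).
  apply: (key (h i) (fun=> false)).
    rewrite /hbase le (pairing_hre _ _ erefl) eqxx prod_turn_real.
    by rewrite eq_complex /= eqxx andbT expf_neq0 // pnatr_eq0.
  move=> j ji; have hji : h j != h i by rewrite (inj_eq hi).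
  rewrite /hbase; case: ifP => _.
    by rewrite (pairing_hre _ _ erefl) (negbTE hji).
  by rewrite (pairing_him _ _ erefl); case: eqP => _ //; rewrite prod_turn_real.
apply: (key (hodge_rev (h i)) (fun n => n == ord0)).
  rewrite /hbase leqNgt gt /= (pairing_him _ _ erefl) eqxx.
  have [x x0 ->] := prod_turn_imag (antihol (htype (hodge_rev (h i)))).
  by rewrite eq_complex /= eqxx andbT.
move=> j ji; rewrite /hbase; case: ifP => _; last first.
  rewrite (pairing_him _ _ erefl) (inj_eq (can_inj hodge_revK)) (inj_eq hi) (negbTE ji) //.
rewrite (pairing_hre _ _ erefl); case: eqP => _ //.
by have [x _ ->] := prod_turn_imag (antihol (htype (h j))).
Qed.

Local Notation V := 'rV[rat]_#|J|.
Local Notation d := (\dim {:V}).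

Lemma dim_card : d = #|J|.
Proof. by rewrite dimvf /dim /= mul1n. Qed.

Definition hval (i : 'I_d) : J := enum_val (cast_ord dim_card i).
Definition hpos (b : J) : 'I_d := cast_ord (esym dim_card) (enum_rank b).

Lemma hvalK : cancel hval hpos.
Proof. by move=> i; rewrite /hpos /hval enum_valK cast_ordK. Qed.

Lemma hposK : cancel hpos hval.
Proof. by move=> i; rewrite /hpos /hval cast_ordKV enum_rankK. Qed.

Definition htau i := htype (hval i).
Definition hrho i := hpos (hodge_rev (hval i)).

Lemma hrhoK : involutive hrho.
Proof. by move=> i; rewrite /hrho hposK hodge_revK hvalK. Qed.

Lemma htauK i : (htau i + htau (hrho i) = K)%N.
Proof. by rewrite /htau hposK htype_rev. Qed.

Lemma hrho_fix i : htau (hrho i) = htau i -> hrho i = i.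
Proof. by rewrite /htau /hrho hposK => /hodge_rev_fix ->; rewrite hvalK. Qed.

Definition halpha i : cohomology R X rat K := coh_class (hbase (hval i)).

Lemma half_double (W : lmodType C) (x : W) : 2^-1 *: (x + x) = x.
Proof. by rewrite -[x + x]mulr2n -[x *+ 2]scaler_nat scalerA mulVf ?scale1r // pnatr_eq0. Qed.

(** For [p < q] the vector gives the class of the cup product, for [p > q] the conjugate class of
    the mirror block. For [p = q] both classes have type (p, p), and the real part is half their
    sum. *)
Lemma hodge_halpha j : hodge_class (htau j) (\sum_i hvec R htau hrho j 0 i *: coh_ratr (halpha i)).
Proof.
pose F (u : 'rV[C]_d) : cohomology R X C K := \sum_i u 0 i *: coh_ratr (halpha i).
have Fee i : F (delta_mx 0 i) = coh_ratr (halpha i).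
  rewrite /F (bigD1 i) //= mxE !eqxx scale1r big1 ?addr0 // => l li.
  by rewrite mxE (negbTE li) andbF scale0r.
have Flin a u w : F (u + a *: w) = F u + a *: F w.
  rewrite /F scaler_sumr -big_split /=; apply: eq_bigr => i _.
  by rewrite !mxE scalerDl scalerA.
have rr : htau (hrho j) = htype (hodge_rev (hval j)) by rewrite /htau hposK.
have H b := @hodge_class_cup R _ (@row_factor J k b) k (htype b).
have Hc b := @hodge_class_conj_cup R _ (@row_factor J k b) k _ _ (htype_rev b).
rewrite -[X in hodge_class _ X]/(F _) /hvec rr -[htau j]/(htype (hval j)); case: ltngtP => h.
- rewrite Flin !Fee /halpha /hrho hposK /hbase hodge_revK (ltnW h) leqNgt h /=.
  rewrite -gcocycle_re_im; exact: H.
- rewrite -scaleNr Flin !Fee /halpha /hrho hposK /hbase hodge_revK (ltnW h) leqNgt h /=.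
  rewrite scaleNr -conj_gcocycle_re_im; have := Hc (hodge_rev (hval j)); by rewrite hodge_revK.
- rewrite Fee /halpha /hbase h leqnn.
  have H1 := H (hval j); rewrite [X in hodge_class X _]h in H1.
  have := hodge_class_lin 2^-1 2^-1 H1 (Hc (hval j)).
  rewrite (gcocycle_re_im (hcup_gauss _)) (conj_gcocycle_re_im (hcup_gauss _)) -scalerDr addrACA subrr addr0.
  by rewrite half_double.
Qed.

Lemma positive_weight : exists H : hodge_structure R (Posz K),
  geometric_hs H /\ forall p q : nat, (p + q = K)%N -> \dim (hs_piece H (Posz p) (Posz q)) = g p q.
Proof.
exists (real_hs R hrhoK htauK hrho_fix); split=> [|p q pq].
  apply: (@real_hs_geometric R V K htau hrho hrhoK htauK hrho_fix _ X halpha).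
  - exact: smooth_projective_segreX.
  - by move=> q; apply: hbase_free; exact: can_inj hvalK.
  - exact: hodge_halpha.
transitivity (#|hpred htau hrho p q|); first exact: (dim_hpiece R htau hrhoK).
have qE : q = (K - p)%N by lia.
rewrite qE -card_htype; last by lia.
apply: etrans (esym (fintype.card_image (can_inj hvalK) _)) _; apply: eq_card => b; rewrite [RHS]inE.
have E i : (i \in hpred htau hrho p (K - p)%N) = (htype (hval i) == p).
  rewrite -[LHS]/(hpred htau hrho p (K - p)%N i) /hpred !eqz_nat -[htype _]/(htau i); have := htauK i.
  by have [->|//] := eqVneq (htau i) p => h; apply/eqP; lia.
apply/fintype.imageP/eqP => [[j jp ->]|hb].
  by move: jp; rewrite E => /eqP.
by exists (hpos b); rewrite ?hposK // E hposK hb.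
Qed.

End PositiveWeight.

(** * Weight zero *)

Section AxisPoints.
Variables (R : realType) (n : nat).
Local Notation C := (CC R).
Local Notation idx := 'I_n.+1.
Implicit Types (v u w : 'rV[C]_n.+1).

Definition on_axis v : Prop := forall i j : idx, i != j -> v 0 i * v 0 j = 0.

Lemma on_axisZ v c : on_axis v -> on_axis (c *: v).
Proof. by move=> h i j ij; rewrite !mxE mulrACA h // mulr0. Qed.

Lemma on_axisE v i : on_axis v -> v 0 i != 0 -> forall j, v 0 j = v 0 i * (j == i)%:R.
Proof.
move=> h vi j; have [->|ji] := eqVneq j i; first by rewrite mulr1.
have /eqP := h _ _ ji; rewrite mulf_eq0 (negbTE vi) orbF mulr0 => /eqP ->//.
Qed.

(** The [n + 1] coordinate points. *)
Definition axes : set (proj_space R n) := [set x | exists2 v, hom_coord x v & on_axis v].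

Lemma axesP x v : hom_coord x v -> axes x <-> on_axis v.
Proof.
move=> xv; split=> [[w xw hw]|h]; last by exists v.
by have [c _ ->] := hom_coord_scale xw xv; exact: on_axisZ.
Qed.

Definition axis_eq (i j : idx) : seq (C * (idx * idx)) := [:: (1, (i, j))].

Lemma qval_axis_eq i j v : qval (axis_eq i j) v = v 0 i * v 0 j.
Proof. by rewrite /qval big_seq1 mul1r. Qed.

Lemma pgrad_linpoly a v : pgrad (linpoly R a) v = delta_mx 0 a.
Proof. by apply/rowP => j; rewrite !mxE eqxx /peval meval_deriv_linpoly eq_sym. Qed.

Lemma smooth_projective_axes : smooth_projective axes.
Proof.
split.
  exists [set F | exists i j, i != j /\ F = qpoly (axis_eq i j)]; split.
    by move=> _ [i [j [_ ->]]]; exact: homogeneous_qpoly.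
  move=> x v xv; rewrite (axesP xv); split=> [h _ [i [j [ij ->]]]|h i j ij].
    by rewrite peval_qpoly qval_axis_eq h.
  by rewrite -qval_axis_eq -peval_qpoly; apply: h; exists i, j.
move=> x v Xx xv; have sv : on_axis v by apply/(axesP xv).
have /rV0Pn [i vi] := hom_coord_neq0 xv.
(* Near the [i]-th coordinate point, the [n] other coordinates are local equations. *)
exists n, (fun l : 'I_n => linpoly R (lift i l)), (linpoly R i); split.
- by move=> l; exact: homogeneous_linpoly.
- exact: homogeneous_linpoly.
- by rewrite peval_linpoly.
- move=> y w yw; rewrite peval_linpoly => wi; rewrite (axesP yw); split=> [sw l|h a b ab].
    by rewrite peval_linpoly (on_axisE sw wi) eq_sym (negbTE (neq_lift _ _)) mulr0.
  have z c : c != i -> w 0 c = 0.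
    by case: (unliftP i c) => [l ->|->]; rewrite ?eqxx // -peval_linpoly h.
  by have [ai|/z ->] := eqVneq a i; rewrite ?mul0r // (z b) ?mulr0 // -ai eq_sym.
apply/eqP; rewrite -/(row_free _) -kermx_eq0; apply/rowV0P => a /sub_kermxP H.
have E : \matrix_(l < n) pgrad (linpoly R (lift i l)) v = \matrix_(l < n, j < n.+1) (lift i l == j)%:R.
  by apply/matrixP => l j; rewrite [LHS]mxE pgrad_linpoly !mxE eqxx eq_sym.
rewrite E in H; apply/rowP => l; rewrite mxE.
have := congr1 (fun M : 'rV[C]_n.+1 => M 0 (lift i l)) H; rewrite !mxE (bigD1 l) //= big1 ?addr0.
  by rewrite !mxE !eqxx mulr1.
by move=> m ml; rewrite !mxE (inj_eq lift_inj) (negbTE ml) mulr0.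
Qed.

Lemma axes_tangent x v u : axes x -> hom_coord x v -> cone_tangent axes v u -> exists c, u = c *: v.
Proof.
move=> Xx xv tu; have sv : on_axis v by apply/(axesP xv).
have /rV0Pn [i vi] := hom_coord_neq0 xv; exists (u 0 i / v 0 i); apply/rowP => j; rewrite mxE.
have [->|ji] := eqVneq j i; first by rewrite divfK.
have := tu _ (homogeneous_qpoly (axis_eq j i)).
rewrite pgrad_qpoly /qdiff big_seq1 mul1r /= (on_axisE sv vi j) (negbTE ji) !mulr0 mul0r addr0.
have h y w : axes y -> hom_coord y w -> peval (qpoly (axis_eq j i)) w = 0.
  by move=> Xy yw; rewrite peval_qpoly qval_axis_eq; apply: (proj1 (axesP yw) Xy).
by move=> /(_ h)/eqP; rewrite mulf_eq0 (negbTE vi) orbF => /eqP.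
Qed.

(* On the [i]-th coordinate point these weights are the Kronecker deltas. *)
Definition axis_weight (j : idx) v : C := mkC (vnorm v)^-1 0 * (v 0 j * (v 0 j)^*).

Lemma axis_weightZ j c v : c != 0 -> v != 0 -> axis_weight j (c *: v) = axis_weight j v.
Proof.
move=> c0 v0; rewrite /axis_weight vnormZ mxE rmorphM /=.
have -> : c * v 0 j * (c^* * (v 0 j)^*) = c * c^* * (v 0 j * (v 0 j)^*) by ring.
rewrite (rC_mk (rC_normsq c)) mulrA; congr (_ * _).
move: (vnorm_gt0 v0) (reC_normsq_gt0 c0); move: (vnorm v) (reC (c * c^*)) => s t s0 t0.
by apply: complex_ext; rewrite ?reCM ?imCM /= ?mul0r ?mulr0 ?addr0 ?subr0 //; field; rewrite !gt_eqF.
Qed.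

Lemma axis_weight_on_axis j v : on_axis v -> v != 0 -> axis_weight j v = (v 0 j != 0)%:R.
Proof.
move=> sv v0; rewrite /axis_weight; have [->|vj] := eqVneq (v 0 j) 0; first by rewrite mul0r mulr0.
have n0 := vnorm_gt0 v0; rewrite (rC_mk (rC_normsq (v 0 j))).
have -> : vnorm v = reC (v 0 j * (v 0 j)^*).
  rewrite /vnorm (bigD1 j) //= big1 ?addr0 // => i ij.
  by rewrite (on_axisE sv vj) (negbTE ij) mulr0 mul0r.
apply: complex_ext; rewrite ?reCM ?imCM /=; last by ring.
by field; rewrite gt_eqF // -reCM reC_normsq_gt0.
Qed.

Definition axis_form (j : idx) : diff_form R n 0 := fun _ => axis_weight j.

Lemma form_val_axis j p v V : form_val p (axis_form j) v V = axis_weight j v.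
Proof.
rewrite /form_val (big_pred1 [ffun=> ord0]) => [|m]; last by apply/esym/eqP/ffunP => -[].
by rewrite det_mx00 mulr1.
Qed.

Lemma is_form_on_P_axis j p : is_form_on_P p (axis_form j).
Proof.
split; last by split=> [x V a x0 a0|x V a []//]; rewrite !form_val_axis axis_weightZ.
move=> m r; have oU : open [set u : 'rV[R]_(n.+1 + n.+1) | u != 0] := @open_neq0 _ _.
have cc i : CkC [set u : 'rV[R]_(n.+1 + n.+1) | u != 0] r (fun y => (of_real y : 'rV[C]_n.+1) 0 i) by exact: CkC_of_real.
have cn i := CkC_mul oU (cc i) (CkC_conj oU (cc i)).
apply: (CkC_mul oU _ (cn j)); split; last exact: Ck_on_cst.
have [c1 _] : CkC [set u : 'rV[R]_(n.+1 + n.+1) | u != 0] r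
    (fun y => \sum_i (of_real y : 'rV[C]_n.+1) 0 i * ((of_real y : 'rV[C]_n.+1) 0 i)^*).
  by apply: (CkC_sum oU) => i _; exact: cn.
have c2 : Ck_on [set u : 'rV[R]_(n.+1 + n.+1) | u != 0] r (fun y : 'rV[R]_(n.+1 + n.+1) => vnorm (of_real y)).
  by apply: (Ck_on_ext oU _ c1) => y _; rewrite /vnorm reC_sum.
by apply: (Ck_on_inv oU _ c2) => u /of_real_neq0 u0; rewrite gt_eqF // vnorm_gt0.
Qed.

(** Tangent directions are radial, and the weight, homogeneous of degree 0, has zero derivative
    along them. *)
Lemma line_closed_axis j p : line_closed axes p (axis_form j).
Proof.
move=> x v V Xx xv tV; have v0 := hom_coord_neq0 xv.
exists (fun=> 0); last by rewrite big1 // => i _; rewrite mulr0.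
move=> i; have [c uE] := axes_tangent Xx xv (tV i).
apply: (@is_dC_ext _ _ _ (fun t => axis_weight j (cline v (row i V) t))) => [t|].
  by rewrite form_val_axis.
have dl a := is_dC_cline v (row i V) a.
have dn a := is_dC_mul (dl a) (is_dC_conj (dl a)).
have dS := @is_dC_sum R 1 idx (index_enum idx) xpredT _ _ _ _ dn.
have vE t : vnorm (cline v (row i V) t) =
    reC (\sum_a cline v (row i V) t 0 a * (cline v (row i V) t 0 a)^*) by rewrite /vnorm reC_sum.
have n0 : reC (\sum_a cline v (row i V) 0 0 a * (cline v (row i V) 0 0 a)^*) != 0.
  by rewrite -vE cline0 gt_eqF // vnorm_gt0.
have di := is_dC_inv_re n0 dS.
apply: (@is_dC_ext _ _ _ (fun t => mkC (reC (\sum_a cline v (row i V) t 0 a * (cline v (row i V) t 0 a)^*))^-1 0 *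
  (cline v (row i V) t 0 j * (cline v (row i V) t 0 j)^*))) => [t|]; first by rewrite /axis_weight vE.
apply: (is_dC_eq (is_dC_mul di (dn j))).
rewrite cline0 in n0 *; rewrite uE.
have E a : (c *: v) 0 a * (v 0 a)^* + v 0 a * ((c *: v) 0 a)^* = mkC (reC c + reC c) 0 * (v 0 a * (v 0 a)^*).
  have -> : mkC (reC c + reC c) 0 = c + c^* by apply: complex_ext; rewrite ?reCD ?imCD ?reC_conj ?imC_conj /=; ring.
  by rewrite mxE rmorphM /=; ring.
rewrite E; under eq_bigr do rewrite E; rewrite -mulr_sumr.
move: n0; set S := \sum_a _ => n0; rewrite reCM /= mul0r subr0.
by apply: complex_ext; rewrite ?reCD ?imCD ?reCM ?imCM /=; field.
Qed.

End AxisPoints.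

Section AxisCocycles.
Variables (R : realType) (n : nat).
Local Notation C := (CC R).
Local Notation idx := 'I_n.+1.
Local Notation X := (@axes R n).

Lemma rep_vec_axes (x : X) : on_axis (rep_vec (set_val x)) /\ rep_vec (set_val x) != 0.
Proof.
split; last exact: hom_coord_neq0 (rep_vecP _).
apply/(axesP (rep_vecP _)); exact: (set_valP x).
Qed.

Definition axis_cochain (j : idx) : cochain R X rat 0 := fun s => (rep_vec (set_val (spoint s 0)) 0 j != 0)%:R.

Lemma axis_weight_cont j : continuous (fun x : X => reC (axis_weight j (rep_vec (set_val x)))).
Proof.
move=> x; apply: (@cont_cmp _ _ _ (@set_val _ X) (fun x : proj_space R n => reC (axis_weight j (rep_vec x)))).
  exact: cont_set_val.
apply: (@proj_fun_cont R n (fun v => reC (axis_weight j v))) => [w|c v c0 v0]; last by rewrite axis_weightZ.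
have cn a : contC (fun w : @nonzero_vec R n => set_val w 0 a * (set_val w 0 a)^*) w.
  by apply: contC_mul; [|apply: contC_conj]; exact: contC_entry.
have cv : {for w, continuous (fun w : @nonzero_vec R n => vnorm (set_val w))}.
  by apply: cont_sum => a; have [] := cn a.
suff [] : contC (fun w : @nonzero_vec R n => axis_weight j (set_val w)) w by [].
apply: contC_mul (cn j); split; last exact: cont_cst.
have w0 : vnorm (set_val w) != 0 by rewrite gt_eqF // vnorm_gt0 //; exact: (set_valP w).
exact: (@contV R _ (fun w : @nonzero_vec R n => vnorm (set_val w)) w w0 cv).
Qed.

(** Along a path the weight is continuous with values 0 and 1; multiplied by [2 pi] it falls under
    [discrete_const], so it is constant and the two ends agree. *)
Lemma axis_cocycle j : coboundary (axis_cochain j) = 0.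
Proof.
apply/funext => s.
have c0 : corner (0 : 'rV[R]_0) by split=> [[]//|]; rewrite big_ord0.
pose d (t : 'rV[R]_1) := pi *+ 2 * reC (axis_weight j (rep_vec (set_val (spoint s t)))).
have cd : continuous d.
  move=> t; apply: (@contM R _ (fun=> pi *+ 2) (fun t => reC (axis_weight j (rep_vec (set_val (spoint s t))))) t); first exact: cont_cst.
  apply: (@cont_cmp _ _ _ (spoint s) (fun x : X => reC (axis_weight j (rep_vec (set_val x))))).
    exact: spoint_cont.
  exact: axis_weight_cont.
have dE t : d t = pi *+ 2 *~ (rep_vec (set_val (spoint s t)) 0 j != 0).
  have [h1 h2] := rep_vec_axes (spoint s t); rewrite /d axis_weight_on_axis //.
  by case: (_ != 0); rewrite /= ?mulr1 ?mulr0.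
have [m Hm] := discrete_const cd (fun t _ => ex_intro _ _ (dE t)).
have E i : axis_cochain j (sing_face i s) = m%:~R.
  have cf := fcoord_corner i c0.
  rewrite /axis_cochain spoint_face //; have := Hm _ cf; rewrite dE.
  have p0 : pi *+ 2 != 0 :> R by rewrite gt_eqF // mulrn_wgt0 // pi_gt0.
  by rewrite -mulrzr -[RHS]mulrzr => /(mulfI p0)/intr_inj <-; case: (_ != 0).
rewrite /coboundary !big_ord_recl big_ord0 !E /= expr0 /bump /= expr1 addr0 mul1r mulN1r subrr //.
Qed.

Definition axis_class j : cohomology R X rat 0 := coh_class (Cocycle (cocycleP (axis_cocycle j))).

Lemma hodge_axis_class j : hodge_class 0 (coh_ratr (axis_class j)).
Proof.
rewrite /axis_class coh_ratr_class; exists (axis_form j); split.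
- exact: is_form_on_P_axis.
- exact: line_closed_axis.
eexists; first by [].
move=> sg s [_ hs]; have c0 : corner (0 : 'rV[R]_0) by split=> [[]//|]; rewrite big_ord0.
have := hs (bary 0); rewrite (_ : rsubmx _ = 0) => [h|]; last by apply/rowP => -[].
have E : on_axis (s 0) by apply/(axesP h); exact: (set_valP (sval sg (bary 0))).
have s0 := hom_coord_neq0 h.
transitivity (axis_weight j (s 0)); last first.
  by rewrite /integral_lift /simplex_integralC /= form_val_axis mkCK.
rewrite axis_weight_on_axis //= /axis_cochain rmorph_nat.
have [c cn0 ->] := hom_coord_scale (rep_vecP (set_val (spoint sg 0))) h.
by rewrite mxE mulf_eq0 (negbTE cn0).
Qed.

Lemma axis_point_subproof j : @nonzero_vec R n (delta_mx 0 j).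
Proof. by apply/eqP => /rowP/(_ j)/eqP; rewrite !mxE !eqxx oner_eq0. Qed.

Definition axis_point j : proj_space R n :=
  (\pi_{eq_quot collinear_equiv R n} (SigSub (mem_set (axis_point_subproof j)) : @nonzero_vec R n))%qT.

Lemma axis_point_hom j : hom_coord (axis_point j) (delta_mx 0 j).
Proof. by exists (SigSub (mem_set (axis_point_subproof j)) : @nonzero_vec R n). Qed.

Lemma axis_point_axes j : X (axis_point j).
Proof.
apply/(axesP (axis_point_hom j)) => a b ab; rewrite !mxE /=.
case: (a =P j) => [aj|_]; last by rewrite mul0r.
by rewrite [b == j]eq_sym -aj (negbTE ab) mulr0.
Qed.

Lemma point_simplex_subproof (T : topologicalType) (x : T) : continuous (fun _ : std_simplex R 0 => x).
Proof. by move=> t; exact: cont_cst. Qed.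

Definition axis_simplex j : singular_simplex R X 0 :=
  exist _ _ (@point_simplex_subproof X (SigSub (mem_set (axis_point_axes j)))).

Lemma axis_cochain_point i j : axis_cochain i (axis_simplex j) = (i == j)%:R.
Proof.
rewrite /axis_cochain; have h := axis_point_hom j.
have [c c0 E] := hom_coord_scale h (rep_vecP (axis_point j)).
have -> : set_val (spoint (axis_simplex j) 0) = axis_point j by [].
by rewrite E !mxE eqxx mulf_eq0 (negbTE c0) /=; case: (i == j); rewrite ?oner_eq0 ?eqxx.
Qed.

(** In degree 0 only the zero cochain is a coboundary, so evaluation at the coordinate points
    decides. *)
Lemma axis_class_free (I : finType) (h : I -> idx) (q : I -> rat) : injective h ->
  \sum_i q i *: axis_class (h i) = 0 -> forall i, q i = 0.
Proof.
move=> hi; pose c i := Cocycle (cocycleP (axis_cocycle (h i))).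
have -> : \sum_i q i *: axis_class (h i) = coh_class (\sum_i q i *: c i).
  by elim/big_rec2: _ => [|i y x _ ->]; [rewrite coh_class0|rewrite coh_class_lin].
move=> /coh_class_eq0 /= E i; have := congr1 (fun f => f (axis_simplex (h i))) E.
have -> : cocycle_val (\sum_i q i *: c i) (axis_simplex (h i)) = \sum_l q l * axis_cochain (h l) (axis_simplex (h i)).
  by elim/big_rec2: _ => [//|l x y _ <-].
rewrite (bigD1 i) //= axis_cochain_point eqxx mulr1 big1 ?addr0 // => l li.
by rewrite axis_cochain_point (inj_eq hi) (negbTE li) mulr0.
Qed.

End AxisCocycles.

Section WeightZero.
Variables (R : realType) (G : nat).
Local Notation V := 'rV[rat]_G.
Local Notation d := (\dim {:V}).

Lemma dim_weight0 : d = G.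
Proof. by rewrite dimvf /dim /= mul1n. Qed.

(** [G] of the [G + 1] coordinate points, so that [G = 0] also has a projective space. *)
Definition axis_index (i : 'I_d) : 'I_G.+1 := widen_ord (leqnSn G) (cast_ord dim_weight0 i).

Lemma weight_zero : exists H : hodge_structure R (Posz 0),
  geometric_hs H /\ \dim (hs_piece H (Posz 0) (Posz 0)) = G.
Proof.
pose tau (i : 'I_d) := 0%N; have rK : involutive (@id 'I_d) by [].
have tK (j : 'I_d) : (tau j + tau (id j) = 0)%N by [].
have rf (j : 'I_d) : tau (id j) = tau j -> id j = j by [].
exists (real_hs R rK tK rf); split.
  apply: (@real_hs_geometric R V 0 tau id rK tK rf _ (@axes R G) (fun i => axis_class R (axis_index i))).
  - exact: smooth_projective_axes.
  - move=> q; apply: axis_class_free => i j /(congr1 val) /= e; exact: val_inj.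
  - move=> j; rewrite (bigD1 j) //= /hvec ltnn mxE !eqxx scale1r big1 ?addr0; first exact: hodge_axis_class.
    by move=> i ij; rewrite mxE (negbTE ij) andbF scale0r.
transitivity (#|hpred tau id 0 0|); first exact: (dim_hpiece R tau rK).
by rewrite -[RHS]dim_weight0 -[RHS]card_ord; apply: eq_card.
Qed.

End WeightZero.

Local Close Scope classical_set_scope.
Local Close Scope ring_scope.

Theorem theorem1p1 (R : realType) (k : nat) (g : nat -> nat -> nat)
  (g_sym : forall p q : nat, (p + q = k)%N -> g p q = g q p) :
  exists H : hodge_structure R (Posz k),
    geometric_hs H /\
    forall p q : nat, (p + q = k)%N ->
      \dim (hs_piece H (Posz p) (Posz q)) = g p q.
Proof.
case: k g_sym => [_|k g_sym]; last exact: positive_weight.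
have [H [gH dH]] := weight_zero R (g 0%N 0%N); exists H; split => // p q.
by case: p q => [|p] [|q].
Qed.
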